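(* For each $\eta>0$ there exist constants $C_\eta>0$ and $t_\eta>0$ such that for all $t\ge t_\eta$ $$\left|\zeta\left(\tfrac12+it\right)\right|^4\le C_\eta\, t^{1/2}\sum_{|n|\le t/\pi}\left|\int_1^{\frac{t}{2\pi}+\eta}\alpha^{-\frac12+it}\,\zeta_1\left(\tfrac12+it,\alpha\right)e^{-2\pi i n\alpha}\,d\alpha\right|^2 ,$$ where the sum is over integers $n$ with $|n|\le t/\pi$. In particular, if the sum on the right-hand side is $\mathcal O_\epsilon(t^{\epsilon})$ as $t\to\infty$ for each $\epsilon>0$, then $|\zeta(\tfrac12+it)|=\mathcal O_\epsilon(t^{1/8+\epsilon})$ as $t\to\infty$ for each $\epsilon>0$.
   Context: $\zeta$ is the Riemann zeta function. The modified Hurwitz zeta function is $\zeta_1(s,\alpha)=\sum_{n=1}^\infty (n+\alpha)^{-s}$ for $\Re s>1$ (here $\alpha\ge 0$), and by analytic continuation for $s\in\mathbf C$, $s\ne 1$. *)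

(* Defs.v *)
From Stdlib Require Import Reals ZArith.
From Coquelicot Require Import Coquelicot.

Open Scope R_scope.

Definition Cexp (z : C) : C :=
  (exp (Re z) * cos (Im z), exp (Re z) * sin (Im z)).

(* [x ^ s] with the real logarithm of the base; only meaningful for [0 < x]. *)
Definition Rcpow (x : R) (s : C) : C := Cexp (s * RtoC (ln x))%C.

(* Local expansion in a convergent power series centred at [z0]. *)
Definition C_analytic_at (f : C -> C) (z0 : C) : Prop :=
  exists a : nat -> C,
    locally z0 (fun z : C =>
      @is_pseries C_AbsRing C_NormedModule a (z - z0)%C (f z)).

(* [f] is the analytic continuation to C \ {1} of the sum, over [k : nat], of
   the [u k s], a series converging for [Re s > 1].  By the identity theorem
   this determines [f] away from 1; the value [f 1] is unconstrained. *)
Definition is_continuation_of_series (u : nat -> C -> C) (f : C -> C) : Prop :=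
  (forall s : C, 1 < Re s ->
     @is_series C_AbsRing C_NormedModule (fun k => u k s) (f s)) /\
  (forall s : C, s <> RtoC 1 -> C_analytic_at f s).

(* Indices are shifted by one: [S k] is the usual summation index. *)
Definition is_riemann_zeta (zeta : C -> C) : Prop :=
  is_continuation_of_series (fun k s => Rcpow (INR (S k)) (- s)%C) zeta.

Definition is_modified_hurwitz_zeta (zeta1 : C -> R -> C) : Prop :=
  forall alpha : R, 0 <= alpha ->
    is_continuation_of_series
      (fun k s => Rcpow (INR (S k) + alpha) (- s)%C)
      (fun s => zeta1 s alpha).

(* Sum of [f n] over the integers [n] with [|n| <= x], for [0 <= x]: with
   [N] the integer part of [x], these are the [k - N] for [0 <= k <= 2 N]. *)
Definition sum_Zabs_le (x : R) (f : Z -> R) : R :=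
  let N := Int_part x in
  sum_n (fun k : nat => f (Z.of_nat k - N)%Z) (Z.to_nat (2 * N)).

Definition crit (t : R) : C := (RtoC (1 / 2) + Ci * RtoC t)%C.

Definition fourier_integral (zeta1 : C -> R -> C) (eta t : R) (n : Z) : C :=
  @RInt C_R_CompleteNormedModule
    (fun alpha : R =>
       (Rcpow alpha (RtoC (- (1 / 2)) + Ci * RtoC t) *
        zeta1 (crit t) alpha *
        Cexp (- (RtoC (2 * PI * IZR n * alpha) * Ci)))%C)
    1 (t / (2 * PI) + eta).

Definition fourier_sum (zeta1 : C -> R -> C) (eta t : R) : R :=
  sum_Zabs_le (t / PI) (fun n => Cmod (fourier_integral zeta1 eta t n) ^ 2).

Definition bigO_infty (f g : R -> R) : Prop :=
  exists K : R,
    Rbar_locally p_infty (fun t : R => Rabs (f t) <= K * Rabs (g t)).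

(* Main.v *)
(* Write [s = 1/2 + it], [Z(x) = zeta_1(s, x)], [I(x) = x^(s-1) Z(x)], [T = t / 2 pi + eta], and
   [S] for the sum over [|n| <= t / pi].

   From [Z(x - 1) = Z(x) + x^(-s)] one gets [|Z(x - 1)|^2 - |Z(x)|^2 = 1/x + 2 Re I(x)].  Integrating
   this against a Fejer kernel [F_N] with [N <= t / pi], whose frequencies are all seen by [S], and
   telescoping over unit intervals gives
   [int_0^1 |Z|^2 F_N <= 2 sqrt (N S) + O(t^(1/8))], because [Z] is bounded near [T].
   The Fourier coefficients of [Z] on [0, 1] are [c_n ~ c_1 n^(s-1)] for [1 <= n <= t / 4 pi] with [|c_1|]
   bounded below (stationary phase) and are small for [n <= 0], so this controls the Cesaro sums of
   [sum n^(s-1)].  Averaging [Z] over a short interval [0, H], [H] of order [t^(-1/2)], and summing by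
   parts twice in the resulting smoothed sum yields [|zeta(s)| <= C t^(1/8) (S^(1/4) + 1)].

   The [+ 1] is absorbed by a lower bound for [S]: pair [I] with the 1-periodic function
   [(1 - cos 2 pi x)^2 (1 + x)^(1/2 - it) e(x)], whose Fourier coefficients at frequencies above [t / pi]
   are negligible.  The interval [1, 2] contributes
   [3/2 c_1 - c_2 - c_0 + (c_3 + c_(-1)) / 4 + o(1)], dominated by [c_1]; on the other unit intervals the
   phases have no stationary point. *)

Require Import Defs.
From Stdlib Require Import Reals ZArith Lra Lia Psatz.
From Coquelicot Require Import Coquelicot.

Open Scope R_scope.

(** * Complex-valued functions of a real variable *)

(** The fourth power comes from two Cauchy-Schwarz steps: one bounds the pairing with the kernel by
    sqrt (N S), the other passes from the weighted mean of |Z|^2 to a mean of Z, so that only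
    S^(1/4) survives. The exponent 1/8 is N^(1/4) at the critical length N of order sqrt t: the
    second differences of the smoothing coefficients are bounded by a^(-2) below sqrt t and by sqrt
    t a^(-3) above it, up to constants, so the Cesaro bound N^(5/4) S^(1/4), summed against them,
    peaks at N = sqrt t. A nonnegative kernel only sees Cesaro sums, which is why two summations by
    parts occur and why the averaging weight must have controlled second differences. The harmonic
    term costs a logarithm; it is relaxed to t^(1/8), because its square root t^(1/16) meets a
    second factor t^(1/16). The inequality admits no additive term, hence the lower bound for S,
    uniform in the endpoint T. The continuation is reached through Euler-Maclaurin summation and an
    identity theorem on a horizontal line of height t <> 0, which stays away from the pole. *)

Definition cis (x : R) : C := (cos x, sin x).

(** Componentwise, so that every rule reduces to the real integral; [CI_RInt] identifies it, for
    continuous integrands, with the vector-valued integral of [fourier_integral]. *)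
Definition CI (f : R -> C) (a b : R) : C :=
  (RInt (fun x => Re (f x)) a b, RInt (fun x => Im (f x)) a b).

Definition Ccont (f : R -> C) (x : R) : Prop :=
  continuous (fun y => Re (f y)) x /\ continuous (fun y => Im (f y)) x.

Definition Cder (f : R -> C) (x : R) (l : C) : Prop :=
  is_derive (fun y => Re (f y)) x (Re l) /\ is_derive (fun y => Im (f y)) x (Im l).

Lemma C_ext (z w : C) : Re z = Re w -> Im z = Im w -> z = w.
Proof. destruct z, w; simpl; intros; subst; reflexivity. Qed.

Lemma Re_mult (z w : C) : Re (z * w)%C = Re z * Re w - Im z * Im w.
Proof. reflexivity. Qed.

Lemma Im_mult (z w : C) : Im (z * w)%C = Re z * Im w + Im z * Re w.
Proof. reflexivity. Qed.

Lemma cis_add (x y : R) : cis (x + y) = (cis x * cis y)%C.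
Proof.
  apply C_ext; unfold cis; simpl; [rewrite cos_plus | rewrite sin_plus]; ring.
Qed.

Lemma cis_0 : cis 0 = RtoC 1.
Proof. unfold cis; rewrite cos_0, sin_0; reflexivity. Qed.

Lemma Cmod_cis (x : R) : Cmod (cis x) = 1.
Proof.
  unfold Cmod, cis; simpl fst; simpl snd.
  rewrite <- sqrt_1; f_equal. generalize (sin2_cos2 x); unfold Rsqr; intros; lra.
Qed.

Lemma Cmod_sqr (z : C) : Cmod z ^ 2 = Re z ^ 2 + Im z ^ 2.
Proof. unfold Cmod. rewrite pow2_sqrt; [reflexivity | nra]. Qed.

Lemma Cmod_R_nonneg (x : R) : 0 <= x -> Cmod (RtoC x) = x.
Proof. intros; rewrite Cmod_R; apply Rabs_pos_eq; assumption. Qed.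

Lemma Re_le_Cmod (z : C) : Rabs (Re z) <= Cmod z.
Proof. apply Rle_trans with (2 := Rmax_Cmod z), Rmax_l. Qed.

Lemma Im_le_Cmod (z : C) : Rabs (Im z) <= Cmod z.
Proof. apply Rle_trans with (2 := Rmax_Cmod z), Rmax_r. Qed.

Lemma Cmod_le_Re_Im (z : C) : Cmod z <= Rabs (Re z) + Rabs (Im z).
Proof.
  apply Rsqr_incr_0_var; [|generalize (Rabs_pos (Re z)) (Rabs_pos (Im z)); lra].
  rewrite !Rsqr_pow2, Cmod_sqr, <- (pow2_abs (Re z)), <- (pow2_abs (Im z)).
  generalize (Rabs_pos (Re z)) (Rabs_pos (Im z)); nra.
Qed.

Lemma Cmod_minus_sym (z w : C) : Cmod (z - w)%C = Cmod (w - z)%C.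
Proof. rewrite <- Cmod_opp; f_equal; ring. Qed.

Lemma Cmod_triangle_minus (z w : C) : Cmod (z - w)%C <= Cmod z + Cmod w.
Proof. unfold Cminus; rewrite <- (Cmod_opp w); apply Cmod_triangle. Qed.

Lemma Cmod_minus_triangle (u v w : C) :
  Cmod (u - w)%C <= Cmod (u - v)%C + Cmod (v - w)%C.
Proof. replace (u - w)%C with ((u - v) + (v - w))%C by ring; apply Cmod_triangle. Qed.

Lemma Cmod_le_add (z w : C) : Cmod z <= Cmod w + Cmod (z - w)%C.
Proof. replace z with (w + (z - w))%C at 1 by ring; apply Cmod_triangle. Qed.

Lemma Cmod_Cconj (z : C) : Cmod (Cconj z) = Cmod z.
Proof. unfold Cmod; f_equal; destruct z; simpl; ring. Qed.

(** ** Continuity *)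

Lemma Ccont_ext (f g : R -> C) (x : R) : (forall y, f y = g y) -> Ccont f x -> Ccont g x.
Proof.
  intros H [H1 H2]; split.
  - apply continuous_ext with (2 := H1); intros; rewrite H; reflexivity.
  - apply continuous_ext with (2 := H2); intros; rewrite H; reflexivity.
Qed.

Lemma Ccont_const (c : C) (x : R) : Ccont (fun _ => c) x.
Proof. split; apply continuous_const. Qed.

Lemma Ccont_plus (f g : R -> C) (x : R) :
  Ccont f x -> Ccont g x -> Ccont (fun y => f y + g y)%C x.
Proof.
  intros [f1 f2] [g1 g2]; split.
  - exact (continuous_plus _ _ _ f1 g1).
  - exact (continuous_plus _ _ _ f2 g2).
Qed.

Lemma Ccont_opp (f : R -> C) (x : R) : Ccont f x -> Ccont (fun y => - f y)%C x.
Proof.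
  intros [f1 f2]; split.
  - exact (continuous_opp _ _ f1).
  - exact (continuous_opp _ _ f2).
Qed.

Lemma Ccont_minus (f g : R -> C) (x : R) :
  Ccont f x -> Ccont g x -> Ccont (fun y => f y - g y)%C x.
Proof. intros Hf Hg; apply Ccont_plus; [|apply Ccont_opp]; assumption. Qed.

Lemma Ccont_mult (f g : R -> C) (x : R) :
  Ccont f x -> Ccont g x -> Ccont (fun y => f y * g y)%C x.
Proof.
  intros [f1 f2] [g1 g2]; split.
  - exact (continuous_minus _ _ _ (continuous_mult _ _ _ f1 g1) (continuous_mult _ _ _ f2 g2)).
  - exact (continuous_plus _ _ _ (continuous_mult _ _ _ f1 g2) (continuous_mult _ _ _ f2 g1)).
Qed.

Lemma Ccont_RtoC (f : R -> R) (x : R) : continuous f x -> Ccont (fun y => RtoC (f y)) x.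
Proof. intros; split; [assumption | apply continuous_const]. Qed.

Lemma Ccont_comp (f : R -> C) (g : R -> R) (x : R) :
  continuous g x -> Ccont f (g x) -> Ccont (fun y => f (g y)) x.
Proof.
  intros Hg [f1 f2]; split.
  - exact (continuous_comp g (fun y => Re (f y)) x Hg f1).
  - exact (continuous_comp g (fun y => Im (f y)) x Hg f2).
Qed.

Lemma Ccont_cis (g : R -> R) (x : R) : continuous g x -> Ccont (fun y => cis (g y)) x.
Proof.
  intros Hg; split; simpl.
  - apply (continuous_comp g cos x Hg), continuous_cos.
  - apply (continuous_comp g sin x Hg), continuous_sin.
Qed.

Lemma continuous_Cmod (f : R -> C) (x : R) : Ccont f x -> continuous (fun y => Cmod (f y)) x.
Proof.
  intros [f1 f2]. unfold Cmod.
  apply (continuous_comp (fun y => fst (f y) ^ 2 + snd (f y) ^ 2) sqrt).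
  - assert (H : forall g : R -> R, continuous g x -> continuous (fun y => g y ^ 2) x).
    { intros g Hg. apply continuous_ext with (fun y => mult (g y) (g y)).
      - intros; unfold mult; simpl; ring.
      - apply (continuous_mult g g x Hg Hg). }
    apply (continuous_plus (fun y => fst (f y) ^ 2) (fun y => snd (f y) ^ 2));
      apply H; assumption.
  - apply continuous_sqrt.
Qed.

(** ** Derivatives *)

Lemma Cder_cont (f : R -> C) (x : R) (l : C) : Cder f x l -> Ccont f x.
Proof.
  intros [H1 H2]; split.
  - apply (ex_derive_continuous (V := R_NormedModule) (fun y => Re (f y))); eexists; exact H1.
  - apply (ex_derive_continuous (V := R_NormedModule) (fun y => Im (f y))); eexists; exact H2.
Qed.

Lemma Cder_ext (f g : R -> C) (x : R) (l : C) :
  (forall y, f y = g y) -> Cder f x l -> Cder g x l.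
Proof.
  intros H [H1 H2]; split.
  - apply is_derive_ext with (2 := H1); intros; rewrite H; reflexivity.
  - apply is_derive_ext with (2 := H2); intros; rewrite H; reflexivity.
Qed.

Lemma Cder_eq (f : R -> C) (x : R) (l l' : C) : l = l' -> Cder f x l -> Cder f x l'.
Proof. intros ->; trivial. Qed.

Lemma Cder_const (c : C) (x : R) : Cder (fun _ => c) x (RtoC 0).
Proof. split; [exact (is_derive_const (V := R_NormedModule) (Re c) x) | exact (is_derive_const (V := R_NormedModule) (Im c) x)]. Qed.

Lemma Cder_plus (f g : R -> C) (x : R) (l m : C) :
  Cder f x l -> Cder g x m -> Cder (fun y => f y + g y)%C x (l + m)%C.
Proof.
  intros [f1 f2] [g1 g2]; split.
  - exact (is_derive_plus _ _ _ _ _ f1 g1).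
  - exact (is_derive_plus _ _ _ _ _ f2 g2).
Qed.

Lemma Cder_opp (f : R -> C) (x : R) (l : C) :
  Cder f x l -> Cder (fun y => - f y)%C x (- l)%C.
Proof.
  intros [f1 f2]; split.
  - exact (is_derive_opp _ _ _ f1).
  - exact (is_derive_opp _ _ _ f2).
Qed.

Lemma Cder_minus (f g : R -> C) (x : R) (l m : C) :
  Cder f x l -> Cder g x m -> Cder (fun y => f y - g y)%C x (l - m)%C.
Proof. intros Hf Hg; apply Cder_plus; [|apply Cder_opp]; assumption. Qed.

Lemma is_derive_Rmult (f g : R -> R) (x a b : R) :
  is_derive f x a -> is_derive g x b -> is_derive (fun y => f y * g y) x (a * g x + f x * b).
Proof.
  intros Hf Hg.
  exact (is_derive_mult f g x a b Hf Hg Rmult_comm).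
Qed.

Lemma Cder_mult (f g : R -> C) (x : R) (l m : C) :
  Cder f x l -> Cder g x m -> Cder (fun y => f y * g y)%C x (l * g x + f x * m)%C.
Proof.
  intros [f1 f2] [g1 g2]; split.
  - replace (Re (l * g x + f x * m)%C) with
      ((Re l * Re (g x) + Re (f x) * Re m) - (Im l * Im (g x) + Im (f x) * Im m))
      by (unfold Re, Im; simpl; ring).
    exact (is_derive_minus _ _ _ _ _ (is_derive_Rmult _ _ _ _ _ f1 g1)
             (is_derive_Rmult _ _ _ _ _ f2 g2)).
  - replace (Im (l * g x + f x * m)%C) with
      ((Re l * Im (g x) + Re (f x) * Im m) + (Im l * Re (g x) + Im (f x) * Re m))
      by (unfold Re, Im; simpl; ring).
    exact (is_derive_plus _ _ _ _ _ (is_derive_Rmult _ _ _ _ _ f1 g2)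
             (is_derive_Rmult _ _ _ _ _ f2 g1)).
Qed.

Lemma Cder_scal (c : C) (f : R -> C) (x : R) (l : C) :
  Cder f x l -> Cder (fun y => c * f y)%C x (c * l)%C.
Proof.
  intros H. apply Cder_eq with (RtoC 0 * f x + c * l)%C; [ring|].
  exact (Cder_mult (fun _ => c) f x (RtoC 0) l (Cder_const c x) H).
Qed.

Lemma Cder_RtoC (f : R -> R) (x l : R) :
  is_derive f x l -> Cder (fun y => RtoC (f y)) x (RtoC l).
Proof. intros; split; [assumption | exact (is_derive_const (V := R_NormedModule) 0 x)]. Qed.

Lemma Cder_comp (f : R -> C) (g : R -> R) (x dg : R) (l : C) :
  is_derive g x dg -> Cder f (g x) l -> Cder (fun y => f (g y)) x (RtoC dg * l)%C.
Proof.
  intros Hg [f1 f2]; split.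
  - replace (Re (RtoC dg * l)%C) with (dg * Re l) by (unfold Re, Im; simpl; ring).
    exact (is_derive_comp (fun y => Re (f y)) g x _ _ f1 Hg).
  - replace (Im (RtoC dg * l)%C) with (dg * Im l) by (unfold Re, Im; simpl; ring).
    exact (is_derive_comp (fun y => Im (f y)) g x _ _ f2 Hg).
Qed.

Lemma Cder_cis (x : R) : Cder cis x (Ci * cis x)%C.
Proof.
  split.
  - replace (Re (Ci * cis x)%C) with (- sin x) by (unfold Re, Im; simpl; ring). apply is_derive_cos.
  - replace (Im (Ci * cis x)%C) with (cos x) by (unfold Re, Im; simpl; ring). apply is_derive_sin.
Qed.

Lemma Cder_cis_comp (g : R -> R) (x dg : R) :
  is_derive g x dg -> Cder (fun y => cis (g y)) x (RtoC dg * Ci * cis (g x))%C.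
Proof.
  intros H. apply Cder_eq with (RtoC dg * (Ci * cis (g x)))%C; [ring|].
  apply (Cder_comp cis g x dg _ H), Cder_cis.
Qed.

(** ** Integrals *)

Lemma Ccont_ex_RInt (f : R -> C) (a b : R) :
  a <= b -> (forall x, a <= x <= b -> Ccont f x) ->
  ex_RInt (fun x => Re (f x)) a b /\ ex_RInt (fun x => Im (f x)) a b.
Proof.
  intros Hab H; split; apply (ex_RInt_continuous (V := R_CompleteNormedModule));
    rewrite Rmin_left, Rmax_right by assumption; intros x Hx; apply (H x Hx).
Qed.

Lemma ex_RInt_cont (f : R -> R) (a b : R) :
  a <= b -> (forall x, a <= x <= b -> continuous f x) -> ex_RInt f a b.
Proof.
  intros Hab H; apply (ex_RInt_continuous (V := R_CompleteNormedModule)).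
  rewrite Rmin_left, Rmax_right by assumption; exact H.
Qed.

Lemma CI_RInt (f : R -> C) (a b : R) :
  a <= b -> (forall x, a <= x <= b -> Ccont f x) ->
  @RInt C_R_CompleteNormedModule f a b = CI f a b.
Proof.
  intros Hab H; apply is_RInt_unique.
  destruct (Ccont_ex_RInt f a b Hab H) as [H1 H2].
  apply (is_RInt_fct_extend_pair (U := R_NormedModule) (V := R_NormedModule)).
  - exact (RInt_correct (V := R_CompleteNormedModule) _ _ _ H1).
  - exact (RInt_correct (V := R_CompleteNormedModule) _ _ _ H2).
Qed.

Lemma CI_ext (f g : R -> C) (a b : R) :
  a <= b -> (forall x, a < x < b -> f x = g x) -> CI f a b = CI g a b.
Proof.
  intros Hab H; unfold CI; f_equal; apply RInt_ext;
    rewrite Rmin_left, Rmax_right by assumption; intros x Hx; rewrite H; trivial.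
Qed.

Lemma CI_plus (f g : R -> C) (a b : R) :
  a <= b -> (forall x, a <= x <= b -> Ccont f x) -> (forall x, a <= x <= b -> Ccont g x) ->
  CI (fun x => f x + g x)%C a b = (CI f a b + CI g a b)%C.
Proof.
  intros Hab Hf Hg.
  destruct (Ccont_ex_RInt f a b Hab Hf) as [f1 f2].
  destruct (Ccont_ex_RInt g a b Hab Hg) as [g1 g2].
  unfold CI, Cplus; simpl; f_equal.
  - exact (RInt_plus _ _ _ _ f1 g1).
  - exact (RInt_plus _ _ _ _ f2 g2).
Qed.

Lemma RInt_Rscal (f : R -> R) (c a b : R) :
  ex_RInt f a b -> RInt (fun x => c * f x) a b = c * RInt f a b.
Proof. exact (RInt_scal (V := R_CompleteNormedModule) f a b c). Qed.

Lemma ex_RInt_Rscal (f : R -> R) (c a b : R) :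
  ex_RInt f a b -> ex_RInt (fun x => c * f x) a b.
Proof. exact (ex_RInt_scal (V := R_NormedModule) f a b c). Qed.

Lemma RInt_Rplus (f g : R -> R) (a b : R) :
  ex_RInt f a b -> ex_RInt g a b ->
  RInt (fun x => f x + g x) a b = RInt f a b + RInt g a b.
Proof. exact (RInt_plus (V := R_CompleteNormedModule) f g a b). Qed.

Lemma RInt_Rminus (f g : R -> R) (a b : R) :
  ex_RInt f a b -> ex_RInt g a b ->
  RInt (fun x => f x - g x) a b = RInt f a b - RInt g a b.
Proof. exact (RInt_minus (V := R_CompleteNormedModule) f g a b). Qed.

Lemma CI_scal (c : C) (f : R -> C) (a b : R) :
  a <= b -> (forall x, a <= x <= b -> Ccont f x) ->
  CI (fun x => c * f x)%C a b = (c * CI f a b)%C.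
Proof.
  intros Hab Hf.
  destruct (Ccont_ex_RInt f a b Hab Hf) as [f1 f2].
  unfold CI, Cmult; simpl; f_equal.
  - unfold Re, Im in *; simpl. rewrite RInt_Rminus, !RInt_Rscal; trivial; apply ex_RInt_Rscal; assumption.
  - unfold Re, Im in *; simpl. rewrite RInt_Rplus, !RInt_Rscal; trivial; apply ex_RInt_Rscal; assumption.
Qed.

Lemma CI_opp (f : R -> C) (a b : R) :
  a <= b -> (forall x, a <= x <= b -> Ccont f x) ->
  CI (fun x => - f x)%C a b = (- CI f a b)%C.
Proof.
  intros Hab Hf. rewrite (CI_ext _ (fun x => RtoC (-1) * f x)%C); trivial.
  - rewrite CI_scal by assumption. apply C_ext; unfold Re, Im; simpl; ring.
  - intros; apply C_ext; unfold Re, Im; simpl; ring.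
Qed.

Lemma CI_minus (f g : R -> C) (a b : R) :
  a <= b -> (forall x, a <= x <= b -> Ccont f x) -> (forall x, a <= x <= b -> Ccont g x) ->
  CI (fun x => f x - g x)%C a b = (CI f a b - CI g a b)%C.
Proof.
  intros Hab Hf Hg. unfold Cminus.
  rewrite CI_plus; [rewrite CI_opp; trivial | assumption | assumption |].
  intros x Hx; apply Ccont_opp; auto.
Qed.

Lemma CI_Chasles (f : R -> C) (a b c : R) :
  a <= b -> b <= c -> (forall x, a <= x <= c -> Ccont f x) ->
  CI f a c = (CI f a b + CI f b c)%C.
Proof.
  intros Hab Hbc Hf.
  destruct (Ccont_ex_RInt f a b Hab) as [f1 f2]; [intros; apply Hf; lra|].
  destruct (Ccont_ex_RInt f b c Hbc) as [g1 g2]; [intros; apply Hf; lra|].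
  unfold CI, Cplus; simpl; f_equal; symmetry;
    apply (RInt_Chasles (V := R_CompleteNormedModule)); assumption.
Qed.

Lemma CI_point (f : R -> C) (a : R) : CI f a a = RtoC 0.
Proof. unfold CI; rewrite !RInt_point; reflexivity. Qed.

Lemma CI_const (c : C) (a b : R) : CI (fun _ => c) a b = (RtoC (b - a) * c)%C.
Proof.
  unfold CI; rewrite !RInt_const; apply C_ext; unfold scal, Re, Im; simpl; unfold mult; simpl; ring.
Qed.

Lemma RInt_shift (f : R -> R) (a b c : R) :
  ex_RInt f (a + c) (b + c) -> RInt (fun x => f (x + c)) a b = RInt f (a + c) (b + c).
Proof.
  intros H.
  assert (E : ex_RInt f (1 * a + c) (1 * b + c)) by (rewrite !Rmult_1_l; exact H).
  rewrite <- (Rmult_1_l a) at 2. rewrite <- (Rmult_1_l b) at 2.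
  rewrite <- (RInt_comp_lin (V := R_CompleteNormedModule) f 1 c a b E).
  apply RInt_ext; intros x _; unfold scal; simpl; unfold mult; simpl.
  rewrite !Rmult_1_l; reflexivity.
Qed.

Lemma CI_shift (f : R -> C) (a b c : R) :
  a <= b -> (forall x, a + c <= x <= b + c -> Ccont f x) ->
  CI (fun x => f (x + c)) a b = CI f (a + c) (b + c).
Proof.
  intros Hab Hf. destruct (Ccont_ex_RInt f (a + c) (b + c)) as [f1 f2]; [lra | exact Hf |].
  unfold CI; f_equal.
  - exact (RInt_shift (fun x => Re (f x)) a b c f1).
  - exact (RInt_shift (fun x => Im (f x)) a b c f2).
Qed.

Lemma CI_dilate (f : R -> C) (a b c : R) :
  a <= b -> 0 < c -> (forall x, c * a <= x <= c * b -> Ccont f x) ->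
  CI (fun x => f (c * x)) a b = (RtoC (/ c) * CI f (c * a) (c * b))%C.
Proof.
  intros Hab Hc Hf.
  destruct (Ccont_ex_RInt f (c * a) (c * b)) as [f1 f2]; [nra | exact Hf |].
  assert (K : forall g : R -> R, ex_RInt g (c * a) (c * b) ->
    RInt (fun x => g (c * x)) a b = / c * RInt g (c * a) (c * b)).
  { intros g Hg.
    assert (E : ex_RInt g (c * a + 0) (c * b + 0)) by (rewrite !Rplus_0_r; exact Hg).
    rewrite <- (Rplus_0_r (c * a)). rewrite <- (Rplus_0_r (c * b)).
    rewrite <- (RInt_comp_lin (V := R_CompleteNormedModule) g c 0 a b E).
    rewrite RInt_scal.
    - unfold scal; simpl; unfold mult; simpl. rewrite <- Rmult_assoc, Rinv_l, Rmult_1_l by lra.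
      apply RInt_ext; intros; now rewrite Rplus_0_r.
    - apply (ex_RInt_comp_lin (V := R_CompleteNormedModule)) in E.
      apply ex_RInt_ext with (fun y => / c * scal c (g (c * y + 0))).
      + intros; unfold scal; simpl; unfold mult; simpl. rewrite Rplus_0_r; field; lra.
      + apply ex_RInt_Rscal. exact E. }
  apply C_ext; simpl.
  - rewrite (K (fun x => Re (f x)) f1); ring.
  - rewrite (K (fun x => Im (f x)) f2); ring.
Qed.

Lemma CI_FTC (F f : R -> C) (a b : R) :
  a <= b -> (forall x, a <= x <= b -> Cder F x (f x)) -> (forall x, a <= x <= b -> Ccont f x) ->
  CI f a b = (F b - F a)%C.
Proof.
  intros Hab HF Hf. unfold CI, Cminus, Cplus; simpl. f_equal.
  - apply is_RInt_unique.
    apply (is_RInt_derive (V := R_CompleteNormedModule) (fun x => Re (F x)) (fun x => Re (f x)));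
      rewrite Rmin_left, Rmax_right by assumption; intros; [apply HF | apply Hf]; assumption.
  - apply is_RInt_unique.
    apply (is_RInt_derive (V := R_CompleteNormedModule) (fun x => Im (F x)) (fun x => Im (f x)));
      rewrite Rmin_left, Rmax_right by assumption; intros; [apply HF | apply Hf]; assumption.
Qed.

Lemma RInt_FTC (F f : R -> R) (a b : R) :
  a <= b -> (forall x, a <= x <= b -> is_derive F x (f x)) ->
  (forall x, a <= x <= b -> continuous f x) -> RInt f a b = F b - F a.
Proof.
  intros Hab HF Hf. apply is_RInt_unique.
  apply (is_RInt_derive (V := R_CompleteNormedModule) F f);
    rewrite Rmin_left, Rmax_right by assumption; intros; [apply HF | apply Hf]; assumption.
Qed.

Lemma RInt_mono (f g : R -> R) (a b : R) :
  a <= b -> (forall x, a <= x <= b -> continuous f x) ->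
  (forall x, a <= x <= b -> continuous g x) ->
  (forall x, a < x < b -> f x <= g x) -> RInt f a b <= RInt g a b.
Proof.
  intros Hab Hf Hg H. apply RInt_le; trivial; apply ex_RInt_cont; assumption.
Qed.

(** A unimodular rotation [u] turns the integral into a nonnegative real number, so only the real
    part of u f has to be compared with [g]. *)
Lemma CI_norm (f : R -> C) (g : R -> R) (a b : R) :
  a <= b -> (forall x, a <= x <= b -> Ccont f x) -> (forall x, a <= x <= b -> continuous g x) ->
  (forall x, a < x < b -> Cmod (f x) <= g x) -> Cmod (CI f a b) <= RInt g a b.
Proof.
  intros Hab Hf Hg H.
  set (z := CI f a b).
  destruct (Ceq_dec z (RtoC 0)) as [E|E].
  - rewrite E, Cmod_0. replace 0 with (RInt (fun _ => 0) a b)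
      by (rewrite RInt_const; unfold scal; simpl; unfold mult; simpl; ring).
    apply RInt_mono; trivial.
    + intros; apply continuous_const.
    + intros x Hx; apply Rle_trans with (2 := H x Hx), Cmod_ge_0.
  - assert (P : 0 < Cmod z) by (apply Cmod_gt_0; exact E).
    set (u := (RtoC (/ Cmod z) * Cconj z)%C).
    assert (U : Cmod u = 1).
    { unfold u. rewrite Cmod_mult, Cmod_Cconj, Cmod_R, Rabs_pos_eq.
      - field; lra.
      - left; apply Rinv_0_lt_compat; assumption. }
    assert (Q : Re (u * z)%C = Cmod z).
    { assert (Q2 := Cmod_sqr z). unfold u.
      replace (Re (RtoC (/ Cmod z) * Cconj z * z)%C) with (/ Cmod z * (Re z ^ 2 + Im z ^ 2))
        by (destruct z; simpl; ring).
      rewrite <- Q2. field; lra. }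
    rewrite <- Q. unfold z. rewrite <- CI_scal by assumption.
    unfold CI; simpl fst.
    apply RInt_mono; trivial.
    + intros x Hx. apply (Ccont_mult (fun _ => u) f x (Ccont_const u x) (Hf x Hx)).
    + intros x Hx. apply Rle_trans with (Cmod (u * f x)).
      * apply Rle_trans with (2 := Re_le_Cmod _), Rle_abs.
      * rewrite Cmod_mult, U, Rmult_1_l. auto.
Qed.

Lemma CI_bound (f : R -> C) (M a b : R) :
  a <= b -> (forall x, a <= x <= b -> Ccont f x) ->
  (forall x, a < x < b -> Cmod (f x) <= M) -> Cmod (CI f a b) <= M * (b - a).
Proof.
  intros Hab Hf H.
  apply Rle_trans with (RInt (fun _ => M) a b).
  - apply CI_norm; trivial. intros; apply continuous_const.
  - rewrite RInt_const; unfold scal; simpl; unfold mult; simpl; lra.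
Qed.

(** * Finite sums *)

Fixpoint rsum (f : nat -> R) (n : nat) : R :=
  match n with O => 0 | S m => rsum f m + f m end.

Fixpoint csum (f : nat -> C) (n : nat) : C :=
  match n with O => RtoC 0 | S m => (csum f m + f m)%C end.

Lemma rsum_sum_n (f : nat -> R) (n : nat) : sum_n f n = rsum f (S n).
Proof.
  induction n as [|n IH]; [rewrite sum_O; simpl; ring|].
  rewrite sum_Sn, IH; reflexivity.
Qed.

Lemma rsum_ext (f g : nat -> R) (n : nat) :
  (forall k, (k < n)%nat -> f k = g k) -> rsum f n = rsum g n.
Proof.
  induction n as [|n IH]; intros H; simpl; trivial.
  rewrite IH, H; auto with arith.
Qed.

Lemma csum_ext (f g : nat -> C) (n : nat) :
  (forall k, (k < n)%nat -> f k = g k) -> csum f n = csum g n.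
Proof.
  induction n as [|n IH]; intros H; simpl; trivial.
  rewrite IH, H; auto with arith.
Qed.

Lemma rsum_le (f g : nat -> R) (n : nat) :
  (forall k, (k < n)%nat -> f k <= g k) -> rsum f n <= rsum g n.
Proof.
  induction n as [|n IH]; intros H; simpl; [lra|].
  apply Rplus_le_compat; auto with arith.
Qed.

Lemma rsum_nonneg (f : nat -> R) (n : nat) :
  (forall k, (k < n)%nat -> 0 <= f k) -> 0 <= rsum f n.
Proof.
  induction n as [|n IH]; intros H; simpl; [lra|].
  apply Rplus_le_le_0_compat; auto with arith.
Qed.

Lemma rsum_plus (f g : nat -> R) (n : nat) :
  rsum (fun k => f k + g k) n = rsum f n + rsum g n.
Proof. induction n as [|n IH]; simpl; [ring | rewrite IH; ring]. Qed.

Lemma rsum_scal (c : R) (f : nat -> R) (n : nat) :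
  rsum (fun k => c * f k) n = c * rsum f n.
Proof. induction n as [|n IH]; simpl; [ring | rewrite IH; ring]. Qed.

Lemma rsum_const (c : R) (n : nat) : rsum (fun _ => c) n = INR n * c.
Proof. induction n as [|n IH]; [simpl; ring | rewrite S_INR; simpl; rewrite IH; ring]. Qed.

Lemma csum_minus (f g : nat -> C) (n : nat) :
  csum (fun k => f k - g k)%C n = (csum f n - csum g n)%C.
Proof. induction n as [|n IH]; simpl; [ring | rewrite IH; ring]. Qed.

Lemma csum_scal (c : C) (f : nat -> C) (n : nat) :
  csum (fun k => c * f k)%C n = (c * csum f n)%C.
Proof. induction n as [|n IH]; simpl; [ring | rewrite IH; ring]. Qed.

Lemma csum_const (c : C) (n : nat) : csum (fun _ => c) n = (RtoC (INR n) * c)%C.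
Proof.
  induction n as [|n IH]; [simpl; ring | rewrite S_INR, RtoC_plus; simpl; rewrite IH; ring].
Qed.

Lemma csum_split (f : nat -> C) (m n : nat) :
  csum f (m + n) = (csum f m + csum (fun k => f (m + k)%nat) n)%C.
Proof.
  induction n as [|n IH]; [rewrite Nat.add_0_r; simpl; ring|].
  rewrite Nat.add_succ_r; simpl; rewrite IH; ring.
Qed.

Lemma rsum_split (f : nat -> R) (m n : nat) :
  rsum f (m + n) = rsum f m + rsum (fun k => f (m + k)%nat) n.
Proof.
  induction n as [|n IH]; [rewrite Nat.add_0_r; simpl; ring|].
  rewrite Nat.add_succ_r; simpl; rewrite IH; ring.
Qed.

Lemma csum_rev (f : nat -> C) (n : nat) :
  csum (fun k => f (n - 1 - k)%nat) n = csum f n.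
Proof.
  induction n as [|n IH]; trivial.
  change (csum f (S n)) with (csum f n + f n)%C.
  change (S n) with (1 + n)%nat at 2. rewrite csum_split.
  rewrite <- IH. simpl. rewrite !Nat.sub_0_r.
  rewrite (csum_ext _ (fun k => f (n - 1 - k)%nat)); [ring|].
  intros k Hk. f_equal. lia.
Qed.

Lemma csum_telescope (F : nat -> C) (n : nat) :
  csum (fun k => F (S k) - F k)%C n = (F n - F O)%C.
Proof. induction n as [|n IH]; simpl; [ring | rewrite IH; ring]. Qed.

Lemma rsum_le_telescope (f G : nat -> R) (n : nat) :
  (forall k, (k < n)%nat -> f k <= G (S k) - G k) -> rsum f n <= G n - G O.
Proof.
  induction n as [|n IH]; intros H; simpl; [lra|].
  assert (rsum f n <= G n - G O) by auto with arith.
  assert (f n <= G (S n) - G n) by auto with arith. lra.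
Qed.

Lemma rsum_mono_range (f : nat -> R) (m n : nat) :
  (m <= n)%nat -> (forall k, (k < n)%nat -> 0 <= f k) -> rsum f m <= rsum f n.
Proof.
  intros Hmn H. replace n with (m + (n - m))%nat by lia. rewrite rsum_split.
  assert (0 <= rsum (fun k => f (m + k)%nat) (n - m)); [|lra].
  apply rsum_nonneg; intros; apply H; lia.
Qed.

Lemma Cmod_csum (f : nat -> C) (n : nat) : Cmod (csum f n) <= rsum (fun k => Cmod (f k)) n.
Proof.
  induction n as [|n IH]; simpl; [rewrite Cmod_0; lra|].
  apply Rle_trans with (1 := Cmod_triangle _ _); lra.
Qed.

Lemma Cmod_csum_le (f : nat -> C) (g : nat -> R) (n : nat) :
  (forall k, (k < n)%nat -> Cmod (f k) <= g k) -> Cmod (csum f n) <= rsum g n.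
Proof. intros; apply Rle_trans with (1 := Cmod_csum f n), rsum_le; assumption. Qed.

Lemma rsum_cauchy_schwarz (f g : nat -> R) (n : nat) :
  rsum (fun k => f k * g k) n ^ 2
    <= rsum (fun k => f k ^ 2) n * rsum (fun k => g k ^ 2) n.
Proof.
  induction n as [|n IH]; [simpl; lra|].
  change (rsum (fun k => f k * g k) (S n)) with (rsum (fun k => f k * g k) n + f n * g n).
  change (rsum (fun k => f k ^ 2) (S n)) with (rsum (fun k => f k ^ 2) n + f n ^ 2).
  change (rsum (fun k => g k ^ 2) (S n)) with (rsum (fun k => g k ^ 2) n + g n ^ 2).
  set (P := rsum (fun k => f k * g k) n) in *.
  set (Q := rsum (fun k => f k ^ 2) n) in *.
  set (W := rsum (fun k => g k ^ 2) n) in *.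
  assert (HQ : 0 <= Q) by (apply rsum_nonneg; intros; apply pow2_ge_0).
  assert (HW : 0 <= W) by (apply rsum_nonneg; intros; apply pow2_ge_0).
  set (a := f n); set (b := g n).
  assert (Ha := pow2_ge_0 a). assert (Hb := pow2_ge_0 b).
  (* The cross term: after squaring it follows from the inductive P^2 <= Q W and from (Q b^2 - W
     a^2)^2 >= 0. *)
  assert (K : 2 * P * (a * b) <= Q * b ^ 2 + W * a ^ 2).
  { apply Rle_trans with (Rabs (2 * P * (a * b))); [apply Rle_abs|].
    assert (0 <= Q * b ^ 2) by (apply Rmult_le_pos; assumption).
    assert (0 <= W * a ^ 2) by (apply Rmult_le_pos; assumption).
    apply Rsqr_incr_0_var; [|lra].
    rewrite <- Rsqr_abs. unfold Rsqr.
    assert (4 * (P ^ 2) * (a * b) ^ 2 <= 4 * (Q * W) * (a * b) ^ 2).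
    { apply Rmult_le_compat_r; [apply pow2_ge_0 | lra]. }
    assert (0 <= (Q * b ^ 2 - W * a ^ 2) ^ 2) by apply pow2_ge_0.
    replace (2 * P * (a * b) * (2 * P * (a * b))) with (4 * P ^ 2 * (a * b) ^ 2) by ring.
    apply Rle_trans with (1 := H1).
    replace (4 * (Q * W) * (a * b) ^ 2) with
      ((Q * b ^ 2 + W * a ^ 2) * (Q * b ^ 2 + W * a ^ 2) - (Q * b ^ 2 - W * a ^ 2) ^ 2) by ring.
    clear - H2; lra. }
  replace ((P + a * b) ^ 2) with (P ^ 2 + 2 * P * (a * b) + a ^ 2 * b ^ 2) by ring.
  replace ((Q + a ^ 2) * (W + b ^ 2)) with (Q * W + (Q * b ^ 2 + W * a ^ 2) + a ^ 2 * b ^ 2) by ring.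
  clear - IH K; lra.
Qed.

Lemma Ccont_csum (F : nat -> R -> C) (n : nat) (x : R) :
  (forall k, (k < n)%nat -> Ccont (F k) x) -> Ccont (fun y => csum (fun k => F k y) n) x.
Proof.
  induction n as [|n IH]; intros H; simpl; [apply Ccont_const|].
  apply Ccont_plus; [apply IH; intros; apply H; lia | apply H; lia].
Qed.

Lemma CI_csum (F : nat -> R -> C) (n : nat) (a b : R) :
  a <= b -> (forall k x, (k < n)%nat -> a <= x <= b -> Ccont (F k) x) ->
  CI (fun x => csum (fun k => F k x) n) a b = csum (fun k => CI (F k) a b) n.
Proof.
  intros Hab; induction n as [|n IH]; intros H; simpl.
  - rewrite CI_const; ring.
  - rewrite CI_plus, IH; trivial.
    + intros; apply H; [lia | assumption].
    + intros; apply Ccont_csum; intros; apply H; [lia | assumption].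
    + intros; apply H; [lia | assumption].
Qed.

(** * Complex powers of positive reals *)

Lemma Rcpow_polar (x : R) (s : C) :
  Rcpow x s = (RtoC (exp (Re s * ln x)) * cis (Im s * ln x))%C.
Proof.
  unfold Rcpow, Cexp, cis. destruct s as [p q].
  replace (Re ((p, q) * RtoC (ln x))%C) with (p * ln x) by (unfold Re; simpl; ring).
  replace (Im ((p, q) * RtoC (ln x))%C) with (q * ln x) by (unfold Im; simpl; ring).
  apply C_ext; unfold Re, Im; simpl; ring.
Qed.

Lemma Cmod_Rcpow (x : R) (s : C) : Cmod (Rcpow x s) = Rpower x (Re s).
Proof.
  rewrite Rcpow_polar, Cmod_mult, Cmod_cis, Cmod_R_nonneg; [unfold Rpower; ring|].
  left; apply exp_pos.
Qed.

Lemma Rcpow_add (x : R) (s r : C) : Rcpow x (s + r)%C = (Rcpow x s * Rcpow x r)%C.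
Proof.
  rewrite !Rcpow_polar. destruct s as [p q], r as [p' q']; unfold Re, Im; simpl.
  rewrite !Rmult_plus_distr_r, cis_add, exp_plus, RtoC_mult; ring.
Qed.

Lemma Rcpow_mul_base (x y : R) (s : C) :
  0 < x -> 0 < y -> Rcpow (x * y) s = (Rcpow x s * Rcpow y s)%C.
Proof.
  intros Hx Hy. rewrite !Rcpow_polar, ln_mult by assumption.
  rewrite !Rmult_plus_distr_l, cis_add, exp_plus, RtoC_mult; ring.
Qed.

Lemma Rcpow_0 (x : R) : Rcpow x (RtoC 0) = RtoC 1.
Proof.
  rewrite Rcpow_polar; unfold Re, Im; simpl.
  rewrite !Rmult_0_l, exp_0, cis_0; ring.
Qed.

Lemma Rcpow_base_1 (s : C) : Rcpow 1 s = RtoC 1.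
Proof. rewrite Rcpow_polar, ln_1, !Rmult_0_r, exp_0, cis_0; ring. Qed.

Lemma Rcpow_1 (x : R) : 0 < x -> Rcpow x (RtoC 1) = RtoC x.
Proof.
  intros Hx; rewrite Rcpow_polar; unfold Re, Im; simpl.
  rewrite Rmult_1_l, Rmult_0_l, exp_ln, cis_0 by assumption; ring.
Qed.

Lemma Rcpow_neq_0 (x : R) (s : C) : Rcpow x s <> RtoC 0.
Proof.
  intros E. assert (H := Cmod_Rcpow x s). rewrite E, Cmod_0 in H.
  generalize (exp_pos (Re s * ln x)); unfold Rpower in H; lra.
Qed.

Lemma Rcpow_opp (x : R) (s : C) : Rcpow x (- s)%C = (/ Rcpow x s)%C.
Proof.
  assert (H := Rcpow_neq_0 x s).
  assert (E : (Rcpow x (- s) * Rcpow x s)%C = RtoC 1).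
  { rewrite <- Rcpow_add, <- (Rcpow_0 x). f_equal; ring. }
  replace (/ Rcpow x s)%C with (RtoC 1 * / Rcpow x s)%C by ring.
  rewrite <- E. field. exact H.
Qed.

Lemma Cconj_Rcpow (x : R) (s : C) : Cconj (Rcpow x s) = Rcpow x (Cconj s).
Proof.
  rewrite !Rcpow_polar. unfold cis, Cconj, Re, Im; simpl.
  replace (- snd s * ln x) with (- (snd s * ln x)) by ring.
  rewrite cos_neg, sin_neg. apply C_ext; unfold Re, Im; simpl; ring.
Qed.

Lemma Cder_Rcpow_base (x : R) (s : C) :
  0 < x -> Cder (fun y => Rcpow y s) x (s * Rcpow x (s - 1))%C.
Proof.
  intros Hx.
  apply Cder_ext with (fun y => RtoC (exp (Re s * ln y)) * cis (Im s * ln y))%C.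
  { intros; symmetry; apply Rcpow_polar. }
  eapply Cder_eq; [|apply Cder_mult; [apply Cder_RtoC | apply Cder_cis_comp]].
  2: { instantiate (1 := exp (Re s * ln x) * (Re s / x)).
       auto_derive; [assumption | field; lra]. }
  2: { instantiate (1 := Im s / x). auto_derive; [assumption | field; lra]. }
  replace (s - 1)%C with (s + - RtoC 1)%C by reflexivity.
  rewrite Rcpow_add, Rcpow_opp, Rcpow_1, Rcpow_polar, <- RtoC_inv by (assumption || lra).
  destruct s as [p q]; unfold cis, Re, Im, Rdiv; simpl.
  apply C_ext; unfold Re, Im; simpl; ring.
Qed.

Lemma Cder_Rcpow (a x : R) (s : C) :
  0 < x + a -> Cder (fun y => Rcpow (y + a) s) x (s * Rcpow (x + a) (s - 1))%C.
Proof.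
  intros H. eapply Cder_eq; [|apply (Cder_comp (fun y => Rcpow y s) (fun y => y + a) x 1)].
  - instantiate (1 := (s * Rcpow (x + a) (s - 1))%C); ring.
  - auto_derive; [trivial | ring].
  - apply Cder_Rcpow_base; assumption.
Qed.

Lemma Ccont_Rcpow_base (x : R) (s : C) : 0 < x -> Ccont (fun y => Rcpow y s) x.
Proof. intros; eapply Cder_cont, Cder_Rcpow_base; assumption. Qed.

Lemma Ccont_Rcpow (a x : R) (s : C) : 0 < x + a -> Ccont (fun y => Rcpow (y + a) s) x.
Proof. intros; eapply Cder_cont, Cder_Rcpow; assumption. Qed.

(** * Real powers *)

Lemma Rpower_pos (x p : R) : 0 < Rpower x p.
Proof. apply exp_pos. Qed.

Lemma Rpower_base_1 (p : R) : Rpower 1 p = 1.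
Proof. unfold Rpower; rewrite ln_1, Rmult_0_r, exp_0; reflexivity. Qed.

Lemma is_derive_Rpower (x p : R) : 0 < x -> is_derive (fun y => Rpower y p) x (p * Rpower x (p - 1)).
Proof.
  intros Hx. unfold Rpower. auto_derive; [assumption|].
  replace ((p - 1) * ln x) with (p * ln x + - ln x) by ring.
  rewrite exp_plus, exp_Ropp, exp_ln by assumption. field; lra.
Qed.

Lemma continuous_Rpower (x p : R) : 0 < x -> continuous (fun y => Rpower y p) x.
Proof.
  intros; apply (ex_derive_continuous (V := R_NormedModule) (fun y => Rpower y p)).
  eexists; apply is_derive_Rpower; assumption.
Qed.

Lemma Rpower_decr (x y p : R) : p <= 0 -> 0 < x <= y -> Rpower y p <= Rpower x p.
Proof.
  intros Hp [Hx Hxy]. unfold Rpower.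
  assert (ln x <= ln y) by (destruct Hxy as [Hlt | <-]; [left; apply ln_increasing; assumption | lra]).
  destruct (Req_dec (p * ln y) (p * ln x)) as [->|E]; [lra|].
  left; apply exp_increasing; nra.
Qed.

Lemma Rpower_incr (x y p : R) : 0 <= p -> 0 < x <= y -> Rpower x p <= Rpower y p.
Proof. intros Hp [Hx Hxy]; apply Rle_Rpower_l; [assumption | split; assumption]. Qed.

Lemma Rpower_mean_value (x y p : R) :
  0 < x < y -> exists z, x < z < y /\ Rpower y p - Rpower x p = p * Rpower z (p - 1) * (y - x).
Proof.
  intros [Hx Hxy].
  destruct (MVT_cor2 (fun u => Rpower u p) (fun u => p * Rpower u (p - 1)) x y Hxy) as [z [E Hz]].
  - intros u Hu. apply is_derive_Reals, is_derive_Rpower; lra.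
  - exists z; split; assumption.
Qed.

(** Comparison with the integral of x^(p-1): as this function decreases, the mean value theorem
    bounds each new term by the increment of x^p / p. *)
Lemma rsum_Rpower_le (p : R) (n : nat) :
  0 < p <= 1 -> (0 < n)%nat ->
  rsum (fun k => Rpower (INR (S k)) (p - 1)) n <= Rpower (INR n) p / p.
Proof.
  intros Hp. induction n as [|n IH]; [lia|]. intros _.
  change (rsum (fun k => Rpower (INR (S k)) (p - 1)) (S n)) with
    (rsum (fun k => Rpower (INR (S k)) (p - 1)) n + Rpower (INR (S n)) (p - 1)).
  destruct n as [|n].
  - simpl rsum. change (INR 1) with 1. rewrite !Rpower_base_1.
    apply Rmult_le_reg_r with p; [lra|]. unfold Rdiv. rewrite Rmult_assoc, Rinv_l; lra.
  - specialize (IH ltac:(lia)).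
    assert (H0 : 0 < INR (S n)) by (apply lt_0_INR; lia).
    destruct (Rpower_mean_value (INR (S n)) (INR (S (S n))) p) as [z [Hz E]].
    { rewrite (S_INR (S n)); lra. }
    assert (D : Rpower (INR (S (S n))) (p - 1) <= Rpower z (p - 1)) by (apply Rpower_decr; lra).
    replace (INR (S (S n)) - INR (S n)) with 1 in E by (rewrite (S_INR (S n)); ring).
    apply Rmult_le_reg_r with p; [lra|].
    assert (IH' : rsum (fun k => Rpower (INR (S k)) (p - 1)) (S n) * p <= Rpower (INR (S n)) p).
    { apply Rmult_le_compat_r with (r := p) in IH; [|lra].
      unfold Rdiv in IH. rewrite Rmult_assoc, Rinv_l in IH; lra. }
    unfold Rdiv. rewrite Rmult_assoc, Rinv_l by lra. nra.
Qed.

Lemma rsum_Rpower_tail (p : R) (m n : nat) :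
  0 < p -> (0 < m)%nat ->
  rsum (fun k => Rpower (INR (S (m + k))) (- p - 1)) n <= Rpower (INR m) (- p) / p.
Proof.
  intros Hp Hm.
  apply Rle_trans with (- Rpower (INR (m + n)) (- p) / p - - Rpower (INR (m + 0)) (- p) / p).
  - apply (rsum_le_telescope _ (fun k => - Rpower (INR (m + k)) (- p) / p)).
    intros k _. rewrite Nat.add_succ_r.
    assert (H0 : 0 < INR (m + k)) by (apply lt_0_INR; lia).
    destruct (Rpower_mean_value (INR (m + k)) (INR (S (m + k))) (- p)) as [z [Hz E]].
    { rewrite S_INR; lra. }
    replace (INR (S (m + k)) - INR (m + k)) with 1 in E by (rewrite S_INR; ring).
    assert (D : Rpower (INR (S (m + k))) (- p - 1) <= Rpower z (- p - 1)) by (apply Rpower_decr; lra).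
    replace (- Rpower (INR (S (m + k))) (- p) / p - - Rpower (INR (m + k)) (- p) / p)
      with (- (Rpower (INR (S (m + k))) (- p) - Rpower (INR (m + k)) (- p)) / p) by (field; lra).
    rewrite E. replace (- (- p * Rpower z (- p - 1) * 1) / p) with (Rpower z (- p - 1)) by (field; lra).
    exact D.
  - rewrite Nat.add_0_r.
    assert (0 <= Rpower (INR (m + n)) (- p) / p).
    { apply Rdiv_le_0_compat; [left; apply Rpower_pos | lra]. }
    lra.
Qed.

Lemma Rpower_half (x : R) : 0 < x -> Rpower x (1 / 2) = sqrt x.
Proof. intros; rewrite <- Rpower_sqrt by assumption; f_equal; lra. Qed.

Lemma Rpower_mhalf (x : R) : 0 < x -> Rpower x (- (1 / 2)) = / sqrt x.
Proof. intros; rewrite Rpower_Ropp, Rpower_half; trivial. Qed.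

Lemma rsum_inv_sqrt (n : nat) : rsum (fun k => / sqrt (INR (S k))) n <= 2 * sqrt (INR n).
Proof.
  destruct n as [|n]; [simpl; rewrite sqrt_0; lra|].
  rewrite (rsum_ext _ (fun k => Rpower (INR (S k)) (1 / 2 - 1))).
  - apply Rle_trans with (1 := rsum_Rpower_le (1 / 2) (S n) ltac:(lra) ltac:(lia)).
    rewrite Rpower_half; [lra | apply lt_0_INR; lia].
  - intros k _. replace (1 / 2 - 1) with (- (1 / 2)) by lra.
    symmetry; apply Rpower_mhalf, lt_0_INR; lia.
Qed.

(** * First derivative test for oscillatory integrals *)

(** With m = A / th', encoded as m th' = A, one integration by parts moves the oscillation onto m'
    cis(th). The variation of [m] is majorised by that of [G], which covers weights that are not
    monotone as well. *)
Lemma first_derivative_test (A th th' m m' g G : R -> R) (a b : R) :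
  a <= b ->
  (forall x, a <= x <= b -> is_derive th x (th' x)) ->
  (forall x, a <= x <= b -> is_derive m x (m' x)) ->
  (forall x, a <= x <= b -> is_derive G x (g x)) ->
  (forall x, a <= x <= b -> continuous A x /\ continuous m' x /\ continuous g x) ->
  (forall x, a <= x <= b -> m x * th' x = A x) ->
  (forall x, a <= x <= b -> Rabs (m' x) <= g x) ->
  Cmod (CI (fun x => RtoC (A x) * cis (th x))%C a b) <= Rabs (m a) + Rabs (m b) + (G b - G a).
Proof.
  intros Hab Hth Hm HG Hc HA Hg.
  assert (Cth : forall x, a <= x <= b -> continuous th x).
  { intros x Hx; apply (ex_derive_continuous (V := R_NormedModule) th); eexists; apply Hth, Hx. }
  assert (Cx : forall x, a <= x <= b -> Ccont (fun x => cis (th x)) x)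
    by (intros; apply Ccont_cis; auto).
  assert (C1 : forall x, a <= x <= b -> Ccont (fun x => RtoC (A x) * cis (th x))%C x).
  { intros x Hx; apply Ccont_mult; [apply Ccont_RtoC, Hc, Hx | auto]. }
  assert (C2 : forall x, a <= x <= b -> Ccont (fun x => RtoC (m' x) * cis (th x))%C x).
  { intros x Hx; apply Ccont_mult; [apply Ccont_RtoC, Hc, Hx | auto]. }
  assert (E : CI (fun x => RtoC (m' x) * cis (th x) + Ci * (RtoC (A x) * cis (th x)))%C a b
    = (RtoC (m b) * cis (th b) - RtoC (m a) * cis (th a))%C).
  { apply (CI_FTC (fun x => RtoC (m x) * cis (th x))%C); trivial.
    - intros x Hx. eapply Cder_eq; [|apply Cder_mult; [apply Cder_RtoC, Hm, Hx|]].
      2: apply Cder_cis_comp, Hth, Hx.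
      simpl. rewrite <- (HA x Hx), RtoC_mult. ring.
    - intros x Hx; apply Ccont_plus; auto. apply Ccont_mult; [apply Ccont_const | auto]. }
  rewrite CI_plus, CI_scal in E; trivial.
  2: { intros x Hx; apply Ccont_mult; [apply Ccont_const | auto]. }
  set (J := CI (fun x => RtoC (A x) * cis (th x))%C a b) in *.
  set (K := CI (fun x => RtoC (m' x) * cis (th x))%C a b) in *.
  assert (HK : Cmod K <= G b - G a).
  { rewrite <- (RInt_FTC G g a b Hab); [|assumption | intros; apply Hc; assumption].
    apply CI_norm; trivial.
    - intros; apply Hc; assumption.
    - intros x Hx. rewrite Cmod_mult, Cmod_cis, Rmult_1_r, Cmod_R. apply Hg; lra. }
  replace (Cmod J) with (Cmod (Ci * J)%C).
  2: { rewrite Cmod_mult. replace (Cmod Ci) with 1; [lra|].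
       unfold Cmod, Ci; simpl. rewrite <- sqrt_1 at 1; f_equal; ring. }
  replace (Ci * J)%C with ((RtoC (m b) * cis (th b) - RtoC (m a) * cis (th a)) - K)%C
    by (rewrite <- E; ring).
  apply Rle_trans with (1 := Cmod_triangle_minus _ _).
  assert (H := Cmod_triangle_minus (RtoC (m b) * cis (th b)) (RtoC (m a) * cis (th a))).
  rewrite !Cmod_mult, !Cmod_cis, !Cmod_R in H. lra.
Qed.

Lemma PI_gt_3 : 3 < PI.
Proof. generalize PI2_3_2; unfold PI; lra. Qed.

Lemma le_div_r (a b c : R) : 0 < c -> a * c <= b -> a <= b / c.
Proof. intros; apply Rle_div_r; [lra | assumption]. Qed.

Lemma div_le_l (a b c : R) : 0 < c -> a <= b * c -> a / c <= b.
Proof. intros; apply Rle_div_l; [lra | assumption]. Qed.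

Lemma lt_div_r (a b c : R) : 0 < c -> a * c < b -> a < b / c.
Proof. intros; apply Rlt_div_r; [lra | assumption]. Qed.

(** * Real-analytic functions and the identity theorem *)

(** Real power series: the complex functions met below are restricted to a horizontal line and split
    into real and imaginary parts. *)
Definition RA (f : R -> R) (x0 : R) : Prop :=
  exists (a : nat -> R) (r : R), 0 < r /\
    forall x, Rabs (x - x0) < r -> is_pseries a (x - x0) (f x).

Lemma RA_ext (f g : R -> R) (x0 : R) : (forall x, f x = g x) -> RA f x0 -> RA g x0.
Proof.
  intros H (a & r & Hr & K). exists a, r; split; trivial.
  intros x Hx; rewrite <- H; auto.
Qed.

(** At a point strictly between |x| and [r] the terms of the series tend to 0, which is impossible
    outside the closed disc of convergence. *)
Lemma pseries_radius (a : nat -> R) (r x : R) :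
  (forall y, Rabs y < r -> exists l, is_pseries a y l) -> Rabs x < r ->
  Rbar_lt (Rabs x) (CV_radius a).
Proof.
  intros H Hx. apply Rbar_not_le_lt. intros Hle.
  set (y := (Rabs x + r) / 2).
  assert (P := Rabs_pos x).
  assert (Hy : Rabs y = y) by (apply Rabs_pos_eq; unfold y; lra).
  destruct (H y) as [l Hl]; [rewrite Hy; unfold y; lra|].
  apply (CV_disk_outside a y).
  - apply Rbar_le_lt_trans with (1 := Hle). simpl. rewrite Hy; unfold y; lra.
  - apply ex_series_lim_0. exists l. exact (proj1 (is_pseries_R a y l) Hl).
Qed.

Lemma RA_plus (f g : R -> R) (x0 : R) : RA f x0 -> RA g x0 -> RA (fun x => f x + g x) x0.
Proof.
  intros (a & r & Hr & Ha) (b & q & Hq & Hb).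
  exists (PS_plus a b), (Rmin r q); split; [apply Rmin_glb_lt; assumption|].
  intros x Hx. apply (is_pseries_plus (K := R_AbsRing) (V := R_NormedModule)).
  - apply Ha, Rlt_le_trans with (1 := Hx), Rmin_l.
  - apply Hb, Rlt_le_trans with (1 := Hx), Rmin_r.
Qed.

Lemma RA_mult (f g : R -> R) (x0 : R) : RA f x0 -> RA g x0 -> RA (fun x => f x * g x) x0.
Proof.
  intros (a & r & Hr & Ha) (b & q & Hq & Hb).
  assert (Ka : forall y, Rabs y < r -> exists l, is_pseries a y l).
  { intros y Hy; exists (f (y + x0)). replace y with (y + x0 - x0) at 1 by ring.
    apply Ha; replace (y + x0 - x0) with y by ring; exact Hy. }
  assert (Kb : forall y, Rabs y < q -> exists l, is_pseries b y l).
  { intros y Hy; exists (g (y + x0)). replace y with (y + x0 - x0) at 1 by ring.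
    apply Hb; replace (y + x0 - x0) with y by ring; exact Hy. }
  exists (PS_mult a b), (Rmin r q); split; [apply Rmin_glb_lt; assumption|].
  intros x Hx.
  assert (Rabs (x - x0) < r) by (apply Rlt_le_trans with (1 := Hx), Rmin_l).
  assert (Rabs (x - x0) < q) by (apply Rlt_le_trans with (1 := Hx), Rmin_r).
  apply is_pseries_mult; auto.
  - apply pseries_radius with r; assumption.
  - apply pseries_radius with q; assumption.
Qed.

Lemma is_series_finite (a : nat -> R) (n : nat) :
  (forall k, (n < k)%nat -> a k = 0) -> is_series a (sum_n a n).
Proof.
  intros H. apply filterlim_ext_loc with (fun _ => sum_n a n).
  - exists n. intros m Hm. induction Hm as [|m Hm IH]; trivial.
    rewrite sum_Sn, <- IH, H by lia. symmetry; apply Rplus_0_r.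
  - apply filterlim_const.
Qed.

Lemma RA_affine (c d x0 : R) : RA (fun x => c * x + d) x0.
Proof.
  exists (fun n => match n with O => c * x0 + d | 1%nat => c | _ => 0 end), 1; split; [lra|].
  intros x _. apply is_pseries_R.
  match goal with |- is_series ?u _ => replace (c * x + d) with (sum_n u 1) end.
  - apply is_series_finite. intros [|[|k]] Hk; [lia | lia | simpl; ring].
  - rewrite sum_Sn, sum_O; unfold plus; simpl; ring.
Qed.

Lemma RA_const (d x0 : R) : RA (fun _ => d) x0.
Proof. apply RA_ext with (2 := RA_affine 0 d x0); intros; ring. Qed.

Lemma RA_exp (c x0 : R) : RA (fun x => exp (c * x)) x0.
Proof.
  apply RA_ext with (fun x => exp (c * x0) * exp (c * (x - x0))).
  { intros; rewrite <- exp_plus; f_equal; ring. }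
  apply (RA_mult (fun _ => exp (c * x0))); [apply RA_const|].
  exists (fun n => c ^ n / INR (fact n)), 1; split; [lra|].
  intros x _. apply is_pseries_R.
  assert (H := is_exp_Reals (c * (x - x0))). apply is_pseries_R in H.
  apply (is_series_ext (K := R_AbsRing) (V := R_NormedModule)) with (2 := H).
  intros n; simpl. rewrite Rpow_mult_distr. unfold Rdiv; ring.
Qed.

(** Continuity of the sum at its centre. The vanishing is assumed on the right of the centre only,
    which is what the supremum argument of [RA_identity] provides. *)
Lemma pseries_zero_const (a : nat -> R) (r : R) :
  0 < r -> (forall x, 0 < x < r -> is_pseries a x 0) -> a O = 0.
Proof.
  intros Hr H.
  destruct (Req_dec (a O) 0) as [|E]; trivial. exfalso.
  assert (Hrad : Rbar_lt (Rabs 0) (CV_radius a)).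
  { apply Rbar_not_le_lt. intros Hle.
    assert (Hy : Rabs (r / 2) = r / 2) by (apply Rabs_pos_eq; lra).
    apply (CV_disk_outside a (r / 2)).
    - apply Rbar_le_lt_trans with (1 := Hle). simpl. rewrite Hy, Rabs_R0; lra.
    - apply ex_series_lim_0. exists 0. exact (proj1 (is_pseries_R a (r / 2) 0) (H (r / 2) ltac:(lra))). }
  assert (Hc := PSeries_continuity a 0 Hrad).
  destruct (Hc (Rabs (a O))) as (d & Hd & K); [apply Rabs_pos_lt; exact E|].
  set (x := Rmin (d / 2) (r / 2)).
  assert (Hx : 0 < x) by (apply Rmin_glb_lt; lra).
  assert (x <= d / 2) by apply Rmin_l. assert (x <= r / 2) by apply Rmin_r.
  specialize (K x). unfold R_dist, dist in K; simpl in K; unfold Rdist in K.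
  rewrite PSeries_0, (is_pseries_unique a x 0) in K by (apply H; lra).
  assert (Rabs (0 - a O) < Rabs (a O)).
  { apply K. split; [split; [exact I | lra]|]. rewrite Rminus_0_r, Rabs_pos_eq; lra. }
  rewrite Rminus_0_l, Rabs_Ropp in H2. lra.
Qed.

Lemma pseries_zero_coeff (n : nat) : forall (a : nat -> R) (r : R),
  0 < r -> (forall x, 0 < x < r -> is_pseries a x 0) -> a n = 0.
Proof.
  induction n as [|n IH]; intros a r Hr H; [exact (pseries_zero_const a r Hr H)|].
  apply (IH (PS_decr_1 a) r Hr). intros x Hx.
  replace 0 with (scal (/ x) (plus 0 (opp (a O)))).
  - apply (is_pseries_decr_1 (K := R_AbsRing) (V := R_NormedModule)).
    + unfold mult, one; simpl; field; lra.
    + apply H, Hx.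
  - rewrite (pseries_zero_const a r Hr H). unfold scal, plus, opp; simpl; unfold mult; simpl; ring.
Qed.

(** Let [m] be the supremum of the points where [g] is nonzero. The expansion at [m] vanishes to the
    right of [m], so all its coefficients are 0 and [g] vanishes slightly to the left as well,
    against the choice of [m]. *)
Lemma RA_identity (g : R -> R) :
  (forall x, 0 < x -> RA g x) -> (forall x, 1 < x -> g x = 0) ->
  forall x, 0 < x -> g x = 0.
Proof.
  intros HA H1 x0 Hx0.
  destruct (Req_dec (g x0) 0) as [|E0]; trivial. exfalso.
  destruct (completeness (fun y => g y <> 0)) as [m [Hm1 Hm2]].
  { exists 1. intros y Hy. apply Rnot_lt_le; intros Hlt; apply Hy, H1, Hlt. }
  { exists x0; exact E0. }
  assert (Hm : x0 <= m) by (apply Hm1; exact E0).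
  destruct (HA m ltac:(lra)) as (a & r & Hr & Ha).
  assert (Z : forall n, a n = 0).
  { intros n; apply (pseries_zero_coeff n a r Hr). intros x Hx.
    replace 0 with (g (x + m)).
    - replace x with (x + m - m) at 1 by ring. apply Ha.
      replace (x + m - m) with x by ring. rewrite Rabs_pos_eq; lra.
    - destruct (Req_dec (g (x + m)) 0) as [|E]; trivial. exfalso.
      assert (x + m <= m) by (apply Hm1; exact E). lra. }
  assert (m <= m - r / 2); [|lra].
  apply Hm2. intros y Hy. apply Rnot_lt_le; intros Hlt. apply Hy.
  destruct (Rlt_le_dec m y) as [L|L].
  - destruct (Req_dec (g y) 0) as [|E]; trivial. exfalso. assert (y <= m) by (apply Hm1; exact E). lra.
  - assert (K := Ha y). specialize (K ltac:(apply Rabs_def1; lra)).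
    apply is_pseries_unique in K. rewrite <- K. unfold PSeries.
    rewrite (Series_ext _ (fun n => 0 * 0)); [rewrite Series_scal_l; ring|].
    intros n; rewrite Z; ring.
Qed.

(** * Analyticity of Laplace-type series *)

Definition texp (n : nat) (u : R) : R := rsum (fun k => u ^ k / INR (fact k)) n.

Lemma is_series_exp (u : R) : is_series (fun k => u ^ k / INR (fact k)) (exp u).
Proof.
  assert (H := is_exp_Reals u). apply is_pseries_R in H.
  apply (is_series_ext (K := R_AbsRing) (V := R_NormedModule)) with (2 := H).
  intros n; simpl; unfold Rdiv; ring.
Qed.

Lemma exp_term_nonneg (v : R) (k : nat) : 0 <= v -> 0 <= v ^ k / INR (fact k).
Proof.
  intros; apply Rdiv_le_0_compat; [apply pow_le; assumption | apply INR_fact_lt_0].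
Qed.

Lemma texp_le_exp (n : nat) (v : R) : 0 <= v -> texp n v <= exp v.
Proof.
  intros Hv. destruct n as [|n]; [left; apply exp_pos|].
  unfold texp. rewrite <- rsum_sum_n.
  assert (H := is_series_exp v).
  apply (is_lim_seq_incr_compare (sum_n (fun k => v ^ k / INR (fact k))) (exp v) H).
  intros m; rewrite sum_Sn. assert (P := exp_term_nonneg v (S m) Hv). unfold plus; simpl plus.
  change (sum_n (fun k => v ^ k / INR (fact k)) m <=
    sum_n (fun k => v ^ k / INR (fact k)) m + v ^ S m / INR (fact (S m))). lra.
Qed.

Lemma exp_term_le (k : nat) (v : R) : 0 <= v -> v ^ k / INR (fact k) <= exp v.
Proof.
  intros Hv. apply Rle_trans with (2 := texp_le_exp (S k) v Hv).
  unfold texp. simpl rsum.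
  assert (0 <= rsum (fun k => v ^ k / INR (fact k)) k); [|lra].
  apply rsum_nonneg; intros; apply exp_term_nonneg; assumption.
Qed.

(** From rank n on, |u|^k <= q^k v^k <= q^n v^k, so the remainder is at most q^n times the series of
    exp v. The rate q^n is the same for all admissible u and v, hence it passes through integrals
    and series. *)
Lemma texp_error (n : nat) (u v q : R) :
  0 <= v -> 0 <= q <= 1 -> Rabs u <= q * v -> Rabs (exp u - texp n u) <= q ^ n * exp v.
Proof.
  intros Hv Hq Hu.
  assert (L : is_lim_seq (fun m => texp (S m) u) (exp u)).
  { apply is_lim_seq_ext with (2 := is_series_exp u). intros; apply rsum_sum_n. }
  assert (L2 : is_lim_seq (fun m => Rabs (texp (S m) u - texp n u)) (Rabs (exp u - texp n u))).
  { apply (is_lim_seq_abs _ (exp u - texp n u)).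
    apply is_lim_seq_minus'; [exact L | apply is_lim_seq_const]. }
  apply (is_lim_seq_le_loc (fun m => Rabs (texp (S m) u - texp n u)) (fun _ => q ^ n * exp v)
    (Rabs (exp u - texp n u)) (q ^ n * exp v)); [|exact L2 | apply is_lim_seq_const].
  exists n. intros m Hm.
  unfold texp. replace (S m) with (n + (S m - n))%nat by lia. rewrite rsum_split.
  set (d := (S m - n)%nat). unfold Rminus. rewrite Rplus_comm, <- Rplus_assoc, Rplus_opp_l, Rplus_0_l.
  apply Rle_trans with (q ^ n * rsum (fun k => v ^ (n + k) / INR (fact (n + k))) d).
  - rewrite <- rsum_scal. clearbody d. induction d as [|d IH]; simpl rsum; [rewrite Rabs_R0; lra|].
    apply Rle_trans with (1 := Rabs_triang _ _). apply Rplus_le_compat; [exact IH|].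
    unfold Rdiv. rewrite Rabs_mult, <- RPow_abs.
    rewrite (Rabs_pos_eq (/ _)) by (left; apply Rinv_0_lt_compat, INR_fact_lt_0).
    rewrite <- Rmult_assoc. apply Rmult_le_compat_r.
    { left; apply Rinv_0_lt_compat, INR_fact_lt_0. }
    apply Rle_trans with ((q * v) ^ (n + d)).
    { apply pow_incr; split; [apply Rabs_pos | exact Hu]. }
    rewrite Rpow_mult_distr. apply Rmult_le_compat_r; [apply pow_le; exact Hv|].
    rewrite pow_add. rewrite <- (Rmult_1_r (q ^ n)) at 2.
    apply Rmult_le_compat_l; [apply pow_le; lra|].
    rewrite <- (pow1 d). apply pow_incr; lra.
  - apply Rmult_le_compat_l; [apply pow_le; lra|].
    apply Rle_trans with (2 := texp_le_exp (n + d) v Hv).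
    unfold texp. rewrite rsum_split.
    assert (0 <= rsum (fun k => v ^ k / INR (fact k)) n); [|lra].
    apply rsum_nonneg; intros; apply exp_term_nonneg; assumption.
Qed.

Lemma Series_rsum (F : nat -> nat -> R) (n : nat) :
  (forall k, (k < n)%nat -> ex_series (F k)) ->
  ex_series (fun l => rsum (fun k => F k l) n) /\
  Series (fun l => rsum (fun k => F k l) n) = rsum (fun k => Series (F k)) n.
Proof.
  induction n as [|n IH]; intros H; simpl.
  - split.
    + exists 0. assert (K := is_series_finite (fun _ => 0) 0 ltac:(trivial)). now rewrite sum_O in K.
    + rewrite (Series_ext _ (fun n => 0 * 0)); [rewrite Series_scal_l; ring | intros; ring].
  - destruct IH as [I1 I2]; [intros; apply H; lia|].
    split.
    + apply (ex_series_plus (K := R_AbsRing) (V := R_NormedModule)); [exact I1 | apply H; lia].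
    + rewrite Series_plus, I2; trivial. apply H; lia.
Qed.

Lemma RInt_rsum (F : nat -> R -> R) (n : nat) (a b : R) :
  (forall k, (k < n)%nat -> ex_RInt (F k) a b) ->
  ex_RInt (fun x => rsum (fun k => F k x) n) a b /\
  RInt (fun x => rsum (fun k => F k x) n) a b = rsum (fun k => RInt (F k) a b) n.
Proof.
  induction n as [|n IH]; intros H; simpl.
  - split; [apply ex_RInt_const|]. rewrite RInt_const; unfold scal; simpl; unfold mult; simpl; ring.
  - destruct IH as [I1 I2]; [intros; apply H; lia|].
    split.
    + apply (ex_RInt_plus (V := R_NormedModule)); [exact I1 | apply H; lia].
    + rewrite RInt_Rplus, I2; trivial. apply H; lia.
Qed.

Lemma RInt_abs_bound (f : R -> R) (M a b : R) :
  a <= b -> (forall x, a <= x <= b -> continuous f x) ->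
  (forall x, a <= x <= b -> Rabs (f x) <= M) -> Rabs (RInt f a b) <= M * (b - a).
Proof.
  intros Hab Hf H.
  rewrite Rmult_comm. apply abs_RInt_le_const; trivial. apply ex_RInt_cont; assumption.
Qed.

Lemma continuous_Rmult (f g : R -> R) (x : R) :
  continuous f x -> continuous g x -> continuous (fun y => f y * g y) x.
Proof. exact (continuous_mult f g x). Qed.

Lemma continuous_Rplus (f g : R -> R) (x : R) :
  continuous f x -> continuous g x -> continuous (fun y => f y + g y) x.
Proof. exact (continuous_plus f g x). Qed.

Lemma continuous_exp_comp (f : R -> R) (x : R) :
  continuous f x -> continuous (fun y => exp (f y)) x.
Proof. intros H; apply (continuous_comp f exp x H), continuous_exp. Qed.

Lemma continuous_pow_comp (f : R -> R) (n : nat) (x : R) :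
  continuous f x -> continuous (fun y => f y ^ n) x.
Proof.
  intros H; induction n as [|n IH]; simpl; [apply continuous_const|].
  apply continuous_Rmult; assumption.
Qed.

Lemma RInt_abs_bound01 (f : R -> R) (M : R) :
  (forall x, 0 <= x <= 1 -> continuous f x) ->
  (forall x, 0 <= x <= 1 -> Rabs (f x) <= M) -> Rabs (RInt f 0 1) <= M.
Proof. intros Hf H. generalize (RInt_abs_bound f M 0 1 Rle_0_1 Hf H). lra. Qed.

(** The exponential is expanded around s0 under the integral and the sum. Domination at s1, at
    distance r to the left of s0, bounds the coefficients by [M l] / r^k, and [texp_error] bounds
    the remainder by q^n [M l], summable in l; only finite sums get interchanged with series and
    integrals. *)
Lemma RA_laplace (phi lam : nat -> R -> R) (M : nat -> R) (s1 s0 : R) :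
  s1 < s0 ->
  (forall l y, 0 <= y <= 1 -> continuous (phi l) y /\ continuous (lam l) y /\ 0 <= lam l y) ->
  (forall l y, 0 <= y <= 1 -> Rabs (phi l y) * exp (- s1 * lam l y) <= M l) ->
  ex_series M ->
  RA (fun x => Series (fun l => RInt (fun y => phi l y * exp (- x * lam l y)) 0 1)) s0.
Proof.
  intros Hs Hc HM HS.
  set (r := s0 - s1). assert (Hr : 0 < r) by (unfold r; lra).
  set (c := fun k l : nat =>
    RInt (fun y => phi l y * exp (- s0 * lam l y) * ((- lam l y) ^ k / INR (fact k))) 0 1).
  assert (Cc : forall k l y, 0 <= y <= 1 ->
    continuous (fun y => phi l y * exp (- s0 * lam l y) * ((- lam l y) ^ k / INR (fact k))) y).
  { intros k l y Hy. destruct (Hc l y Hy) as (C1 & C2 & _).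
    apply continuous_Rmult; [apply continuous_Rmult; [exact C1|]|].
    - apply continuous_exp_comp, (continuous_Rmult (fun _ => - s0)); [apply continuous_const | exact C2].
    - unfold Rdiv. apply continuous_Rmult; [|apply continuous_const].
      apply continuous_pow_comp, (continuous_opp (lam l) y C2). }
  assert (Cx : forall x l y, 0 <= y <= 1 -> continuous (fun y => phi l y * exp (- x * lam l y)) y).
  { intros x l y Hy. destruct (Hc l y Hy) as (C1 & C2 & _).
    apply continuous_Rmult; [exact C1|].
    apply continuous_exp_comp, (continuous_Rmult (fun _ => - x)); [apply continuous_const | exact C2]. }
  assert (HM0 : forall l, 0 <= M l).
  { intros l. apply Rle_trans with (2 := HM l 0 ltac:(lra)).
    apply Rmult_le_pos; [apply Rabs_pos | left; apply exp_pos]. }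
  assert (Bpt : forall l y w, 0 <= y <= 1 ->
    Rabs w <= exp (r * lam l y) -> Rabs (phi l y * exp (- s0 * lam l y) * w) <= M l).
  { intros l y w Hy Hw. apply Rle_trans with (2 := HM l y Hy).
    rewrite !Rabs_mult, (Rabs_pos_eq (exp _)) by (left; apply exp_pos).
    replace (- s1 * lam l y) with (- s0 * lam l y + r * lam l y) by (unfold r; ring).
    rewrite exp_plus, <- Rmult_assoc. apply Rmult_le_compat_l; [|exact Hw].
    apply Rmult_le_pos; [apply Rabs_pos | left; apply exp_pos]. }
  assert (Bc : forall k l, Rabs (c k l * r ^ k) <= M l).
  { intros k l. unfold c. rewrite Rmult_comm, <- RInt_Rscal by (apply ex_RInt_cont; [lra | auto]).
    apply RInt_abs_bound01.
    - intros y Hy; apply (continuous_Rmult (fun _ => r ^ k)); [apply continuous_const | auto].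
    - intros y Hy.
      replace (r ^ k * (phi l y * exp (- s0 * lam l y) * ((- lam l y) ^ k / INR (fact k)))) with
        (phi l y * exp (- s0 * lam l y) * ((r * - lam l y) ^ k / INR (fact k)))
        by (rewrite Rpow_mult_distr; unfold Rdiv; ring).
      apply Bpt; trivial. destruct (Hc l y Hy) as (_ & _ & P).
      unfold Rdiv. rewrite Rabs_mult, <- RPow_abs.
      rewrite (Rabs_pos_eq (/ _)) by (left; apply Rinv_0_lt_compat, INR_fact_lt_0).
      replace (Rabs (r * - lam l y)) with (r * lam l y).
      + apply exp_term_le. apply Rmult_le_pos; lra.
      + rewrite Rabs_mult, Rabs_Ropp, !Rabs_pos_eq; lra. }
  assert (Ec : forall k, ex_series (c k)).
  { intros k. apply (ex_series_le (K := R_AbsRing) (V := R_CompleteNormedModule) _ (fun l => / r ^ k * M l)).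
    - intros l. change (norm (c k l)) with (Rabs (c k l)).
      assert (P : 0 < r ^ k) by (apply pow_lt; exact Hr).
      apply Rmult_le_reg_l with (r ^ k); [exact P|].
      rewrite <- Rmult_assoc, Rinv_r, Rmult_1_l by lra.
      rewrite <- (Rabs_pos_eq (r ^ k)) by lra. rewrite <- Rabs_mult, Rmult_comm. apply Bc.
    - apply (ex_series_scal (K := R_AbsRing) (V := R_NormedModule)); exact HS. }
  assert (Ex : forall x, Rabs (x - s0) < r ->
    ex_series (fun l => RInt (fun y => phi l y * exp (- x * lam l y)) 0 1)).
  { intros x Hx. apply (ex_series_le (K := R_AbsRing) (V := R_CompleteNormedModule) _ M); [|exact HS].
    intros l. match goal with |- norm ?u <= _ => change (norm u) with (Rabs u) end.
    apply RInt_abs_bound01; [auto |].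
    intros y Hy. destruct (Hc l y Hy) as (_ & _ & P).
    replace (phi l y * exp (- x * lam l y)) with
      (phi l y * exp (- s0 * lam l y) * exp (- (x - s0) * lam l y)).
    + apply Bpt; trivial. rewrite Rabs_pos_eq by (left; apply exp_pos).
      destruct (Req_dec (- (x - s0) * lam l y) (r * lam l y)) as [->|Ne]; [lra|].
      left; apply exp_increasing. apply Rabs_def2 in Hx. nra.
    + rewrite Rmult_assoc, <- exp_plus. f_equal; f_equal; ring. }
  exists (fun k => Series (c k)), r. split; [exact Hr|].
  intros x Hx. apply is_pseries_R. set (z := x - s0) in *.
  set (h := Series (fun l => RInt (fun y => phi l y * exp (- x * lam l y)) 0 1)).
  (* A ratio strictly between |z| / r and 1, hence geometric decay of the remainder. *)
  set (q := (Rabs z / r + 1) / 2).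
  assert (Hz0 := Rabs_pos z).
  assert (Hq0 : 0 <= Rabs z / r < 1).
  { split; [apply Rdiv_le_0_compat; lra|]. apply Rmult_lt_reg_r with r; [lra|].
    unfold Rdiv; rewrite Rmult_assoc, Rinv_l; lra. }
  assert (Hq : 0 <= q < 1) by (unfold q; lra).
  assert (Hzq : Rabs z <= q * r).
  { replace (Rabs z) with (Rabs z / r * r) by (field; lra). apply Rmult_le_compat_r; unfold q; lra. }
  assert (Bn : forall n, Rabs (h - rsum (fun k => Series (c k) * z ^ k) n) <= q ^ n * Series M).
  { intros n.
    destruct (Series_rsum (fun k l => z ^ k * c k l) n) as [S1 S2].
    { intros k _. apply (ex_series_scal (K := R_AbsRing) (V := R_NormedModule)), Ec. }
    rewrite (rsum_ext _ (fun k => Series (fun l => z ^ k * c k l))).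
    2: { intros k _; rewrite Series_scal_l; ring. }
    rewrite <- S2. unfold h. rewrite <- Series_minus by (trivial; apply Ex, Hx).
    assert (Bd : forall l, Rabs (RInt (fun y => phi l y * exp (- x * lam l y)) 0 1 -
      rsum (fun k => z ^ k * c k l) n) <= q ^ n * M l).
    { intros l.
      rewrite (rsum_ext _ (fun k => RInt (fun y => z ^ k *
         (phi l y * exp (- s0 * lam l y) * ((- lam l y) ^ k / INR (fact k)))) 0 1)).
      2: { intros k _. unfold c. symmetry; apply RInt_Rscal. apply ex_RInt_cont; [lra | auto]. }
      destruct (RInt_rsum (fun k y => z ^ k *
         (phi l y * exp (- s0 * lam l y) * ((- lam l y) ^ k / INR (fact k)))) n 0 1) as [R1 R2].
      { intros k _. apply ex_RInt_Rscal, ex_RInt_cont; [lra | auto]. }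
      rewrite <- R2, <- RInt_Rminus; trivial.
      2: { apply ex_RInt_cont; [lra | auto]. }
      rewrite (RInt_ext _ (fun y => phi l y * exp (- s0 * lam l y) *
         (exp (- z * lam l y) - texp n (- z * lam l y)))).
      2: { intros y _. unfold texp. rewrite Rmult_minus_distr_l, Rmult_assoc, <- exp_plus.
           replace (- s0 * lam l y + - z * lam l y) with (- x * lam l y) by (unfold z; ring).
           f_equal. rewrite <- rsum_scal. apply rsum_ext; intros k _.
           replace (- z * lam l y) with (z * - lam l y) by ring.
           rewrite Rpow_mult_distr. unfold Rdiv; ring. }
      apply RInt_abs_bound01.
      - intros y Hy. destruct (Hc l y Hy) as (C1 & C2 & _).
        assert (Cz : forall a, continuous (fun y => a * lam l y) y).
        { intros a; apply (continuous_Rmult (fun _ => a)); [apply continuous_const | exact C2]. }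
        apply continuous_Rmult; [apply continuous_Rmult; [exact C1 | apply continuous_exp_comp, Cz]|].
        apply (continuous_minus (fun y => exp (- z * lam l y)) (fun y => texp n (- z * lam l y))).
        + apply continuous_exp_comp, Cz.
        + unfold texp. clear - Cz. induction n as [|n IH]; simpl; [apply continuous_const|].
          apply continuous_Rplus; [exact IH|]. unfold Rdiv.
          apply continuous_Rmult; [apply continuous_pow_comp, Cz | apply continuous_const].
      - intros y Hy. destruct (Hc l y Hy) as (_ & _ & P).
        apply Rle_trans with (Rabs (phi l y * exp (- s0 * lam l y) * (q ^ n * exp (r * lam l y)))).
        + rewrite !Rabs_mult. apply Rmult_le_compat_l.
          { rewrite <- Rabs_mult; apply Rabs_pos. }
          rewrite (Rabs_pos_eq (q ^ n)) by (apply pow_le; lra).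
          rewrite (Rabs_pos_eq (exp (r * _))) by (left; apply exp_pos).
          apply texp_error; [apply Rmult_le_pos; lra | lra |].
          rewrite Rabs_mult, Rabs_Ropp, (Rabs_pos_eq (lam l y)) by lra.
          rewrite <- Rmult_assoc. apply Rmult_le_compat_r; lra.
        + replace (phi l y * exp (- s0 * lam l y) * (q ^ n * exp (r * lam l y))) with
            (q ^ n * (phi l y * exp (- s0 * lam l y) * exp (r * lam l y))) by ring.
          rewrite Rabs_mult, Rabs_pos_eq by (apply pow_le; lra).
          apply Rmult_le_compat_l; [apply pow_le; lra|]. apply Bpt; trivial.
          rewrite Rabs_pos_eq; [lra | left; apply exp_pos]. }
    assert (EM : ex_series (fun l => q ^ n * M l))
      by (apply (ex_series_scal (K := R_AbsRing) (V := R_NormedModule)); exact HS).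
    rewrite <- Series_scal_l.
    apply Rle_trans with (1 := Series_Rabs _
      (ex_series_le (K := R_AbsRing) (V := R_CompleteNormedModule) _ _
        (fun l => Rle_trans _ _ _ (Req_le _ _ (Rabs_Rabsolu _)) (Bd l)) EM)).
    apply Series_le; [|exact EM]. intros l; split; [apply Rabs_pos | apply Bd]. }
  apply (is_lim_seq_spec _ h). intros eps.
  assert (L : is_lim_seq (fun n => q ^ n * Series M) 0).
  { replace (Finite 0) with (Rbar_mult 0 (Series M)) by (simpl; f_equal; ring).
    apply is_lim_seq_scal_r. apply is_lim_seq_geom. rewrite Rabs_pos_eq; lra. }
  apply is_lim_seq_spec in L. destruct (L eps) as [N HN].
  exists N. intros n Hn. rewrite rsum_sum_n, Rabs_minus_sym.
  apply Rle_lt_trans with (1 := Bn (S n)).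
  apply Rle_lt_trans with (2 := HN (S n) ltac:(lia)).
  rewrite Rminus_0_r. apply Rle_abs.
Qed.

(** * Complex functions that are analytic along a horizontal line *)

Definition RAC (F : R -> C) (x0 : R) : Prop :=
  RA (fun x => Re (F x)) x0 /\ RA (fun x => Im (F x)) x0.

Lemma RAC_ext (F G : R -> C) (x0 : R) : (forall x, F x = G x) -> RAC F x0 -> RAC G x0.
Proof.
  intros H [H1 H2]; split.
  - apply RA_ext with (2 := H1); intros; rewrite H; reflexivity.
  - apply RA_ext with (2 := H2); intros; rewrite H; reflexivity.
Qed.

Lemma RAC_const (c : C) (x0 : R) : RAC (fun _ => c) x0.
Proof. split; apply RA_const. Qed.

Lemma RAC_plus (F G : R -> C) (x0 : R) : RAC F x0 -> RAC G x0 -> RAC (fun x => F x + G x)%C x0.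
Proof. intros [F1 F2] [G1 G2]; split; [exact (RA_plus _ _ _ F1 G1) | exact (RA_plus _ _ _ F2 G2)]. Qed.

Lemma RAC_mult (F G : R -> C) (x0 : R) : RAC F x0 -> RAC G x0 -> RAC (fun x => F x * G x)%C x0.
Proof.
  intros [F1 F2] [G1 G2]; split.
  - apply RA_ext with (fun x => Re (F x) * Re (G x) + (-1) * (Im (F x) * Im (G x))).
    + intros; unfold Re, Im; simpl; ring.
    + apply RA_plus; [apply RA_mult; assumption|].
      apply (RA_mult (fun _ => -1)); [apply RA_const | apply RA_mult; assumption].
  - exact (RA_plus _ _ _ (RA_mult _ _ _ F1 G2) (RA_mult _ _ _ F2 G1)).
Qed.

Lemma RAC_minus (F G : R -> C) (x0 : R) : RAC F x0 -> RAC G x0 -> RAC (fun x => F x - G x)%C x0.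
Proof.
  intros HF HG. apply RAC_ext with (fun x => F x + RtoC (-1) * G x)%C.
  - intros; apply C_ext; unfold Re, Im; simpl; ring.
  - apply RAC_plus; [exact HF | apply RAC_mult; [apply RAC_const | exact HG]].
Qed.

Lemma RAC_line (t x0 : R) : RAC (fun x => (x, t)) x0.
Proof.
  split; simpl; [|apply RA_const].
  apply RA_ext with (2 := RA_affine 1 0 x0); intros; ring.
Qed.

Lemma RAC_Rcpow (b t x0 : R) (c : C) : RAC (fun x => Rcpow b (c - (x, t))%C) x0.
Proof.
  apply RAC_ext with (fun x => Rcpow b (c - (0, t))%C * RtoC (exp (- ln b * x)))%C.
  - intros x. rewrite !Rcpow_polar. destruct c as [p q]; unfold Re, Im; simpl.
    replace ((p + - x) * ln b) with ((p + - 0) * ln b + - ln b * x) by ring.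
    rewrite exp_plus, RtoC_mult. ring.
  - apply RAC_mult; [apply RAC_const|]. split; simpl; [apply RA_exp | apply RA_const].
Qed.

Lemma is_series_C_parts (u : nat -> C) (l : C) :
  @is_series C_AbsRing C_NormedModule u l ->
  is_series (fun k => Re (u k)) (Re l) /\ is_series (fun k => Im (u k)) (Im l).
Proof.
  intros H.
  assert (E : forall n, Re (sum_n u n) = sum_n (fun k => Re (u k)) n /\
                        Im (sum_n u n) = sum_n (fun k => Im (u k)) n).
  { induction n as [|n [I1 I2]]; [rewrite !sum_O; split; reflexivity|].
    rewrite !sum_Sn, <- I1, <- I2; split; reflexivity. }
  split.
  - apply filterlim_ext with (fun n => Re (sum_n u n)); [intros; apply E|].
    apply filterlim_comp with (1 := H). apply (continuous_fst (U := R_UniformSpace) (V := R_UniformSpace)).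
  - apply filterlim_ext with (fun n => Im (sum_n u n)); [intros; apply E|].
    apply filterlim_comp with (1 := H). apply (continuous_snd (U := R_UniformSpace) (V := R_UniformSpace)).
Qed.

(** Along the horizontal line through the centre the increment is real, so the complex power series
    splits into two real ones, with coefficients [Re (a k)] and [Im (a k)]. *)
Lemma RAC_analytic (f : C -> C) (s0 t : R) :
  C_analytic_at f (s0, t) -> RAC (fun x => f (x, t)) s0.
Proof.
  intros (a & [d Hd]).
  assert (K : forall x, Rabs (x - s0) < d ->
    @is_pseries C_AbsRing C_NormedModule a (RtoC (x - s0)) (f (x, t))).
  { intros x Hx.
    replace (RtoC (x - s0)) with ((x, t) - (s0, t))%C
      by (apply C_ext; unfold Re, Im; simpl; ring).
    apply Hd. split; simpl.
    - exact Hx.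
    - apply (ball_center (M := R_UniformSpace) t d). }
  assert (P : forall x k, scal (pow_n (K := C_AbsRing) (RtoC x) k) (a k) =
    (x ^ k * Re (a k), x ^ k * Im (a k))).
  { intros x k.
    assert (E : pow_n (K := C_AbsRing) (RtoC x) k = RtoC (x ^ k)).
    { induction k as [|k IH]; [reflexivity|].
      change (pow_n (K := C_AbsRing) (RtoC x) (S k)) with (RtoC x * pow_n (K := C_AbsRing) (RtoC x) k)%C.
      rewrite IH, <- RtoC_mult; reflexivity. }
    rewrite E. apply C_ext; unfold scal, Re, Im; simpl; unfold mult; simpl; ring. }
  split.
  - exists (fun k => Re (a k)), d; split; [apply cond_pos|]. intros x Hx.
    destruct (is_series_C_parts _ _ (K x Hx)) as [H1 _].
    apply is_pseries_R. apply (is_series_ext (K := R_AbsRing) (V := R_NormedModule)) with (2 := H1).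
    intros k; rewrite P; simpl; ring.
  - exists (fun k => Im (a k)), d; split; [apply cond_pos|]. intros x Hx.
    destruct (is_series_C_parts _ _ (K x Hx)) as [_ H1].
    apply is_pseries_R. apply (is_series_ext (K := R_AbsRing) (V := R_NormedModule)) with (2 := H1).
    intros k; rewrite P; simpl; ring.
Qed.

Lemma RAC_identity (F : R -> C) :
  (forall x, 0 < x -> RAC F x) -> (forall x, 1 < x -> F x = RtoC 0) ->
  forall x, 0 < x -> F x = RtoC 0.
Proof.
  intros HA H1 x Hx; apply C_ext.
  - apply (RA_identity (fun x => Re (F x))); trivial; [apply HA|].
    intros y Hy; rewrite H1; trivial.
  - apply (RA_identity (fun x => Im (F x))); trivial; [apply HA|].
    intros y Hy; rewrite H1; trivial.
Qed.

(** * Limits of complex sequences *)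

Definition Clim (u : nat -> C) (l : C) : Prop :=
  is_lim_seq (fun n => Re (u n)) (Re l) /\ is_lim_seq (fun n => Im (u n)) (Im l).

Lemma Clim_ext (u v : nat -> C) (l : C) : (forall n, u n = v n) -> Clim u l -> Clim v l.
Proof.
  intros H [H1 H2]; split.
  - apply is_lim_seq_ext with (2 := H1); intros; rewrite H; reflexivity.
  - apply is_lim_seq_ext with (2 := H2); intros; rewrite H; reflexivity.
Qed.

Lemma Clim_const (c : C) : Clim (fun _ => c) c.
Proof. split; apply is_lim_seq_const. Qed.

Lemma Clim_plus (u v : nat -> C) (l m : C) :
  Clim u l -> Clim v m -> Clim (fun n => u n + v n)%C (l + m)%C.
Proof. intros [u1 u2] [v1 v2]; split; [exact (is_lim_seq_plus' _ _ _ _ u1 v1) | exact (is_lim_seq_plus' _ _ _ _ u2 v2)]. Qed.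

Lemma Clim_mult (u v : nat -> C) (l m : C) :
  Clim u l -> Clim v m -> Clim (fun n => u n * v n)%C (l * m)%C.
Proof.
  intros [u1 u2] [v1 v2]; split.
  - exact (is_lim_seq_minus' _ _ _ _ (is_lim_seq_mult' _ _ _ _ u1 v1) (is_lim_seq_mult' _ _ _ _ u2 v2)).
  - exact (is_lim_seq_plus' _ _ _ _ (is_lim_seq_mult' _ _ _ _ u1 v2) (is_lim_seq_mult' _ _ _ _ u2 v1)).
Qed.

Lemma Clim_minus (u v : nat -> C) (l m : C) :
  Clim u l -> Clim v m -> Clim (fun n => u n - v n)%C (l - m)%C.
Proof.
  intros [u1 u2] [v1 v2]; split; [exact (is_lim_seq_minus' _ _ _ _ u1 v1) | exact (is_lim_seq_minus' _ _ _ _ u2 v2)].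
Qed.

Lemma Clim_unique (u : nat -> C) (l m : C) : Clim u l -> Clim u m -> l = m.
Proof.
  intros [u1 u2] [v1 v2].
  apply is_lim_seq_unique in u1, u2, v1, v2. apply C_ext; congruence.
Qed.

Lemma Clim_Cmod_0 (u : nat -> C) (l : C) (w : nat -> R) :
  (forall n, Cmod (u n - l)%C <= w n) -> is_lim_seq w 0 -> Clim u l.
Proof.
  intros H Hw.
  assert (K : forall (a : nat -> R) (b : R), (forall n, Rabs (a n - b) <= w n) -> is_lim_seq a b).
  { intros a b Hab. apply is_lim_seq_ext with (fun n => b + (a n - b)); [intros; ring|].
    replace (Finite b) with (Finite (b + 0)) by (f_equal; ring).
    apply is_lim_seq_plus'; [apply is_lim_seq_const|].
    apply is_lim_seq_abs_0. apply is_lim_seq_le_le with (fun _ => 0) w; trivial.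
    - intros n; split; [apply Rabs_pos | apply Hab].
    - apply is_lim_seq_const. }
  split; apply K; intros n; apply Rle_trans with (2 := H n).
  - apply (Re_le_Cmod (u n - l)%C).
  - apply (Im_le_Cmod (u n - l)%C).
Qed.

Lemma Clim_Cmod (u : nat -> C) (l : C) : Clim u l -> is_lim_seq (fun n => Cmod (u n)) (Cmod l).
Proof.
  intros [H1 H2]. unfold Cmod.
  apply (is_lim_seq_continuous sqrt (fun n => fst (u n) ^ 2 + snd (u n) ^ 2)).
  - apply continuity_pt_filterlim, continuous_sqrt.
  - apply is_lim_seq_plus'; apply is_lim_seq_mult'; trivial; apply is_lim_seq_mult'; trivial;
      apply is_lim_seq_const.
Qed.

Lemma Clim_Cmod_le (u : nat -> C) (l : C) (M : R) (N : nat) :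
  (forall n, (N <= n)%nat -> Cmod (u n) <= M) -> Clim u l -> Cmod l <= M.
Proof.
  intros H HL.
  apply (is_lim_seq_le_loc (fun n => Cmod (u n)) (fun _ => M) (Cmod l) M).
  - exists N; exact H.
  - apply Clim_Cmod, HL.
  - apply is_lim_seq_const.
Qed.

Lemma Clim_csum (u : nat -> C) (l : C) :
  is_series (fun k => Re (u k)) (Re l) -> is_series (fun k => Im (u k)) (Im l) ->
  Clim (fun n => csum u (S n)) l.
Proof.
  intros H1 H2.
  assert (E : forall n, Re (csum u (S n)) = sum_n (fun k => Re (u k)) n /\
                        Im (csum u (S n)) = sum_n (fun k => Im (u k)) n).
  { induction n as [|n [I1 I2]].
    - rewrite !sum_O; split; unfold Re, Im; simpl; ring.
    - rewrite !sum_Sn, <- I1, <- I2; split; reflexivity. }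
  split.
  - apply is_lim_seq_ext with (2 := H1); intros; symmetry; apply E.
  - apply is_lim_seq_ext with (2 := H2); intros; symmetry; apply E.
Qed.

(** * Euler-Maclaurin formula on the critical line *)

(** Up to the factor -s, the Euler-Maclaurin remainder of one step; the kernel is y instead of y -
    1/2, so that no half terms appear. *)
Definition euler_term (al : R) (s : C) (l : nat) : C :=
  CI (fun y => RtoC y * Rcpow (y + (INR (S l) + al)) (- s - RtoC 1))%C 0 1.

Lemma INR_S_pos (n : nat) : 0 < INR (S n).
Proof. apply lt_0_INR; lia. Qed.

Lemma INR_S_ge_1 (n : nat) : 1 <= INR (S n).
Proof. change 1 with (INR 1); apply le_INR; lia. Qed.

Lemma euler_term_cont (al : R) (s : C) (l : nat) (y : R) :
  0 <= al -> 0 <= y -> Ccont (fun y => RtoC y * Rcpow (y + (INR (S l) + al)) (- s - RtoC 1))%C y.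
Proof.
  intros Ha Hy. generalize (INR_S_pos l); intros P.
  apply Ccont_mult; [apply Ccont_RtoC, continuous_id | apply Ccont_Rcpow; lra].
Qed.

Lemma euler_term_eq (al : R) (s : C) (l : nat) :
  0 <= al ->
  (- (s * (RtoC 1 - s)) * euler_term al s l =
   (RtoC 1 - s) * Rcpow (INR (S (S l)) + al) (- s)
     - Rcpow (INR (S (S l)) + al) (RtoC 1 - s) + Rcpow (INR (S l) + al) (RtoC 1 - s))%C.
Proof.
  intros Ha. generalize (INR_S_pos l); intros P.
  unfold euler_term. set (c := INR (S l) + al).
  rewrite <- CI_scal; [|lra | intros; apply euler_term_cont; lra].
  rewrite (CI_FTC (fun y => (RtoC 1 - s) * (RtoC y * Rcpow (y + c) (- s)) - Rcpow (y + c) (RtoC 1 - s))%C).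
  - rewrite Rplus_0_l. replace (INR (S (S l)) + al) with (1 + c) by (unfold c; rewrite (S_INR (S l)); ring).
    ring.
  - lra.
  - intros y Hy. assert (0 < y + c) by (unfold c; lra).
    eapply Cder_eq; [|apply Cder_minus; [apply Cder_scal, Cder_mult; [apply Cder_RtoC, is_derive_id|]|]].
    2, 3: apply Cder_Rcpow; assumption.
    replace (RtoC 1 - s - 1)%C with (- s)%C by ring.
    change (RtoC one) with (RtoC 1). ring.
  - intros y Hy. apply Ccont_mult; [apply Ccont_const | apply euler_term_cont; lra].
Qed.

Lemma zeta_partial_sum (al : R) (s : C) (L : nat) :
  0 <= al ->
  ((RtoC 1 - s) * csum (fun k => Rcpow (INR (S k) + al) (- s)) (S L) =
   (RtoC 1 - s) * Rcpow (1 + al) (- s) - Rcpow (1 + al) (RtoC 1 - s)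
   + Rcpow (INR (S L) + al) (RtoC 1 - s)
   - s * (RtoC 1 - s) * csum (euler_term al s) L)%C.
Proof.
  intros Ha. induction L as [|L IH].
  - simpl. ring.
  - change (csum (fun k => Rcpow (INR (S k) + al) (- s)%C) (S (S L))) with
      (csum (fun k => Rcpow (INR (S k) + al) (- s)%C) (S L) + Rcpow (INR (S (S L)) + al) (- s)%C)%C.
    change (csum (euler_term al s) (S L)) with (csum (euler_term al s) L + euler_term al s L)%C.
    rewrite Cmult_plus_distr_l, IH.
    assert (E := euler_term_eq al s L Ha).
    transitivity ((RtoC 1 - s) * Rcpow (1 + al) (- s) - Rcpow (1 + al) (RtoC 1 - s) +
      Rcpow (INR (S (S L)) + al) (RtoC 1 - s) - s * (RtoC 1 - s) * csum (euler_term al s) L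
      + (- (s * (RtoC 1 - s)) * euler_term al s L))%C; [rewrite E|]; ring.
Qed.

Lemma Clim_incr_1 (u : nat -> C) (l : C) : Clim u l -> Clim (fun n => u (S n)) l.
Proof. intros [H1 H2]; split; [apply (is_lim_seq_incr_1 (fun n => Re (u n))) | apply (is_lim_seq_incr_1 (fun n => Im (u n)))]; assumption. Qed.

Lemma ex_series_bounded (a : nat -> R) (M : R) :
  (forall k, 0 <= a k) -> (forall n, rsum a n <= M) -> ex_series a.
Proof.
  intros H HM.
  destruct (ex_finite_lim_seq_incr (sum_n a) M) as [l Hl].
  - intros n; rewrite !rsum_sum_n. simpl. generalize (H (S n)); lra.
  - intros n; rewrite rsum_sum_n; apply HM.
  - exists l; exact Hl.
Qed.

Lemma ex_series_Rpower (p : R) : 0 < p -> ex_series (fun l => Rpower (INR (S l)) (- p - 1)).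
Proof.
  intros Hp. apply ex_series_bounded with (1 + / p).
  - intros; left; apply Rpower_pos.
  - intros [|n].
    + simpl. assert (0 < / p) by (apply Rinv_0_lt_compat; lra). lra.
    + change (S n) with (1 + n)%nat. rewrite rsum_split.
      assert (H := rsum_Rpower_tail p 1 n Hp ltac:(lia)).
      change (INR 1) with 1 in H. rewrite Rpower_base_1 in H.
      simpl rsum at 1. change (INR 1) with 1. rewrite Rpower_base_1.
      unfold Rdiv in H. lra.
Qed.

Lemma Cmod_euler_term (al sig t : R) (l : nat) :
  0 <= al -> 0 < sig -> Cmod (euler_term al (sig, t) l) <= Rpower (INR (S l)) (- sig - 1).
Proof.
  intros Ha Hs. generalize (INR_S_pos l); intros P. unfold euler_term.
  assert (K := CI_bound (fun y => RtoC y * Rcpow (y + (INR (S l) + al)) (- (sig, t) - RtoC 1))%C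
    (Rpower (INR (S l)) (- sig - 1)) 0 1 Rle_0_1).
  rewrite Rminus_0_r, Rmult_1_r in K. apply K.
  - intros; apply euler_term_cont; lra.
  - intros y Hy. rewrite Cmod_mult, Cmod_Rcpow, Cmod_R_nonneg by lra.
    replace (Re (- (sig, t) - RtoC 1)%C) with (- sig - 1) by (unfold Re; simpl; ring).
    rewrite <- (Rmult_1_l (Rpower (INR (S l)) _)).
    apply Rmult_le_compat; [lra | left; apply Rpower_pos | lra |].
    apply Rpower_decr; lra.
Qed.

Definition euler_sum (al : R) (s : C) : C :=
  (Series (fun l => Re (euler_term al s l)), Series (fun l => Im (euler_term al s l))).

Lemma euler_sum_lim (al sig t : R) :
  0 <= al -> 0 < sig -> Clim (fun n => csum (euler_term al (sig, t)) (S n)) (euler_sum al (sig, t)).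
Proof.
  intros Ha Hs. apply Clim_csum; apply Series_correct;
    apply (ex_series_le (K := R_AbsRing) (V := R_CompleteNormedModule) _
      (fun l => Rpower (INR (S l)) (- sig - 1)));
    try (apply ex_series_Rpower; exact Hs); intros l.
  - apply Rle_trans with (2 := Cmod_euler_term al sig t l Ha Hs), Re_le_Cmod.
  - apply Rle_trans with (2 := Cmod_euler_term al sig t l Ha Hs), Im_le_Cmod.
Qed.

(** For a fixed imaginary part the integrand is exp(-x ln(y + c)) times factors free of x, the
    situation of [RA_laplace] with exponent ln(y + c) >= 0, as c >= 1. Convergence at the abscissa
    x0 / 2 supplies the domination. *)
Lemma euler_sum_RAC (al t x0 : R) : 0 <= al -> 0 < x0 -> RAC (fun x => euler_sum al (x, t)) x0.
Proof.
  intros Ha Hx.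
  set (lam := fun (l : nat) y => ln (y + (INR (S l) + al))).
  assert (Clam : forall l y, 0 <= y <= 1 -> continuous (lam l) y).
  { intros l y Hy. generalize (INR_S_pos l); intros P.
    revert P; unfold lam; generalize (INR (S l)); intros b P.
    apply (ex_derive_continuous (V := R_NormedModule)). auto_derive. lra. }
  assert (K : forall psi : nat -> R -> R,
    (forall l y, 0 <= y <= 1 -> continuous (psi l) y /\ Rabs (psi l y) <= 1) ->
    RA (fun x => Series (fun l => RInt (fun y => (y * exp (- lam l y) * psi l y) * exp (- x * lam l y)) 0 1)) x0).
  { intros psi Hpsi.
    apply (RA_laplace _ lam (fun l => Rpower (INR (S l)) (- (x0 / 2) - 1)) (x0 / 2)); [lra | | |].
    - intros l y Hy. generalize (INR_S_ge_1 l); intros P. split; [|split].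
      + apply continuous_Rmult; [apply continuous_Rmult|].
        * apply continuous_id.
        * apply continuous_exp_comp, (continuous_opp (lam l)), Clam, Hy.
        * apply Hpsi, Hy.
      + apply Clam, Hy.
      + unfold lam. rewrite <- ln_1. destruct (Req_dec 1 (y + (INR (S l) + al))) as [<-|Ne]; [lra|].
        left; apply ln_increasing; lra.
    - intros l y Hy. generalize (INR_S_ge_1 l); intros P.
      destruct (Hpsi l y Hy) as [_ B].
      rewrite !Rabs_mult, (Rabs_pos_eq y), (Rabs_pos_eq (exp _)) by (try (left; apply exp_pos); lra).
      apply Rle_trans with (Rpower (y + (INR (S l) + al)) (- (x0 / 2) - 1)).
      2: apply Rpower_decr; lra.
      unfold Rpower. fold (lam l y).
      replace ((- (x0 / 2) - 1) * lam l y) with (- lam l y + - (x0 / 2) * lam l y) by ring.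
      rewrite exp_plus. apply Rmult_le_compat_r; [left; apply exp_pos|].
      rewrite <- (Rmult_1_r (exp (- lam l y))) at 2. rewrite (Rmult_comm y), Rmult_assoc.
      apply Rmult_le_compat_l; [left; apply exp_pos|].
      generalize (Rabs_pos (psi l y)); nra.
    - apply ex_series_Rpower; lra. }
  assert (Ccos : forall l y, 0 <= y <= 1 -> continuous (fun y => cos (- t * lam l y)) y /\
                 continuous (fun y => sin (- t * lam l y)) y).
  { intros l y Hy. assert (E : continuous (fun y => - t * lam l y) y)
      by (apply (continuous_Rmult (fun _ => - t)); [apply continuous_const | auto]).
    split; [apply (continuous_comp _ cos _ E), continuous_cos | apply (continuous_comp _ sin _ E), continuous_sin]. }
  assert (Q : forall x l y, Rcpow (y + (INR (S l) + al)) (- (x, t) - RtoC 1) =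
     (RtoC (exp (- lam l y) * exp (- x * lam l y)) * cis (- t * lam l y))%C).
  { intros x l y. rewrite Rcpow_polar, <- exp_plus. f_equal; [do 2 f_equal|f_equal];
      unfold lam, Re, Im; simpl; ring. }
  split.
  - apply RA_ext with (2 := K (fun l y => cos (- t * lam l y))
      (fun l y Hy => conj (proj1 (Ccos l y Hy)) (Rabs_le _ _ (COS_bound _)))).
    intros x. change (Re (euler_sum al (x, t))) with (Series (fun l =>
      RInt (fun y => Re (RtoC y * Rcpow (y + (INR (S l) + al)) (- (x, t) - RtoC 1))%C) 0 1)).
    apply Series_ext; intros l. apply RInt_ext; intros y _. rewrite Q. unfold cis, Re, Im; simpl; ring.
  - apply RA_ext with (2 := K (fun l y => sin (- t * lam l y))
      (fun l y Hy => conj (proj2 (Ccos l y Hy)) (Rabs_le _ _ (SIN_bound _)))).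
    intros x. change (Im (euler_sum al (x, t))) with (Series (fun l =>
      RInt (fun y => Im (RtoC y * Rcpow (y + (INR (S l) + al)) (- (x, t) - RtoC 1))%C) 0 1)).
    apply Series_ext; intros l. apply RInt_ext; intros y _. rewrite Q. unfold cis, Re, Im; simpl; ring.
Qed.

Lemma is_lim_seq_Rpower_0 (al p : R) : 0 < p -> 0 <= al ->
  is_lim_seq (fun n => Rpower (INR (S n) + al) (- p)) 0.
Proof.
  intros Hp Ha. apply is_lim_seq_spec. intros eps.
  (* The threshold solves B^(-p) = eps. *)
  set (B := Rpower eps (- / p)).
  destruct (nfloor_ex B) as [N HN]; [left; apply exp_pos|].
  exists N. intros n Hn.
  assert (L : B < INR (S n) + al).
  { apply Rlt_le_trans with (INR (S n)); [|lra]. rewrite S_INR.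
    apply Rlt_le_trans with (1 := proj2 HN). apply le_INR in Hn. lra. }
  rewrite Rminus_0_r, Rabs_pos_eq by (left; apply Rpower_pos).
  assert (B0 : 0 < B) by apply exp_pos.
  apply Rlt_le_trans with (Rpower B (- p)).
  - unfold Rpower. apply exp_increasing. assert (ln B < ln (INR (S n) + al)) by (apply ln_increasing; assumption). nra.
  - unfold B. rewrite Rpower_mult. replace (- / p * - p) with 1 by (field; lra).
    rewrite Rpower_1; [lra | apply cond_pos].
Qed.

(** Along Im s = t both sides are analytic for Re s > 0, and they agree for Re s > 1, where the
    partial sum formula passes to the limit. The condition t <> 0 keeps the line away from the
    pole. *)
Lemma continuation_eq (al t : R) (f : C -> C) :
  0 <= al -> t <> 0 ->
  is_continuation_of_series (fun k s => Rcpow (INR (S k) + al) (- s)%C) f ->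
  forall x, 0 < x ->
  let s := (x, t) in
  ((RtoC 1 - s) * f s = (RtoC 1 - s) * Rcpow (1 + al) (- s) - Rcpow (1 + al) (RtoC 1 - s)
     - s * (RtoC 1 - s) * euler_sum al s)%C.
Proof.
  intros Ha Ht [H1 H2].
  set (E := fun x : R => ((RtoC 1 - (x, t)) * f (x, t) - ((RtoC 1 - (x, t)) * Rcpow (1 + al) (- (x, t)) - Rcpow (1 + al) (RtoC 1 - (x, t))
     - (x, t) * (RtoC 1 - (x, t)) * euler_sum al (x, t)))%C).
  assert (HE : forall x, 0 < x -> E x = RtoC 0).
  { apply RAC_identity.
    - intros x Hx. unfold E.
      assert (R1 : RAC (fun x => RtoC 1 - (x, t))%C x)
        by (apply RAC_minus; [apply RAC_const | apply RAC_line]).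
      assert (R2 : forall c, RAC (fun x => Rcpow (1 + al) (c - (x, t))%C) x) by (intros; apply RAC_Rcpow).
      apply RAC_minus; [apply RAC_mult; [exact R1|]|].
      + apply RAC_analytic, H2. intros K. apply Ht. exact (f_equal snd K).
      + apply RAC_minus; [apply RAC_minus; [apply RAC_mult; [exact R1|]|apply R2]|].
        * apply RAC_ext with (2 := R2 (RtoC 0)). intros; f_equal; ring.
        * apply RAC_mult; [apply RAC_mult; [apply RAC_line | exact R1]|].
          apply euler_sum_RAC; assumption.
    - intros x Hx. unfold E. set (s := (x, t)).
      destruct (is_series_C_parts _ _ (H1 s Hx)) as [S1 S2].
      assert (L1 := Clim_incr_1 _ _ (Clim_csum _ _ S1 S2)).
      assert (L2 := euler_sum_lim al x t Ha ltac:(lra)). fold s in L2.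
      assert (L3 : Clim (fun n => Rcpow (INR (S (S n)) + al) (RtoC 1 - s)) (RtoC 0)).
      { apply Clim_Cmod_0 with (fun n => Rpower (INR (S (S n)) + al) (- (x - 1))).
        - intros n. replace (Rcpow (INR (S (S n)) + al) (RtoC 1 - s) - RtoC 0)%C
            with (Rcpow (INR (S (S n)) + al) (RtoC 1 - s)) by ring.
          rewrite Cmod_Rcpow. right; f_equal. unfold s, Re; simpl; ring.
        - apply (is_lim_seq_incr_1 (fun n => Rpower (INR (S n) + al) (- (x - 1)))), is_lim_seq_Rpower_0; lra. }
      assert (L4 := Clim_mult _ _ _ _ (Clim_const (RtoC 1 - s)%C) L1).
      assert (L5 := Clim_minus _ _ _ _ (Clim_plus _ _ _ _ (Clim_const ((RtoC 1 - s) * Rcpow (1 + al) (- s) - Rcpow (1 + al) (RtoC 1 - s))%C) L3)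
         (Clim_mult _ _ _ _ (Clim_const (s * (RtoC 1 - s))%C) L2)).
      assert (Q := Clim_unique _ _ _ (Clim_ext _ _ _ (fun n => zeta_partial_sum al s (S n) Ha) L4) L5).
      rewrite Q. ring. }
  intros x Hx s. specialize (HE x Hx). unfold E in HE. fold s in HE.
  match type of HE with (?a - ?b)%C = _ => replace a with (a - b + b)%C by ring; rewrite HE end. ring.
Qed.

(** The truncated series with a correction for its divergent growth; it is the correction that makes
    these expressions converge at real part 1/2. *)
Definition hurwitz_partial (t al : R) (L : nat) : C :=
  (csum (fun k => Rcpow (INR (S k) + al) (- crit t)) L
     - Rcpow (INR L + al) (RtoC 1 - crit t) / (RtoC 1 - crit t))%C.

Lemma crit_eq (t : R) : crit t = (1 / 2, t).
Proof. unfold crit; apply C_ext; unfold Re, Im; simpl; ring. Qed.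

Lemma crit_neq_1 (t : R) : (RtoC 1 - crit t)%C <> RtoC 0.
Proof. rewrite crit_eq. intros H. apply (f_equal fst) in H. simpl in H. lra. Qed.

Lemma Cmod_crit (t : R) : 1 <= t -> Cmod (crit t) <= 2 * t.
Proof.
  intros Ht. rewrite crit_eq. apply Rle_trans with (1 := Cmod_le_Re_Im _).
  unfold Re, Im; simpl. rewrite !Rabs_pos_eq; lra.
Qed.

Lemma Cmod_1_minus_crit (t : R) : 1 <= t -> t <= Cmod (RtoC 1 - crit t).
Proof.
  intros Ht. rewrite crit_eq. apply Rle_trans with (2 := Im_le_Cmod _).
  unfold Im; simpl. rewrite Rplus_0_l, Rabs_Ropp, Rabs_pos_eq; lra.
Qed.

(** The kernel y is bounded by 1; what remains has the primitive -2 (y + c)^(-1/2), which telescopes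
    over the terms. *)
Lemma euler_term_tail (t al : R) (L n : nat) :
  0 <= al ->
  Cmod (csum (fun l => euler_term al (crit t) (L + l)) n) <= 2 / sqrt (INR (S L) + al).
Proof.
  intros Ha.
  assert (HL := INR_S_pos L).
  apply Rle_trans with (1 := Cmod_csum _ _).
  assert (H : forall k, Cmod (euler_term al (crit t) (L + k)) <=
    - 2 * Rpower (INR (S (L + S k)) + al) (- (1 / 2)) - (- 2) * Rpower (INR (S (L + k)) + al) (- (1 / 2))).
  { intros k; rewrite Nat.add_succ_r, (S_INR (S (L + k))). assert (Hb := INR_S_pos (L + k)).
    unfold euler_term.
    set (c := INR (S (L + k)) + al).
    replace (INR (S (L + k)) + 1 + al) with (1 + c) by (unfold c; ring).
    replace (-2 * Rpower (1 + c) (- (1 / 2)) - -2 * Rpower c (- (1 / 2))) with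
      ((fun y => -2 * Rpower (y + c) (- (1 / 2))) 1 - (fun y => -2 * Rpower (y + c) (- (1 / 2))) 0)
      by (rewrite Rplus_0_l; reflexivity).
    assert (Cp : forall y, 0 <= y <= 1 -> continuous (fun y => Rpower (y + c) (- (1 / 2) - 1)) y).
    { intros y Hy. apply (continuous_comp (fun y => y + c) (fun z => Rpower z (- (1 / 2) - 1))).
      - apply (ex_derive_continuous (V := R_NormedModule)); auto_derive; trivial.
      - apply continuous_Rpower; unfold c; lra. }
    rewrite <- (RInt_FTC (fun y => -2 * Rpower (y + c) (- (1 / 2))) (fun y => Rpower (y + c) (- (1 / 2) - 1)));
      [| lra | | exact Cp].
    - apply CI_norm; [lra | | exact Cp |].
      + intros y Hy. apply euler_term_cont; lra.
      + intros y Hy. rewrite Cmod_mult, Cmod_Rcpow, Cmod_R_nonneg by lra.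
        replace (Re (- crit t - RtoC 1)%C) with (- (1 / 2) - 1) by (rewrite crit_eq; unfold Re; simpl; ring).
        fold c. generalize (Rpower_pos (y + c) (- (1 / 2) - 1)); nra.
    - intros y Hy. assert (P : 0 < y + c) by (unfold c; lra).
      replace (Rpower (y + c) (- (1 / 2) - 1)) with (-2 * (1 * (- (1 / 2) * Rpower (y + c) (- (1 / 2) - 1)))) by field.
      apply (is_derive_scal (fun y => Rpower (y + c) (- (1 / 2))) y (-2)).
      apply (is_derive_comp (fun z => Rpower z (- (1 / 2))) (fun y => y + c)).
      + apply is_derive_Rpower; exact P.
      + auto_derive; [trivial | ring]. }
  apply Rle_trans with (1 := rsum_le_telescope _ (fun k => -2 * Rpower (INR (S (L + k)) + al) (- (1 / 2))) n (fun k _ => H k)).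
  rewrite Nat.add_0_r, (Rpower_mhalf (INR (S L) + al)) by lra.
  generalize (Rpower_pos (INR (S (L + n)) + al) (- (1 / 2))). unfold Rdiv. lra.
Qed.

Lemma Cmult_cancel_l (a b c : C) : a <> RtoC 0 -> (a * b = a * c)%C -> b = c.
Proof.
  intros Ha H. replace b with (/ a * (a * b))%C by (field; exact Ha). rewrite H. field; exact Ha.
Qed.

Lemma hurwitz_approx (t al : R) (f : C -> C) :
  0 <= al -> 1 <= t ->
  is_continuation_of_series (fun k s => Rcpow (INR (S k) + al) (- s)%C) f ->
  forall L, (0 < L)%nat ->
  Cmod (f (crit t) - hurwitz_partial t al L) <= 4 * t / sqrt (INR L + al).
Proof.
  intros Ha Ht Hf [|L] HL; [lia|]. clear HL.
  set (s := crit t). assert (Hs : s = (1 / 2, t)) by apply crit_eq.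
  assert (Ns := crit_neq_1 t). fold s in Ns.
  assert (E1 := continuation_eq al t f Ha ltac:(lra) Hf (1 / 2) ltac:(lra)).
  cbv zeta in E1. rewrite <- Hs in E1.
  assert (Lim := euler_sum_lim al (1 / 2) t Ha ltac:(lra)). rewrite <- Hs in Lim.
  assert (E2 := zeta_partial_sum al s L Ha).
  assert (E3 : (f s - hurwitz_partial t al (S L) = - s * (euler_sum al s - csum (euler_term al s) L))%C).
  { unfold hurwitz_partial. fold s.
    apply (Cmult_cancel_l (RtoC 1 - s)%C); [exact Ns|].
    replace ((RtoC 1 - s) * (f s - (csum (fun k => Rcpow (INR (S k) + al) (- s)) (S L)
      - Rcpow (INR (S L) + al) (RtoC 1 - s) / (RtoC 1 - s))))%C with
      ((RtoC 1 - s) * f s - (RtoC 1 - s) * csum (fun k => Rcpow (INR (S k) + al) (- s)) (S L)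
        + Rcpow (INR (S L) + al) (RtoC 1 - s))%C by (field; exact Ns).
    rewrite E1, E2. ring. }
  rewrite E3, Cmod_mult, Cmod_opp.
  assert (B : Cmod (euler_sum al s - csum (euler_term al s) L) <= 2 / sqrt (INR (S L) + al)).
  { apply Clim_Cmod_le with (fun n => csum (euler_term al s) (S n) - csum (euler_term al s) L)%C L.
    - intros n Hn. replace (S n) with (L + (S n - L))%nat by lia. rewrite csum_split.
      replace (csum (euler_term al s) L + csum (fun k => euler_term al s (L + k)) (S n - L)
        - csum (euler_term al s) L)%C with (csum (fun k => euler_term al s (L + k)) (S n - L)) by ring.
      apply euler_term_tail; exact Ha.
    - apply Clim_minus; [exact Lim | apply Clim_const]. }
  assert (C := Cmod_crit t Ht). fold s in C.
  apply Rle_trans with (2 * t * (2 / sqrt (INR (S L) + al))).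
  - apply Rmult_le_compat; try apply Cmod_ge_0; assumption.
  - right; unfold Rdiv; ring.
Qed.

(** * The Hurwitz zeta function on the critical line, as a function of the shift *)

(** The interface for the rest of the proof: continuity in the shift and an explicit rate of
    approximation by finite sums. Continuity is stated on the whole line so that the endpoint 0 of
    the unit interval requires no special care. *)
Definition is_hurwitz_on_line (t : R) (Z : R -> C) : Prop :=
  (forall x, Ccont Z x) /\
  forall x L, 0 <= x -> (0 < L)%nat ->
    Cmod (Z x - hurwitz_partial t x L) <= 4 * t / sqrt (INR L + x).

(** The passage to the limit L -> infinity, in the form used for every truncated estimate below: one
    and the same L serves for all approximations occurring in an inequality. *)
Lemma le_of_inv_sqrt (a b c : R) :
  0 <= c -> (forall L, (0 < L)%nat -> a <= b + c / sqrt (INR L)) -> a <= b.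
Proof.
  intros Hc H. apply Rnot_lt_le; intros Hlt.
  set (d := (a - b) / 2). assert (Hd : 0 < d) by (unfold d; lra).
  set (B := ((c + 1) / d) ^ 2).
  destruct (nfloor_ex B) as [N [_ HN]]; [apply pow2_ge_0|].
  specialize (H (S N) ltac:(lia)).
  assert (P := INR_S_pos N).
  assert (Q : (c + 1) / d <= sqrt (INR (S N))).
  { rewrite <- (sqrt_pow2 ((c + 1) / d)) by (apply Rdiv_le_0_compat; lra).
    apply sqrt_le_1; [apply pow2_ge_0 | lra |]. rewrite S_INR. unfold B in HN; lra. }
  assert (S0 : 0 < sqrt (INR (S N))) by (apply sqrt_lt_R0; lra).
  assert (c / sqrt (INR (S N)) <= d); [|unfold d in *; lra].
  apply Rmult_le_reg_r with (sqrt (INR (S N))); [exact S0|].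
  unfold Rdiv; rewrite Rmult_assoc, Rinv_l, Rmult_1_r by lra.
  apply Rle_trans with (d * ((c + 1) / d)); [|apply Rmult_le_compat_l; lra].
  replace (d * ((c + 1) / d)) with (c + 1) by (field; lra). lra.
Qed.

Lemma Cmod_le_0 (z : C) : Cmod z <= 0 -> z = RtoC 0.
Proof. intros H. apply Cmod_eq_0. generalize (Cmod_ge_0 z); lra. Qed.

Lemma div_sqrt_le (c x y : R) : 0 <= c -> 0 < x -> x <= y -> c / sqrt y <= c / sqrt x.
Proof.
  intros Hc Hx Hxy. apply Rmult_le_compat_l; [exact Hc|].
  apply Rinv_le_contravar; [apply sqrt_lt_R0; exact Hx | apply sqrt_le_1; lra].
Qed.

Lemma hurwitz_partial_shift (t x : R) (L : nat) :
  hurwitz_partial t x (S L) = (Rcpow (x + 1) (- crit t) + hurwitz_partial t (x + 1) L)%C.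
Proof.
  unfold hurwitz_partial. change (S L) with (1 + L)%nat at 1. rewrite csum_split.
  rewrite (csum_ext (fun k => Rcpow (INR (S (1 + k)) + x) (- crit t))
    (fun k => Rcpow (INR (S k) + (x + 1)) (- crit t))).
  - simpl csum at 1. replace (INR (S L) + x) with (INR L + (x + 1)) by (rewrite S_INR; ring).
    change (INR 1) with 1. replace (1 + x) with (x + 1) by ring. unfold Cminus. ring.
  - intros k _. f_equal. change (1 + k)%nat with (S k). rewrite (S_INR (S k)). ring.
Qed.

(** At a finite level the two sides differ exactly by the shift of the summation index
    ([hurwitz_partial_shift]), so only truncation errors remain. *)
Lemma hurwitz_shift (t : R) (Z : R -> C) (x : R) :
  1 <= t -> is_hurwitz_on_line t Z -> 0 <= x ->
  Z x = (Rcpow (x + 1) (- crit t) + Z (x + 1)%R)%C.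
Proof.
  intros Ht [_ H] Hx.
  assert (K : Cmod (Z x - (Rcpow (x + 1) (- crit t) + Z (x + 1)%R))%C <= 0).
  { apply le_of_inv_sqrt with (8 * t); [lra|]. intros L HL.
    assert (0 < INR L) by (apply lt_0_INR; exact HL).
    replace (Z x - (Rcpow (x + 1) (- crit t) + Z (x + 1)%R))%C with
      ((Z x - hurwitz_partial t x (S L)) - (Z (x + 1)%R - hurwitz_partial t (x + 1) L))%C
      by (rewrite hurwitz_partial_shift; ring).
    apply Rle_trans with (1 := Cmod_triangle_minus _ _).
    assert (A := H x (S L) Hx ltac:(lia)). assert (B := H (x + 1) L ltac:(lra) HL).
    assert (4 * t / sqrt (INR (S L) + x) <= 4 * t / sqrt (INR L)) by (apply div_sqrt_le; rewrite ?S_INR; lra).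
    assert (4 * t / sqrt (INR L + (x + 1)) <= 4 * t / sqrt (INR L)) by (apply div_sqrt_le; lra).
    unfold Rdiv in *. lra. }
  apply Cmod_le_0 in K.
  replace (Z x) with (Z x - (Rcpow (x + 1) (- crit t) + Z (x + 1)%R) + (Rcpow (x + 1) (- crit t) + Z (x + 1)%R))%C at 1 by ring.
  rewrite K; ring.
Qed.

Lemma continuous_of_approx (g : R -> R) (x : R) :
  (forall eps, 0 < eps -> exists h, continuous h x /\ forall y, Rabs (g y - h y) <= eps) ->
  continuous g x.
Proof.
  intros H. apply continuity_pt_filterlim. intros eps Heps.
  destruct (H (eps / 3) ltac:(lra)) as [h [Hh B]].
  apply continuity_pt_filterlim in Hh.
  destruct (Hh (eps / 3) ltac:(lra)) as [d [Hd K]].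
  exists d; split; [exact Hd|]. intros y Hy. specialize (K y Hy).
  simpl in *; unfold Rdist in *.
  assert (B1 := B y). assert (B2 := B x). rewrite Rabs_minus_sym in B2.
  replace (g y - g x) with ((g y - h y) + (h y - h x) + (h x - g x)) by ring.
  generalize (Rabs_triang ((g y - h y) + (h y - h x)) (h x - g x)) (Rabs_triang (g y - h y) (h y - h x)).
  lra.
Qed.

Lemma continuous_Rmax_0 (x : R) : continuous (fun y => Rmax 0 y) x.
Proof.
  apply continuous_ext with (fun y => (y + Rabs y) / 2).
  - intros y. unfold Rmax, Rabs. destruct (Rle_dec 0 y), (Rcase_abs y); lra.
  - unfold Rdiv. apply (continuous_Rmult (fun y => y + Rabs y) (fun _ => / 2)); [|apply continuous_const].
    apply continuous_Rplus; [apply continuous_id | apply continuous_Rabs].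
Qed.

Lemma hurwitz_partial_cont (t x : R) (L : nat) : (0 < L)%nat ->
  Ccont (fun y => hurwitz_partial t (Rmax 0 y) L) x.
Proof.
  intros HL. assert (P : 0 < INR L) by (apply lt_0_INR; exact HL).
  assert (Q := Rmax_l 0 x).
  apply (Ccont_comp (fun y => hurwitz_partial t y L) (Rmax 0)); [apply continuous_Rmax_0|].
  unfold hurwitz_partial, Cdiv. apply Ccont_minus.
  - apply Ccont_csum. intros k _. generalize (INR_S_pos k); intros Pk.
    apply Ccont_ext with (fun y => Rcpow (y + INR (S k)) (- crit t)); [intros; f_equal; ring|].
    apply Ccont_Rcpow; lra.
  - apply Ccont_mult; [|apply Ccont_const].
    apply Ccont_ext with (fun y => Rcpow (y + INR L) (RtoC 1 - crit t)); [intros; f_equal; ring|].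
    apply Ccont_Rcpow; lra.
Qed.

Lemma exists_small_inv_sqrt (c eps : R) : 0 <= c -> 0 < eps ->
  exists L, (0 < L)%nat /\ c / sqrt (INR L) <= eps.
Proof.
  intros Hc He. apply Classical_Prop.NNPP. intros H.
  assert (eps <= 0); [|lra].
  apply le_of_inv_sqrt with c; [exact Hc|]. intros L HL. rewrite Rplus_0_l.
  apply Rnot_lt_le. intros K. apply H. exists L; split; [exact HL | lra].
Qed.

(** The error 4 t / sqrt L is uniform over x >= 0, so continuity in the shift is inherited from the
    finite sums. Freezing the argument at 0 through [Rmax 0 x] extends the function continuously to
    negative x. *)
Lemma hurwitz_zeta_on_line (zeta1 : C -> R -> C) (t : R) :
  is_modified_hurwitz_zeta zeta1 -> 1 <= t ->
  is_hurwitz_on_line t (fun x => zeta1 (crit t) (Rmax 0 x)).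
Proof.
  intros Hz Ht.
  assert (A : forall x L, (0 < L)%nat ->
    Cmod (zeta1 (crit t) (Rmax 0 x) - hurwitz_partial t (Rmax 0 x) L) <= 4 * t / sqrt (INR L + Rmax 0 x)).
  { intros x L HL. assert (Q := Rmax_l 0 x).
    apply (hurwitz_approx t (Rmax 0 x) (fun s => zeta1 s (Rmax 0 x)) Q Ht (Hz _ Q) L HL). }
  split.
  - intros x.
    assert (B : forall eps, 0 < eps -> exists L, (0 < L)%nat /\ forall y,
      Cmod (zeta1 (crit t) (Rmax 0 y) - hurwitz_partial t (Rmax 0 y) L) <= eps).
    { intros eps He. destruct (exists_small_inv_sqrt (4 * t) eps ltac:(lra) He) as [L [HL K]].
      exists L; split; [exact HL|]. intros y.
      assert (0 < INR L) by (apply lt_0_INR; exact HL). assert (Q := Rmax_l 0 y).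
      apply Rle_trans with (1 := A y L HL). apply Rle_trans with (2 := K). apply div_sqrt_le; lra. }
    split; apply continuous_of_approx; intros eps He; destruct (B eps He) as [L [HL K]].
    + exists (fun y => Re (hurwitz_partial t (Rmax 0 y) L)). split; [exact (proj1 (hurwitz_partial_cont t x L HL))|].
      intros y; apply Rle_trans with (2 := K y).
      apply (Re_le_Cmod (zeta1 (crit t) (Rmax 0 y) - hurwitz_partial t (Rmax 0 y) L)%C).
    + exists (fun y => Im (hurwitz_partial t (Rmax 0 y) L)). split; [exact (proj2 (hurwitz_partial_cont t x L HL))|].
      intros y; apply Rle_trans with (2 := K y).
      apply (Im_le_Cmod (zeta1 (crit t) (Rmax 0 y) - hurwitz_partial t (Rmax 0 y) L)%C).
  - intros x L Hx HL. assert (B := A x L HL). rewrite Rmax_right in * by exact Hx. exact B.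
Qed.

(** Both functions are continuations of the same series and are therefore approximated by the same
    [hurwitz_partial t 0 L]. *)
Lemma zeta_eq_hurwitz (zeta : C -> C) (zeta1 : C -> R -> C) (t : R) :
  is_riemann_zeta zeta -> is_modified_hurwitz_zeta zeta1 -> 1 <= t ->
  zeta (crit t) = zeta1 (crit t) 0.
Proof.
  intros [H1 H2] Hz Ht.
  assert (K : is_continuation_of_series (fun k s => Rcpow (INR (S k) + 0) (- s)%C) zeta).
  { split; [|exact H2]. intros s Hs.
    apply (is_series_ext (K := C_AbsRing) (V := C_NormedModule)) with (2 := H1 s Hs).
    intros n. rewrite Rplus_0_r; reflexivity. }
  assert (E : Cmod (zeta (crit t) - zeta1 (crit t) 0)%C <= 0).
  { apply le_of_inv_sqrt with (8 * t); [lra|]. intros L HL.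
    assert (A := hurwitz_approx t 0 zeta ltac:(lra) Ht K L HL).
    assert (B := hurwitz_approx t 0 (fun s => zeta1 s 0) ltac:(lra) Ht (Hz 0 ltac:(lra)) L HL).
    simpl in B. rewrite Rplus_0_r in A, B. rewrite Cmod_minus_sym in B.
    apply Rle_trans with (1 := Cmod_minus_triangle _ (hurwitz_partial t 0 L) _).
    unfold Rdiv in *; lra. }
  apply Cmod_le_0 in E.
  replace (zeta (crit t)) with (zeta (crit t) - zeta1 (crit t) 0 + zeta1 (crit t) 0)%C by ring.
  rewrite E; ring.
Qed.

(** * Fourier coefficients on the unit interval *)

Definition expi (n : Z) (x : R) : C := cis (2 * PI * IZR n * x).

Lemma cis_opp (x : R) : cis (- x) = Cconj (cis x).
Proof. unfold cis, Cconj; simpl; rewrite cos_neg, sin_neg; reflexivity. Qed.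

Lemma cis_2PI_nat (k : nat) : cis (2 * PI * INR k) = RtoC 1.
Proof.
  rewrite <- cis_0. unfold cis. f_equal.
  - rewrite <- (cos_period 0 k); f_equal; ring.
  - rewrite <- (sin_period 0 k); f_equal; ring.
Qed.

Lemma cis_2PI_Z (n : Z) : cis (2 * PI * IZR n) = RtoC 1.
Proof.
  destruct (Z_le_gt_dec 0 n) as [H|H].
  - rewrite <- (Z2Nat.id n H), <- INR_IZR_INZ. apply cis_2PI_nat.
  - replace (2 * PI * IZR n) with (- (2 * PI * INR (Z.to_nat (- n)))).
    + rewrite cis_opp, cis_2PI_nat. apply C_ext; unfold Re, Im; simpl; ring.
    + rewrite INR_IZR_INZ, Z2Nat.id by lia. rewrite opp_IZR; ring.
Qed.

Lemma expi_add_Z (n m : Z) (x : R) : expi n (x + IZR m) = expi n x.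
Proof.
  unfold expi. rewrite Rmult_plus_distr_l, cis_add.
  replace (2 * PI * IZR n * IZR m) with (2 * PI * IZR (n * m)) by (rewrite mult_IZR; ring).
  rewrite cis_2PI_Z; ring.
Qed.

Lemma expi_add_nat (n : Z) (k : nat) (x : R) : expi n (x + INR k) = expi n x.
Proof. rewrite INR_IZR_INZ; apply expi_add_Z. Qed.

Lemma expi_plus (n m : Z) (x : R) : expi (n + m) x = (expi n x * expi m x)%C.
Proof. unfold expi. rewrite <- cis_add, plus_IZR. f_equal; ring. Qed.

Lemma expi_0 (x : R) : expi 0 x = RtoC 1.
Proof. unfold expi. rewrite Rmult_0_r, Rmult_0_l; apply cis_0. Qed.

Lemma expi_opp (n : Z) (x : R) : expi (- n) x = Cconj (expi n x).
Proof. unfold expi. rewrite <- cis_opp, opp_IZR. f_equal; ring. Qed.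

Lemma Cmod_expi (n : Z) (x : R) : Cmod (expi n x) = 1.
Proof. apply Cmod_cis. Qed.

Lemma Cder_expi (n : Z) (x : R) : Cder (expi n) x (RtoC (2 * PI * IZR n) * Ci * expi n x)%C.
Proof.
  unfold expi. apply (Cder_cis_comp (fun y => 2 * PI * IZR n * y)).
  auto_derive; [trivial | ring].
Qed.

Lemma Ccont_expi (n : Z) (x : R) : Ccont (expi n) x.
Proof. eapply Cder_cont, Cder_expi. Qed.

Lemma Ci_neq_0 : Ci <> RtoC 0.
Proof. intros H. apply (f_equal snd) in H. simpl in H. lra. Qed.

Lemma CI_expi (n : Z) : n <> 0%Z -> CI (expi n) 0 1 = RtoC 0.
Proof.
  intros Hn. set (c := (RtoC (2 * PI * IZR n) * Ci)%C).
  assert (N : c <> RtoC 0).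
  { apply Cmult_neq_0; [|apply Ci_neq_0]. intros H. apply (f_equal fst) in H. simpl in H.
    apply Hn, eq_IZR. generalize PI_RGT_0; intros. nra. }
  apply (Cmult_cancel_l c); [exact N|].
  rewrite <- CI_scal; [|lra | intros; apply Ccont_expi].
  rewrite (CI_FTC (expi n)); [| lra | intros; apply Cder_expi |].
  - replace 1 with (0 + IZR 1) at 1 by (simpl; ring). rewrite expi_add_Z; ring.
  - intros; apply Ccont_mult; [apply Ccont_const | apply Ccont_expi].
Qed.

(** With the sign e(+ n x), the phases 2 PI n b - t ln b of the unfolded integrals have their
    stationary points t / (2 PI n) for positive n. *)
Definition fourier_coef (Z : R -> C) (n : BinInt.Z) : C := CI (fun x => Z x * expi n x)%C 0 1.

Lemma CI_unit_intervals (g : R -> C) (L : nat) :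
  (forall x, 1 <= x -> Ccont g x) ->
  CI g 1 (1 + INR L) = csum (fun k => CI (fun x => g (x + INR (S k))) 0 1) L.
Proof.
  intros Hg. induction L as [|L IH].
  - simpl. rewrite Rplus_0_r, CI_point; reflexivity.
  - assert (P := pos_INR L). rewrite (CI_Chasles g 1 (1 + INR L)).
    + change (csum (fun k => CI (fun x => g (x + INR (S k))) 0 1) (S L)) with
       (csum (fun k => CI (fun x => g (x + INR (S k))%R) 0 1) L + CI (fun x => g (x + INR (S L))%R) 0 1)%C.
      rewrite IH. f_equal. rewrite CI_shift; [|lra|intros; apply Hg; rewrite S_INR in *; lra].
      f_equal; rewrite S_INR; ring.
    + lra.
    + rewrite S_INR; lra.
    + intros; apply Hg; lra.
Qed.

(** The correction term varies so little over a unit interval that it may be frozen at x = 0 when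
    Fourier coefficients are taken. *)
Lemma hurwitz_tail_increment (t : R) (L : nat) (x : R) :
  (0 < L)%nat -> 0 <= x <= 1 ->
  Cmod (Rcpow (INR L + x) (RtoC 1 - crit t) / (RtoC 1 - crit t)
    - Rcpow (INR L) (RtoC 1 - crit t) / (RtoC 1 - crit t))%C <= 1 / sqrt (INR L).
Proof.
  intros HL Hx. assert (P : 0 < INR L) by (apply lt_0_INR; exact HL).
  assert (N := crit_neq_1 t).
  replace (Rcpow (INR L + x) (RtoC 1 - crit t) / (RtoC 1 - crit t)
    - Rcpow (INR L) (RtoC 1 - crit t) / (RtoC 1 - crit t))%C with
    (CI (fun y => Rcpow (y + INR L) (- crit t)) 0 x).
  - apply Rle_trans with (1 / sqrt (INR L) * (x - 0)).
    + apply CI_bound; [lra | intros; apply Ccont_Rcpow; lra |].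
      intros y Hy. rewrite Cmod_Rcpow. replace (Re (- crit t)%C) with (- (1 / 2))
        by (rewrite crit_eq; unfold Re; simpl; ring).
      unfold Rdiv at 2. rewrite Rmult_1_l, <- Rpower_mhalf by exact P. apply Rpower_decr; lra.
    + assert (0 < 1 / sqrt (INR L)) by (apply Rdiv_lt_0_compat; [lra | apply sqrt_lt_R0; exact P]). nra.
  - rewrite (CI_FTC (fun y => Rcpow (y + INR L) (RtoC 1 - crit t) / (RtoC 1 - crit t))%C).
    + rewrite Rplus_0_l, (Rplus_comm x). reflexivity.
    + lra.
    + intros y Hy. eapply Cder_eq; [|apply Cder_ext with
        (fun y => / (RtoC 1 - crit t) * Rcpow (y + INR L) (RtoC 1 - crit t))%C].
      2: intros; unfold Cdiv; ring.
      2: apply Cder_scal, Cder_Rcpow; lra.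
      replace (RtoC 1 - crit t - 1)%C with (- crit t)%C by ring. field; exact N.
    + intros; apply Ccont_Rcpow; lra.
Qed.

Definition osc (t : R) (n : BinInt.Z) (b : R) : C := (Rcpow b (- crit t) * expi n b)%C.

Lemma osc_cont (t : R) (n : Z) (b : R) : 0 < b -> Ccont (osc t n) b.
Proof. intros; apply Ccont_mult; [apply Ccont_Rcpow_base; assumption | apply Ccont_expi]. Qed.

Lemma hurwitz_coef_approx (t : R) (Z : R -> C) (n : BinInt.Z) (L : nat) (r : C) :
  1 <= t -> is_hurwitz_on_line t Z -> (0 < L)%nat ->
  (r = CI (fun x => Rcpow (INR L) (RtoC 1 - crit t) / (RtoC 1 - crit t) * expi n x)%C 0 1) ->
  Cmod (fourier_coef Z n - (CI (osc t n) 1 (1 + INR L) - r))%C <= (4 * t + 1) / sqrt (INR L).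
Proof.
  intros Ht [HZ1 HZ2] HL Hr. assert (P : 0 < INR L) by (apply lt_0_INR; exact HL).
  assert (N := crit_neq_1 t).
  set (R0 := (Rcpow (INR L) (RtoC 1 - crit t) / (RtoC 1 - crit t))%C) in *.
  set (Sm := fun x => csum (fun k => Rcpow (x + INR (S k)) (- crit t)) L).
  assert (CS : forall x, 0 <= x <= 1 -> Ccont Sm x).
  { intros x Hx. apply Ccont_csum; intros k _. generalize (INR_S_pos k); intros.
    apply Ccont_Rcpow; lra. }
  assert (E1 : CI (osc t n) 1 (1 + INR L) = CI (fun x => Sm x * expi n x)%C 0 1).
  { rewrite CI_unit_intervals by (intros; apply osc_cont; lra).
    rewrite <- CI_csum.
    - apply CI_ext; [lra|]. intros x Hx. unfold Sm, osc.
      rewrite Cmult_comm, <- csum_scal. apply csum_ext; intros k _. rewrite expi_add_nat; ring.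
    - lra.
    - intros k x Hk Hx. generalize (INR_S_pos k); intros.
      apply (Ccont_comp (osc t n) (fun y => y + INR (S k))).
      + apply (ex_derive_continuous (V := R_NormedModule) (fun y => y + INR (S k))). auto_derive; trivial.
      + apply osc_cont; lra. }
  rewrite E1, Hr. unfold fourier_coef.
  assert (Ce := fun x => Ccont_expi n x).
  assert (C1 : forall x, 0 <= x <= 1 -> Ccont (fun x => Sm x * expi n x)%C x)
    by (intros; apply Ccont_mult; auto).
  assert (C2 : forall x, 0 <= x <= 1 -> Ccont (fun x => R0 * expi n x)%C x)
    by (intros; apply Ccont_mult; [apply Ccont_const | auto]).
  assert (C3 : forall x, 0 <= x <= 1 -> Ccont (fun x => Z x * expi n x)%C x)
    by (intros; apply Ccont_mult; auto).
  assert (C4 : forall x, 0 <= x <= 1 -> Ccont (fun x => Sm x * expi n x - R0 * expi n x)%C x).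
  { intros x Hx; exact (Ccont_minus _ _ x (C1 x Hx) (C2 x Hx)). }
  rewrite <- (CI_minus _ _ 0 1 Rle_0_1 C1 C2), <- (CI_minus _ _ 0 1 Rle_0_1 C3 C4).
  apply Rle_trans with ((4 * t + 1) / sqrt (INR L) * (1 - 0)); [|lra].
  apply CI_bound; [lra | intros x Hx; exact (Ccont_minus _ _ x (C3 x Hx) (C4 x Hx)) |].
  - intros x Hx.
    replace (Z x * expi n x - (Sm x * expi n x - R0 * expi n x))%C with
      ((Z x - (Sm x - R0)) * expi n x)%C by ring.
    rewrite Cmod_mult, Cmod_expi, Rmult_1_r.
    assert (A := HZ2 x L ltac:(lra) HL).
    assert (B := hurwitz_tail_increment t L x HL ltac:(lra)). fold R0 in B.
    assert (D : 4 * t / sqrt (INR L + x) <= 4 * t / sqrt (INR L)) by (apply div_sqrt_le; lra).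
    replace (Z x - (Sm x - R0))%C with ((Z x - hurwitz_partial t x L) -
      (Rcpow (INR L + x) (RtoC 1 - crit t) / (RtoC 1 - crit t) - R0))%C.
    + apply Rle_trans with (1 := Cmod_triangle_minus _ _). unfold Rdiv in *; lra.
    + unfold hurwitz_partial, Sm.
      rewrite (csum_ext (fun k => Rcpow (INR (S k) + x) (- crit t)) (fun k => Rcpow (x + INR (S k)) (- crit t)))
        by (intros; f_equal; ring). ring.
Qed.

Lemma hurwitz_coef_limit (t : R) (Z : R -> C) (n : BinInt.Z) (L : nat) :
  1 <= t -> is_hurwitz_on_line t Z -> (0 < L)%nat -> n <> 0%Z ->
  Cmod (fourier_coef Z n - CI (osc t n) 1 (1 + INR L))%C <= (4 * t + 1) / sqrt (INR L).
Proof.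
  intros Ht HZ HL Hn.
  assert (K := hurwitz_coef_approx t Z n L (RtoC 0) Ht HZ HL).
  replace (CI (osc t n) 1 (1 + INR L) - RtoC 0)%C with (CI (osc t n) 1 (1 + INR L)) in K by ring.
  apply K. rewrite CI_scal, CI_expi by (trivial || lra || (intros; apply Ccont_expi)). ring.
Qed.

Lemma osc_polar (t : R) (n : Z) (b : R) :
  0 < b -> osc t n b = (RtoC (/ sqrt b) * cis (2 * PI * IZR n * b - t * ln b))%C.
Proof.
  intros Hb. unfold osc, expi. rewrite Rcpow_polar, crit_eq.
  replace (exp (Re (- ((1 / 2)%R, t)) * ln b)) with (/ sqrt b).
  - replace (2 * PI * IZR n * b - t * ln b) with (Im (- ((1 / 2)%R, t))%C * ln b + 2 * PI * IZR n * b)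
      by (unfold Im; simpl; ring).
    rewrite cis_add; ring.
  - rewrite <- Rpower_mhalf by exact Hb. unfold Rpower, Re; simpl. do 2 f_equal; ring.
Qed.

Lemma continuous_inv_sqrt (x : R) : 0 < x -> continuous (fun b => / sqrt b) x.
Proof.
  intros Hx. apply (ex_derive_continuous (V := R_NormedModule) (fun b => / sqrt b)).
  assert (0 < sqrt x) by (apply sqrt_lt_R0; exact Hx). auto_derive. repeat split; lra.
Qed.

(** The integral of b^(-s) is explicit. The correction cancels its upper limit asymptotically and
    leaves -1 / (1 - s), of modulus at most 1 / t. *)
Lemma fourier_coef_0_bound (t : R) (Z : R -> C) :
  1 <= t -> is_hurwitz_on_line t Z -> Cmod (fourier_coef Z 0) <= / t.
Proof.
  intros Ht HZ. assert (N := crit_neq_1 t).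
  apply le_of_inv_sqrt with (4 * t + 2); [lra|]. intros L HL.
  assert (P : 0 < INR L) by (apply lt_0_INR; exact HL).
  set (R0 := (Rcpow (INR L) (RtoC 1 - crit t) / (RtoC 1 - crit t))%C).
  assert (K := hurwitz_coef_approx t Z 0 L R0 Ht HZ HL).
  assert (E : CI (osc t 0) 1 (1 + INR L) =
    (Rcpow (INR L + 1) (RtoC 1 - crit t) / (RtoC 1 - crit t) - RtoC 1 / (RtoC 1 - crit t))%C).
  { rewrite (CI_FTC (fun b => Rcpow b (RtoC 1 - crit t) / (RtoC 1 - crit t))%C).
    - rewrite Rcpow_base_1, Rplus_comm. reflexivity.
    - lra.
    - intros b Hb. eapply Cder_eq; [|apply Cder_ext with
        (fun y => / (RtoC 1 - crit t) * Rcpow y (RtoC 1 - crit t))%C].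
      2: intros; unfold Cdiv; ring.
      2: apply Cder_scal, Cder_Rcpow_base; lra.
      unfold osc. rewrite expi_0.
      replace (RtoC 1 - crit t - 1)%C with (- crit t)%C by ring. field; exact N.
    - intros; apply osc_cont; lra. }
  assert (T := hurwitz_tail_increment t L 1 HL ltac:(lra)). fold R0 in T.
  rewrite E in K.
  set (A := (Rcpow (INR L + 1) (RtoC 1 - crit t) / (RtoC 1 - crit t))%C) in *.
  set (B := (RtoC 1 / (RtoC 1 - crit t))%C) in *.
  assert (HB : Cmod B <= / t).
  { unfold B. rewrite Cmod_div, Cmod_1 by exact N. unfold Rdiv. rewrite Rmult_1_l.
    apply Rinv_le_contravar; [lra | apply Cmod_1_minus_crit; exact Ht]. }
  replace (fourier_coef Z 0) with ((fourier_coef Z 0 - (A - B - R0)) + ((A - R0) - B))%C by ring.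
  apply Rle_trans with (1 := Cmod_triangle _ _).
  assert (H1 := Cmod_triangle_minus (A - R0) B).
  assert (K1 : Cmod (fourier_coef Z 0 - (A - B - R0)) <= (4 * t + 1) / sqrt (INR L)).
  { apply K. rewrite (CI_ext _ (fun _ => R0)).
    - rewrite CI_const. replace (1 - 0) with 1 by ring. ring.
    - lra.
    - intros; rewrite expi_0; unfold R0; ring. }
  unfold Rdiv in *; lra.
Qed.

(** * Oscillatory integrals without a stationary point, and the coefficients that they govern *)

Lemma osc_first_derivative (t : R) (n : Z) (a b : R) (m m' g G : R -> R) :
  0 < a <= b ->
  (forall x, a <= x <= b -> is_derive m x (m' x)) ->
  (forall x, a <= x <= b -> is_derive G x (g x)) ->
  (forall x, a <= x <= b -> continuous m' x /\ continuous g x) ->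
  (forall x, a <= x <= b -> m x * (2 * PI * IZR n - t / x) = / sqrt x) ->
  (forall x, a <= x <= b -> Rabs (m' x) <= g x) ->
  Cmod (CI (osc t n) a b) <= Rabs (m a) + Rabs (m b) + (G b - G a).
Proof.
  intros Ha Hm HG Hc HA Hg.
  rewrite (CI_ext _ (fun x => RtoC (/ sqrt x) * cis (2 * PI * IZR n * x - t * ln x))%C); [|lra|].
  2: intros; apply osc_polar; lra.
  apply (first_derivative_test (fun x => / sqrt x) (fun x => 2 * PI * IZR n * x - t * ln x)
    (fun x => 2 * PI * IZR n - t / x) m m' g G a b); trivial; try lra.
  - intros x Hx. auto_derive; [lra | field; lra].
  - intros x Hx. destruct (Hc x Hx). repeat split; trivial. apply continuous_inv_sqrt; lra.
Qed.

Lemma continuous_sqrt_rational (f : R -> R) (x : R) : ex_derive f x -> continuous f x.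
Proof. exact (ex_derive_continuous (V := R_NormedModule) f x). Qed.

(** For x <= t / (4 PI) the derivative 2 PI - t / x of the phase is at least t / (2 x) in absolute
    value. The quotient [m] is decreasing there, so its own opposite serves as majorant of its
    variation. *)
Lemma osc_below_stationary (t : R) (b : R) :
  1 <= b -> 4 * PI * b <= t -> Cmod (CI (osc t 1) 1 b) <= 4 * sqrt b / t.
Proof.
  intros Hb Hbt. assert (Hpi := PI_RGT_0).
  assert (Ht : 0 < t) by nra.
  set (m := fun x => - (sqrt x / (t - 2 * PI * x))).
  set (m' := fun x => - ((/ (2 * sqrt x) * (t - 2 * PI * x) + 2 * PI * sqrt x) / (t - 2 * PI * x) ^ 2)).
  assert (Pos : forall x, 1 <= x <= b -> 0 < sqrt x /\ t / 2 <= t - 2 * PI * x).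
  { intros x Hx; split; [apply sqrt_lt_R0; lra | nra]. }
  assert (H : Cmod (CI (osc t 1) 1 b) <= Rabs (m 1) + Rabs (m b) + ((fun x => - m x) b - (fun x => - m x) 1)).
  { apply (osc_first_derivative t 1 1 b m m' (fun x => - m' x) (fun x => - m x)); [lra | | | | |].
    - intros x Hx. destruct (Pos x Hx). unfold m, m'. auto_derive.
      + repeat split; lra.
      + field; repeat split; lra.
    - intros x Hx. destruct (Pos x Hx). unfold m, m'. auto_derive.
      + repeat split; lra.
      + field; repeat split; lra.
    - intros x Hx. destruct (Pos x Hx).
      split; apply continuous_sqrt_rational; unfold m'; auto_derive; repeat split; try lra;
        (apply Rgt_not_eq; nra) || nra.
    - intros x Hx. destruct (Pos x Hx) as [P1 P2]. unfold m.
      rewrite Rmult_1_r.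
      assert (S : x = sqrt x * sqrt x) by (rewrite sqrt_sqrt; lra).
      set (r := sqrt x) in *. rewrite S. rewrite S in P2. field. repeat split; lra.
    - intros x Hx. destruct (Pos x Hx) as [P1 P2]. unfold m'.
      rewrite Rabs_Ropp, Ropp_involutive, Rabs_pos_eq; [lra|].
      apply Rdiv_le_0_compat; [|nra].
      assert (0 < / (2 * sqrt x)) by (apply Rinv_0_lt_compat; lra). nra. }
  assert (B : forall x, 1 <= x <= b -> 0 <= - m x).
  { intros x Hx. destruct (Pos x Hx) as [P1 P2]. unfold m. rewrite Ropp_involutive.
    apply Rdiv_le_0_compat; lra. }
  assert (M : - m b <= 2 * sqrt b / t).
  { unfold m. rewrite Ropp_involutive. destruct (Pos b ltac:(lra)) as [P1 P2].
    replace (2 * sqrt b / t) with (sqrt b / (t / 2)) by (field; lra).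
    apply Rmult_le_compat_l; [lra|]. apply Rinv_le_contravar; lra. }
  assert (B1 := B 1 ltac:(lra)). assert (Bb := B b ltac:(lra)).
  rewrite (Rabs_left1 (m 1)), (Rabs_left1 (m b)) in H by lra.
  unfold Rdiv in *. lra.
Qed.

(** The dilation u = n b turns the unfolded integral into n^(s-1) times the one of frequency 1 over
    [n, n (1 + L)]. What this lacks compared with c_1 is the piece [1, n], which lies below the
    stationary point as long as n <= t / (4 PI). *)
Lemma fourier_coef_pos (t : R) (Z : R -> C) (n : nat) :
  1 <= t -> is_hurwitz_on_line t Z -> (0 < n)%nat -> 4 * PI * INR n <= t ->
  Cmod (fourier_coef Z (Z.of_nat n) - Rcpow (INR n) (crit t - 1) * fourier_coef Z 1)%C <= 4 / t.
Proof.
  intros Ht HZ Hn Hnt. assert (P : 1 <= INR n) by (change 1 with (INR 1); apply le_INR; lia).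
  apply le_of_inv_sqrt with (8 * t + 2); [lra|]. intros L HL.
  (* Chosen so that 1 + M is the dilated endpoint n (1 + L). *)
  set (M := (n * (1 + L) - 1)%nat).
  assert (HM : (L <= M)%nat) by (unfold M; nia).
  assert (EM : 1 + INR M = INR n * (1 + INR L)).
  { unfold M. rewrite minus_INR, mult_INR, plus_INR by nia. change (INR 1) with 1. ring. }
  assert (K1 := hurwitz_coef_limit t Z (Z.of_nat n) L Ht HZ HL ltac:(lia)).
  assert (K2 := hurwitz_coef_limit t Z 1 M Ht HZ ltac:(lia) ltac:(lia)).
  assert (PL : 0 < INR L) by (apply lt_0_INR; exact HL).
  assert (D : (4 * t + 1) / sqrt (INR M) <= (4 * t + 1) / sqrt (INR L)).
  { apply div_sqrt_le; [lra | exact PL | apply le_INR; exact HM]. }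
  assert (E : CI (osc t (Z.of_nat n)) 1 (1 + INR L) =
    (Rcpow (INR n) (crit t - 1) * (CI (osc t 1) 1 (1 + INR M) - CI (osc t 1) 1 (INR n)))%C).
  { rewrite (CI_Chasles (osc t 1) 1 (INR n) (1 + INR M)); [| lra | rewrite EM; nra | intros; apply osc_cont; lra].
    rewrite EM.
    assert (Q := CI_dilate (osc t 1) 1 (1 + INR L) (INR n) ltac:(lra) ltac:(lra)
      ltac:(intros; apply osc_cont; nra)).
    rewrite Rmult_1_r in Q.
    replace (CI (osc t 1) 1 (INR n) + CI (osc t 1) (INR n) (INR n * (1 + INR L)) - CI (osc t 1) 1 (INR n))%C
      with (CI (osc t 1) (INR n) (INR n * (1 + INR L))) by ring.
    replace (Rcpow (INR n) (crit t - 1) * CI (osc t 1) (INR n) (INR n * (1 + INR L)))%C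
      with (Rcpow (INR n) (crit t) * (RtoC (/ INR n) * CI (osc t 1) (INR n) (INR n * (1 + INR L))))%C.
    2: { unfold Cminus. rewrite Rcpow_add, Rcpow_opp, Rcpow_1 by lra. rewrite RtoC_inv by lra. ring. }
    rewrite <- Q, <- CI_scal; [|lra|].
    2: { intros x Hx. apply (Ccont_comp (osc t 1) (fun y => INR n * y)); [|apply osc_cont; nra].
         apply continuous_sqrt_rational. auto_derive; trivial. }
    apply CI_ext; [lra|]. intros x Hx. unfold osc.
    rewrite Rcpow_mul_base by lra. rewrite (Rcpow_opp (INR n)).
    replace (expi 1 (INR n * x)) with (expi (Z.of_nat n) x).
    - field. apply Rcpow_neq_0.
    - unfold expi. rewrite <- INR_IZR_INZ. f_equal; ring. }
  assert (B := osc_below_stationary t (INR n) P Hnt).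
  assert (Nm : Cmod (Rcpow (INR n) (crit t - 1)) = / sqrt (INR n)).
  { rewrite Cmod_Rcpow, <- Rpower_mhalf by lra. f_equal. rewrite crit_eq; unfold Re; simpl; lra. }
  assert (S1 : 1 <= sqrt (INR n)) by (rewrite <- sqrt_1; apply sqrt_le_1; lra).
  assert (Nm1 : / sqrt (INR n) <= 1) by (rewrite <- Rinv_1; apply Rinv_le_contravar; lra).
  rewrite E in K1.
  set (w := Rcpow (INR n) (crit t - 1)) in *.
  set (c := fourier_coef Z (Z.of_nat n)) in *. set (c1 := fourier_coef Z 1) in *.
  set (I1 := CI (osc t 1) 1 (1 + INR M)) in *. set (I2 := CI (osc t 1) 1 (INR n)) in *.
  replace (c - w * c1)%C with ((c - w * (I1 - I2)) - (w * (c1 - I1)) - w * I2)%C by ring.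
  apply Rle_trans with (1 := Cmod_triangle_minus _ _).
  assert (T1 := Cmod_triangle_minus (c - w * (I1 - I2)) (w * (c1 - I1))).
  rewrite !Cmod_mult, Nm in *.
  assert (T2 : / sqrt (INR n) * Cmod (c1 - I1) <= (4 * t + 1) / sqrt (INR L)).
  { apply Rle_trans with (1 * Cmod (c1 - I1)); [|lra].
    apply Rmult_le_compat_r; [apply Cmod_ge_0 | exact Nm1]. }
  assert (T3 : / sqrt (INR n) * Cmod I2 <= 4 / t).
  { apply Rle_trans with (/ sqrt (INR n) * (4 * sqrt (INR n) / t)).
    - apply Rmult_le_compat_l; [left; apply Rinv_0_lt_compat; lra | exact B].
    - right; field; split; lra. }
  unfold Rdiv in *; lra.
Qed.

(** The derivative -(2 PI n + t / x) of the phase never vanishes. The quotient [m] has an extremum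
    where a^2 x = t, so its variation is majorised by the arctangent [G], which is bounded over the
    whole half line and yields the order 1 / (a w) = (2 PI n t)^(-1/2) at once. *)
Lemma fourier_coef_neg (t : R) (Z : R -> C) (n : nat) :
  1 <= t -> is_hurwitz_on_line t Z -> (0 < n)%nat ->
  Cmod (fourier_coef Z (- Z.of_nat n)) <= 3 / sqrt (t * INR n).
Proof.
  intros Ht HZ Hn. assert (P : 1 <= INR n) by (change 1 with (INR 1); apply le_INR; lia).
  assert (Hpi := PI_RGT_0). assert (Hpi3 := PI_gt_3).
  apply le_of_inv_sqrt with (4 * t + 1); [lra|]. intros L HL.
  assert (PL : 0 < INR L) by (apply lt_0_INR; exact HL).
  assert (K1 := hurwitz_coef_limit t Z (- Z.of_nat n) L Ht HZ HL ltac:(lia)).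
  set (a := sqrt (2 * PI * INR n)). set (w := sqrt t).
  assert (Ha2 : a * a = 2 * PI * INR n) by (apply sqrt_sqrt; nra).
  assert (Hw2 : w * w = t) by (apply sqrt_sqrt; lra).
  assert (Ha : 0 < a) by (apply sqrt_lt_R0; nra).
  assert (Hw : 0 < w) by (apply sqrt_lt_R0; lra).
  set (m := fun x => - (sqrt x / (t + a * a * x))).
  set (m' := fun x => - ((t - a * a * x) / (2 * sqrt x * (t + a * a * x) ^ 2))).
  set (g := fun x => / (2 * sqrt x * (t + a * a * x))).
  set (G := fun x => atan (sqrt x * a / w) / (a * w)).
  assert (Pos : forall x, 1 <= x -> 0 < sqrt x /\ 0 < t + a * a * x) by
    (intros x Hx; split; [apply sqrt_lt_R0; lra | nra]).
  assert (H : Cmod (CI (osc t (- Z.of_nat n)) 1 (1 + INR L)) <=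
    Rabs (m 1) + Rabs (m (1 + INR L)) + (G (1 + INR L) - G 1)).
  { apply (osc_first_derivative t _ 1 (1 + INR L) m m' g G); [lra | | | | |].
    - intros x [Hx _]. destruct (Pos x Hx) as [P1 P2]. unfold m, m'. auto_derive.
      + repeat split; lra.
      + assert (S : x = sqrt x * sqrt x) by (rewrite sqrt_sqrt; lra).
        set (r := sqrt x) in *. rewrite S. rewrite S in P2. field; repeat split; lra.
    - intros x [Hx _]. destruct (Pos x Hx) as [P1 P2]. unfold G, g. auto_derive.
      + repeat split; lra.
      + assert (S : x = sqrt x * sqrt x) by (rewrite sqrt_sqrt; lra).
        set (r := sqrt x) in *. rewrite S. rewrite S in P2. rewrite <- Hw2 in *.
        unfold Rsqr. field. repeat split; nra || lra.
    - intros x [Hx _]. destruct (Pos x Hx) as [P1 P2].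
      split; apply continuous_sqrt_rational; unfold m', g; auto_derive; repeat split; try lra;
        repeat (apply Rmult_integral_contrapositive_currified; try lra).
    - intros x [Hx _]. destruct (Pos x Hx) as [P1 P2]. unfold m.
      rewrite opp_IZR, <- INR_IZR_INZ.
      replace (2 * PI * - INR n) with (- (a * a)) by lra.
      assert (S : x = sqrt x * sqrt x) by (rewrite sqrt_sqrt; lra).
      set (r := sqrt x) in *. rewrite S. rewrite S in P2. field. split; lra.
    - intros x [Hx _]. destruct (Pos x Hx) as [P1 P2]. unfold m', g.
      rewrite Rabs_Ropp. unfold Rdiv. rewrite Rabs_mult.
      assert (Q : 0 < 2 * sqrt x * (t + a * a * x) ^ 2) by (apply Rmult_lt_0_compat; [lra | apply pow_lt; lra]).
      rewrite (Rabs_pos_eq (/ _)) by (left; apply Rinv_0_lt_compat; exact Q).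
      apply Rle_trans with ((t + a * a * x) * / (2 * sqrt x * (t + a * a * x) ^ 2)).
      + apply Rmult_le_compat_r; [left; apply Rinv_0_lt_compat; exact Q|].
        assert (0 < a * a * x) by nra. apply Rabs_le; lra.
      + right; field; split; lra. }
  (* Arithmetic-geometric mean: 2 w a sqrt x <= w^2 + a^2 x. *)
  assert (Hm : forall x, 1 <= x -> Rabs (m x) <= / (2 * (a * w))).
  { intros x Hx. destruct (Pos x Hx) as [P1 P2]. unfold m.
    rewrite Rabs_Ropp, Rabs_pos_eq by (apply Rdiv_le_0_compat; lra).
    assert (S : x = sqrt x * sqrt x) by (rewrite sqrt_sqrt; lra).
    apply Rmult_le_reg_r with (2 * (a * w) * (t + a * a * x)); [apply Rmult_lt_0_compat; [assert (0 < a * w) by (apply Rmult_lt_0_compat; assumption); lra | exact P2]|].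
    replace (sqrt x / (t + a * a * x) * (2 * (a * w) * (t + a * a * x))) with (2 * w * (a * sqrt x)) by (field; lra).
    replace (/ (2 * (a * w)) * (2 * (a * w) * (t + a * a * x))) with (t + a * a * x) by (field; split; lra).
    assert (Q0 := pow2_ge_0 (w - a * sqrt x)).
    assert (E0 : a * a * x = (a * sqrt x) * (a * sqrt x)) by (rewrite S at 1; ring).
    rewrite E0, <- Hw2.
    replace (w * w + a * sqrt x * (a * sqrt x)) with ((w - a * sqrt x) ^ 2 + 2 * w * (a * sqrt x)) by ring.
    lra. }
  assert (HG : G (1 + INR L) - G 1 <= 2 / (a * w)).
  { unfold G, Rdiv. rewrite <- Rmult_minus_distr_r.
    apply Rmult_le_compat_r; [left; apply Rinv_0_lt_compat; nra|].
    assert (A1 := atan_bound (sqrt (1 + INR L) * a * / w)).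
    assert (A2 : 0 < atan (sqrt 1 * a * / w)).
    { rewrite <- atan_0. apply atan_increasing. rewrite sqrt_1.
      assert (0 < / w) by (apply Rinv_0_lt_compat; exact Hw). nra. }
    generalize PI_4; lra. }
  assert (Hm1 := Hm 1 ltac:(lra)). assert (HmL := Hm (1 + INR L) ltac:(lra)).
  assert (Q : 3 / (a * w) <= 3 / sqrt (t * INR n)).
  { apply Rmult_le_compat_l; [lra|]. apply Rinv_le_contravar; [apply sqrt_lt_R0; nra|].
    unfold a, w. rewrite <- sqrt_mult by nra.
    assert (0 < t * INR n) by (apply Rmult_lt_0_compat; lra).
    apply sqrt_le_1; [lra | |]; replace (2 * PI * INR n * t) with (2 * PI * (t * INR n)) by ring; nra. }
  replace (/ (2 * (a * w))) with (/ 2 * / (a * w)) in * by (field; split; lra).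
  set (J := CI (osc t (- Z.of_nat n)) 1 (1 + INR L)) in *.
  apply Rle_trans with (1 := Cmod_le_add _ J). unfold Rdiv in *. lra.
Qed.

(** * Lower bound for the first Fourier coefficient *)

(* Phase of the first Fourier coefficient relative to its stationary point [t / 2 pi]. *)
Definition rel_phase (t x : R) : R := t * (x / (t / (2 * PI)) - 1 - ln (x / (t / (2 * PI)))).

(** Factoring out the value of the phase at its stationary point leaves a nonnegative phase with
    minimum 0, so that the imaginary part alone can be bounded below. *)
Lemma osc_1_rel (t x : R) :
  0 < t -> 0 < x ->
  osc t 1 x = (cis (t - t * ln (t / (2 * PI))) * (RtoC (/ sqrt x) * cis (rel_phase t x)))%C.
Proof.
  intros Ht Hx. assert (Hpi := PI_RGT_0).
  rewrite osc_polar by exact Hx.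
  replace (2 * PI * 1 * x - t * ln x) with ((t - t * ln (t / (2 * PI))) + rel_phase t x).
  - rewrite cis_add; ring.
  - unfold rel_phase. rewrite (ln_div x) by (try apply Rdiv_lt_0_compat; lra).
    field. split; lra.
Qed.

Lemma ln_le_minus_1 (y : R) : 0 < y -> ln y <= y - 1.
Proof.
  intros Hy. destruct (Req_dec y 1) as [->|Ne]; [rewrite ln_1; lra|].
  assert (K := exp_ineq1 (ln y)). rewrite exp_ln in K by exact Hy.
  assert (ln y <> 0). { intros E. apply Ne. rewrite <- (exp_ln y Hy), E. apply exp_0. }
  specialize (K H). lra.
Qed.

Lemma minus_ln_upper (v : R) : -1 < v -> v - ln (1 + v) <= v ^ 2 / (1 + v).
Proof.
  intros Hv. assert (K := ln_le_minus_1 (/ (1 + v)) ltac:(apply Rinv_0_lt_compat; lra)).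
  rewrite ln_Rinv in K by lra.
  replace (v ^ 2 / (1 + v)) with (v - 1 + / (1 + v)) by (field; lra). lra.
Qed.

Lemma derive_nonneg_ge (f f' : R -> R) (a b : R) :
  a <= b -> (forall x, a <= x <= b -> is_derive f x (f' x)) ->
  (forall x, a <= x <= b -> 0 <= f' x) -> f a <= f b.
Proof.
  intros Hab Hd Hp. destruct (Req_dec a b) as [->|Ne]; [lra|].
  destruct (MVT_cor2 f f' a b ltac:(lra)) as [z [E Hz]].
  - intros x Hx; apply is_derive_Reals, Hd, Hx.
  - assert (0 <= f' z) by (apply Hp; lra). nra.
Qed.

Lemma minus_ln_lower (v : R) : 0 <= v -> v ^ 2 / (2 * (1 + v)) <= v - ln (1 + v).
Proof.
  intros Hv.
  assert (K := derive_nonneg_ge (fun v => v - ln (1 + v) - v ^ 2 / (2 * (1 + v)))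
    (fun v => v ^ 2 / (2 * (1 + v) ^ 2)) 0 v Hv).
  cbv beta in K. rewrite Rplus_0_r, ln_1 in K.
  assert (0 - 0 - 0 ^ 2 / (2 * 1) <= v - ln (1 + v) - v ^ 2 / (2 * (1 + v))); [|lra].
  apply K.
  - intros x Hx. auto_derive; [repeat split; lra | field; lra].
  - intros x Hx. apply Rdiv_le_0_compat; [apply pow2_ge_0 | nra].
Qed.

Lemma minus_ln_half (v : R) : 0 <= v -> v - ln (1 + v) <= v ^ 2 / 2.
Proof.
  intros Hv.
  assert (K := derive_nonneg_ge (fun v => v ^ 2 / 2 - (v - ln (1 + v)))
    (fun v => v ^ 2 / (1 + v)) 0 v Hv).
  cbv beta in K. rewrite Rplus_0_r, ln_1 in K.
  assert (0 ^ 2 / 2 - (0 - 0) <= v ^ 2 / 2 - (v - ln (1 + v))); [|lra].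
  apply K.
  - intros x Hx. auto_derive; [repeat split; lra | field; lra].
  - intros x Hx. apply Rdiv_le_0_compat; [apply pow2_ge_0 | lra].
Qed.

Lemma one_minus_cos_le (x : R) : 0 <= x -> 1 - cos x <= x.
Proof.
  intros Hx.
  assert (K := derive_nonneg_ge (fun v => v - (1 - cos v)) (fun v => 1 - sin v) 0 x Hx).
  cbv beta in K. rewrite cos_0 in K. assert (0 - (1 - 1) <= x - (1 - cos x)); [|lra]. apply K.
  - intros y _. auto_derive; [trivial | ring].
  - intros y _. generalize (SIN_bound y); lra.
Qed.

(* Weight [x^(-1/2) / phase'] and the primitive obtained by integrating [phase' sin phase]. *)
Definition mw (t x : R) : R := sqrt x / (2 * PI * x - t).
Definition mw' (t x : R) : R := - ((2 * PI * x + t) / (2 * sqrt x * (2 * PI * x - t) ^ 2)).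
Definition Fp (t x : R) : R := mw t x * (1 - cos (rel_phase t x)).

Lemma is_derive_mw (t x : R) : 0 < x -> 2 * PI * x <> t -> is_derive (mw t) x (mw' t x).
Proof.
  intros Hx Hne. assert (0 < sqrt x) by (apply sqrt_lt_R0; exact Hx).
  unfold mw, mw'. auto_derive; [repeat split; lra|].
  assert (S : x = sqrt x * sqrt x) by (rewrite sqrt_sqrt; lra).
  set (r := sqrt x) in *. rewrite S in *. field. repeat split; lra.
Qed.

Lemma is_derive_rel_phase (t x : R) : 0 < t -> 0 < x -> is_derive (rel_phase t) x (2 * PI - t / x).
Proof.
  intros Ht Hx. assert (Hpi := PI_RGT_0). unfold rel_phase.
  assert (0 < t / (2 * PI)) by (apply Rdiv_lt_0_compat; lra).
  auto_derive.
  - apply Rdiv_lt_0_compat; assumption.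
  - field. repeat split; lra.
Qed.

Lemma is_derive_Fp (t x : R) : 0 < t -> 0 < x -> 2 * PI * x <> t ->
  is_derive (Fp t) x (mw' t x * (1 - cos (rel_phase t x)) + / sqrt x * sin (rel_phase t x)).
Proof.
  intros Ht Hx Hne. assert (0 < sqrt x) by (apply sqrt_lt_R0; exact Hx).
  assert (D := is_derive_rel_phase t x Ht Hx).
  replace (/ sqrt x * sin (rel_phase t x)) with
    (mw t x * ((2 * PI - t / x) * sin (rel_phase t x))).
  - apply (is_derive_Rmult (mw t) (fun y => 1 - cos (rel_phase t y))).
    + apply is_derive_mw; assumption.
    + assert (E := is_derive_comp cos (rel_phase t) x _ _ (is_derive_cos _) D).
      replace ((2 * PI - t / x) * sin (rel_phase t x)) with (0 - (2 * PI - t / x) * - sin (rel_phase t x)) by ring.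
      exact (is_derive_minus (fun _ => 1) _ x _ _ (is_derive_const (V := R_NormedModule) 1 x) E).
  - rewrite <- Rmult_assoc. f_equal. unfold mw.
    assert (S : x = sqrt x * sqrt x) by (rewrite sqrt_sqrt; lra).
    set (r := sqrt x) in *. rewrite S in *. field. repeat split; lra.
Qed.

(** The weight decreases on each side of its pole, hence - mw' (1 - cos) contributes positively both
    before and after the stationary point. *)
Lemma mw'_neg (t x : R) : 0 < t -> 0 < x -> 2 * PI * x <> t -> mw' t x <= 0.
Proof.
  intros Ht Hx Hne. assert (Hpi := PI_RGT_0). assert (0 < sqrt x) by (apply sqrt_lt_R0; exact Hx).
  unfold mw'. assert (0 <= (2 * PI * x + t) / (2 * sqrt x * (2 * PI * x - t) ^ 2)); [|lra].
  apply Rdiv_le_0_compat; [nra|]. apply Rmult_lt_0_compat; [lra|].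
  assert (2 * PI * x - t <> 0) by lra. assert (K := pow2_gt_0 _ H0). exact K.
Qed.

Lemma continuous_sin_phase (t x : R) : 0 < t -> 0 < x ->
  continuous (fun y => / sqrt y * sin (rel_phase t y)) x.
Proof.
  intros Ht Hx. apply continuous_Rmult; [apply continuous_inv_sqrt; exact Hx|].
  apply (continuous_comp (rel_phase t) sin); [|apply continuous_sin].
  apply continuous_sqrt_rational. eexists. apply is_derive_rel_phase; assumption.
Qed.

Lemma continuous_mw' (t x : R) : 0 < x -> 2 * PI * x <> t -> continuous (mw' t) x.
Proof.
  intros Hx Hne. assert (0 < sqrt x) by (apply sqrt_lt_R0; exact Hx).
  apply continuous_sqrt_rational. unfold mw'. auto_derive. repeat split; try lra.
  repeat (apply Rmult_integral_contrapositive_currified; try lra).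
Qed.

Lemma continuous_one_minus_cos (t x : R) : 0 < t -> 0 < x ->
  continuous (fun y => 1 - cos (rel_phase t y)) x.
Proof.
  intros Ht Hx. apply (continuous_minus (fun _ => 1) (fun y => cos (rel_phase t y))); [apply continuous_const|].
  apply (continuous_comp (rel_phase t) cos); [|apply continuous_cos].
  apply continuous_sqrt_rational. eexists. apply is_derive_rel_phase; assumption.
Qed.

(* [gain] is 0 or 1 according to whether the contribution of [- mw'] is kept. *)
Lemma phase_integral_ge (t a b gain : R) :
  0 < t -> 0 < a -> a <= b -> (forall x, a <= x <= b -> 2 * PI * x <> t) ->
  (forall x, a <= x <= b -> gain <= 1 - cos (rel_phase t x)) ->
  Fp t b - Fp t a + gain * (mw t a - mw t b) <= RInt (fun x => / sqrt x * sin (rel_phase t x)) a b.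
Proof.
  intros Ht Ha Hab Hne Hg.
  replace (Fp t b - Fp t a + gain * (mw t a - mw t b)) with
    ((fun x => Fp t x - gain * mw t x) b - (fun x => Fp t x - gain * mw t x) a) by (cbv beta; ring).
  assert (C : forall x, a <= x <= b -> continuous (fun x => (mw' t x * (1 - cos (rel_phase t x)) +
     / sqrt x * sin (rel_phase t x)) - gain * mw' t x) x).
  { intros x Hx.
    assert (Cm := continuous_mw' t x ltac:(lra) (Hne x Hx)).
    apply (continuous_minus (fun x => mw' t x * (1 - cos (rel_phase t x)) + / sqrt x * sin (rel_phase t x))
       (fun x => gain * mw' t x)).
    - apply continuous_Rplus; [|apply continuous_sin_phase; lra].
      apply continuous_Rmult; [exact Cm | apply continuous_one_minus_cos; lra].
    - apply (continuous_Rmult (fun _ => gain)); [apply continuous_const | exact Cm]. }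
  rewrite <- (RInt_FTC (fun x => Fp t x - gain * mw t x) (fun x => (mw' t x * (1 - cos (rel_phase t x)) +
     / sqrt x * sin (rel_phase t x)) - gain * mw' t x)); [| exact Hab | | exact C].
  - apply RInt_mono; trivial.
    + intros; apply continuous_sin_phase; lra.
    + intros x Hx. assert (M := mw'_neg t x Ht ltac:(lra) (Hne x ltac:(lra))).
      assert (G := Hg x ltac:(lra)). nra.
  - intros x Hx.
    apply (is_derive_minus (Fp t) (fun x => gain * mw t x)).
    + apply is_derive_Fp; try lra. apply Hne, Hx.
    + apply (is_derive_scal (mw t) x gain). apply is_derive_mw; [lra | apply Hne, Hx].
Qed.

Lemma rel_phase_v (t v : R) : 0 < t -> -1 < v ->
  rel_phase t (t / (2 * PI) * (1 + v)) = t * (v - ln (1 + v)).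
Proof.
  intros Ht Hv. assert (Hpi := PI_RGT_0). unfold rel_phase.
  replace (t / (2 * PI) * (1 + v) / (t / (2 * PI))) with (1 + v) by (field; split; lra). ring.
Qed.

(** The pole of [mw] is compensated by 1 - cos of a phase of size t v^2. A bound linear in |v| is
    enough to let the excised neighbourhood shrink. *)
Lemma Fp_small (t v : R) : 0 < t -> v <> 0 -> Rabs v <= 1 / 2 -> 1 <= t / (2 * PI) * (1 + v) ->
  Rabs (Fp t (t / (2 * PI) * (1 + v))) <= 4 * t * Rabs v.
Proof.
  intros Ht Hv Hv2 H1. assert (Hpi := PI_RGT_0). assert (P3 := PI_gt_3).
  assert (V := Rabs_le_between v (1 / 2)). destruct V as [V _]. specialize (V Hv2).
  unfold Fp. rewrite rel_phase_v by lra. unfold mw.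
  replace (2 * PI * (t / (2 * PI) * (1 + v)) - t) with (t * v) by (field; lra).
  set (x := t / (2 * PI) * (1 + v)) in *.
  assert (Sx : sqrt x <= 2 * t).
  { apply Rle_trans with (sqrt (x * x)); [apply sqrt_le_1; nra|]. rewrite sqrt_square by lra.
    unfold x. replace (t / (2 * PI) * (1 + v)) with (t * ((1 + v) / (2 * PI))) by (field; lra).
    assert ((1 + v) / (2 * PI) <= 1) by (apply div_le_l; lra). nra. }
  assert (S0 := sqrt_pos x).
  assert (U := minus_ln_upper v ltac:(lra)).
  assert (L := ln_le_minus_1 (1 + v) ltac:(lra)).
  assert (U2 : v ^ 2 / (1 + v) <= 2 * v ^ 2).
  { apply div_le_l; [lra|]. assert (0 <= v ^ 2) by apply pow2_ge_0. nra. }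
  set (w := v - ln (1 + v)) in *.
  assert (W0 : 0 <= t * w) by (apply Rmult_le_pos; unfold w; lra).
  assert (C1 := one_minus_cos_le (t * w) W0).
  assert (C0 : 0 <= 1 - cos (t * w)) by (generalize (COS_bound (t * w)); lra).
  rewrite Rabs_mult, (Rabs_pos_eq (1 - _)) by exact C0.
  unfold Rdiv. rewrite Rabs_mult, (Rabs_pos_eq (sqrt x)), Rabs_inv, Rabs_mult, (Rabs_pos_eq t) by lra.
  assert (A : 0 < Rabs v) by (apply Rabs_pos_lt; exact Hv).
  apply Rle_trans with (2 * t * / (t * Rabs v) * (t * (2 * v ^ 2))).
  - apply Rmult_le_compat; trivial.
    + apply Rmult_le_pos; [exact S0|]. left; apply Rinv_0_lt_compat; nra.
    + apply Rmult_le_compat_r; [|exact Sx]. left; apply Rinv_0_lt_compat; nra.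
    + apply Rle_trans with (1 := C1). apply Rmult_le_compat_l; lra.
  - right. rewrite <- (pow2_abs v). field. split; lra.
Qed.

(** At relative distance c / sqrt t from the stationary point the weight is about 1 / (c sqrt (2
    PI)). Between c = 21/10 and c = 29/10 it drops by about 0.05, and t >= 3600 keeps the factors
    sqrt (1 + c / r) within 1/40 of 1. *)
Lemma mw_gain (t : R) : 3600 <= t ->
  1 / 25 <= mw t (t / (2 * PI) * (1 + (21 / 10) / sqrt t)) - mw t (t / (2 * PI) * (1 + (29 / 10) / sqrt t)).
Proof.
  intros Ht. assert (Hpi := PI_RGT_0). assert (P4 := PI_4).
  set (r := sqrt t).
  assert (Hr2 : r * r = t) by (apply sqrt_sqrt; lra).
  assert (Hr : 60 <= r).
  { unfold r. replace 60 with (sqrt (60 * 60)) by (apply sqrt_square; lra). apply sqrt_le_1; lra. }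
  assert (K : forall c, 0 < c -> mw t (t / (2 * PI) * (1 + c / r)) = sqrt (1 + c / r) / sqrt (2 * PI) / c).
  { intros c Hc. unfold mw.
    assert (0 < c / r) by (apply Rdiv_lt_0_compat; lra).
    rewrite sqrt_mult by (try apply Rdiv_le_0_compat; lra).
    rewrite sqrt_div_alt by lra. fold r.
    replace (2 * PI * (t / (2 * PI) * (1 + c / r)) - t) with (c * r) by (rewrite <- Hr2; field; split; lra).
    assert (0 < sqrt (2 * PI)) by (apply sqrt_lt_R0; lra). field. repeat split; lra. }
  rewrite !K by lra.
  assert (A : 1 <= sqrt (1 + (21 / 10) / r)).
  { rewrite <- sqrt_1 at 1. apply sqrt_le_1; [lra | |]; assert (0 < (21 / 10) / r) by (apply Rdiv_lt_0_compat; lra); lra. }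
  assert (B : sqrt (1 + (29 / 10) / r) <= (41 / 40)).
  { replace (41 / 40) with (sqrt ((41 / 40) * (41 / 40))) by (apply sqrt_square; lra).
    assert (0 < (29 / 10) / r) by (apply Rdiv_lt_0_compat; lra).
    assert ((29 / 10) / r <= (1 / 20)) by (apply div_le_l; lra).
    apply sqrt_le_1; lra. }
  assert (C : sqrt (2 * PI) <= (71 / 25)).
  { replace (71 / 25) with (sqrt ((71 / 25) * (71 / 25))) by (apply sqrt_square; lra). apply sqrt_le_1; lra. }
  assert (D : 0 < sqrt (2 * PI)) by (apply sqrt_lt_R0; lra).
  assert (E : / (71 / 25) <= / sqrt (2 * PI)) by (apply Rinv_le_contravar; lra).
  set (i := / sqrt (2 * PI)) in *. set (sa := sqrt (1 + (21 / 10) / r)) in *. set (sb := sqrt (1 + (29 / 10) / r)) in *.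
  replace (sa / sqrt (2 * PI) / (21 / 10) - sb / sqrt (2 * PI) / (29 / 10)) with (i * (sa * (10 / 21) - sb * (10 / 29)))
    by (unfold i; field; lra).
  replace (/ (71 / 25)) with (25 / 71) in E by lra.
  assert (F : 122 / 1000 <= sa * (10 / 21) - sb * (10 / 29)) by lra.
  apply Rle_trans with (25 / 71 * (122 / 1000)); [lra|].
  apply Rmult_le_compat; lra.
Qed.

(** The integral of x^(-1/2) sin(phase) is integrated by parts against the primitive 1 - cos instead
    of - cos: up to the terms next to the stationary point, everything then has a favourable sign.
    Cutting out a neighbourhood of relative size [eps] costs 10 t eps, which tends to 0 for fixed
    t. *)
Lemma osc_1_lower (t M : R) : 3600 <= t -> t <= M ->
  1 / 25 <= Cmod (CI (osc t 1) 1 M).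
Proof.
  intros Ht HM. assert (Hpi := PI_RGT_0). assert (P4 := PI_4). assert (P3 := PI_gt_3).
  set (b0 := t / (2 * PI)).
  assert (Hb0 : 450 <= b0) by (unfold b0; apply le_div_r; lra).
  assert (Hb0t : b0 <= t / 6) by (unfold b0; apply Rmult_le_compat_l; [lra | apply Rinv_le_contravar; lra]).
  assert (Eb0 : 2 * PI * b0 = t) by (unfold b0; field; lra).
  rewrite (CI_ext _ (fun x => cis (t - t * ln b0) * (RtoC (/ sqrt x) * cis (rel_phase t x)))%C);
    [| lra | intros; apply osc_1_rel; lra].
  assert (CC : forall x, 1 <= x <= M -> Ccont (fun x => RtoC (/ sqrt x) * cis (rel_phase t x))%C x).
  { intros x Hx. apply Ccont_mult; [apply Ccont_RtoC, continuous_inv_sqrt; lra|].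
    apply Ccont_cis, continuous_sqrt_rational. eexists; apply is_derive_rel_phase; lra. }
  rewrite CI_scal, Cmod_mult, Cmod_cis, Rmult_1_l by (exact CC || lra).
  apply Rle_trans with (2 := Im_le_Cmod _), Rle_trans with (2 := Rle_abs _).
  unfold CI; simpl snd.
  change (1 / 25 <= RInt (fun x => Im (RtoC (/ sqrt x) * cis (rel_phase t x))%C) 1 M).
  rewrite (RInt_ext _ (fun x => / sqrt x * sin (rel_phase t x))) by (intros; unfold Im, cis; simpl; ring).
  set (f := fun x => / sqrt x * sin (rel_phase t x)).
  assert (Cf : forall x, 1 <= x -> continuous f x) by (intros; apply continuous_sin_phase; lra).
  assert (If : forall a b, 1 <= a <= b -> ex_RInt f a b) by (intros; apply ex_RInt_cont; [lra | intros; apply Cf; lra]).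
  set (r := sqrt t).
  assert (Hr2 : r * r = t) by (apply sqrt_sqrt; lra).
  assert (Hr : 60 <= r).
  { unfold r. replace 60 with (sqrt (60 * 60)) by (apply sqrt_square; lra). apply sqrt_le_1; lra. }
  assert (Main : forall eps, 0 < eps <= 1 / t -> 1 / 25 - 10 * t * eps <= RInt f 1 M).
  { intros eps He.
    assert (He2 : eps <= 1 / 3600) by (apply Rle_trans with (1 := proj2 He); apply Rmult_le_compat_l; [lra | apply Rinv_le_contravar; lra]).
    assert (Her : eps < (21 / 10) / r).
    { apply Rle_lt_trans with (1 := proj2 He). apply lt_div_r; [lra|].
      unfold Rdiv. rewrite Rmult_1_l. apply Rmult_lt_reg_r with t; [lra|].
      replace (/ t * r * t) with r by (field; lra). nra. }
    set (p := b0 * (1 + - eps)). set (q := b0 * (1 + eps)).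
    set (a0 := b0 * (1 + (21 / 10) / r)). set (d0 := b0 * (1 + (29 / 10) / r)).
    assert (Hr1 : (21 / 10) / r <= (29 / 10) / r) by (unfold Rdiv; apply Rmult_le_compat_r; [left; apply Rinv_0_lt_compat|]; lra).
    assert (Hr3 : (29 / 10) / r <= (1 / 20)) by (apply div_le_l; lra).
    assert (O1 : 1 <= p) by (unfold p; nra).
    assert (O2 : p < b0) by (unfold p; nra).
    assert (O3 : b0 < q) by (unfold q; nra).
    assert (O4 : q <= a0) by (unfold q, a0; nra).
    assert (O5 : a0 <= d0) by (unfold a0, d0; nra).
    assert (O6 : d0 <= M) by (unfold d0; nra).
    assert (G0 : forall x, 0 <= 1 - cos (rel_phase t x)) by (intros; generalize (COS_bound (rel_phase t x)); lra).
    assert (I1 := phase_integral_ge t 1 p 0 ltac:(lra) ltac:(lra) O1 ltac:(intros; apply Rlt_not_eq; nra) ltac:(intros; apply G0)).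
    assert (I3 := phase_integral_ge t q a0 0 ltac:(lra) ltac:(lra) O4 ltac:(intros; apply Rgt_not_eq; nra) ltac:(intros; apply G0)).
    assert (I5 := phase_integral_ge t d0 M 0 ltac:(lra) ltac:(lra) O6 ltac:(intros; apply Rgt_not_eq; nra) ltac:(intros; apply G0)).
    (* The one interval whose gain is kept: the phase, close to t v^2 / 2, runs through about
       [2.2, 4.2], inside [PI / 2, 3 PI / 2], so that 1 - cos >= 1. *)
    assert (I4 : Fp t d0 - Fp t a0 + 1 * (mw t a0 - mw t d0) <= RInt f a0 d0).
    { apply phase_integral_ge; try lra; [intros; apply Rgt_not_eq; nra|].
      intros x Hx.
      assert (cos (rel_phase t x) <= 0); [|lra].
      set (v := x / b0 - 1).
      assert (Ex : x = b0 * (1 + v)) by (unfold v; field; lra).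
      assert (V1 : (21 / 10) / r <= v).
      { unfold v. assert (1 + (21 / 10) / r <= x / b0); [|lra]. apply le_div_r; [lra|]. unfold a0 in Hx; lra. }
      assert (V2 : v <= (29 / 10) / r).
      { unfold v. assert (x / b0 <= 1 + (29 / 10) / r); [|lra]. apply div_le_l; [lra|]. unfold d0 in Hx; lra. }
      assert (V0 : 0 < (21 / 10) / r) by (apply Rdiv_lt_0_compat; lra).
      rewrite Ex. unfold b0. rewrite rel_phase_v by lra.
      assert (L1 := minus_ln_lower v ltac:(lra)). assert (L2 := minus_ln_half v ltac:(lra)).
      assert (T1 : (21 / 10) <= r * v).
      { apply Rmult_le_compat_l with (r := r) in V1; [|lra].
        replace (r * ((21 / 10) / r)) with (21 / 10) in V1 by (field; lra). exact V1. }
      assert (T2 : r * v <= (29 / 10)).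
      { apply Rmult_le_compat_l with (r := r) in V2; [|lra].
        replace (r * ((29 / 10) / r)) with (29 / 10) in V2 by (field; lra). exact V2. }
      apply cos_le_0.
      - apply Rle_trans with (t * (v ^ 2 / (2 * (1 + v)))); [|apply Rmult_le_compat_l; lra].
        apply Rle_trans with 2; [lra|].
        replace (t * (v ^ 2 / (2 * (1 + v)))) with ((r * v) * (r * v) / (2 * (1 + v))) by (rewrite <- Hr2; field; lra).
        apply le_div_r; [lra|].
        assert ((21 / 10) * (21 / 10) <= r * v * (r * v)) by (apply Rmult_le_compat; lra). lra.
      - apply Rle_trans with (t * (v ^ 2 / 2)); [apply Rmult_le_compat_l; lra|].
        replace (t * (v ^ 2 / 2)) with ((r * v) * (r * v) / 2) by (rewrite <- Hr2; field).
        apply Rle_trans with (9 / 2); [nra | lra]. }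
    assert (I2 : Rabs (RInt f p q) <= 1 * (q - p)).
    { apply RInt_abs_bound; [lra | intros; apply Cf; lra |].
      intros x Hx. unfold f. rewrite Rabs_mult.
      assert (1 <= sqrt x) by (rewrite <- sqrt_1; apply sqrt_le_1; lra).
      rewrite Rabs_inv, (Rabs_pos_eq (sqrt x)) by lra.
      assert (/ sqrt x <= 1) by (rewrite <- Rinv_1; apply Rinv_le_contravar; lra).
      assert (0 < / sqrt x) by (apply Rinv_0_lt_compat; lra).
      assert (Rabs (sin (rel_phase t x)) <= 1) by (apply Rabs_le, SIN_bound).
      generalize (Rabs_pos (sin (rel_phase t x))). nra. }
    assert (E : RInt f 1 M = RInt f 1 p + RInt f p q + RInt f q a0 + RInt f a0 d0 + RInt f d0 M).
    { rewrite <- (RInt_Chasles f 1 p M) by (apply If; lra).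
      rewrite <- (RInt_Chasles f p q M) by (apply If; lra).
      rewrite <- (RInt_Chasles f q a0 M) by (apply If; lra).
      rewrite <- (RInt_Chasles f a0 d0 M) by (apply If; lra).
      unfold plus; simpl; ring. }
    rewrite E. fold f in I1, I3, I5.
    assert (S1 : Rabs (Fp t p) <= 4 * t * eps).
    { unfold p, b0. replace eps with (Rabs (- eps)) at 2 by (rewrite Rabs_Ropp; apply Rabs_pos_eq; lra).
      apply Fp_small; [lra | lra | rewrite Rabs_Ropp, Rabs_pos_eq; lra | exact O1]. }
    assert (S2 : Rabs (Fp t q) <= 4 * t * eps).
    { unfold q, b0. replace eps with (Rabs eps) at 2 by (apply Rabs_pos_eq; lra).
      apply Fp_small; [lra | lra | rewrite Rabs_pos_eq; lra |]. fold b0. fold q. lra. }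
    assert (S3 : 0 <= Fp t M).
    { unfold Fp. apply Rmult_le_pos; [|apply G0]. unfold mw. apply Rdiv_le_0_compat; [apply sqrt_pos|].
      nra. }
    assert (S4 : Fp t 1 <= 0).
    { unfold Fp, mw. assert (0 <= sqrt 1 / (t - 2 * PI * 1) * (1 - cos (rel_phase t 1))).
      - apply Rmult_le_pos; [|apply G0]. apply Rdiv_le_0_compat; [apply sqrt_pos | lra].
      - replace (sqrt 1 / (2 * PI * 1 - t)) with (- (sqrt 1 / (t - 2 * PI * 1))) by (field; split; lra). lra. }
    assert (G := mw_gain t Ht). fold r b0 a0 d0 in G.
    assert (Hpq : q - p <= 2 * t * eps) by (unfold p, q; nra).
    apply Rabs_le_between in S1, S2, I2. lra. }
  apply Rnot_lt_le; intros Hlt.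
  set (g := 1 / 25 - RInt f 1 M) in *.
  (* Small enough for 10 t eps to be at most half of the supposed deficit [g]. *)
  set (eps := Rmin (1 / t) (g / (20 * t))).
  assert (Hg : 0 < g) by (unfold g; lra).
  assert (He : 0 < eps) by (apply Rmin_glb_lt; apply Rdiv_lt_0_compat; lra).
  assert (He1 : eps <= 1 / t) by apply Rmin_l.
  assert (He2 : eps <= g / (20 * t)) by apply Rmin_r.
  specialize (Main eps ltac:(lra)).
  assert (10 * t * eps <= 10 * t * (g / (20 * t))) by (apply Rmult_le_compat_l; lra).
  replace (10 * t * (g / (20 * t))) with (g / 2) in H by (field; lra).
  unfold g in *; lra.
Qed.

(** The bound for the truncated integral holds at every endpoint beyond t, so it survives the
    limit. *)
Lemma fourier_coef_1_lower (t : R) (Z : R -> C) :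
  3600 <= t -> is_hurwitz_on_line t Z -> 1 / 25 <= Cmod (fourier_coef Z 1).
Proof.
  intros Ht HZ. apply le_of_inv_sqrt with (4 * t + 1); [lra|]. intros L HL.
  assert (PL : 0 < INR L) by (apply lt_0_INR; exact HL).
  destruct (nfloor_ex t ltac:(lra)) as [N [HN1 HN2]].
  set (M := (L + S N)%nat).
  assert (HM : t <= 1 + INR M).
  { unfold M. rewrite plus_INR, S_INR. lra. }
  assert (K := osc_1_lower t (1 + INR M) Ht HM).
  assert (K2 := hurwitz_coef_limit t Z 1 M ltac:(lra) HZ ltac:(lia) ltac:(lia)).
  assert ((4 * t + 1) / sqrt (INR M) <= (4 * t + 1) / sqrt (INR L)).
  { apply div_sqrt_le; [lra | exact PL | apply le_INR; lia]. }
  rewrite Cmod_minus_sym in K2.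
  assert (T := Cmod_le_add (CI (osc t 1) 1 (1 + INR M)) (fourier_coef Z 1)). lra.
Qed.

(** * Boundedness near the end of the range *)

(** From sin x >= x - x^3 / 6 and x <= PI / 2 <= 2. *)
Lemma sin_ge_third (x : R) : 0 <= x <= PI / 2 -> x / 3 <= sin x.
Proof.
  intros [H0 H1]. assert (P4 := PI_4).
  assert (K := sin_bound x 0 H0 ltac:(lra)). destruct K as [K _].
  unfold sin_approx, sin_term in K. simpl in K.
  apply Rle_trans with (2 := K). nra.
Qed.

Lemma sin_half_lower (phi : R) : 0 <= phi <= 2 * PI ->
  Rmin (phi / 6) ((2 * PI - phi) / 6) <= sin (phi / 2).
Proof.
  intros H. destruct (Rle_dec phi PI) as [L|L].
  - apply Rle_trans with (1 := Rmin_l _ _).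
    apply Rle_trans with (phi / 2 / 3); [lra|]. apply sin_ge_third; lra.
  - apply Rle_trans with (1 := Rmin_r _ _).
    rewrite <- sin_PI_x. apply Rle_trans with ((PI - phi / 2) / 3); [lra|]. apply sin_ge_third; lra.
Qed.

(** The square of the modulus is (1 - rho)^2 + 4 rho sin^2(phi / 2). *)
Lemma Cmod_1_minus_polar (rho phi : R) : / 2 <= rho -> 0 <= phi <= 2 * PI ->
  sin (phi / 2) <= Cmod (RtoC 1 - RtoC rho * cis (- phi))%C.
Proof.
  intros Hr Hp.
  assert (S0 : 0 <= sin (phi / 2)) by (apply sin_ge_0; lra).
  apply Rsqr_incr_0_var; [|apply Cmod_ge_0].
  rewrite !Rsqr_pow2, Cmod_sqr.
  set (a := sin (phi / 2)) in *. set (b := cos (phi / 2)).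
  assert (Ec : cos phi = 1 - 2 * a * a) by (replace phi with (2 * (phi / 2)) by lra; apply cos_2a_sin).
  assert (Es : sin phi = 2 * a * b) by (replace phi with (2 * (phi / 2)) by lra; apply sin_2a).
  assert (E : b * b = 1 - a * a).
  { unfold a, b. assert (Q := sin2_cos2 (phi / 2)). unfold Rsqr in Q. lra. }
  replace (Re (RtoC 1 - RtoC rho * cis (- phi))%C) with (1 - rho * (1 - 2 * a * a))
    by (rewrite <- Ec, <- (cos_neg phi); unfold cis, Re; simpl; ring).
  replace (Im (RtoC 1 - RtoC rho * cis (- phi))%C) with (rho * (2 * a * b))
    by (rewrite <- Es, <- (Ropp_involutive (sin phi)), <- (sin_neg phi); unfold cis, Im; simpl; ring).
  replace ((1 - rho * (1 - 2 * a * a)) ^ 2 + (rho * (2 * a * b)) ^ 2) with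
    ((1 - rho) ^ 2 + 4 * rho * (a * a) + 4 * rho ^ 2 * (a * a) * (a * a + b * b - 1)) by ring.
  rewrite E. replace (a * a + (1 - a * a) - 1) with 0 by ring.
  assert (0 <= (1 - rho) ^ 2) by apply pow2_ge_0.
  assert (0 <= a * a) by apply Rle_0_sqr.
  assert (a * a * 1 <= a * a * (4 * rho)) by (apply Rmult_le_compat_l; lra).
  rewrite Rmult_0_r, Rplus_0_r. lra.
Qed.

(** * The Kusmin-Landau method for the sum of the (k + alpha)^(-s) *)

Definition ratio (t y : R) : C := Rcpow (1 + / y) (- crit t).

Lemma ratio_spec (t y : R) : 0 < y ->
  Rcpow (y + 1) (- crit t) = (Rcpow y (- crit t) * ratio t y)%C.
Proof.
  intros Hy. unfold ratio. assert (0 < / y) by (apply Rinv_0_lt_compat; exact Hy).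
  rewrite <- Rcpow_mul_base by lra. f_equal. field; lra.
Qed.

(** The argument of the ratio is -phi with phi = t ln(1 + 1 / y). It is at least t / (2 y), and once
    y exceeds t / (2 PI) + l - 1 it stays below 2 PI by at least 3 l / y; sin(phi / 2) converts both
    margins into a distance from 1. *)
Lemma ratio_gap (t y l : R) : 1 <= t -> 2 <= l -> l <= y -> t / (2 * PI) + l - 1 <= y ->
  / Cmod (RtoC 1 - ratio t y) <= 12 * y * (/ t + / l) /\ (RtoC 1 - ratio t y)%C <> RtoC 0.
Proof.
  intros Ht Hl Hly Hy. assert (P3 := PI_gt_3).
  assert (Iy : 0 < / y) by (apply Rinv_0_lt_compat; lra).
  assert (Iy1 : / y <= / 2) by (apply Rinv_le_contravar; lra).
  set (phi := t * ln (1 + / y)).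
  assert (U : ln (1 + / y) <= / y) by (generalize (ln_le_minus_1 (1 + / y)); lra).
  assert (L : / (y + 1) <= ln (1 + / y)).
  { assert (K := ln_le_minus_1 (/ (1 + / y)) ltac:(apply Rinv_0_lt_compat; lra)).
    rewrite ln_Rinv in K by lra.
    replace (/ (y + 1)) with (1 - / (1 + / y)) by (field; lra). lra. }
  assert (Phi1 : t / (2 * y) <= phi).
  { unfold phi, Rdiv. apply Rmult_le_compat_l; [lra|]. apply Rle_trans with (2 := L).
    apply Rinv_le_contravar; lra. }
  assert (Phi2 : phi <= t / y) by (apply Rmult_le_compat_l; lra).
  assert (Phi3 : t / y <= 2 * PI - 2 * PI * (l - 1) / y).
  { assert (t / y + 2 * PI * (l - 1) / y <= 2 * PI); [|lra].
    replace (t / y + 2 * PI * (l - 1) / y) with (2 * PI * ((t / (2 * PI) + l - 1) / y)) by (field; lra).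
    assert ((t / (2 * PI) + l - 1) / y <= 1) by (apply div_le_l; lra). nra. }
  assert (Phi4 : 3 * l / y <= 2 * PI * (l - 1) / y).
  { unfold Rdiv. apply Rmult_le_compat_r; [lra|]. nra. }
  assert (Q : 0 < 3 * l / y) by (apply Rdiv_lt_0_compat; lra).
  assert (Q1 : 0 < t / (2 * y)) by (apply Rdiv_lt_0_compat; lra).
  assert (B : Rmin (phi / 6) ((2 * PI - phi) / 6) <= Cmod (RtoC 1 - ratio t y)%C).
  { apply Rle_trans with (1 := sin_half_lower phi ltac:(lra)).
    unfold ratio. rewrite Rcpow_polar, crit_eq.
    replace (Im (- (1 / 2, t)%R) * ln (1 + / y)) with (- phi) by (unfold Im, phi; simpl; ring).
    apply Cmod_1_minus_polar; [|lra].
    replace (Re (- (1 / 2, t)%R) * ln (1 + / y)) with (- (1 / 2 * ln (1 + / y))) by (unfold Re; simpl; ring).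
    rewrite exp_Ropp. apply Rinv_le_contravar; [apply exp_pos|].
    apply Rle_trans with (exp (ln 2)); [|rewrite exp_ln; lra].
    assert (1 / 2 * ln (1 + / y) < ln 2).
    { assert (0 < ln 2) by (rewrite <- ln_1; apply ln_increasing; lra).
      assert (ln (1 + / y) < ln 2) by (apply ln_increasing; lra). lra. }
    left; apply exp_increasing; exact H. }
  assert (D : Rmin t l / (12 * y) <= Cmod (RtoC 1 - ratio t y)%C).
  { apply Rle_trans with (2 := B). apply Rmin_glb.
    - apply Rle_trans with (t / (12 * y)); [|replace (t / (12 * y)) with (t / (2 * y) / 6) by (field; lra); lra].
      unfold Rdiv. apply Rmult_le_compat_r; [left; apply Rinv_0_lt_compat; lra | apply Rmin_l].
    - apply Rle_trans with (l / (12 * y)).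
      + unfold Rdiv. apply Rmult_le_compat_r; [left; apply Rinv_0_lt_compat; lra | apply Rmin_r].
      + replace (l / (12 * y)) with (3 * l / y / 36) by (field; lra). lra. }
  assert (M0 : 0 < Rmin t l) by (apply Rmin_glb_lt; lra).
  assert (D0 : 0 < Rmin t l / (12 * y)) by (apply Rdiv_lt_0_compat; lra).
  split.
  - apply Rle_trans with (/ (Rmin t l / (12 * y))); [apply Rinv_le_contravar; lra|].
    replace (/ (Rmin t l / (12 * y))) with (12 * y * / Rmin t l) by (field; lra).
    apply Rmult_le_compat_l; [lra|].
    assert (0 < / t) by (apply Rinv_0_lt_compat; lra).
    assert (0 < / l) by (apply Rinv_0_lt_compat; lra).
    unfold Rmin. destruct (Rle_dec t l); lra.
  - intros E. rewrite E, Cmod_0 in D. lra.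
Qed.

Lemma ratio_increment (t y : R) : 1 <= t -> 0 < y ->
  Cmod (ratio t (y + 1) - ratio t y)%C <= 2 * t / y ^ 2.
Proof.
  intros Ht Hy.
  set (D := fun z : R => (RtoC (- / z ^ 2) * (- crit t * Rcpow (1 + / z) (- crit t - 1)))%C).
  assert (HD : forall z, y <= z -> Cder (ratio t) z (D z)).
  { intros z Hz. assert (0 < / z) by (apply Rinv_0_lt_compat; lra).
    apply (Cder_comp (fun u => Rcpow u (- crit t)) (fun z => 1 + / z)).
    - auto_derive; [lra | field; lra].
    - apply Cder_Rcpow_base; lra. }
  assert (HC : forall z, y <= z -> Ccont D z).
  { intros z Hz. assert (0 < / z) by (apply Rinv_0_lt_compat; lra). apply Ccont_mult.
    - apply Ccont_RtoC, continuous_sqrt_rational. auto_derive. apply Rgt_not_eq; nra.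
    - apply Ccont_mult; [apply Ccont_const|].
      apply (Ccont_comp (fun u => Rcpow u (- crit t - 1)) (fun z => 1 + / z)).
      + apply continuous_sqrt_rational. auto_derive; lra.
      + apply Ccont_Rcpow_base; lra. }
  rewrite <- (CI_FTC (ratio t) D); [| lra | intros; apply HD; lra | intros; apply HC; lra].
  replace (2 * t / y ^ 2) with (2 * t / y ^ 2 * (y + 1 - y)) by (field; lra).
  apply CI_bound; [lra | intros; apply HC; lra |].
  intros z Hz. unfold D. assert (0 < / z) by (apply Rinv_0_lt_compat; lra).
  rewrite !Cmod_mult, Cmod_opp, Cmod_R, Rabs_Ropp, Cmod_Rcpow.
  assert (Iz : 0 < / z ^ 2) by (apply Rinv_0_lt_compat, pow_lt; lra).
  rewrite (Rabs_pos_eq (/ z ^ 2)) by lra.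
  assert (A1 : / z ^ 2 <= / y ^ 2) by (apply Rinv_le_contravar; [apply pow_lt; lra | apply pow_incr; lra]).
  assert (A2 := Cmod_crit t Ht).
  assert (A3 : Rpower (1 + / z) (Re (- crit t - 1)%C) <= 1).
  { apply Rle_trans with (Rpower 1 (Re (- crit t - 1)%C)); [|rewrite Rpower_base_1; lra].
    apply Rpower_decr; [rewrite crit_eq; unfold Re; simpl; lra | lra]. }
  assert (A4 := Rpower_pos (1 + / z) (Re (- crit t - 1)%C)).
  assert (A5 := Cmod_ge_0 (crit t)).
  set (p := Rpower (1 + / z) _) in *.
  apply Rle_trans with (/ y ^ 2 * (2 * t * 1)); [|right; unfold Rdiv; ring].
  apply Rmult_le_compat; trivial; [lra | nra | apply Rmult_le_compat; lra].
Qed.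

(** Each term is u_k = (u_k - u_(k+1)) / d_k, and summation by parts leaves two boundary terms and
    the variation of 1 / d. *)
Lemma kusmin_landau_identity (t y : R) (n : nat) :
  0 < y ->
  (forall k, (k <= n)%nat -> (RtoC 1 - ratio t (y + INR k))%C <> RtoC 0) ->
  let u := fun k => Rcpow (y + INR k) (- crit t) in
  let d := fun k => (RtoC 1 - ratio t (y + INR k))%C in
  csum u n = (u O / d O - u n / d n + csum (fun k => u (S k) * (/ d (S k) - / d k)) n)%C.
Proof.
  intros Hy Hd u d. induction n as [|n IH].
  - simpl. ring.
  - simpl csum. rewrite IH by (intros; apply Hd; lia).
    assert (E : u (S n) = (u n - u n * d n)%C).
    { unfold u, d. rewrite S_INR. replace (y + (INR n + 1)) with (y + INR n + 1) by ring.
      rewrite ratio_spec by (generalize (pos_INR n); lra). ring. }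
    assert (N1 : d n <> RtoC 0) by (apply Hd; lia).
    assert (N2 : d (S n) <> RtoC 0) by (apply Hd; lia).
    set (X := csum _ n). set (A := (u O / d O)%C).
    replace (u (S n) * (/ d (S n) - / d n))%C with (u (S n) / d (S n) - (u n - u n * d n) / d n)%C
      by (rewrite <- E; unfold Cdiv; ring).
    replace ((u n - u n * d n) / d n)%C with (u n / d n - u n)%C by (field; exact N1).
    unfold Cdiv. ring.
Qed.

Lemma Cmod_Rcpow_crit (t x : R) : 0 < x -> Cmod (Rcpow x (- crit t)) = / sqrt x.
Proof.
  intros Hx. rewrite Cmod_Rcpow, <- Rpower_mhalf by exact Hx. f_equal.
  rewrite crit_eq; unfold Re; simpl; ring.
Qed.

Lemma Cmod_Rcpow_1_crit (t x : R) : 0 < x -> Cmod (Rcpow x (RtoC 1 - crit t)) = sqrt x.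
Proof.
  intros Hx. rewrite Cmod_Rcpow, <- Rpower_half by exact Hx. f_equal.
  rewrite crit_eq; unfold Re; simpl; lra.
Qed.

Lemma nat_above (x : R) : 0 <= x -> exists n : nat, (0 < n)%nat /\ x < INR n <= x + 1.
Proof.
  intros Hx. destruct (nfloor_ex x Hx) as [N [H1 H2]]. exists (S N). split; [lia|].
  rewrite S_INR; lra.
Qed.

Lemma rsum_inv_sqr (m n : nat) : (0 < m)%nat ->
  rsum (fun k => / INR (S (m + k)) ^ 2) n <= / INR m.
Proof.
  intros Hm.
  apply Rle_trans with (- / INR (m + n) - - / INR (m + 0)).
  - apply (rsum_le_telescope _ (fun k => - / INR (m + k))). intros k _.
    rewrite Nat.add_succ_r, S_INR. assert (0 < INR (m + k)) by (apply lt_0_INR; lia).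
    set (x := INR (m + k)) in *.
    replace (- / (x + 1) - - / x) with (/ (x * (x + 1))) by (field; lra).
    apply Rinv_le_contravar; nra.
  - rewrite Nat.add_0_r. assert (0 < / INR (m + n)) by (apply Rinv_0_lt_compat, lt_0_INR; lia). lra.
Qed.

(** The variation of 1 / d is that of the ratio, at most 2 t / y^2, divided by two gaps. This gives
    1 / t + t / l^2 times y^(-1/2) up to constants, in a form whose sum over sqrt t <= l <= t^2 is
    bounded. *)
Lemma kusmin_landau_term (t y l : R) : 400 <= t -> sqrt t <= l -> l <= y -> t / (2 * PI) + l - 1 <= y ->
  t / 9 <= y ->
  Cmod (Rcpow (y + 1) (- crit t) * (/ (RtoC 1 - ratio t (y + 1)) - / (RtoC 1 - ratio t y)))%C
    <= 1152 * (/ t * / sqrt l + 3 * sqrt t * / l ^ 2).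
Proof.
  intros Ht Hl Hly Hy Hyt.
  assert (R20 : 20 <= sqrt t).
  { replace 20 with (sqrt (20 * 20)) by (apply sqrt_square; lra). apply sqrt_le_1; lra. }
  set (r := sqrt t) in *. assert (Rr : r * r = t) by (apply sqrt_sqrt; lra).
  destruct (ratio_gap t y l ltac:(lra) ltac:(lra) Hly Hy) as [G1 N1].
  destruct (ratio_gap t (y + 1) l ltac:(lra) ltac:(lra) ltac:(lra) ltac:(lra)) as [G2 N2].
  assert (I := ratio_increment t y ltac:(lra) ltac:(lra)).
  set (q1 := ratio t y) in *. set (q2 := ratio t (y + 1)) in *.
  assert (It : 0 < / t) by (apply Rinv_0_lt_compat; lra).
  assert (Il : 0 < / l) by (apply Rinv_0_lt_compat; lra).
  assert (E : (/ (RtoC 1 - q2) - / (RtoC 1 - q1))%C = ((q2 - q1) * / (RtoC 1 - q1) * / (RtoC 1 - q2))%C)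
    by (field; split; assumption).
  rewrite E, !Cmod_mult, Cmod_Rcpow_crit, !Cmod_inv by (assumption || lra).
  set (a := / t + / l) in *. assert (Ha : 0 < a) by (unfold a; lra).
  assert (B : Cmod (q2 - q1) * / Cmod (RtoC 1 - q1) * / Cmod (RtoC 1 - q2) <= 1152 * (/ t + t * / l ^ 2)).
  { apply Rle_trans with (2 * t / y ^ 2 * (12 * y * a) * (12 * (y + 1) * a)).
    - assert (P1 : 0 < / Cmod (RtoC 1 - q1)) by (apply Rinv_0_lt_compat, Cmod_gt_0; exact N1).
      assert (P2 : 0 < / Cmod (RtoC 1 - q2)) by (apply Rinv_0_lt_compat, Cmod_gt_0; exact N2).
      assert (P0 := Cmod_ge_0 (q2 - q1)%C).
      apply Rmult_le_compat; [apply Rmult_le_pos; lra | lra | apply Rmult_le_compat; lra | exact G2].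
    - replace (2 * t / y ^ 2 * (12 * y * a) * (12 * (y + 1) * a)) with (288 * t * (1 + / y) * a ^ 2) by (field; lra).
      assert (Iy : / y <= 1) by (rewrite <- Rinv_1; apply Rinv_le_contravar; lra).
      assert (A2 : a ^ 2 <= 2 * (/ t) ^ 2 + 2 * (/ l) ^ 2).
      { unfold a. assert (0 <= (/ t - / l) ^ 2) by apply pow2_ge_0. lra. }
      apply Rle_trans with (576 * t * (2 * (/ t) ^ 2 + 2 * (/ l) ^ 2)).
      + apply Rmult_le_compat; [apply Rmult_le_pos; [lra|] | apply pow2_ge_0 | | exact A2].
        * assert (0 < / y) by (apply Rinv_0_lt_compat; lra). lra.
        * replace (288 * t * (1 + / y)) with (288 * (t * (1 + / y))) by ring.
          replace (576 * t) with (288 * (t * 2)) by ring.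
          apply Rmult_le_compat_l; [lra|]. apply Rmult_le_compat_l; lra.
      + right. field. lra. }
  assert (S1 : / sqrt (y + 1) <= / sqrt l).
  { apply Rinv_le_contravar; [apply sqrt_lt_R0; lra | apply sqrt_le_1; lra]. }
  assert (S2 : / sqrt (y + 1) <= 3 / r).
  { replace (3 / r) with (/ (r / 3)) by (field; lra). apply Rinv_le_contravar; [lra|].
    replace (r / 3) with (sqrt (r / 3 * (r / 3))) by (apply sqrt_square; lra). apply sqrt_le_1; nra. }
  assert (S0 : 0 < / sqrt (y + 1)) by (apply Rinv_0_lt_compat, sqrt_lt_R0; lra).
  apply Rle_trans with (/ sqrt (y + 1) * (1152 * (/ t + t * / l ^ 2))).
  { apply Rmult_le_compat_l; [lra | exact B]. }
  replace (/ sqrt (y + 1) * (1152 * (/ t + t * / l ^ 2))) with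
    (1152 * (/ t * / sqrt (y + 1) + / sqrt (y + 1) * (t * / l ^ 2))) by ring.
  apply Rmult_le_compat_l; [lra|]. apply Rplus_le_compat.
  - apply Rmult_le_compat_l; lra.
  - apply Rle_trans with (3 / r * (t * / l ^ 2)).
    + apply Rmult_le_compat_r; [|exact S2]. apply Rmult_le_pos; [lra|].
      left; apply Rinv_0_lt_compat, pow_lt; lra.
    + right. rewrite <- Rr. field. split; lra.
Qed.

(** About sqrt t initial terms, where the argument of the ratio may be too close to 2 PI, are of
    order t^(-1/2) each and are bounded trivially. The next t^2 or so cancel by Kusmin-Landau, and
    after that many terms both the truncation error and the correction are O(1). *)
Lemma hurwitz_bounded (t al : R) (Z : R -> C) :
  400 <= t -> is_hurwitz_on_line t Z -> t / (2 * PI) - 1 <= al <= t -> Cmod (Z al) <= 10000.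
Proof.
  intros Ht HZ Hal. assert (P3 := PI_gt_3). assert (P4 := PI_4).
  assert (Hal8 : t / 8 <= al + 1).
  { apply Rle_trans with (t / (2 * PI)); [|lra].
    apply Rmult_le_compat_l; [lra | apply Rinv_le_contravar; lra]. }
  assert (R20 : 20 <= sqrt t).
  { replace 20 with (sqrt (20 * 20)) by (apply sqrt_square; lra). apply sqrt_le_1; lra. }
  set (r := sqrt t) in *. assert (Rr : r * r = t) by (apply sqrt_sqrt; lra).
  destruct (nat_above r ltac:(lra)) as [m [Hm0 [Hm1 Hm2]]].
  destruct (nat_above (t ^ 2) ltac:(apply pow2_ge_0)) as [n [Hn0 [Hn1 Hn2]]].
  assert (Hmn : INR (m + n) = INR m + INR n) by apply plus_INR.
  assert (Tr : r + 2 <= t) by nra.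
  assert (T2 : 2 * t + 2 <= t ^ 2) by nra.
  set (L := (m + n)%nat) in *.
  destruct HZ as [_ HZ]. specialize (HZ al L ltac:(lra) ltac:(lia)).
  assert (SL : t <= sqrt (INR L + al)).
  { rewrite <- (sqrt_pow2 t) at 1 by lra. apply sqrt_le_1; [apply pow2_ge_0 | lra | lra]. }
  assert (SL2 : sqrt (INR L + al) <= 2 * t).
  { replace (2 * t) with (sqrt ((2 * t) * (2 * t))) by (apply sqrt_square; lra). apply sqrt_le_1; nra. }
  assert (E4 : 4 * t / sqrt (INR L + al) <= 4) by (apply div_le_l; lra).
  apply Rle_trans with (1 := Cmod_le_add _ (hurwitz_partial t al L)).
  assert (B : Cmod (hurwitz_partial t al L) <= 9000); [|lra].
  unfold hurwitz_partial. apply Rle_trans with (1 := Cmod_triangle_minus _ _).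
  assert (B1 : Cmod (Rcpow (INR L + al) (RtoC 1 - crit t) / (RtoC 1 - crit t)) <= 2).
  { rewrite Cmod_div, Cmod_Rcpow_1_crit by (try apply crit_neq_1; lra).
    assert (K := Cmod_1_minus_crit t ltac:(lra)). apply div_le_l; lra. }
  assert (B2 : Cmod (csum (fun k => Rcpow (INR (S k) + al) (- crit t)) L) <= 8000); [|lra].
  unfold L. rewrite csum_split. apply Rle_trans with (1 := Cmod_triangle _ _).
  assert (B3 : Cmod (csum (fun k => Rcpow (INR (S k) + al) (- crit t)) m) <= 6).
  { apply Rle_trans with (rsum (fun _ => 3 / r) m).
    - apply Cmod_csum_le. intros k _. assert (Pk := INR_S_ge_1 k).
      rewrite Cmod_Rcpow_crit by lra.
      replace (3 / r) with (/ (r / 3)) by (field; lra). apply Rinv_le_contravar; [lra|].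
      replace (r / 3) with (sqrt (r / 3 * (r / 3))) by (apply sqrt_square; lra). apply sqrt_le_1; nra.
    - rewrite rsum_const. replace (INR m * (3 / r)) with (INR m * 3 / r) by (field; lra).
      apply div_le_l; lra. }
  set (y := INR (S m) + al).
  assert (Hy : r + 1 <= y) by (unfold y; rewrite S_INR; lra).
  rewrite (csum_ext (fun k => Rcpow (INR (S (m + k)) + al) (- crit t)) (fun k => Rcpow (y + INR k) (- crit t))).
  2: { intros k _. replace (INR (S (m + k)) + al) with (y + INR k); [reflexivity|].
       unfold y. rewrite !S_INR, plus_INR. ring. }
  assert (G : forall k, r <= INR (S (m + k)) /\ INR (S (m + k)) <= y + INR k /\
    t / (2 * PI) + INR (S (m + k)) - 1 <= y + INR k).
  { intros k. unfold y. rewrite !S_INR, plus_INR.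
    generalize (pos_INR k). repeat split; lra. }
  assert (Gap : forall k, / Cmod (RtoC 1 - ratio t (y + INR k)) <= 12 * (y + INR k) * (/ t + / INR (S (m + k))) /\
    (RtoC 1 - ratio t (y + INR k))%C <> RtoC 0).
  { intros k. destruct (G k) as (G1 & G2 & G3). apply ratio_gap; lra. }
  assert (KL := kusmin_landau_identity t y n ltac:(lra) (fun k _ => proj2 (Gap k))).
  cbv zeta in KL. rewrite KL. clear KL.
  assert (V : forall k, y + INR k <= 4 * (t * t) -> forall w, y + INR k <= w * w -> 0 < w ->
    Cmod (Rcpow (y + INR k) (- crit t) / (RtoC 1 - ratio t (y + INR k))) <= 12 * w * (/ t + / INR (S (m + k)))).
  { intros k _ w Hw Hw0. destruct (Gap k) as [G1 N1]. assert (Pk := pos_INR k).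
    rewrite Cmod_div, Cmod_Rcpow_crit by (assumption || lra).
    assert (Sy : 0 < sqrt (y + INR k)) by (apply sqrt_lt_R0; lra).
    assert (Sq : sqrt (y + INR k) * sqrt (y + INR k) = y + INR k) by (apply sqrt_sqrt; lra).
    assert (Sw : sqrt (y + INR k) <= w) by (rewrite <- (sqrt_square w) by lra; apply sqrt_le_1; lra).
    assert (It : 0 < / t) by (apply Rinv_0_lt_compat; lra).
    assert (Il : 0 < / INR (S (m + k))) by (apply Rinv_0_lt_compat, INR_S_pos).
    unfold Rdiv. apply Rle_trans with (/ sqrt (y + INR k) * (12 * (y + INR k) * (/ t + / INR (S (m + k))))).
    - apply Rmult_le_compat_l; [left; apply Rinv_0_lt_compat; exact Sy | exact G1].
    - rewrite <- Sq at 2.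
      replace (/ sqrt (y + INR k) * (12 * (sqrt (y + INR k) * sqrt (y + INR k)) * (/ t + / INR (S (m + k)))))
        with (12 * sqrt (y + INR k) * (/ t + / INR (S (m + k)))) by (field; split; [apply Rgt_not_eq, INR_S_pos | split; lra]).
      apply Rmult_le_compat_r; lra. }
  assert (V0 : Cmod (Rcpow (y + INR 0) (- crit t) / (RtoC 1 - ratio t (y + INR 0))) <= 48).
  { assert (Ey : y + INR 0 <= 2 * r * (2 * r)) by (unfold y; rewrite S_INR; simpl; nra).
    apply Rle_trans with (1 := V O ltac:(nra) (2 * r) Ey ltac:(lra)).
    rewrite Nat.add_0_r.
    assert (/ t <= / r) by (apply Rinv_le_contravar; nra).
    assert (/ INR (S m) <= / r) by (apply Rinv_le_contravar; rewrite ?S_INR; lra).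
    apply Rle_trans with (12 * (2 * r) * (/ r + / r)); [apply Rmult_le_compat_l; lra | right; field; lra]. }
  assert (Vn : Cmod (Rcpow (y + INR n) (- crit t) / (RtoC 1 - ratio t (y + INR n))) <= 48).
  { assert (Ey : y + INR n <= 2 * t * (2 * t)).
    { unfold y; rewrite S_INR. replace (2 * t * (2 * t)) with (4 * t ^ 2) by ring. lra. }
    apply Rle_trans with (1 := V n ltac:(lra) (2 * t) Ey ltac:(lra)).
    assert (/ INR (S (m + n)) <= / t) by (apply Rinv_le_contravar; rewrite ?S_INR, ?plus_INR; nra).
    apply Rle_trans with (12 * (2 * t) * (/ t + / t)); [apply Rmult_le_compat_l; lra | right; field; lra]. }
  assert (W : Cmod (csum (fun k => Rcpow (y + INR (S k)) (- crit t) *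
      (/ (RtoC 1 - ratio t (y + INR (S k))) - / (RtoC 1 - ratio t (y + INR k))))%C n) <= 7200).
  { apply Rle_trans with (rsum (fun k => 1152 * (/ t * / sqrt (INR (S (m + k))) + 3 * r * / INR (S (m + k)) ^ 2)) n).
    - apply Cmod_csum_le. intros k _. destruct (G k) as (G1 & G2 & G3).
      rewrite S_INR, <- Rplus_assoc. apply kusmin_landau_term; [lra | exact G1 | lra | lra |].
      unfold y. rewrite S_INR. generalize (pos_INR k); lra.
    - rewrite rsum_scal, rsum_plus, !rsum_scal.
      assert (Q1 := rsum_inv_sqr m n Hm0).
      assert (Q2 : rsum (fun k => / sqrt (INR (S (m + k)))) n <= 2 * sqrt (INR L)).
      { apply Rle_trans with (2 := rsum_inv_sqrt L). unfold L. rewrite rsum_split.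
        assert (0 <= rsum (fun k => / sqrt (INR (S k))) m); [|lra].
        apply rsum_nonneg; intros; left; apply Rinv_0_lt_compat, sqrt_lt_R0, INR_S_pos. }
      assert (Q3 : sqrt (INR L) <= 3 / 2 * t).
      { replace (3 / 2 * t) with (sqrt ((3 / 2 * t) * (3 / 2 * t))) by (apply sqrt_square; lra). apply sqrt_le_1; nra. }
      assert (Q4 : / INR m <= / r) by (apply Rinv_le_contravar; lra).
      assert (It : 0 < / t) by (apply Rinv_0_lt_compat; lra).
      assert (T1 : / t * rsum (fun k => / sqrt (INR (S (m + k)))) n <= 3).
      { apply Rle_trans with (/ t * (3 * t)); [apply Rmult_le_compat_l; lra | right; field; lra]. }
      assert (T3 : 3 * r * rsum (fun k => / INR (S (m + k)) ^ 2) n <= 3).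
      { apply Rle_trans with (3 * r * / r); [apply Rmult_le_compat_l; lra | right; field; lra]. }
      lra. }
  match goal with |- _ + Cmod (?a - ?b + ?c)%C <= _ =>
    assert (X1 := Cmod_triangle (a - b)%C c); assert (X2 := Cmod_triangle_minus a b) end.
  lra.
Qed.

(** * The Fejer kernel *)

Definition dirichlet_sum (N : nat) (x : R) : C := csum (fun k => expi (Z.of_nat k) x) N.

Definition fejer (N : nat) (x : R) : R := / INR N * Cmod (dirichlet_sum N x) ^ 2.

Lemma fejer_nonneg (N : nat) (x : R) : (0 < N)%nat -> 0 <= fejer N x.
Proof.
  intros HN. apply Rmult_le_pos; [left; apply Rinv_0_lt_compat, lt_0_INR; exact HN | apply pow2_ge_0].
Qed.

Lemma RtoC_Cmod_sqr (z : C) : RtoC (Cmod z ^ 2) = (z * Cconj z)%C.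
Proof. rewrite Cmod_sqr. apply C_ext; unfold Re, Im; simpl; ring. Qed.

Lemma Cconj_csum (f : nat -> C) (n : nat) : Cconj (csum f n) = csum (fun k => Cconj (f k)) n.
Proof.
  induction n as [|n IH]; simpl.
  - apply C_ext; unfold Re, Im; simpl; ring.
  - rewrite <- IH. apply C_ext; unfold Re, Im; simpl; ring.
Qed.

Lemma fejer_expand (N : nat) (x : R) :
  RtoC (fejer N x) = (RtoC (/ INR N) *
    csum (fun j => csum (fun k => expi (Z.of_nat j - Z.of_nat k) x) N) N)%C.
Proof.
  unfold fejer. rewrite RtoC_mult, RtoC_Cmod_sqr. f_equal.
  unfold dirichlet_sum at 2. rewrite Cconj_csum. unfold dirichlet_sum.
  rewrite Cmult_comm, <- csum_scal. apply csum_ext; intros j _.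
  rewrite Cmult_comm, <- csum_scal. apply csum_ext; intros k _.
  rewrite <- expi_opp, <- expi_plus. reflexivity.
Qed.

Lemma fejer_periodic (N : nat) (x : R) (k : nat) : fejer N (x + INR k) = fejer N x.
Proof.
  unfold fejer, dirichlet_sum. do 3 f_equal. apply csum_ext; intros j _. apply expi_add_nat.
Qed.

Lemma fejer_continuous (N : nat) (x : R) : continuous (fejer N) x.
Proof.
  unfold fejer. apply (continuous_Rmult (fun _ => / INR N)); [apply continuous_const|].
  apply continuous_pow_comp, continuous_Cmod, Ccont_csum. intros; apply Ccont_expi.
Qed.

Lemma CI_expi_unit (n : Z) (a : R) : n <> 0%Z -> CI (expi n) a (a + 1) = RtoC 0.
Proof.
  intros Hn.
  rewrite (CI_ext _ (fun x => expi n a * expi n (x + - a))%C); [|lra|].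
  - rewrite CI_scal; [|lra|].
    + rewrite (CI_shift (expi n) a (a + 1) (- a)) by (try lra; intros; apply Ccont_expi).
      replace (a + - a) with 0 by ring. replace (a + 1 + - a) with 1 by ring.
      rewrite CI_expi by exact Hn. ring.
    + intros x _. apply (Ccont_comp (expi n) (fun y => y + - a)); [|apply Ccont_expi].
      apply continuous_sqrt_rational. auto_derive; trivial.
  - intros x _. unfold expi. rewrite <- cis_add. f_equal; ring.
Qed.

Lemma CI_fejer (g : R -> C) (N : nat) (a b : R) :
  a <= b -> (forall x, a <= x <= b -> Ccont g x) ->
  CI (fun x => g x * RtoC (fejer N x))%C a b = (RtoC (/ INR N) *
    csum (fun j => csum (fun k => CI (fun x => g x * expi (Z.of_nat j - Z.of_nat k) x)%C a b) N) N)%C.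
Proof.
  intros Hab Hg.
  assert (C1 : forall n x, a <= x <= b -> Ccont (fun x => g x * expi n x)%C x).
  { intros n x Hx; apply Ccont_mult; [apply Hg, Hx | apply Ccont_expi]. }
  assert (C2 : forall j x, a <= x <= b ->
     Ccont (fun x => csum (fun k => g x * expi (Z.of_nat j - Z.of_nat k) x)%C N) x).
  { intros j x Hx. apply (Ccont_csum (fun k x => g x * expi (Z.of_nat j - Z.of_nat k) x)%C).
    intros; apply C1, Hx. }
  rewrite (CI_ext _ (fun x => RtoC (/ INR N) *
    csum (fun j => csum (fun k => g x * expi (Z.of_nat j - Z.of_nat k) x) N) N)%C); [|exact Hab|].
  - rewrite CI_scal; [|exact Hab|].
    + f_equal.
      rewrite (CI_csum (fun j x => csum (fun k => g x * expi (Z.of_nat j - Z.of_nat k) x)%C N)); trivial.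
      * apply csum_ext; intros j _.
        apply (CI_csum (fun k x => g x * expi (Z.of_nat j - Z.of_nat k) x)%C); trivial.
        intros; apply C1; assumption.
      * intros; apply C2; assumption.
    + intros x Hx. apply (Ccont_csum (fun j x => csum (fun k => g x * expi (Z.of_nat j - Z.of_nat k) x)%C N)).
      intros; apply C2, Hx.
  - intros x _. rewrite fejer_expand.
    rewrite (csum_ext (fun j => csum (fun k => g x * expi (Z.of_nat j - Z.of_nat k) x)%C N)
       (fun j => g x * csum (fun k => expi (Z.of_nat j - Z.of_nat k) x) N)%C) by (intros; apply csum_scal).
    rewrite csum_scal. ring.
Qed.

Lemma csum_single (n j : nat) (c : C) : (j < n)%nat ->
  csum (fun k => if Nat.eq_dec j k then c else RtoC 0) n = c.
Proof.
  induction n as [|n IH]; intros H; [lia|]. simpl. destruct (Nat.eq_dec j n) as [->|Ne].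
  - rewrite (csum_ext _ (fun _ => RtoC 0)).
    + rewrite csum_const; ring.
    + intros k Hk. destruct (Nat.eq_dec n k); [lia | reflexivity].
  - rewrite IH by lia. ring.
Qed.

(** Only the N diagonal pairs j = k survive integration over a period, and the normalisation divides
    by N. *)
Lemma fejer_mass (N : nat) (a : R) : (0 < N)%nat -> RInt (fejer N) a (a + 1) = 1.
Proof.
  intros HN. assert (P : 0 < INR N) by (apply lt_0_INR; exact HN).
  assert (E := CI_fejer (fun _ => RtoC 1) N a (a + 1) ltac:(lra) (fun x _ => Ccont_const _ x)).
  assert (E2 : CI (fun x => RtoC 1 * RtoC (fejer N x))%C a (a + 1) = RtoC 1).
  { rewrite E. rewrite (csum_ext _ (fun _ => RtoC 1)).
    - rewrite csum_const, Cmult_1_r, <- RtoC_mult, Rinv_l by lra. reflexivity.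
    - intros j Hj. rewrite (csum_ext _ (fun k => if Nat.eq_dec j k then RtoC 1 else RtoC 0)).
      + apply csum_single; exact Hj.
      + intros k _. destruct (Nat.eq_dec j k) as [->|Ne].
        * rewrite Z.sub_diag, (CI_ext _ (fun _ => RtoC 1)) by (try lra; intros; rewrite expi_0; ring).
          rewrite CI_const. replace (a + 1 - a) with 1 by ring. ring.
        * rewrite (CI_ext _ (expi (Z.of_nat j - Z.of_nat k))) by (try lra; intros; ring).
          apply CI_expi_unit. lia. }
  apply (f_equal fst) in E2. unfold CI in E2; simpl in E2.
  apply eq_trans with (2 := E2). apply RInt_ext; intros x _. change (fejer N x = 1 * fejer N x - 0 * 0). ring.
Qed.

(** On this range all the angles 2 PI k x are at most PI / 4, so each term of the Dirichlet sum has
    real part at least 1/2. *)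
Lemma fejer_lower (N : nat) (x : R) : (0 < N)%nat -> 0 <= x <= / (8 * INR N) -> INR N / 4 <= fejer N x.
Proof.
  intros HN Hx. assert (P : 0 < INR N) by (apply lt_0_INR; exact HN). assert (P4 := PI_4). assert (P0 := PI_RGT_0).
  assert (Hx2 : x * INR N <= / 8).
  { apply Rle_trans with (/ (8 * INR N) * INR N); [apply Rmult_le_compat_r; lra | right; field; lra]. }
  assert (B : INR N / 2 <= Cmod (dirichlet_sum N x)).
  { apply Rle_trans with (2 := Re_le_Cmod _), Rle_trans with (2 := Rle_abs _).
    assert (K : forall n, (n <= N)%nat -> INR n / 2 <= Re (csum (fun k => expi (Z.of_nat k) x) n)).
    { induction n as [|n IH]; intros Hn; [simpl; lra|].
      simpl csum. specialize (IH ltac:(lia)). rewrite S_INR.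
      assert (1 / 2 <= Re (expi (Z.of_nat n) x)).
      { unfold expi, cis; simpl. rewrite <- INR_IZR_INZ.
        assert (Hn' : INR n <= INR N) by (apply le_INR; lia). assert (Pn := pos_INR n).
        set (u := 2 * PI * INR n * x).
        assert (U0 : 0 <= u) by (unfold u; apply Rmult_le_pos; [apply Rmult_le_pos|]; lra).
        assert (U1 : u <= PI / 4).
        { unfold u. replace (2 * PI * INR n * x) with (2 * PI * (x * INR n)) by ring.
          assert (x * INR n <= / 8) by nra. nra. }
        assert (V := one_minus_cos_le u U0).
        assert (W : cos (PI / 3) <= cos u) by (apply cos_decr_1; lra).
        rewrite cos_PI3 in W. lra. }
      unfold Re in *; simpl in *; lra. }
    apply K; lia. }
  unfold fejer.
  apply Rle_trans with (/ INR N * (INR N / 2) ^ 2); [right; field; lra|].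
  apply Rmult_le_compat_l; [left; apply Rinv_0_lt_compat; exact P|].
  apply pow_incr; split; lra.
Qed.

Lemma ex_RInt_Rplus (f g : R -> R) (a b : R) :
  ex_RInt f a b -> ex_RInt g a b -> ex_RInt (fun x => f x + g x) a b.
Proof. exact (ex_RInt_plus (V := R_NormedModule) f g a b). Qed.

(** The variance of [Z] about its mean [P], for the probability density [q], is nonnegative. *)
Lemma weighted_cauchy_schwarz (Z : R -> C) (q : R -> R) (a b : R) :
  a <= b -> (forall x, a <= x <= b -> Ccont Z x) -> (forall x, a <= x <= b -> continuous q x) ->
  (forall x, a <= x <= b -> 0 <= q x) -> RInt q a b = 1 ->
  Cmod (CI (fun x => Z x * RtoC (q x))%C a b) ^ 2 <= RInt (fun x => Cmod (Z x) ^ 2 * q x) a b.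
Proof.
  intros Hab HZ Hq Hp H1.
  set (P := CI (fun x => Z x * RtoC (q x))%C a b).
  assert (Cz : forall x, a <= x <= b -> continuous (fun x => Cmod (Z x) ^ 2 * q x) x).
  { intros x Hx. apply continuous_Rmult; [apply continuous_pow_comp, continuous_Cmod|]; auto. }
  assert (C1 : forall x, a <= x <= b -> continuous (fun x => Re (Z x * RtoC (q x))%C) x).
  { intros x Hx. apply (Ccont_mult Z (fun x => RtoC (q x)) x); [auto | apply Ccont_RtoC; auto]. }
  assert (C2 : forall x, a <= x <= b -> continuous (fun x => Im (Z x * RtoC (q x))%C) x).
  { intros x Hx. apply (Ccont_mult Z (fun x => RtoC (q x)) x); [auto | apply Ccont_RtoC; auto]. }
  assert (I0 := ex_RInt_cont _ a b Hab Cz).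
  assert (I1 := ex_RInt_cont _ a b Hab C1).
  assert (I2 := ex_RInt_cont _ a b Hab C2).
  assert (Iq := ex_RInt_cont _ a b Hab Hq).
  assert (J1 := ex_RInt_Rscal _ (-2 * Re P) a b I1).
  assert (J2 := ex_RInt_Rscal _ (-2 * Im P) a b I2).
  assert (Jq := ex_RInt_Rscal _ (Cmod P ^ 2) a b Iq).
  assert (J12 := ex_RInt_Rplus _ _ a b J1 J2).
  assert (J12q := ex_RInt_Rplus _ _ a b J12 Jq).
  assert (K : 0 <= RInt (fun x => Cmod (Z x) ^ 2 * q x + ((-2 * Re P * Re (Z x * RtoC (q x))%C +
     -2 * Im P * Im (Z x * RtoC (q x))%C) + Cmod P ^ 2 * q x)) a b).
  { apply RInt_ge_0; [exact Hab | exact (ex_RInt_Rplus _ _ a b I0 J12q) |].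
    intros x Hx.
    replace (Cmod (Z x) ^ 2 * q x + ((-2 * Re P * Re (Z x * RtoC (q x))%C +
     -2 * Im P * Im (Z x * RtoC (q x))%C) + Cmod P ^ 2 * q x)) with
      (((Re (Z x) - Re P) ^ 2 + (Im (Z x) - Im P) ^ 2) * q x).
    - apply Rmult_le_pos; [|apply Hp; lra].
      apply Rplus_le_le_0_compat; apply pow2_ge_0.
    - rewrite !Cmod_sqr. unfold Re, Im; simpl; ring. }
  rewrite (RInt_Rplus _ _ a b I0 J12q), (RInt_Rplus _ _ a b J12 Jq), (RInt_Rplus _ _ a b J1 J2),
    (RInt_Rscal _ _ a b I1), (RInt_Rscal _ _ a b I2), (RInt_Rscal _ _ a b Iq), H1 in K.
  assert (K2 : 0 <= RInt (fun x : R => Cmod (Z x) ^ 2 * q x) a b +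
    (-2 * Re P * Re P + -2 * Im P * Im P + Cmod P ^ 2 * 1)) by exact K.
  assert (E := Cmod_sqr P). clear - K2 E. lra.
Qed.

(** * The Fourier sum *)

(** On the critical line s - 1 is the conjugate of -s, so a^(s-1) is the conjugate of the term by
    which Z(a - 1) and Z(a) differ. This is why the cross term of the telescoping identity is the
    integrand of the theorem. *)
Definition pairing (t : R) (Z : R -> C) (a : R) : C := (Rcpow a (crit t - 1) * Z a)%C.

Definition pairing_coef (t T : R) (Z : R -> C) (n : BinInt.Z) : C :=
  CI (fun a => pairing t Z a * expi (- n) a)%C 1 T.

Definition pairing_sum (t T : R) (Z : R -> C) : R :=
  sum_Zabs_le (t / PI) (fun n => Cmod (pairing_coef t T Z n) ^ 2).

Lemma pairing_cont (t : R) (Z : R -> C) (a : R) :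
  is_hurwitz_on_line t Z -> 0 < a -> Ccont (pairing t Z) a.
Proof. intros [HZ _] Ha. apply Ccont_mult; [apply Ccont_Rcpow_base; exact Ha | apply HZ]. Qed.

Lemma Cexp_opp_Ci (u : R) : Cexp (- (RtoC u * Ci))%C = cis (- u).
Proof.
  unfold Cexp, cis.
  replace (Re (- (RtoC u * Ci))%C) with 0 by (unfold Re; simpl; ring).
  replace (Im (- (RtoC u * Ci))%C) with (- u) by (unfold Im; simpl; ring).
  rewrite exp_0, !Rmult_1_l. reflexivity.
Qed.

Lemma fourier_integral_eq (zeta1 : C -> R -> C) (eta t : R) (n : Z) :
  1 <= t / (2 * PI) + eta -> is_hurwitz_on_line t (fun x => zeta1 (crit t) (Rmax 0 x)) ->
  fourier_integral zeta1 eta t n =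
  pairing_coef t (t / (2 * PI) + eta) (fun x => zeta1 (crit t) (Rmax 0 x)) n.
Proof.
  intros HT HZ. unfold fourier_integral, pairing_coef. set (T := t / (2 * PI) + eta) in *.
  rewrite <- CI_RInt; [|exact HT|].
  - apply (RInt_ext (V := C_R_CompleteNormedModule)). rewrite Rmin_left, Rmax_right by exact HT. intros x Hx.
    unfold pairing. rewrite Rmax_right by lra. f_equal; [f_equal|].
    + f_equal. unfold crit. apply C_ext; unfold Re, Im; simpl; lra.
    + rewrite Cexp_opp_Ci. unfold expi. f_equal. rewrite opp_IZR; ring.
  - intros x Hx. apply Ccont_mult; [apply pairing_cont; [exact HZ | lra] | apply Ccont_expi].
Qed.

Lemma fourier_sum_eq (zeta1 : C -> R -> C) (eta t : R) :
  1 <= t / (2 * PI) + eta -> is_hurwitz_on_line t (fun x => zeta1 (crit t) (Rmax 0 x)) ->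
  fourier_sum zeta1 eta t =
  pairing_sum t (t / (2 * PI) + eta) (fun x => zeta1 (crit t) (Rmax 0 x)).
Proof.
  intros HT HZ. unfold fourier_sum, pairing_sum, sum_Zabs_le.
  rewrite !rsum_sum_n. apply rsum_ext; intros k _. rewrite fourier_integral_eq by assumption. reflexivity.
Qed.

(** Rows of the Fejer double sum and symmetric windows are both compared with S through this
    inclusion; nonnegativity makes the discarded frequencies harmless. *)
Lemma sum_Zabs_le_sub (x : R) (f : Z -> R) (a : Z) (len M : nat) :
  (forall n, 0 <= f n) -> INR M <= x -> (- Z.of_nat M <= a)%Z ->
  (a + Z.of_nat len <= Z.of_nat M + 1)%Z ->
  rsum (fun k => f (a + Z.of_nat k)%Z) len <= sum_Zabs_le x f.
Proof.
  intros Hf HM Ha Hlen. unfold sum_Zabs_le. set (N := Int_part x).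
  assert (HN : (Z.of_nat M <= N)%Z).
  { destruct (base_Int_part x) as [_ K]. fold N in K.
    assert (IZR (Z.of_nat M) < IZR (N + 1)) by (rewrite plus_IZR, <- INR_IZR_INZ; lra).
    apply lt_IZR in H. lia. }
  rewrite rsum_sum_n.
  set (g := fun k : nat => f (Z.of_nat k - N)%Z).
  set (d := Z.to_nat (a + N)).
  rewrite (rsum_ext _ (fun k => g (d + k)%nat)).
  - apply Rle_trans with (rsum g (d + len)).
    + rewrite rsum_split. assert (0 <= rsum g d); [|lra]. apply rsum_nonneg; intros; apply Hf.
    + apply rsum_mono_range; [unfold d; lia | intros; apply Hf].
  - intros k _. unfold g. f_equal. unfold d. lia.
Qed.

Lemma pairing_sum_nonneg (t T : R) (Z : R -> C) : 0 <= pairing_sum t T Z.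
Proof.
  unfold pairing_sum, sum_Zabs_le. rewrite rsum_sum_n. apply rsum_nonneg; intros; apply pow2_ge_0.
Qed.

Lemma le_sqrt_of_sqr (x y : R) : 0 <= x -> x ^ 2 <= y -> x <= sqrt y.
Proof. intros Hx H. rewrite <- (sqrt_pow2 x) by exact Hx. apply sqrt_le_1; [apply pow2_ge_0 | | exact H]. generalize (pow2_ge_0 x); lra. Qed.

(** Each row of the double sum involves N distinct frequencies of absolute value at most N, so
    Cauchy-Schwarz bounds it by sqrt (N S). The factor 1 / N averages the N rows. *)
Lemma pairing_fejer_bound (t T : R) (Z : R -> C) (N : nat) :
  is_hurwitz_on_line t Z -> 1 <= T -> (0 < N)%nat -> INR N <= t / PI ->
  Cmod (CI (fun a => pairing t Z a * RtoC (fejer N a))%C 1 T) <= sqrt (INR N * pairing_sum t T Z).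
Proof.
  intros HZ HT HN HNt. assert (P : 0 < INR N) by (apply lt_0_INR; exact HN).
  rewrite CI_fejer; [|exact HT | intros; apply pairing_cont; [exact HZ | lra]].
  rewrite Cmod_mult, Cmod_R_nonneg by (left; apply Rinv_0_lt_compat; exact P).
  set (S := pairing_sum t T Z). assert (S0 : 0 <= S) by apply pairing_sum_nonneg.
  apply Rle_trans with (/ INR N * rsum (fun _ => sqrt (INR N * S)) N).
  2: { rewrite rsum_const. right; field; lra. }
  apply Rmult_le_compat_l; [left; apply Rinv_0_lt_compat; exact P|].
  apply Cmod_csum_le. intros j Hj.
  rewrite (csum_ext _ (fun k => pairing_coef t T Z (- Z.of_nat j + Z.of_nat k))).
  2: { intros k _. unfold pairing_coef. apply CI_ext; [exact HT|]. intros x _. do 2 f_equal. lia. }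
  apply Rle_trans with (1 := Cmod_csum _ _).
  apply le_sqrt_of_sqr; [apply rsum_nonneg; intros; apply Cmod_ge_0|].
  assert (K := rsum_cauchy_schwarz (fun _ => 1) (fun k => Cmod (pairing_coef t T Z (- Z.of_nat j + Z.of_nat k))) N).
  rewrite (rsum_ext (fun k => 1 * _) (fun k => Cmod (pairing_coef t T Z (- Z.of_nat j + Z.of_nat k)))) in K
    by (intros; ring).
  rewrite (rsum_ext (fun _ => 1 ^ 2) (fun _ => 1)), rsum_const in K by (intros; ring).
  apply Rle_trans with (1 := K). rewrite Rmult_1_r. apply Rmult_le_compat_l; [lra|].
  apply (sum_Zabs_le_sub (t / PI) (fun n => Cmod (pairing_coef t T Z n) ^ 2) (- Z.of_nat j) N N);
    [intros; apply pow2_ge_0 | exact HNt | lia | lia].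
Qed.

(** * The telescoping identity *)

Lemma Cmod_sqr_shift (t : R) (Z : R -> C) (a : R) :
  1 <= t -> is_hurwitz_on_line t Z -> 1 <= a ->
  Cmod (Z (a - 1)) ^ 2 = Cmod (Z a) ^ 2 + / a + 2 * Re (pairing t Z a).
Proof.
  intros Ht HZ Ha.
  rewrite (hurwitz_shift t Z (a - 1) Ht HZ) by lra. replace (a - 1 + 1) with a by ring.
  unfold pairing.
  set (u := Rcpow a (- crit t)).
  assert (Eu : Rcpow a (crit t - 1) = Cconj u).
  { unfold u. rewrite Cconj_Rcpow. f_equal. rewrite crit_eq. apply C_ext; unfold Re, Im; simpl; lra. }
  assert (Nu : Cmod u ^ 2 = / a).
  { unfold u. rewrite Cmod_Rcpow_crit, pow_inv by lra. rewrite pow2_sqrt by lra. reflexivity. }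
  rewrite Eu. rewrite <- Nu, !Cmod_sqr. unfold Re, Im; simpl. ring.
Qed.

Lemma RInt_cut (f : R -> R) (a b c : R) :
  a <= b <= c -> (forall x, a <= x <= c -> continuous f x) -> RInt f a c = RInt f a b + RInt f b c.
Proof.
  intros H Hf. symmetry.
  apply (RInt_Chasles (V := R_CompleteNormedModule) f a b c); apply ex_RInt_cont; try lra; intros; apply Hf; lra.
Qed.

Lemma telescoping_identity (t T : R) (Z : R -> C) (N : nat) :
  1 <= t -> is_hurwitz_on_line t Z -> 2 <= T ->
  RInt (fun x => Cmod (Z x) ^ 2 * fejer N x) 0 1 =
  RInt (fun x => Cmod (Z x) ^ 2 * fejer N x) (T - 1) T + RInt (fun x => / x * fejer N x) 1 T
  + 2 * Re (CI (fun a => pairing t Z a * RtoC (fejer N a))%C 1 T).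
Proof.
  intros Ht HZ HT.
  set (h := fun x => Cmod (Z x) ^ 2 * fejer N x).
  set (g := fun x => Re (pairing t Z x * RtoC (fejer N x))%C).
  set (v := fun x => / x * fejer N x).
  assert (Ch : forall x, continuous h x).
  { intros x. apply continuous_Rmult; [apply continuous_pow_comp, continuous_Cmod, HZ | apply fejer_continuous]. }
  assert (Cv : forall x, 1 <= x <= T -> continuous v x).
  { intros x Hx. apply continuous_Rmult; [|apply fejer_continuous].
    apply continuous_sqrt_rational. auto_derive; lra. }
  assert (Cg : forall x, 1 <= x <= T -> continuous g x).
  { intros x Hx. apply (Ccont_mult (pairing t Z) (fun x => RtoC (fejer N x)) x).
    - apply pairing_cont; [exact HZ | lra].
    - apply Ccont_RtoC, fejer_continuous. }
  (* The shift identity integrated over [1, T]; the kernel, having period 1, is the same at x and at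
     x - 1. *)
  assert (E1 : RInt h 0 (T - 1) = RInt (fun x => h x + (v x + 2 * g x)) 1 T).
  { assert (Q := RInt_shift h 1 T (-1) ltac:(apply ex_RInt_cont; [lra | intros; apply Ch])).
    replace (1 + -1) with 0 in Q by ring. replace (T + -1) with (T - 1) in Q by ring. rewrite <- Q.
    apply RInt_ext. rewrite Rmin_left, Rmax_right by lra. intros x Hx.
    unfold h. replace (x + -1) with (x - 1) by ring.
    replace (fejer N (x - 1)) with (fejer N x).
    2: { rewrite <- (fejer_periodic N (x - 1) 1). f_equal. simpl; ring. }
    rewrite (Cmod_sqr_shift t Z x Ht HZ) by lra. unfold g, v.
    replace (Re (pairing t Z x * RtoC (fejer N x))%C) with (Re (pairing t Z x) * fejer N x) by (unfold Re; simpl; ring).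
    change (Cmod (Z x) ^ 2 * fejer N x) with (Cmod (Z x) ^ 2 * fejer N x).
    match goal with |- ?A = ?B => change (A = B :> R) end. ring. }
  assert (Ih : ex_RInt h 1 T) by (apply ex_RInt_cont; [lra | intros; apply Ch]).
  assert (Iv : ex_RInt v 1 T) by (apply ex_RInt_cont; [lra | exact Cv]).
  assert (Ig : ex_RInt g 1 T) by (apply ex_RInt_cont; [lra | exact Cg]).
  rewrite RInt_Rplus, RInt_Rplus, RInt_Rscal in E1; trivial.
  2: apply ex_RInt_Rscal; exact Ig.
  2: apply ex_RInt_Rplus; [exact Iv | apply ex_RInt_Rscal; exact Ig].
  (* The part over [1, T - 1] is common to both sides and cancels, leaving the two extreme unit
     intervals. *)
  rewrite (RInt_cut h 0 1 (T - 1)) in E1 by (lra || (intros; apply Ch)).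
  rewrite (RInt_cut h 1 (T - 1) T) in E1 by (lra || (intros; apply Ch)).
  change (Re (CI (fun a => pairing t Z a * RtoC (fejer N a))%C 1 T)) with (RInt g 1 T).
  lra.
Qed.

(** On [k, k + 1] the factor 1 / x is at most 1 / k and the kernel has mass 1, whence a harmonic
    sum; the majorant k^(1/8 - 1) turns its logarithm into a power that the final exponent
    tolerates. *)
Lemma harmonic_fejer (T : R) (N : nat) : 1 <= T -> (0 < N)%nat ->
  RInt (fun x => / x * fejer N x) 1 T <= 16 * Rpower T (1 / 8).
Proof.
  intros HT HN.
  set (v := fun x => / x * fejer N x).
  assert (Cv : forall x, 1 <= x -> continuous v x).
  { intros x Hx. apply continuous_Rmult; [|apply fejer_continuous].
    apply continuous_sqrt_rational. auto_derive; lra. }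
  assert (Pv : forall x, 1 <= x -> 0 <= v x).
  { intros x Hx. apply Rmult_le_pos; [left; apply Rinv_0_lt_compat; lra | apply fejer_nonneg; exact HN]. }
  destruct (nat_above T ltac:(lra)) as [K [HK [K1 K2]]].
  assert (A : RInt v 1 T <= RInt v 1 (1 + INR K)).
  { rewrite (RInt_cut v 1 T (1 + INR K)) by (lra || (intros; apply Cv; lra)).
    assert (0 <= RInt v T (1 + INR K)); [|lra].
    apply RInt_ge_0; [lra | apply ex_RInt_cont; [lra | intros; apply Cv; lra] | intros; apply Pv; lra]. }
  apply Rle_trans with (1 := A).
  assert (B : forall n, RInt v 1 (1 + INR n) <= rsum (fun k => Rpower (INR (S k)) (1 / 8 - 1)) n).
  { induction n as [|n IH].
    - simpl. rewrite Rplus_0_r, RInt_point. right; reflexivity.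
    - assert (Pn := pos_INR n).
      rewrite (RInt_cut v 1 (1 + INR n) (1 + INR (S n))) by (rewrite ?S_INR; lra || (intros; apply Cv; lra)).
      apply Rplus_le_compat; [exact IH|].
      assert (Q : RInt v (1 + INR n) (1 + INR (S n)) <= RInt (fun x => / INR (S n) * fejer N x) (1 + INR n) (1 + INR (S n))).
      { apply RInt_mono.
        - rewrite S_INR; lra.
        - intros; apply Cv; lra.
        - intros x _. apply (continuous_Rmult (fun _ => / INR (S n))); [apply continuous_const | apply fejer_continuous].
        - intros x Hx. apply Rmult_le_compat_r; [apply fejer_nonneg; exact HN|].
          apply Rinv_le_contravar; [apply INR_S_pos | rewrite S_INR; lra]. }
      apply Rle_trans with (1 := Q).
      rewrite RInt_Rscal by (apply ex_RInt_cont; [rewrite S_INR; lra | intros; apply fejer_continuous]).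
      replace (1 + INR (S n)) with (1 + INR n + 1) by (rewrite S_INR; ring).
      rewrite fejer_mass, Rmult_1_r by exact HN.
      replace (1 / 8 - 1) with (- (7 / 8)) by lra. rewrite Rpower_Ropp.
      apply Rinv_le_contravar; [apply Rpower_pos|].
      rewrite <- (Rpower_1 (INR (S n))) at 2 by apply INR_S_pos.
      apply Rle_Rpower; [apply INR_S_ge_1 | lra]. }
  apply Rle_trans with (1 := B K).
  apply Rle_trans with (1 := rsum_Rpower_le (1 / 8) K ltac:(lra) HK).
  assert (D : Rpower (INR K) (1 / 8) <= 2 * Rpower T (1 / 8)).
  { apply Rle_trans with (Rpower (2 * T) (1 / 8)); [apply Rpower_incr; lra|].
    rewrite <- Rpower_mult_distr by lra. apply Rmult_le_compat_r; [left; apply Rpower_pos|].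
    rewrite <- (Rpower_1 2) at 2 by lra. apply Rle_Rpower; lra. }
  unfold Rdiv. lra.
Qed.

Lemma fejer_square_bound (t T : R) (Z : R -> C) (N : nat) :
  400 <= t -> is_hurwitz_on_line t Z -> t / (2 * PI) <= T <= t -> (0 < N)%nat -> INR N <= t / PI ->
  RInt (fun x => Cmod (Z x) ^ 2 * fejer N x) 0 1
    <= 2 * sqrt (INR N * pairing_sum t T Z) + 2 * 10 ^ 8 * Rpower t (1 / 8).
Proof.
  intros Ht HZ HT HN HNt. assert (P3 := PI_gt_3). assert (P4 := PI_4).
  assert (HT2 : 2 <= T).
  { apply Rle_trans with (2 := proj1 HT). apply le_div_r; lra. }
  rewrite (telescoping_identity t T Z N ltac:(lra) HZ HT2).
  assert (A := pairing_fejer_bound t T Z N HZ ltac:(lra) HN HNt).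
  assert (A2 := Rle_trans _ _ _ (Rle_trans _ _ _ (Rle_abs _) (Re_le_Cmod _)) A).
  assert (B := harmonic_fejer T N ltac:(lra) HN).
  assert (B2 : Rpower T (1 / 8) <= Rpower t (1 / 8)) by (apply Rpower_incr; lra).
  assert (B3 : 1 <= Rpower t (1 / 8)).
  { apply Rle_trans with (Rpower 1 (1 / 8)); [rewrite Rpower_base_1; lra | apply Rpower_incr; lra]. }
  (* The last unit interval lies beyond t / (2 PI) - 1, where |Z| <= 10^4, and the kernel has mass
     1. *)
  assert (D : RInt (fun x => Cmod (Z x) ^ 2 * fejer N x) (T - 1) T <= 10 ^ 8).
  { apply Rle_trans with (RInt (fun x => 10 ^ 8 * fejer N x) (T - 1) T).
    - apply RInt_mono; [lra | | |].
      + intros x _. apply continuous_Rmult; [apply continuous_pow_comp, continuous_Cmod, HZ | apply fejer_continuous].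
      + intros x _. apply (continuous_Rmult (fun _ => 10 ^ 8)); [apply continuous_const | apply fejer_continuous].
      + intros x Hx. apply Rmult_le_compat_r; [apply fejer_nonneg; exact HN|].
        replace (10 ^ 8) with (10000 ^ 2) by ring. apply pow_incr. split; [apply Cmod_ge_0|].
        apply (hurwitz_bounded t x Z Ht HZ). lra.
    - rewrite RInt_Rscal by (apply ex_RInt_cont; [lra | intros; apply fejer_continuous]).
      replace T with (T - 1 + 1) at 2 by ring. rewrite fejer_mass by exact HN. lra. }
  lra.
Qed.

(** * Cesaro sums of the Dirichlet polynomial *)

Definition partial_poly (t : R) (j : nat) : C :=
  csum (fun m => Rcpow (INR (S m)) (crit t - 1)) j.

(* [sum over 1 <= m < N of (N - m) m^(s - 1)]. *)
Definition cesaro_poly (t : R) (N : nat) : C := csum (partial_poly t) N.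

(** In row j the frequencies run from j down to j - N + 1. The positive ones reproduce c_1 times the
    partial sum, with total error at most 4; the frequency 0 adds at most 1 and the negative ones at
    most 6, since N <= t. *)
Lemma coef_row (t : R) (Z : R -> C) (N j : nat) :
  1 <= t -> is_hurwitz_on_line t Z -> (j < N)%nat -> 4 * PI * INR N <= t ->
  Cmod (csum (fun k => fourier_coef Z (Z.of_nat j - Z.of_nat k)) N - fourier_coef Z 1 * partial_poly t j)%C
    <= 11.
Proof.
  intros Ht HZ Hj HNt. assert (Hpi := PI_gt_3).
  assert (PN : 1 <= INR N) by (change 1 with (INR 1); apply le_INR; lia).
  replace N with (j + (N - j))%nat at 1 by lia. rewrite csum_split, <- (csum_rev _ j).
  rewrite (csum_ext (fun k => fourier_coef Z (Z.of_nat j - Z.of_nat (j - 1 - k)))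
    (fun m => fourier_coef Z (Z.of_nat (S m)))) by (intros; f_equal; lia).
  rewrite (csum_ext (fun k => fourier_coef Z (Z.of_nat j - Z.of_nat (j + k)))
    (fun i => fourier_coef Z (- Z.of_nat i))) by (intros; f_equal; lia).
  set (U := csum (fun m => fourier_coef Z (Z.of_nat (S m))) j).
  set (V := csum (fun i => fourier_coef Z (- Z.of_nat i)) (N - j)).
  assert (BU : Cmod (U - fourier_coef Z 1 * partial_poly t j)%C <= 4).
  { unfold partial_poly. rewrite <- csum_scal. unfold U. rewrite <- csum_minus.
    apply Rle_trans with (rsum (fun _ => 4 / t) j).
    - apply Cmod_csum_le. intros m Hm. rewrite (Cmult_comm (fourier_coef Z 1)).
      apply fourier_coef_pos; [exact Ht | exact HZ | lia |].
      apply Rle_trans with (2 := HNt). apply Rmult_le_compat_l; [lra|]. apply le_INR; lia.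
    - rewrite rsum_const. assert (INR j <= t) by (apply Rle_trans with (INR N); [apply le_INR; lia | nra]).
      replace (INR j * (4 / t)) with (INR j * 4 / t) by (field; lra). apply div_le_l; lra. }
  assert (BV : Cmod V <= 7).
  { unfold V. replace (N - j)%nat with (1 + (N - j - 1))%nat by lia. rewrite csum_split.
    apply Rle_trans with (1 := Cmod_triangle _ _).
    assert (B0 : Cmod (csum (fun i => fourier_coef Z (- Z.of_nat i)) 1) <= 1).
    { simpl. rewrite Cplus_0_l. apply Rle_trans with (1 := fourier_coef_0_bound t Z Ht HZ).
      rewrite <- Rinv_1. apply Rinv_le_contravar; lra. }
    assert (B1 : Cmod (csum (fun k => fourier_coef Z (- Z.of_nat (1 + k))) (N - j - 1)) <= 6).
    { set (n := (N - j - 1)%nat).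
      apply Rle_trans with (rsum (fun k => 3 / sqrt t * / sqrt (INR (S k))) n).
      - apply Cmod_csum_le. intros k _.
        apply Rle_trans with (1 := fourier_coef_neg t Z (1 + k) Ht HZ ltac:(lia)).
        rewrite sqrt_mult by (try apply pos_INR; lra).
        assert (0 < sqrt t) by (apply sqrt_lt_R0; lra).
        assert (0 < sqrt (INR (S k))) by (apply sqrt_lt_R0, INR_S_pos).
        right. change (1 + k)%nat with (S k). field. split; lra.
      - rewrite rsum_scal. assert (Q := rsum_inv_sqrt n).
        assert (S0 : 0 < sqrt t) by (apply sqrt_lt_R0; lra).
        assert (Q2 : sqrt (INR n) <= sqrt t).
        { apply sqrt_le_1; [apply pos_INR | lra|]. apply Rle_trans with (INR N); [apply le_INR; lia | nra]. }
        apply Rle_trans with (3 / sqrt t * (2 * sqrt t)); [|right; field; lra].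
        apply Rmult_le_compat_l; [apply Rdiv_le_0_compat; lra | lra]. }
    lra. }
  replace (U + V - fourier_coef Z 1 * partial_poly t j)%C with
    ((U - fourier_coef Z 1 * partial_poly t j) + V)%C by ring.
  apply Rle_trans with (1 := Cmod_triangle _ _). lra.
Qed.

(** N times the Fejer mean of [Z] is the sum of all the rows of coefficients; 25 is the inverse of
    the lower bound for |c_1|. *)
Lemma cesaro_poly_bound (t : R) (Z : R -> C) (N : nat) :
  3600 <= t -> is_hurwitz_on_line t Z -> (0 < N)%nat -> 4 * PI * INR N <= t ->
  Cmod (cesaro_poly t N) <= 25 * INR N * (Cmod (CI (fun x => Z x * RtoC (fejer N x))%C 0 1) + 11).
Proof.
  intros Ht HZ HN HNt. assert (P : 0 < INR N) by (apply lt_0_INR; exact HN).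
  assert (E := CI_fejer Z N 0 1 Rle_0_1 (fun x _ => proj1 HZ x)).
  set (PN := CI (fun x => Z x * RtoC (fejer N x))%C 0 1) in *.
  set (D := csum (fun j => csum (fun k => fourier_coef Z (Z.of_nat j - Z.of_nat k)) N) N).
  assert (E2 : D = (RtoC (INR N) * PN)%C).
  { rewrite E, Cmult_assoc, <- RtoC_mult, Rinv_r by lra. rewrite Cmult_1_l. reflexivity. }
  assert (B : Cmod (D - fourier_coef Z 1 * cesaro_poly t N)%C <= INR N * 11).
  { unfold D, cesaro_poly. rewrite <- csum_scal, <- csum_minus, <- rsum_const.
    apply Cmod_csum_le. intros j Hj. apply coef_row; [lra | exact HZ | exact Hj | exact HNt]. }
  assert (L := fourier_coef_1_lower t Z Ht HZ).
  assert (K : Cmod (fourier_coef Z 1) * Cmod (cesaro_poly t N) <= INR N * (Cmod PN + 11)).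
  { rewrite <- Cmod_mult.
    apply Rle_trans with (1 := Cmod_le_add _ D). rewrite Cmod_minus_sym.
    rewrite E2 at 1. rewrite Cmod_mult, Cmod_R_nonneg by lra. lra. }
  assert (0 <= Cmod (cesaro_poly t N)) by apply Cmod_ge_0. nra.
Qed.

Lemma sqrt_plus_le (a b : R) : 0 <= a -> 0 <= b -> sqrt (a + b) <= sqrt a + sqrt b.
Proof.
  intros Ha Hb. assert (A := sqrt_pos a). assert (B := sqrt_pos b).
  apply Rsqr_incr_0_var; [|lra]. rewrite Rsqr_sqrt by lra. unfold Rsqr.
  assert (E1 := sqrt_sqrt a Ha). assert (E2 := sqrt_sqrt b Hb). nra.
Qed.

Lemma sqrt_Rpower (x p : R) : sqrt (Rpower x p) = Rpower x (p / 2).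
Proof.
  rewrite <- Rpower_sqrt by apply Rpower_pos. rewrite Rpower_mult. f_equal; field.
Qed.

Lemma sqrt_sqrt_mult_le (n S : R) : 0 < n -> 0 <= S ->
  sqrt (2 * sqrt (n * S)) <= 2 * (Rpower n (1 / 4) * sqrt (sqrt S)).
Proof.
  intros Hn HS. rewrite sqrt_mult by (try apply sqrt_pos; lra).
  rewrite (sqrt_mult n S), (sqrt_mult (sqrt n)) by (try apply sqrt_pos; lra).
  rewrite <- (Rpower_half n), sqrt_Rpower by exact Hn.
  replace (1 / 2 / 2) with (1 / 4) by field.
  apply Rmult_le_compat_r.
  - apply Rmult_le_pos; [left; apply Rpower_pos | apply sqrt_pos].
  - replace 2 with (sqrt (2 * 2)) at 2 by (apply sqrt_square; lra). apply sqrt_le_1; lra.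
Qed.

Lemma average_from_square (t T : R) (Z : R -> C) (N : nat) :
  400 <= t -> is_hurwitz_on_line t Z -> t / (2 * PI) <= T <= t -> (0 < N)%nat -> INR N <= t / PI ->
  sqrt (RInt (fun x => Cmod (Z x) ^ 2 * fejer N x) 0 1)
    <= 2 * (Rpower (INR N) (1 / 4) * sqrt (sqrt (pairing_sum t T Z))) + 20000 * Rpower t (1 / 16).
Proof.
  intros Ht HZ HT HN HNt.
  assert (P : 0 < INR N) by (apply lt_0_INR; exact HN).
  assert (S0 := pairing_sum_nonneg t T Z).
  assert (K := fejer_square_bound t T Z N Ht HZ HT HN HNt).
  assert (R0 := Rpower_pos t (1 / 8)).
  apply Rle_trans with (sqrt (2 * sqrt (INR N * pairing_sum t T Z) + 2 * 10 ^ 8 * Rpower t (1 / 8))).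
  { apply sqrt_le_1_alt. exact K. }
  assert (Q := sqrt_pos (INR N * pairing_sum t T Z)).
  apply Rle_trans with (sqrt (2 * sqrt (INR N * pairing_sum t T Z)) + sqrt (2 * 10 ^ 8 * Rpower t (1 / 8))).
  { apply sqrt_plus_le; lra. }
  apply Rplus_le_compat; [apply sqrt_sqrt_mult_le; assumption|].
  rewrite sqrt_mult by lra. rewrite sqrt_Rpower. replace (1 / 8 / 2) with (1 / 16) by field.
  apply Rmult_le_compat_r; [left; apply Rpower_pos|].
  replace 20000 with (sqrt (20000 * 20000)) by (apply sqrt_square; lra). apply sqrt_le_1; lra.
Qed.

Lemma cesaro_poly_estimate (t T : R) (Z : R -> C) (N : nat) :
  3600 <= t -> is_hurwitz_on_line t Z -> t / (2 * PI) <= T <= t -> (0 < N)%nat -> 4 * PI * INR N <= t ->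
  Cmod (cesaro_poly t N) <= 10 ^ 6 * INR N *
    (Rpower (INR N) (1 / 4) * sqrt (sqrt (pairing_sum t T Z)) + Rpower t (1 / 16)).
Proof.
  intros Ht HZ HT HN HNt. assert (Hpi := PI_gt_3).
  assert (P : 0 < INR N) by (apply lt_0_INR; exact HN).
  assert (A := average_from_square t T Z N ltac:(lra) HZ HT HN ltac:(apply le_div_r; nra)).
  assert (C := cesaro_poly_bound t Z N Ht HZ HN HNt).
  assert (M : RInt (fejer N) 0 1 = 1).
  { replace 1 with (0 + 1) at 1 by ring. apply fejer_mass; exact HN. }
  assert (W := weighted_cauchy_schwarz Z (fejer N) 0 1 Rle_0_1 (fun x _ => proj1 HZ x)
    (fun x _ => fejer_continuous N x) (fun x _ => fejer_nonneg N x HN) M).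
  apply le_sqrt_of_sqr in W; [|apply Cmod_ge_0].
  assert (B3 : 1 <= Rpower t (1 / 16)).
  { apply Rle_trans with (Rpower 1 (1 / 16)); [rewrite Rpower_base_1; lra | apply Rpower_incr; lra]. }
  assert (Y0 : 0 <= Rpower (INR N) (1 / 4) * sqrt (sqrt (pairing_sum t T Z))).
  { apply Rmult_le_pos; [left; apply Rpower_pos | apply sqrt_pos]. }
  apply Rle_trans with (1 := C).
  replace (10 ^ 6 * INR N * (Rpower (INR N) (1 / 4) * sqrt (sqrt (pairing_sum t T Z)) + Rpower t (1 / 16)))
    with (25 * INR N * (40000 * (Rpower (INR N) (1 / 4) * sqrt (sqrt (pairing_sum t T Z)) + Rpower t (1 / 16)))) by ring.
  apply Rmult_le_compat_l; [lra|]. lra.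
Qed.

(** * Smoothing weights for the approximate functional equation *)

(** A probability density on [0, H], largest at 0 where the value of Z is sought, with a double zero
    at H: the first two integrations by parts against it leave no boundary term there. *)
Definition weight (H x : R) : R := 3 * (H - x) ^ 2 / H ^ 3.

Lemma weight_cont (H x : R) : 0 < H -> continuous (weight H) x.
Proof. intros HH. apply continuous_sqrt_rational. unfold weight. auto_derive. trivial. Qed.

Lemma weight_nonneg (H x : R) : 0 < H -> 0 <= weight H x.
Proof.
  intros HH. apply Rdiv_le_0_compat; [|apply pow_lt; exact HH].
  generalize (pow2_ge_0 (H - x)); lra.
Qed.

Lemma weight_mass (H : R) : 0 < H -> RInt (weight H) 0 H = 1.
Proof.
  intros HH. rewrite (RInt_FTC (fun x => - (H - x) ^ 3 / H ^ 3) (weight H)).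
  - match goal with |- ?A = ?B => change (@eq R A B) end. field; lra.
  - lra.
  - intros x _. unfold weight. auto_derive; [trivial | field; lra].
  - intros; apply weight_cont; exact HH.
Qed.

Lemma weighted_average_le (f : R -> C) (H M : R) :
  0 < H -> (forall x, 0 <= x <= H -> Ccont f x) -> (forall x, 0 <= x <= H -> Cmod (f x) <= M) ->
  Cmod (CI (fun x => f x * RtoC (weight H x))%C 0 H) <= M.
Proof.
  intros HH Hf HM.
  apply Rle_trans with (RInt (fun x => M * weight H x) 0 H).
  - apply CI_norm; [lra | | |].
    + intros x Hx. apply Ccont_mult; [apply Hf, Hx | apply Ccont_RtoC, weight_cont, HH].
    + intros x _. apply (continuous_Rmult (fun _ => M)); [apply continuous_const | apply weight_cont, HH].
    + intros x Hx. rewrite Cmod_mult, (Cmod_R_nonneg (weight H x)) by (apply weight_nonneg; exact HH).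
      apply Rmult_le_compat_r; [apply weight_nonneg; exact HH | apply HM; lra].
  - rewrite RInt_Rscal, weight_mass by (exact HH || (apply ex_RInt_cont; [lra | intros; apply weight_cont, HH])).
    lra.
Qed.

Definition shift_ratio (t x y : R) : C := Rcpow (1 + x / y) (- crit t).

(** The coefficient of y^(-s) in Z(0) minus the weighted mean of Z over [0, H]. *)
Definition smooth_coef (t H y : R) : C :=
  CI (fun x => (RtoC 1 - shift_ratio t x y) * RtoC (weight H x))%C 0 H.

Lemma Rpower_le_1 (x p : R) : 1 <= x -> p <= 0 -> Rpower x p <= 1.
Proof.
  intros Hx Hp. apply Rle_trans with (Rpower 1 p); [apply Rpower_decr; lra | rewrite Rpower_base_1; lra].
Qed.

Lemma CI_increment_bound (f f' : R -> C) (a b M : R) :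
  a <= b -> (forall x, a <= x <= b -> Cder f x (f' x)) -> (forall x, a <= x <= b -> Ccont f' x) ->
  (forall x, a <= x <= b -> Cmod (f' x) <= M) -> Cmod (f b - f a)%C <= M * (b - a).
Proof.
  intros Hab Hd Hc HM. rewrite <- (CI_FTC f f' a b Hab Hd Hc).
  apply CI_bound; trivial. intros; apply HM; lra.
Qed.

(** The second difference is the increment over [0, 1] of u -> f(u + a) - f(u + a - 1), whose
    derivative is again an increment over a unit interval. *)
Lemma second_difference_bound (f f' f'' : R -> C) (a M : R) :
  (forall x, a - 1 <= x <= a + 1 -> Cder f x (f' x)) ->
  (forall x, a - 1 <= x <= a + 1 -> Cder f' x (f'' x)) ->
  (forall x, a - 1 <= x <= a + 1 -> Ccont f'' x) ->
  (forall x, a - 1 <= x <= a + 1 -> Cmod (f'' x) <= M) ->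
  Cmod (f (a + 1)%R - RtoC 2 * f a + f (a - 1)%R)%C <= M.
Proof.
  intros H1 H2 H3 HM.
  assert (E : (f (a + 1)%R - RtoC 2 * f a + f (a - 1)%R)%C =
    ((fun u => f (u + a)%R - f (u + (a - 1))%R)%C 1 - (fun u => f (u + a)%R - f (u + (a - 1))%R)%C 0)%C).
  { cbv beta. rewrite !Rplus_0_l, (Rplus_comm 1 a). replace (1 + (a - 1)) with a by ring. ring. }
  rewrite E. replace M with (M * (1 - 0)) by ring.
  assert (Sh : forall (g g' : R -> C) c u, Cder g (u + c) (g' (u + c)) -> Cder (fun u => g (u + c)) u (g' (u + c))).
  { intros g g' c u Hg. eapply Cder_eq; [|apply (Cder_comp g (fun u => u + c) u 1 (g' (u + c)))]; [|auto_derive; [trivial | ring] | exact Hg].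
    ring. }
  apply (CI_increment_bound (fun u => f (u + a)%R - f (u + (a - 1))%R)%C
    (fun u => f' (u + a)%R - f' (u + (a - 1))%R)%C 0 1 M); [lra | | |].
  - intros u Hu. apply Cder_minus; apply Sh, H1; lra.
  - intros u Hu.
    apply (Ccont_minus (fun u => f' (u + a)) (fun u => f' (u + (a - 1)))); eapply Cder_cont.
    + apply (Sh f' f''), H2; lra.
    + apply (Sh f' f''), H2; lra.
  - intros u Hu. replace M with (M * ((u + a) - (u + (a - 1)))) by ring.
    apply (CI_increment_bound f' f''); [lra | | |]; intros; [apply H2 | apply H3 | apply HM]; lra.
Qed.

Lemma shift_ratio_der_y (t x y : R) : 0 <= x -> 0 < y ->
  Cder (fun y => shift_ratio t x y) y
    (RtoC (x / y ^ 2) * (crit t * Rcpow (1 + x / y) (- crit t - 1)))%C.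
Proof.
  intros Hx Hy. assert (0 <= x / y) by (apply Rdiv_le_0_compat; lra).
  eapply Cder_eq; [|apply (Cder_comp (fun u => Rcpow u (- crit t)) (fun y => 1 + x / y) y (- (x / y ^ 2)))].
  - instantiate (1 := (- crit t * Rcpow (1 + x / y) (- crit t - 1))%C). rewrite RtoC_opp. ring.
  - auto_derive; [lra | field; lra].
  - apply Cder_Rcpow_base; lra.
Qed.

Lemma shift_ratio_der_x (t x y : R) : 0 <= x -> 0 < y ->
  Cder (fun x => shift_ratio t x y) x
    (RtoC (/ y) * (- crit t * Rcpow (1 + x / y) (- crit t - 1)))%C.
Proof.
  intros Hx Hy. assert (0 <= x / y) by (apply Rdiv_le_0_compat; lra).
  apply (Cder_comp (fun u => Rcpow u (- crit t)) (fun x => 1 + x / y) x (/ y)).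
  - auto_derive; [lra | field; lra].
  - apply Cder_Rcpow_base; lra.
Qed.

Lemma shift_ratio_cont_x (t x y : R) : 0 <= x -> 0 < y -> Ccont (fun x => shift_ratio t x y) x.
Proof. intros Hx Hy. eapply Cder_cont, shift_ratio_der_x; assumption. Qed.

Lemma Ccont_ratio_pow (x y : R) (c : C) : 0 <= x -> 0 < y ->
  Ccont (fun x => Rcpow (1 + x / y) c) x /\ Ccont (fun y => Rcpow (1 + x / y) c) y.
Proof.
  intros Hx Hy. assert (0 <= x / y) by (apply Rdiv_le_0_compat; lra). split.
  - apply (Ccont_comp (fun u => Rcpow u c) (fun x => 1 + x / y)).
    + apply continuous_sqrt_rational. auto_derive; lra.
    + apply Ccont_Rcpow_base; lra.
  - apply (Ccont_comp (fun u => Rcpow u c) (fun y => 1 + x / y)).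
    + apply continuous_sqrt_rational. auto_derive; lra.
    + apply Ccont_Rcpow_base; lra.
Qed.

Lemma Cmod_ratio_pow (t x y : R) (n : R) : 0 <= x -> 0 < y -> 0 <= n ->
  Cmod (Rcpow (1 + x / y) (- crit t - RtoC n)) <= 1.
Proof.
  intros Hx Hy Hn. assert (0 <= x / y) by (apply Rdiv_le_0_compat; lra).
  rewrite Cmod_Rcpow. apply Rpower_le_1; [lra|]. rewrite crit_eq; unfold Re; simpl; lra.
Qed.

Lemma shift_ratio_0 (t y : R) : shift_ratio t 0 y = RtoC 1.
Proof.
  unfold shift_ratio, Rdiv. rewrite Rmult_0_l, Rplus_0_r. apply Rcpow_base_1.
Qed.

Lemma one_minus_shift_ratio (t x y : R) : 1 <= t -> 0 <= x -> 0 < y ->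
  Cmod (RtoC 1 - shift_ratio t x y)%C <= 2 * t * x / y.
Proof.
  intros Ht Hx Hy. rewrite <- (shift_ratio_0 t y), Cmod_minus_sym.
  replace (2 * t * x / y) with (2 * t / y * (x - 0)) by (field; lra).
  apply (CI_increment_bound (fun x => shift_ratio t x y)
    (fun x => (RtoC (/ y) * (- crit t * Rcpow (1 + x / y) (- crit t - 1)))%C)); [exact Hx | | |].
  - intros u Hu. apply shift_ratio_der_x; lra.
  - intros u Hu. apply Ccont_mult; [apply Ccont_const|]. apply Ccont_mult; [apply Ccont_const|].
    exact (proj1 (Ccont_ratio_pow u y _ ltac:(lra) ltac:(lra))).
  - intros u Hu. assert (0 < / y) by (apply Rinv_0_lt_compat; exact Hy).
    rewrite !Cmod_mult, Cmod_opp, Cmod_R_nonneg by lra.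
    assert (B := Cmod_ratio_pow t u y 1 ltac:(lra) Hy ltac:(lra)).
    assert (A := Cmod_crit t Ht). assert (A0 := Cmod_ge_0 (crit t)).
    assert (B0 := Cmod_ge_0 (Rcpow (1 + u / y) (- crit t - 1))).
    unfold Rdiv at 2. rewrite (Rmult_comm (2 * t)). apply Rmult_le_compat_l; [lra|].
    rewrite <- (Rmult_1_r (2 * t)). apply Rmult_le_compat; assumption.
Qed.

Lemma shift_ratio_increment (t x y : R) : 1 <= t -> 0 <= x -> 0 < y ->
  Cmod (shift_ratio t x (y + 1) - shift_ratio t x y)%C <= 2 * t * x / y ^ 2.
Proof.
  intros Ht Hx Hy.
  replace (2 * t * x / y ^ 2) with (2 * t * x / y ^ 2 * (y + 1 - y)) by (field; lra).
  apply (CI_increment_bound (fun y => shift_ratio t x y)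
    (fun y => (RtoC (x / y ^ 2) * (crit t * Rcpow (1 + x / y) (- crit t - 1)))%C)); [lra | | |].
  - intros u Hu. apply shift_ratio_der_y; lra.
  - intros u Hu. apply Ccont_mult.
    + apply Ccont_RtoC, continuous_sqrt_rational. auto_derive. apply Rgt_not_eq; nra.
    + apply Ccont_mult; [apply Ccont_const|].
      exact (proj2 (Ccont_ratio_pow x u _ ltac:(lra) ltac:(lra))).
  - intros u Hu. assert (Iu : 0 < u ^ 2) by (apply pow_lt; lra).
    assert (X0 : 0 <= x / u ^ 2) by (apply Rdiv_le_0_compat; lra).
    rewrite !Cmod_mult, Cmod_R_nonneg by exact X0.
    assert (B := Cmod_ratio_pow t x u 1 Hx ltac:(lra) ltac:(lra)).
    assert (A := Cmod_crit t Ht). assert (A0 := Cmod_ge_0 (crit t)).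
    assert (B0 := Cmod_ge_0 (Rcpow (1 + x / u) (- crit t - 1))).
    assert (X1 : x / u ^ 2 <= x / y ^ 2).
    { apply Rmult_le_compat_l; [exact Hx|]. apply Rinv_le_contravar; [apply pow_lt; lra | apply pow_incr; lra]. }
    replace (2 * t * x / y ^ 2) with (x / y ^ 2 * (2 * t * 1)) by (field; lra).
    apply Rmult_le_compat; [exact X0 | apply Rmult_le_pos; assumption | exact X1 | apply Rmult_le_compat; assumption].
Qed.

Lemma Cmod_crit_1 (t : R) : 1 <= t -> Cmod (- crit t - 1)%C <= 3 * t.
Proof.
  intros Ht.
  apply Rle_trans with (1 := Cmod_triangle_minus _ _). rewrite Cmod_opp, Cmod_1.
  generalize (Cmod_crit t Ht). lra.
Qed.

Lemma shift_ratio_second_difference (t x a : R) : 1 <= t -> 0 <= x -> 2 <= a ->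
  Cmod (shift_ratio t x (a + 1) - RtoC 2 * shift_ratio t x a + shift_ratio t x (a - 1))%C
    <= 6 * t ^ 2 * x ^ 2 / (a - 1) ^ 4 + 4 * t * x / (a - 1) ^ 3.
Proof.
  intros Ht Hx Ha.
  set (p := fun y => Rcpow (1 + x / y) (- crit t - 1)).
  set (q := fun y => Rcpow (1 + x / y) (- crit t - 1 - 1)).
  apply (second_difference_bound (fun y => shift_ratio t x y)
    (fun y => (RtoC (x / y ^ 2) * (crit t * p y))%C)
    (fun y => (RtoC (- (2 * x / y ^ 3)) * (crit t * p y) +
       RtoC (x / y ^ 2) * (crit t * (RtoC (- (x / y ^ 2)) * ((- crit t - 1) * q y))))%C)).
  - intros y Hy. apply shift_ratio_der_y; lra.
  - intros y Hy. assert (0 <= x / y) by (apply Rdiv_le_0_compat; lra).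
    apply (Cder_mult (fun y => RtoC (x / y ^ 2)) (fun y => (crit t * p y)%C) y (RtoC (- (2 * x / y ^ 3)))
      (crit t * (RtoC (- (x / y ^ 2)) * ((- crit t - 1) * q y)))%C).
    + apply Cder_RtoC. auto_derive; [apply Rgt_not_eq; nra | field; lra].
    + apply Cder_scal.
      apply (Cder_comp (fun u => Rcpow u (- crit t - 1)) (fun y => 1 + x / y) y (- (x / y ^ 2)) ((- crit t - 1) * q y)%C).
      * auto_derive; [lra | field; lra].
      * apply Cder_Rcpow_base; lra.
  - intros y Hy. assert (Cx : Ccont (fun y => RtoC (x / y ^ 2)) y).
    { apply Ccont_RtoC, continuous_sqrt_rational. auto_derive. apply Rgt_not_eq; nra. }
    assert (Cp := proj2 (Ccont_ratio_pow x y (- crit t - 1)%C Hx ltac:(lra))).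
    assert (Cq := proj2 (Ccont_ratio_pow x y (- crit t - 1 - 1)%C Hx ltac:(lra))).
    apply Ccont_plus; apply Ccont_mult.
    + apply Ccont_RtoC, continuous_sqrt_rational. auto_derive.
      apply Rgt_not_eq. assert (0 < y ^ 3) by (apply pow_lt; lra). simpl in *; lra.
    + apply Ccont_mult; [apply Ccont_const | exact Cp].
    + exact Cx.
    + apply Ccont_mult; [apply Ccont_const|]. apply Ccont_mult.
      * apply Ccont_RtoC, continuous_sqrt_rational. auto_derive. apply Rgt_not_eq; nra.
      * apply Ccont_mult; [apply Ccont_const | exact Cq].
  - intros y Hy.
    assert (Bp : Cmod (p y) <= 1) by (apply (Cmod_ratio_pow t x y 1); lra).
    assert (Bq : Cmod (q y) <= 1).
    { unfold q. replace (- crit t - 1 - 1)%C with (- crit t - RtoC 2)%C by (apply C_ext; unfold Re, Im; simpl; ring).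
      apply Cmod_ratio_pow; lra. }
    assert (P0 := Cmod_ge_0 (p y)). assert (Q0 := Cmod_ge_0 (q y)).
    assert (A := Cmod_crit t Ht). assert (A0 := Cmod_ge_0 (crit t)).
    assert (D := Cmod_crit_1 t Ht). assert (D0 := Cmod_ge_0 (- crit t - 1)%C).
    assert (I2 : / y ^ 2 <= / (a - 1) ^ 2) by (apply Rinv_le_contravar; [apply pow_lt; lra | apply pow_incr; lra]).
    assert (I3 : / y ^ 3 <= / (a - 1) ^ 3) by (apply Rinv_le_contravar; [apply pow_lt; lra | apply pow_incr; lra]).
    assert (J2 : 0 < / y ^ 2) by (apply Rinv_0_lt_compat, pow_lt; lra).
    assert (J3 : 0 < / y ^ 3) by (apply Rinv_0_lt_compat, pow_lt; lra).
    assert (X2 : 0 <= x / y ^ 2 <= x / (a - 1) ^ 2) by (unfold Rdiv; nra).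
    assert (X3 : 0 <= 2 * x / y ^ 3 <= 2 * x / (a - 1) ^ 3) by (unfold Rdiv; nra).
    apply Rle_trans with (1 := Cmod_triangle _ _). rewrite !Cmod_mult, !Cmod_R, !Rabs_Ropp.
    rewrite (Rabs_pos_eq (2 * x / y ^ 3)), (Rabs_pos_eq (x / y ^ 2)) by lra.
    replace (6 * t ^ 2 * x ^ 2 / (a - 1) ^ 4 + 4 * t * x / (a - 1) ^ 3) with
      (2 * x / (a - 1) ^ 3 * (2 * t * 1) +
       x / (a - 1) ^ 2 * (2 * t * (x / (a - 1) ^ 2 * (3 * t * 1)))) by (field; lra).
    apply Rplus_le_compat.
    + apply Rmult_le_compat; [lra | apply Rmult_le_pos; lra | lra | apply Rmult_le_compat; lra].
    + apply Rmult_le_compat; [lra | | lra |].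
      * repeat apply Rmult_le_pos; lra.
      * apply Rmult_le_compat; [lra | repeat apply Rmult_le_pos; lra | lra |].
        apply Rmult_le_compat; [lra | apply Rmult_le_pos; lra | lra | apply Rmult_le_compat; lra].
Qed.

Lemma smooth_integrand_cont (t H x y : R) : 0 < H -> 0 <= x -> 0 < y ->
  Ccont (fun x => (RtoC 1 - shift_ratio t x y) * RtoC (weight H x))%C x.
Proof.
  intros HH Hx Hy. apply Ccont_mult; [|apply Ccont_RtoC, weight_cont, HH].
  apply Ccont_minus; [apply Ccont_const | apply shift_ratio_cont_x; assumption].
Qed.

Lemma smooth_coef_bound (t H y : R) : 1 <= t -> 0 < H -> 0 < y ->
  Cmod (smooth_coef t H y) <= 2 * t * H / y.
Proof.
  intros Ht HH Hy. apply (weighted_average_le (fun x => (RtoC 1 - shift_ratio t x y)%C)); [exact HH | |].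
  - intros x Hx. apply Ccont_minus; [apply Ccont_const | apply shift_ratio_cont_x; lra].
  - intros x Hx. apply Rle_trans with (1 := one_minus_shift_ratio t x y Ht ltac:(lra) Hy).
    unfold Rdiv. apply Rmult_le_compat_r; [left; apply Rinv_0_lt_compat; exact Hy | nra].
Qed.

Lemma smooth_coef_increment (t H y : R) : 1 <= t -> 0 < H -> 0 < y ->
  Cmod (smooth_coef t H (y + 1) - smooth_coef t H y)%C <= 2 * t * H / y ^ 2.
Proof.
  intros Ht HH Hy. unfold smooth_coef.
  assert (C1 : forall y, 0 < y -> forall x, 0 <= x <= H ->
    Ccont (fun x => (RtoC 1 - shift_ratio t x y) * RtoC (weight H x))%C x)
    by (intros; apply smooth_integrand_cont; lra).
  rewrite <- (CI_minus _ _ 0 H ltac:(lra) (C1 (y + 1) ltac:(lra)) (C1 y Hy)).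
  rewrite (CI_ext _ (fun x => (shift_ratio t x y - shift_ratio t x (y + 1)) * RtoC (weight H x))%C);
    [|lra | intros; ring].
  apply (weighted_average_le (fun x => (shift_ratio t x y - shift_ratio t x (y + 1))%C)); [exact HH | |].
  - intros x Hx. apply Ccont_minus; apply shift_ratio_cont_x; lra.
  - intros x Hx. rewrite Cmod_minus_sym.
    apply Rle_trans with (1 := shift_ratio_increment t x y Ht ltac:(lra) Hy).
    unfold Rdiv. apply Rmult_le_compat_r; [left; apply Rinv_0_lt_compat, pow_lt; exact Hy | nra].
Qed.

Definition second_diff (f : R -> C) (a : R) : C :=
  (f (a + 1)%R - RtoC 2 * f a + f (a - 1)%R)%C.

(** Direct differentiation of (1 + x / y)^(-s) in y, which is efficient when t H / y is bounded;
    with H of order t^(-1/2) this is the range beyond sqrt t. *)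
Lemma smooth_second_difference_large (t H a : R) : 1 <= t -> 0 < H -> 2 <= a ->
  Cmod (second_diff (smooth_coef t H) a)
    <= 6 * t ^ 2 * H ^ 2 / (a - 1) ^ 4 + 4 * t * H / (a - 1) ^ 3.
Proof.
  intros Ht HH Ha. unfold second_diff, smooth_coef.
  set (f := fun y x => ((RtoC 1 - shift_ratio t x y) * RtoC (weight H x))%C).
  assert (C1 : forall y, 0 < y -> forall x, 0 <= x <= H -> Ccont (f y) x)
    by (intros; apply smooth_integrand_cont; lra).
  assert (C2 : forall x, 0 <= x <= H -> Ccont (fun x => RtoC 2 * f a x)%C x).
  { intros x Hx. apply Ccont_mult; [apply Ccont_const | apply C1; lra]. }
  assert (C3 : forall x, 0 <= x <= H -> Ccont (fun x => f (a + 1)%R x - RtoC 2 * f a x)%C x).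
  { intros x Hx. apply Ccont_minus; [apply C1; lra | apply C2, Hx]. }
  change (Cmod (CI (f (a + 1)%R) 0 H - RtoC 2 * CI (f a) 0 H + CI (f (a - 1)%R) 0 H)%C <=
    6 * t ^ 2 * H ^ 2 / (a - 1) ^ 4 + 4 * t * H / (a - 1) ^ 3).
  rewrite <- (CI_scal (RtoC 2) (f a) 0 H ltac:(lra) (C1 a ltac:(lra))).
  rewrite <- (CI_minus _ _ 0 H ltac:(lra) (C1 (a + 1) ltac:(lra)) C2).
  rewrite <- (CI_plus _ _ 0 H ltac:(lra) C3 (C1 (a - 1) ltac:(lra))).
  rewrite (CI_ext _ (fun x => (- (shift_ratio t x (a + 1) - RtoC 2 * shift_ratio t x a + shift_ratio t x (a - 1))) * RtoC (weight H x))%C);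
    [|lra | intros; unfold f; ring].
  apply (weighted_average_le (fun x => (- (shift_ratio t x (a + 1) - RtoC 2 * shift_ratio t x a + shift_ratio t x (a - 1)))%C)); [exact HH | |].
  - intros x Hx. apply Ccont_opp. apply Ccont_plus; [|apply shift_ratio_cont_x; lra].
    apply Ccont_minus; [apply shift_ratio_cont_x; lra|].
    apply Ccont_mult; [apply Ccont_const | apply shift_ratio_cont_x; lra].
  - intros x Hx. rewrite Cmod_opp.
    apply Rle_trans with (1 := shift_ratio_second_difference t x a Ht ltac:(lra) Ha).
    assert (x ^ 2 <= H ^ 2) by (apply pow_incr; lra).
    assert (0 < / (a - 1) ^ 4) by (apply Rinv_0_lt_compat, pow_lt; lra).
    assert (0 < / (a - 1) ^ 3) by (apply Rinv_0_lt_compat, pow_lt; lra).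
    apply Rplus_le_compat; unfold Rdiv; apply Rmult_le_compat_r; try lra; apply Rmult_le_compat_l; try lra.
    apply Rmult_le_pos; [lra | apply pow2_ge_0].
Qed.

(** * Closed form of the smoothing coefficients and their second differences below sqrt t *)

Lemma n_minus_crit_neq_0 (n t : R) : 0 < t -> (RtoC n - crit t)%C <> RtoC 0.
Proof. intros Ht E. rewrite crit_eq in E. apply (f_equal snd) in E. simpl in E. lra. Qed.

Lemma Cmod_n_minus_crit (n t : R) : 0 < t -> t <= Cmod (RtoC n - crit t).
Proof.
  intros Ht. apply Rle_trans with (2 := Im_le_Cmod _). rewrite crit_eq. unfold Im; simpl.
  rewrite Rplus_0_l, Rabs_Ropp, Rabs_pos_eq; lra.
Qed.

Lemma Rcpow_mul_same (y : R) (s : C) : 0 < y ->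
  (Rcpow y s * Rcpow y (RtoC 1 - s) = RtoC y)%C /\
  (Rcpow y s * Rcpow y (RtoC 2 - s) = RtoC (y ^ 2))%C /\
  (Rcpow y s * Rcpow y (RtoC 3 - s) = RtoC (y ^ 3))%C.
Proof.
  intros Hy. rewrite <- !Rcpow_add.
  replace (s + (RtoC 1 - s))%C with (RtoC 1) by ring.
  replace (s + (RtoC 2 - s))%C with (RtoC 1 + RtoC 1)%C by (apply C_ext; unfold Re, Im; simpl; ring).
  replace (s + (RtoC 3 - s))%C with (RtoC 1 + RtoC 1 + RtoC 1)%C by (apply C_ext; unfold Re, Im; simpl; ring).
  rewrite !Rcpow_add, !Rcpow_1 by exact Hy. rewrite <- !RtoC_mult.
  repeat split; f_equal; ring.
Qed.

(** Each factor oscillates at the rate t / y, but the two phases nearly cancel, so the product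
    varies slowly in y. *)
Definition power_pair (t H y : R) : C := (Rcpow y (crit t) * Rcpow (y + H) (RtoC 3 - crit t))%C.

Definition smooth_closed (t H y : R) : C :=
  let k1 := (RtoC 1 - crit t)%C in let k2 := (RtoC 2 - crit t)%C in let k3 := (RtoC 3 - crit t)%C in
  (RtoC 1 - RtoC (3 / H ^ 3) * (- (RtoC (H ^ 2) * RtoC y) / k1 - RtoC (2 * H) * RtoC (y ^ 2) / (k1 * k2)
     + RtoC 2 * (power_pair t H y - RtoC (y ^ 3)) / (k1 * k2 * k3)))%C.

(** Three integrations by parts in x exhaust the quadratic weight. The resulting primitive [Q] is
    written down and verified by differentiation. *)
Lemma smooth_coef_closed (t H y : R) : 0 < t -> 0 < H -> 0 < y ->
  smooth_coef t H y = smooth_closed t H y.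
Proof.
  intros Ht HH Hy. unfold smooth_closed. cbv zeta.
  set (s := crit t). set (k1 := (RtoC 1 - s)%C). set (k2 := (RtoC 2 - s)%C). set (k3 := (RtoC 3 - s)%C).
  assert (N1 : k1 <> RtoC 0) by (apply n_minus_crit_neq_0; exact Ht).
  assert (N2 : k2 <> RtoC 0) by (apply n_minus_crit_neq_0; exact Ht).
  assert (N3 : k3 <> RtoC 0) by (apply n_minus_crit_neq_0; exact Ht).
  set (Q := fun x => (Rcpow y s * (RtoC ((H - x) ^ 2) * (Rcpow (x + y) k1 / k1) +
     RtoC (2 * (H - x)) * (Rcpow (x + y) k2 / (k1 * k2)) + RtoC 2 * Rcpow (x + y) k3 / (k1 * k2 * k3)))%C).
  assert (E1 : CI (fun x => Rcpow y s * (RtoC ((H - x) ^ 2) * Rcpow (x + y) (- s)))%C 0 H = (Q H - Q 0)%C).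
  { apply (CI_FTC Q); [lra | |].
    - intros x Hx. assert (P : 0 < x + y) by lra.
      assert (D1 : forall k c, Cder (fun x => Rcpow (x + y) k / c)%C x (k * Rcpow (x + y) (k - 1) / c)%C).
      { intros k c. apply Cder_ext with (fun x => / c * Rcpow (x + y) k)%C; [intros; unfold Cdiv; ring|].
        eapply Cder_eq; [|apply Cder_scal, Cder_Rcpow; exact P]. unfold Cdiv; ring. }
      unfold Q. eapply Cder_eq; [|apply Cder_scal; apply Cder_plus; [apply Cder_plus|]].
      2: { apply (Cder_mult (fun x => RtoC ((H - x) ^ 2)) (fun x => Rcpow (x + y) k1 / k1)%C x (RtoC (- 2 * (H - x)))); [|apply D1].
           apply Cder_RtoC. auto_derive; [trivial | ring]. }
      2: { apply (Cder_mult (fun x => RtoC (2 * (H - x))) (fun x => Rcpow (x + y) k2 / (k1 * k2))%C x (RtoC (- 2))); [|apply D1].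
           apply Cder_RtoC. auto_derive; [trivial | ring]. }
      2: { apply Cder_ext with (fun x => RtoC 2 * (Rcpow (x + y) k3 / (k1 * k2 * k3)))%C; [intros; unfold Cdiv; ring|].
           apply Cder_scal, D1. }
      replace (k1 - 1)%C with (- s)%C by (unfold k1; ring).
      replace (k2 - 1)%C with k1 by (unfold k1, k2; apply C_ext; unfold Re, Im; simpl; ring).
      replace (k3 - 1)%C with k2 by (unfold k2, k3; apply C_ext; unfold Re, Im; simpl; ring).
      rewrite !RtoC_mult. replace (RtoC (-2)) with (- RtoC 2)%C by (apply C_ext; unfold Re, Im; simpl; ring). field. repeat split; assumption.
    - intros x Hx. apply Ccont_mult; [apply Ccont_const|]. apply Ccont_mult; [|apply Ccont_Rcpow; lra].
      apply Ccont_RtoC, continuous_sqrt_rational. auto_derive; trivial. }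
  assert (E2 : CI (fun x => RtoC (weight H x)) 0 H = RtoC 1).
  { unfold CI, RtoC. cbn [Re Im fst snd]. f_equal; [exact (weight_mass H HH)|].
    rewrite RInt_const. unfold scal; simpl; unfold mult; simpl; ring. }
  unfold smooth_coef.
  rewrite (CI_ext _ (fun x => RtoC (weight H x) - RtoC (3 / H ^ 3) * (Rcpow y s * (RtoC ((H - x) ^ 2) * Rcpow (x + y) (- s))))%C); [|lra|].
  - rewrite CI_minus, CI_scal, E1, E2; [| lra | | lra | |].
    + unfold Q. rewrite !Rplus_0_l, !Rminus_0_r, Rminus_diag.
      destruct (Rcpow_mul_same y s Hy) as (M1 & M2 & M3). fold k1 k2 k3 in M1, M2, M3.
      unfold power_pair. fold s k3. rewrite <- M1, <- M2, <- M3. rewrite (Rplus_comm H y).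
      rewrite !Rmult_0_r, pow_i, !RtoC_mult by lia. field. repeat split; assumption.
    + intros x Hx. apply Ccont_mult; [apply Ccont_const|]. apply Ccont_mult; [|apply Ccont_Rcpow; lra].
      apply Ccont_RtoC, continuous_sqrt_rational. auto_derive; trivial.
    + intros; apply Ccont_RtoC, weight_cont, HH.
    + intros x Hx. apply Ccont_mult; [apply Ccont_const|]. apply Ccont_mult; [apply Ccont_const|]. apply Ccont_mult; [|apply Ccont_Rcpow; lra].
      apply Ccont_RtoC, continuous_sqrt_rational. auto_derive; trivial.
  - intros x Hx. unfold shift_ratio, weight. fold s.
    assert (0 < 1 + x / y) by (assert (0 < x / y) by (apply Rdiv_lt_0_compat; lra); lra).
    replace (x + y) with (y * (1 + x / y)) by (field; lra).
    rewrite Rcpow_mul_base, (Rcpow_opp y) by assumption.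
    replace (3 * (H - x) ^ 2 / H ^ 3) with (3 / H ^ 3 * (H - x) ^ 2) by (field; lra).
    rewrite RtoC_mult. field. apply Rcpow_neq_0.
Qed.

(** Once the common factor w = y^(s-2) (y + H)^(1-s) is extracted, the second derivative becomes w
    (s^2 H^2 + s (4 y H - H^2) + 6 y^2): the contributions s^2 y^2 cancel, and the remaining s^2
    comes with H^2. *)
Lemma power_pair_second_difference (t H a M : R) : 1 <= t -> 0 < H <= 1 -> 2 <= a ->
  (forall y, a - 1 <= y <= a + 1 -> 2 * (4 * t ^ 2 * H ^ 2 + 10 * t * y * H + 6 * y ^ 2) / y <= M) ->
  Cmod (second_diff (power_pair t H) a) <= M.
Proof.
  intros Ht HH Ha HM. set (s := crit t).
  apply (second_difference_bound (power_pair t H)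
    (fun y => s * Rcpow y (s - 1) * Rcpow (y + H) (RtoC 3 - s) + Rcpow y s * ((RtoC 3 - s) * Rcpow (y + H) (RtoC 3 - s - 1)))%C
    (fun y => (s * ((s - 1) * Rcpow y (s - 1 - 1)) * Rcpow (y + H) (RtoC 3 - s) +
               s * Rcpow y (s - 1) * ((RtoC 3 - s) * Rcpow (y + H) (RtoC 3 - s - 1))) +
              (s * Rcpow y (s - 1) * ((RtoC 3 - s) * Rcpow (y + H) (RtoC 3 - s - 1)) +
               Rcpow y s * ((RtoC 3 - s) * ((RtoC 3 - s - 1) * Rcpow (y + H) (RtoC 3 - s - 1 - 1)))))%C).
  - intros y Hy. apply (Cder_mult (fun y => Rcpow y s) (fun y => Rcpow (y + H) (RtoC 3 - s))).
    + apply Cder_Rcpow_base; lra.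
    + apply Cder_Rcpow; lra.
  - intros y Hy. apply Cder_plus.
    + apply (Cder_mult (fun y => s * Rcpow y (s - 1))%C (fun y => Rcpow (y + H) (RtoC 3 - s))).
      * apply Cder_scal, Cder_Rcpow_base; lra.
      * apply Cder_Rcpow; lra.
    + apply (Cder_mult (fun y => Rcpow y s)%C (fun y => (RtoC 3 - s) * Rcpow (y + H) (RtoC 3 - s - 1))%C).
      * apply Cder_Rcpow_base; lra.
      * apply Cder_scal, Cder_Rcpow; lra.
  - intros y Hy.
    assert (B1 : forall c, Ccont (fun y => Rcpow y c) y) by (intros; apply Ccont_Rcpow_base; lra).
    assert (B2 : forall c, Ccont (fun y => Rcpow (y + H) c) y) by (intros; apply Ccont_Rcpow; lra).
    assert (B3 : forall c d, Ccont (fun y => c * Rcpow y d)%C y) by (intros; apply Ccont_mult; [apply Ccont_const | apply B1]).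
    assert (B4 : forall c d, Ccont (fun y => c * Rcpow (y + H) d)%C y) by (intros; apply Ccont_mult; [apply Ccont_const | apply B2]).
    apply Ccont_plus; apply Ccont_plus.
    + exact (Ccont_mult _ _ y (Ccont_mult _ _ y (Ccont_const s y) (B3 _ _)) (B2 _)).
    + exact (Ccont_mult _ _ y (B3 _ _) (B4 _ _)).
    + exact (Ccont_mult _ _ y (B3 _ _) (B4 _ _)).
    + exact (Ccont_mult _ _ y (B1 _) (Ccont_mult _ _ y (Ccont_const _ y) (B4 _ _))).
  - intros y Hy. apply Rle_trans with (2 := HM y Hy).
    set (Y := y + H).
    set (w := (Rcpow y (s - 1 - 1) * Rcpow Y (RtoC 3 - s - 1 - 1))%C).
    assert (Ey : forall c, Rcpow y c = (Rcpow y (c - 1) * RtoC y)%C).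
    { intros c. rewrite <- (Rcpow_1 y) by lra. rewrite <- Rcpow_add. f_equal; ring. }
    assert (EY : forall c, Rcpow Y c = (Rcpow Y (c - 1) * RtoC Y)%C).
    { intros c. rewrite <- (Rcpow_1 Y) by (unfold Y; lra). rewrite <- Rcpow_add. f_equal; ring. }
    match goal with |- Cmod ?X <= _ =>
      replace X with (w * (s * s * RtoC (H ^ 2) + s * RtoC (4 * y * H - H ^ 2) + RtoC (6 * y ^ 2)))%C end.
    2: { unfold w. rewrite (EY (RtoC 3 - s)%C), (EY (RtoC 3 - s - 1)%C), (Ey s), (Ey (s - 1)%C).
         replace (RtoC Y) with (RtoC y + RtoC H)%C by (unfold Y; rewrite RtoC_plus; reflexivity).
         rewrite RtoC_minus, !RtoC_mult, !RtoC_pow.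
         replace (RtoC 3) with (RtoC 1 + RtoC 1 + RtoC 1)%C by (apply C_ext; unfold Re, Im; simpl; ring).
         replace (RtoC 4) with (RtoC 1 + RtoC 1 + RtoC 1 + RtoC 1)%C by (apply C_ext; unfold Re, Im; simpl; ring).
         replace (RtoC 6) with (RtoC 1 + RtoC 1 + RtoC 1 + RtoC 1 + RtoC 1 + RtoC 1)%C by (apply C_ext; unfold Re, Im; simpl; ring).
         unfold Cpow. ring. }
    assert (S1 := Cmod_crit t Ht). fold s in S1. assert (S0 := Cmod_ge_0 s).
    rewrite Cmod_mult.
    assert (W : Cmod w <= 2 / y).
    { unfold w. rewrite Cmod_mult, !Cmod_Rcpow.
      replace (Re (s - 1 - 1)%C) with (- (1 / 2) + Ropp 1) by (unfold s; rewrite crit_eq; unfold Re; simpl; lra).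
      replace (Re (RtoC 3 - s - 1 - 1)%C) with (1 / 2) by (unfold s; rewrite crit_eq; unfold Re; simpl; lra).
      rewrite Rpower_plus, Rpower_mhalf, Rpower_half, Rpower_Ropp, Rpower_1 by (unfold Y; lra).
      assert (Q : sqrt Y <= 2 * sqrt y).
      { replace 2 with (sqrt (2 * 2)) at 1 by (apply sqrt_square; lra).
        rewrite <- sqrt_mult by lra. apply sqrt_le_1; unfold Y; lra. }
      assert (Q0 : 0 < sqrt y) by (apply sqrt_lt_R0; lra).
      replace (/ sqrt y * / y * sqrt Y) with (sqrt Y / sqrt y * / y) by (field; lra).
      apply Rmult_le_compat_r; [left; apply Rinv_0_lt_compat; lra|]. apply div_le_l; lra. }
    assert (B : Cmod (s * s * RtoC (H ^ 2) + s * RtoC (4 * y * H - H ^ 2) + RtoC (6 * y ^ 2))%C <=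
      4 * t ^ 2 * H ^ 2 + 10 * t * y * H + 6 * y ^ 2).
    { apply Rle_trans with (1 := Cmod_triangle _ _). apply Rplus_le_compat.
      - apply Rle_trans with (1 := Cmod_triangle _ _). rewrite !Cmod_mult, !Cmod_R.
        apply Rplus_le_compat.
        + rewrite (Rabs_pos_eq (H ^ 2)) by apply pow2_ge_0. apply Rmult_le_compat_r; [apply pow2_ge_0|].
          replace (4 * t ^ 2) with (2 * t * (2 * t)) by ring. apply Rmult_le_compat; assumption.
        + replace (10 * t * y * H) with (2 * t * (5 * y * H)) by ring.
          apply Rmult_le_compat; [exact S0 | apply Rabs_pos | exact S1|].
          apply Rabs_le; split; nra.
      - rewrite Cmod_R, Rabs_pos_eq; [lra|]. generalize (pow2_ge_0 y); lra. }
    replace (2 * (4 * t ^ 2 * H ^ 2 + 10 * t * y * H + 6 * y ^ 2) / y) with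
      (2 / y * (4 * t ^ 2 * H ^ 2 + 10 * t * y * H + 6 * y ^ 2)) by (field; lra).
    apply Rmult_le_compat; [apply Cmod_ge_0 | apply Cmod_ge_0 | exact W | exact B].
Qed.

(** In the closed form the second difference kills the constant and the linear term, sends y^2 to 2
    and y^3 to 6 a. The denominators k1 k2 and k1 k2 k3 gain t^2 and t^3, against a prefactor H^(-3)
    of order t^(3/2). *)
Lemma smooth_second_difference_small (t H a : R) :
  400 <= t -> / (16 * sqrt t) <= H <= / (8 * sqrt t) -> 2 <= a <= sqrt t ->
  Cmod (second_diff (smooth_coef t H) a) <= 3 * 10 ^ 6 / a ^ 2.
Proof.
  intros Ht HH Ha.
  assert (R20 : 20 <= sqrt t).
  { replace 20 with (sqrt (20 * 20)) by (apply sqrt_square; lra). apply sqrt_le_1; lra. }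
  set (r := sqrt t) in *. assert (Rr : r * r = t) by (apply sqrt_sqrt; lra).
  assert (H0 : 0 < H) by (apply Rlt_le_trans with (2 := proj1 HH), Rinv_0_lt_compat; lra).
  assert (Hr : r * H <= / 8).
  { apply Rle_trans with (r * / (8 * r)); [apply Rmult_le_compat_l; lra | right; field; lra]. }
  assert (HI : / H <= 16 * r).
  { replace (16 * r) with (/ / (16 * r)) by (apply Rinv_inv). apply Rinv_le_contravar; [apply Rinv_0_lt_compat|]; lra. }
  assert (HI0 : 0 < / H) by (apply Rinv_0_lt_compat; exact H0).
  assert (PP : Cmod (second_diff (power_pair t H) a) <= 108 * t / a).
  { apply power_pair_second_difference; [lra | nra | lra |].
    intros y Hy.
    assert (Y1 : t ^ 2 * H ^ 2 <= t / 64).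
    { replace (t ^ 2 * H ^ 2) with (t * ((r * H) * (r * H))) by (rewrite <- Rr; ring).
      assert ((r * H) * (r * H) <= / 8 * / 8) by (apply Rmult_le_compat; nra). nra. }
    assert (Y2 : t * y * H <= t / 4).
    { replace (t * y * H) with (r * y * (r * H)) by (rewrite <- Rr; ring).
      assert (r * y <= 2 * t) by nra. assert (0 <= r * H) by nra. nra. }
    assert (Y3 : y ^ 2 <= 4 * t) by nra.
    apply Rle_trans with (54 * t / y).
    - unfold Rdiv. apply Rmult_le_compat_r; [left; apply Rinv_0_lt_compat; lra | lra].
    - replace (108 * t / a) with (54 * t / (a / 2)) by (field; lra).
      apply Rmult_le_compat_l; [lra|]. apply Rinv_le_contravar; lra. }
  unfold second_diff in *. rewrite !smooth_coef_closed by lra.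
  unfold smooth_closed. cbv zeta.
  set (s := crit t). set (k1 := (RtoC 1 - s)%C). set (k2 := (RtoC 2 - s)%C). set (k3 := (RtoC 3 - s)%C).
  assert (N1 : k1 <> RtoC 0) by (apply n_minus_crit_neq_0; lra).
  assert (N2 : k2 <> RtoC 0) by (apply n_minus_crit_neq_0; lra).
  assert (N3 : k3 <> RtoC 0) by (apply n_minus_crit_neq_0; lra).
  set (D := (power_pair t H (a + 1)%R - RtoC 2 * power_pair t H a + power_pair t H (a - 1)%R)%C) in *.
  match goal with |- Cmod ?X <= _ => replace X with
    (RtoC (3 / H ^ 3) * (RtoC (4 * H) / (k1 * k2) - RtoC 2 * (D - RtoC (6 * a)) / (k1 * k2 * k3)))%C end.
  2: { unfold D.
       replace (RtoC (6 * a)) with (RtoC ((a + 1) ^ 3) - RtoC 2 * RtoC (a ^ 3) + RtoC ((a - 1) ^ 3))%C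
         by (apply C_ext; unfold Re, Im; simpl; ring).
       replace (RtoC (4 * H)) with (RtoC (2 * H) * (RtoC ((a + 1) ^ 2) - RtoC 2 * RtoC (a ^ 2) + RtoC ((a - 1) ^ 2)))%C
         by (apply C_ext; unfold Re, Im; simpl; ring).
       rewrite (RtoC_plus a 1), (RtoC_minus a 1).
       replace (RtoC 2) with (RtoC 1 + RtoC 1)%C by (apply C_ext; unfold Re, Im; simpl; ring).
       field. repeat split; assumption. }
  assert (L1 := Cmod_n_minus_crit 1 t ltac:(lra)). fold s k1 in L1.
  assert (L2 := Cmod_n_minus_crit 2 t ltac:(lra)). fold s k2 in L2.
  assert (L3 := Cmod_n_minus_crit 3 t ltac:(lra)). fold s k3 in L3.
  assert (K12 : t * t <= Cmod (k1 * k2)) by (rewrite Cmod_mult; apply Rmult_le_compat; lra).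
  assert (K123 : t * t * t <= Cmod (k1 * k2 * k3)) by (rewrite Cmod_mult; apply Rmult_le_compat; nra).
  assert (N12 : (k1 * k2)%C <> RtoC 0) by (apply Cmult_neq_0; assumption).
  assert (N123 : (k1 * k2 * k3)%C <> RtoC 0) by (apply Cmult_neq_0; assumption).
  assert (H3 : 0 < / H ^ 3) by (apply Rinv_0_lt_compat, pow_lt; exact H0).
  assert (t2 : 0 < t * t) by nra. assert (t3 : 0 < t * t * t) by nra.
  rewrite Cmod_mult, Cmod_R_nonneg by (unfold Rdiv; lra).
  apply Rle_trans with (3 / H ^ 3 * (4 * H / (t * t) + 2 * (108 * t / a + 6 * a) / (t * t * t))).
  - apply Rmult_le_compat_l; [unfold Rdiv; lra|].
    apply Rle_trans with (1 := Cmod_triangle_minus _ _). apply Rplus_le_compat.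
    + rewrite Cmod_div, Cmod_R_nonneg by (assumption || lra).
      apply Rmult_le_compat_l; [lra|]. apply Rinv_le_contravar; assumption.
    + rewrite Cmod_div, Cmod_mult, Cmod_R_nonneg by (assumption || lra).
      assert (B : Cmod (D - RtoC (6 * a))%C <= 108 * t / a + 6 * a).
      { apply Rle_trans with (1 := Cmod_triangle_minus _ _). rewrite Cmod_R_nonneg by lra. lra. }
      apply Rmult_le_compat; [apply Rmult_le_pos; [lra | apply Cmod_ge_0] | | lra | apply Rinv_le_contravar; assumption].
      left; apply Rinv_0_lt_compat; lra.
  - set (h := / H) in *.
    replace (3 / H ^ 3 * (4 * H / (t * t) + 2 * (108 * t / a + 6 * a) / (t * t * t))) with
      (12 * (h ^ 2) * / (t * t) + h ^ 3 * (6 * (108 * t / a + 6 * a) * / (t * t * t))) by (unfold h; field; repeat split; lra).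
    assert (h2 : h ^ 2 <= (16 * r) ^ 2) by (apply pow_incr; lra).
    assert (h3 : h ^ 3 <= (16 * r) ^ 3) by (apply pow_incr; lra).
    assert (A0 : 0 <= 108 * t / a) by (apply Rdiv_le_0_compat; lra).
    apply Rle_trans with (12 * (16 * r) ^ 2 * / (t * t) + (16 * r) ^ 3 * (6 * (108 * t / a + 6 * a) * / (t * t * t))).
    + apply Rplus_le_compat.
      * apply Rmult_le_compat_r; [left; apply Rinv_0_lt_compat; exact t2 | lra].
      * apply Rmult_le_compat_r; [|exact h3]. apply Rmult_le_pos; [lra | left; apply Rinv_0_lt_compat; exact t3].
    + replace (12 * (16 * r) ^ 2 * / (t * t) + (16 * r) ^ 3 * (6 * (108 * t / a + 6 * a) * / (t * t * t))) with
        (3072 * / (r * r) + 24576 * (108 * / (r * a) + 6 * (a * / (r * r * r)))) by (rewrite <- Rr; field; lra).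
      assert (I1 : / (r * r) <= / a ^ 2) by (apply Rinv_le_contravar; [apply pow_lt; lra | nra]).
      assert (I2 : / (r * a) <= / a ^ 2) by (apply Rinv_le_contravar; [apply pow_lt; lra | nra]).
      assert (I3 : a * / (r * r * r) <= / a ^ 2).
      { apply Rle_trans with (a * / (a * a * a)); [|right; field; lra].
        apply Rmult_le_compat_l; [lra|]. apply Rinv_le_contravar; [apply Rmult_lt_0_compat; nra|].
        apply Rmult_le_compat; [nra | lra | apply Rmult_le_compat; lra | lra]. }
      unfold Rdiv. assert (0 < / a ^ 2) by (apply Rinv_0_lt_compat, pow_lt; lra). lra.
Qed.

(** * The approximate functional equation *)

(** For the coefficients [dirichlet_term] the double sums [A] are conjugates of the Cesaro sums
    ([csum_csum_dirichlet_conj]), so two summations by parts bring the sum within reach of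
    [cesaro_poly_estimate]. *)
Lemma abel_twice (a V : nat -> C) (n : nat) :
  let B := csum a in let A := csum B in
  csum (fun k => a k * V k)%C n =
  (B n * V n - A (S n) * (V (S n) - V n)
   + csum (fun k => A (S (S k)) * (V (S (S k)) - RtoC 2 * V (S k) + V k)) n)%C.
Proof.
  intros B A. induction n as [|n IH].
  - simpl. unfold A. simpl. unfold B. simpl. ring.
  - simpl csum at 1. rewrite IH.
    change (csum (fun k => A (S (S k)) * (V (S (S k)) - RtoC 2 * V (S k) + V k))%C (S n)) with
      (csum (fun k => A (S (S k)) * (V (S (S k)) - RtoC 2 * V (S k) + V k)) n +
       A (S (S n)) * (V (S (S n)) - RtoC 2 * V (S n) + V n))%C.
    change (A (S (S n))) with (A (S n) + B (S n))%C.
    change (B (S n)) with (B n + a n)%C.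
    replace (RtoC 2) with (RtoC 1 + RtoC 1)%C by (apply C_ext; unfold Re, Im; simpl; ring).
    ring.
Qed.

Definition dirichlet_term (t : R) (k : nat) : C := Rcpow (INR (S k)) (- crit t).

Lemma Cconj_crit (t : R) : Cconj (crit t - 1)%C = (- crit t)%C.
Proof. rewrite crit_eq. apply C_ext; unfold Re, Im; simpl; lra. Qed.

Lemma csum_dirichlet_conj (t : R) (n : nat) :
  csum (dirichlet_term t) n = Cconj (partial_poly t n).
Proof.
  unfold partial_poly. rewrite Cconj_csum. apply csum_ext; intros k _.
  rewrite Cconj_Rcpow, Cconj_crit. reflexivity.
Qed.

Lemma csum_csum_dirichlet_conj (t : R) (n : nat) :
  csum (csum (dirichlet_term t)) n = Cconj (cesaro_poly t n).
Proof.
  unfold cesaro_poly. rewrite Cconj_csum. apply csum_ext; intros k _. apply csum_dirichlet_conj.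
Qed.

Lemma Cmod_dirichlet_term (t : R) (k : nat) : Cmod (dirichlet_term t k) = / sqrt (INR (S k)).
Proof. apply Cmod_Rcpow_crit, INR_S_pos. Qed.

Lemma Cmod_dirichlet_sum (t : R) (n : nat) : Cmod (csum (dirichlet_term t) n) <= 2 * sqrt (INR n).
Proof.
  apply Rle_trans with (2 := rsum_inv_sqrt n). apply Cmod_csum_le. intros k _.
  rewrite Cmod_dirichlet_term; lra.
Qed.

Lemma Cmod_dirichlet_double_sum (t : R) (n : nat) :
  Cmod (csum (csum (dirichlet_term t)) n) <= INR n * (2 * sqrt (INR n)).
Proof.
  rewrite <- rsum_const. apply Cmod_csum_le. intros k Hk.
  apply Rle_trans with (1 := Cmod_dirichlet_sum t k).
  apply Rmult_le_compat_l; [lra|]. apply sqrt_le_1; try apply pos_INR. apply le_INR; lia.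
Qed.

(** With about t^2 terms, the truncation error is at most 4 and the correction at most 2 at each
    point of [0, H]; comparing the point 0 with the point x doubles this to 12. *)
Lemma smoothing_error (t H : R) (Z : R -> C) (M : nat) :
  400 <= t -> is_hurwitz_on_line t Z -> 0 < H <= 1 -> t ^ 2 < INR M <= t ^ 2 + 1 ->
  Cmod (Z 0%R - CI (fun x => Z x * RtoC (weight H x)) 0 H
    - csum (fun k => dirichlet_term t k * smooth_coef t H (INR (S k))) M)%C <= 12.
Proof.
  intros Ht HZ HH HM. destruct HZ as [HZ1 HZ2].
  assert (HM0 : (0 < M)%nat) by (apply INR_lt; simpl; nra).
  assert (Cw : forall x, 0 <= x <= H -> Ccont (fun x => RtoC (weight H x)) x)
    by (intros; apply Ccont_RtoC, weight_cont; lra).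
  assert (C1 : forall x, 0 <= x <= H -> Ccont (fun x => Z x * RtoC (weight H x))%C x)
    by (intros; apply Ccont_mult; auto).
  assert (C0 : forall x, 0 <= x <= H -> Ccont (fun x => Z 0%R * RtoC (weight H x))%C x)
    by (intros; apply Ccont_mult; [apply Ccont_const | auto]).
  assert (E2 : CI (fun x => RtoC (weight H x)) 0 H = RtoC 1).
  { unfold CI, RtoC. cbn [Re Im fst snd]. f_equal; [exact (weight_mass H (proj1 HH))|].
    rewrite RInt_const. unfold scal; simpl; unfold mult; simpl; ring. }
  assert (E0 : Z 0%R = CI (fun x => Z 0%R * RtoC (weight H x))%C 0 H).
  { rewrite CI_scal, E2 by (lra || exact Cw). ring. }
  assert (C2 : forall k x, (k < M)%nat -> 0 <= x <= H -> Ccont (fun x => dirichlet_term t k *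
     ((RtoC 1 - shift_ratio t x (INR (S k))) * RtoC (weight H x)))%C x).
  { intros k x _ Hx. apply Ccont_mult; [apply Ccont_const|].
    apply smooth_integrand_cont; [lra | lra | apply INR_S_pos]. }
  assert (E3 : csum (fun k => dirichlet_term t k * smooth_coef t H (INR (S k)))%C M =
    CI (fun x => csum (fun k => dirichlet_term t k *
      ((RtoC 1 - shift_ratio t x (INR (S k))) * RtoC (weight H x)))%C M) 0 H).
  { rewrite (CI_csum (fun k x => dirichlet_term t k *
      ((RtoC 1 - shift_ratio t x (INR (S k))) * RtoC (weight H x)))%C M 0 H ltac:(lra) C2).
    apply csum_ext; intros k _. unfold smooth_coef. symmetry; apply CI_scal; [lra|].
    intros; apply smooth_integrand_cont; [lra | lra | apply INR_S_pos]. }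
  assert (C3 : forall x, 0 <= x <= H -> Ccont (fun x => csum (fun k => dirichlet_term t k *
      ((RtoC 1 - shift_ratio t x (INR (S k))) * RtoC (weight H x)))%C M) x).
  { intros x Hx. apply (Ccont_csum (fun k x => dirichlet_term t k *
      ((RtoC 1 - shift_ratio t x (INR (S k))) * RtoC (weight H x)))%C M). intros; apply C2; assumption. }
  assert (C4 : forall x, 0 <= x <= H -> Ccont (fun x => Z 0%R * RtoC (weight H x) - Z x * RtoC (weight H x))%C x).
  { intros x Hx. exact (Ccont_minus _ _ x (C0 x Hx) (C1 x Hx)). }
  rewrite E0 at 1. rewrite E3.
  rewrite <- (CI_minus _ _ 0 H ltac:(lra) C0 C1), <- (CI_minus _ _ 0 H ltac:(lra) C4 C3).
  set (f := fun x => (Z 0%R - Z x - csum (fun k => dirichlet_term t k * (RtoC 1 - shift_ratio t x (INR (S k)))) M)%C).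
  rewrite (CI_ext _ (fun x => f x * RtoC (weight H x))%C); [|lra|].
  2: { intros x _. unfold f.
       rewrite (csum_ext (fun k => dirichlet_term t k * ((RtoC 1 - shift_ratio t x (INR (S k))) * RtoC (weight H x)))%C
         (fun k => RtoC (weight H x) * (dirichlet_term t k * (RtoC 1 - shift_ratio t x (INR (S k)))))%C) by (intros; ring).
       rewrite csum_scal. ring. }
  apply weighted_average_le; [lra | |].
  - intros x Hx. unfold f. apply Ccont_minus; [apply Ccont_minus; [apply Ccont_const | apply HZ1]|].
    apply (Ccont_csum (fun k x => dirichlet_term t k * (RtoC 1 - shift_ratio t x (INR (S k))))%C M).
    intros k _. apply Ccont_mult; [apply Ccont_const|]. apply Ccont_minus; [apply Ccont_const|].
    apply shift_ratio_cont_x; [lra | apply INR_S_pos].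
  - intros x Hx.
    assert (G : forall y, 0 <= y <= H -> Cmod (Z y - csum (fun k => Rcpow (INR (S k) + y) (- crit t)) M)%C <= 6).
    { intros y Hy.
      assert (K := HZ2 y M ltac:(lra) HM0).
      assert (S1 : t <= sqrt (INR M + y)).
      { rewrite <- (sqrt_pow2 t) at 1 by lra. apply sqrt_le_1; [apply pow2_ge_0 | nra | lra]. }
      assert (S2 : sqrt (INR M + y) <= 2 * t).
      { replace (2 * t) with (sqrt (2 * t * (2 * t))) by (apply sqrt_square; lra). apply sqrt_le_1; nra. }
      assert (4 * t / sqrt (INR M + y) <= 4) by (apply div_le_l; lra).
      assert (Cmod (Rcpow (INR M + y) (RtoC 1 - crit t) / (RtoC 1 - crit t)) <= 2).
      { rewrite Cmod_div, Cmod_Rcpow_1_crit by (try apply crit_neq_1; nra).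
        assert (K2 := Cmod_1_minus_crit t ltac:(lra)). apply div_le_l; lra. }
      unfold hurwitz_partial in K.
      replace (Z y - csum (fun k => Rcpow (INR (S k) + y) (- crit t)) M)%C with
        ((Z y - (csum (fun k => Rcpow (INR (S k) + y) (- crit t)) M - Rcpow (INR M + y) (RtoC 1 - crit t) / (RtoC 1 - crit t)))
         - Rcpow (INR M + y) (RtoC 1 - crit t) / (RtoC 1 - crit t))%C by ring.
      apply Rle_trans with (1 := Cmod_triangle_minus _ _). lra. }
    replace (f x) with ((Z 0%R - csum (fun k => Rcpow (INR (S k) + 0) (- crit t)) M) -
       (Z x - csum (fun k => Rcpow (INR (S k) + x) (- crit t)) M))%C.
    + apply Rle_trans with (1 := Cmod_triangle_minus _ _).
      assert (G0 := G 0 ltac:(lra)). assert (Gx := G x Hx). lra.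
    + unfold f.
      rewrite (csum_ext (fun k => dirichlet_term t k * (RtoC 1 - shift_ratio t x (INR (S k))))%C
        (fun k => Rcpow (INR (S k) + 0) (- crit t) - Rcpow (INR (S k) + x) (- crit t))%C).
      * rewrite csum_minus. ring.
      * intros k _. assert (P := INR_S_pos k). unfold dirichlet_term, shift_ratio.
        rewrite Rplus_0_r.
        replace (INR (S k) + x) with (INR (S k) * (1 + x / INR (S k))) by (field; lra).
        rewrite Rcpow_mul_base; [ring | exact P |].
        assert (0 <= x / INR (S k)) by (apply Rdiv_le_0_compat; lra). lra.
Qed.

(** On [0, H] the weight is at most 3 / H = 24 N while F_N >= N / 4, so 100 F_N dominates it. This
    domination is what ties H to 1 / (8 N). *)
Lemma smooth_average_bound (t T : R) (Z : R -> C) (N : nat) :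
  400 <= t -> is_hurwitz_on_line t Z -> t / (2 * PI) <= T <= t -> (0 < N)%nat -> INR N <= t / PI ->
  let H := / (8 * INR N) in
  Cmod (CI (fun x => Z x * RtoC (weight H x))%C 0 H) <=
    10 * (2 * (Rpower (INR N) (1 / 4) * sqrt (sqrt (pairing_sum t T Z))) + 20000 * Rpower t (1 / 16)).
Proof.
  intros Ht HZ HT HN HNt H. assert (P : 1 <= INR N) by (change 1 with (INR 1); apply le_INR; lia).
  assert (H0 : 0 < H) by (apply Rinv_0_lt_compat; lra).
  assert (H1 : H <= 1) by (rewrite <- Rinv_1; apply Rinv_le_contravar; lra).
  assert (A := average_from_square t T Z N Ht HZ HT HN HNt).
  assert (W := weighted_cauchy_schwarz Z (weight H) 0 H ltac:(lra) (fun x _ => proj1 HZ x)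
    (fun x _ => weight_cont H x H0) (fun x _ => weight_nonneg H x H0) (weight_mass H H0)).
  apply le_sqrt_of_sqr in W; [|apply Cmod_ge_0].
  apply Rle_trans with (1 := W).
  apply Rle_trans with (10 * sqrt (RInt (fun x => Cmod (Z x) ^ 2 * fejer N x) 0 1)); [|lra].
  set (h := fun x => Cmod (Z x) ^ 2 * fejer N x).
  assert (Ch : forall x, continuous h x).
  { intros x. apply continuous_Rmult; [apply continuous_pow_comp, continuous_Cmod, HZ | apply fejer_continuous]. }
  assert (h0 : forall x, 0 <= h x).
  { intros x. apply Rmult_le_pos; [apply pow2_ge_0 | apply fejer_nonneg; exact HN]. }
  assert (I1 : 0 <= RInt h H 1) by (apply RInt_ge_0; [lra | apply ex_RInt_cont; [lra | intros; apply Ch] | intros; apply h0]).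
  assert (I0 : 0 <= RInt h 0 H) by (apply RInt_ge_0; [lra | apply ex_RInt_cont; [lra | intros; apply Ch] | intros; apply h0]).
  assert (Ic := RInt_cut h 0 H 1 ltac:(lra) (fun x _ => Ch x)).
  assert (B : RInt (fun x => Cmod (Z x) ^ 2 * weight H x) 0 H <= 100 * RInt h 0 1).
  { apply Rle_trans with (RInt (fun x => 100 * h x) 0 H).
    - apply RInt_mono; [lra | | |].
      + intros x _. apply continuous_Rmult; [apply continuous_pow_comp, continuous_Cmod, HZ | apply weight_cont, H0].
      + intros x _. apply (continuous_Rmult (fun _ => 100)); [apply continuous_const | apply Ch].
      + intros x Hx. unfold h. replace (100 * (Cmod (Z x) ^ 2 * fejer N x)) with (Cmod (Z x) ^ 2 * (100 * fejer N x)) by ring.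
        apply Rmult_le_compat_l; [apply pow2_ge_0|].
        assert (F := fejer_lower N x HN ltac:(split; [lra | unfold H in Hx; lra])).
        apply Rle_trans with (24 * INR N); [|lra].
        unfold weight. apply Rle_trans with (3 * H ^ 2 / H ^ 3).
        * apply Rmult_le_compat_r; [left; apply Rinv_0_lt_compat, pow_lt; exact H0|].
          apply Rmult_le_compat_l; [lra|]. apply pow_incr; lra.
        * right. replace (3 * H ^ 2 / H ^ 3) with (3 * / H) by (field; lra). unfold H. rewrite Rinv_inv. ring.
    - rewrite RInt_Rscal by (apply ex_RInt_cont; [lra | intros; apply Ch]). lra. }
  apply Rle_trans with (sqrt (100 * RInt h 0 1)); [apply sqrt_le_1_alt; exact B|].
  rewrite sqrt_mult by lra.
  replace (sqrt 100) with 10; [lra|]. replace 100 with (10 * 10) by ring. symmetry; apply sqrt_square; lra.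
Qed.

Lemma Rpower_sqrt_base (t p : R) : 0 < t -> Rpower (sqrt t) p = Rpower t (p / 2).
Proof.
  intros Ht. rewrite <- Rpower_half, Rpower_mult by exact Ht. f_equal; field.
Qed.

Lemma Rpower_16_sqr (t : R) : Rpower t (1 / 16) * Rpower t (1 / 16) = Rpower t (1 / 8).
Proof. rewrite <- Rpower_plus. f_equal; field. Qed.

Lemma Rpower_div_self (x p : R) : 0 < x -> Rpower x p * / x = Rpower x (p - 1).
Proof.
  intros Hx. rewrite <- (Rpower_1 x) at 2 by exact Hx. rewrite <- Rpower_Ropp, <- Rpower_plus. reflexivity.
Qed.

(** N^(5/4) X / N^2 sums to the order (sqrt t)^(1/4) X = t^(1/8) X. In the other part 1 / N is
    enlarged to N^(1/8 - 1), whose sum, of order t^(1/16), combines with the factor t^(1/16). *)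
Lemma sum_small_indices (t X : R) (K : nat) :
  400 <= t -> 0 <= X -> INR (S K) <= sqrt t ->
  rsum (fun k => INR (S (S k)) * (Rpower (INR (S (S k))) (1 / 4) * X + Rpower t (1 / 16)) * / INR (S (S k)) ^ 2) K
    <= 8 * Rpower t (1 / 8) * (X + 1).
Proof.
  intros Ht HX HK.
  set (y := Rpower t (1 / 16)). assert (Y0 : 0 < y) by apply Rpower_pos.
  apply Rle_trans with (rsum (fun k => X * Rpower (INR (S (S k))) (1 / 4 - 1) + y * Rpower (INR (S (S k))) (1 / 8 - 1)) K).
  - apply rsum_le. intros k _. assert (P := INR_S_ge_1 (S k)). set (N := INR (S (S k))) in *.
    replace (N * (Rpower N (1 / 4) * X + y) * / N ^ 2) with (X * (Rpower N (1 / 4) * / N) + y * / N) by (field; lra).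
    rewrite Rpower_div_self by lra. apply Rplus_le_compat_l. apply Rmult_le_compat_l; [lra|].
    rewrite <- (Rpower_div_self N (1 / 8)) by lra.
    rewrite <- (Rmult_1_l (/ N)) at 1. apply Rmult_le_compat_r; [left; apply Rinv_0_lt_compat; lra|].
    apply Rle_trans with (Rpower 1 (1 / 8)); [rewrite Rpower_base_1; lra | apply Rpower_incr; lra].
  - rewrite rsum_plus, !rsum_scal.
    assert (Q : forall p, 0 < p <= 1 -> rsum (fun k => Rpower (INR (S (S k))) (p - 1)) K <= Rpower t (p / 2) / p).
    { intros p Hp. apply Rle_trans with (Rpower (INR (S K)) p / p).
      - apply Rle_trans with (2 := rsum_Rpower_le p (S K) Hp ltac:(lia)).
        change (S K) with (1 + K)%nat. rewrite rsum_split.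
        assert (0 <= rsum (fun k => Rpower (INR (S k)) (p - 1)) 1) by (simpl; generalize (Rpower_pos 1 (p - 1)); lra).
        change (rsum (fun k => Rpower (INR (S (1 + k))) (p - 1)) K) with (rsum (fun k => Rpower (INR (S (S k))) (p - 1)) K). lra.
      - unfold Rdiv. apply Rmult_le_compat_r; [left; apply Rinv_0_lt_compat; lra|].
        replace (p * / 2) with (p / 2) by reflexivity. rewrite <- Rpower_sqrt_base by lra. apply Rpower_incr; [lra|].
        split; [apply INR_S_pos | exact HK]. }
    assert (Q1 := Q (1 / 4) ltac:(lra)). assert (Q2 := Q (1 / 8) ltac:(lra)).
    replace (1 / 4 / 2) with (1 / 8) in Q1 by field. replace (1 / 8 / 2) with (1 / 16) in Q2 by field. fold y in Q2.
    assert (E := Rpower_16_sqr t). fold y in E.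
    assert (Z0 := Rpower_pos t (1 / 8)).
    apply Rle_trans with (X * (Rpower t (1 / 8) / (1 / 4)) + y * (y / (1 / 8))).
    + apply Rplus_le_compat; apply Rmult_le_compat_l; lra.
    + replace (y * (y / (1 / 8))) with (8 * (y * y)) by field. rewrite E.
      replace (X * (Rpower t (1 / 8) / (1 / 4))) with (4 * (Rpower t (1 / 8) * X)) by field.
      assert (0 <= Rpower t (1 / 8) * X) by (apply Rmult_le_pos; lra). lra.
Qed.

(** sqrt t N^(5/4 - 3) X is summable beyond sqrt t, with sum of order t^(1/2 - 3/8) X = t^(1/8) X,
    matching the range below sqrt t. *)
Lemma sum_large_indices (t X : R) (m n : nat) :
  400 <= t -> 0 <= X -> (0 < m)%nat -> sqrt t / 2 <= INR m ->
  rsum (fun i => INR (S (m + i)) * (Rpower (INR (S (m + i))) (1 / 4) * X + Rpower t (1 / 16)) * (sqrt t * / INR (S (m + i)) ^ 3)) n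
    <= 4 * Rpower t (1 / 8) * (X + 1).
Proof.
  intros Ht HX Hm Hmr.
  assert (R20 : 20 <= sqrt t).
  { replace 20 with (sqrt (20 * 20)) by (apply sqrt_square; lra). apply sqrt_le_1; lra. }
  set (r := sqrt t) in *.
  set (y := Rpower t (1 / 16)). assert (Y0 : 0 < y) by apply Rpower_pos.
  rewrite (rsum_ext _ (fun i => r * X * Rpower (INR (S (m + i))) (- (3 / 4) - 1) + r * y * / INR (S (m + i)) ^ 2)).
  2: { intros i _. assert (P := INR_S_ge_1 (m + i)). set (N := INR (S (m + i))) in *.
       replace (- (3 / 4) - 1) with (1 / 4 - 1 - 1) by field. rewrite <- !Rpower_div_self by lra. field; lra. }
  rewrite rsum_plus, !rsum_scal.
  assert (Q1 := rsum_Rpower_tail (3 / 4) m n ltac:(lra) Hm).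
  assert (Q2 := rsum_inv_sqr m n Hm).
  assert (M1 : Rpower (INR m) (- (3 / 4)) <= 2 * Rpower r (- (3 / 4))).
  { apply Rle_trans with (Rpower (/ 2 * r) (- (3 / 4))); [apply Rpower_decr; lra|].
    rewrite <- Rpower_mult_distr by lra. apply Rmult_le_compat_r; [left; apply Rpower_pos|].
    rewrite Rpower_Ropp. rewrite <- (Rinv_inv 2) at 2. apply Rinv_le_contravar; [lra|].
    rewrite <- (Rpower_1 (/ 2)) at 1 by lra.
    unfold Rpower. assert (ln (/ 2) < 0) by (rewrite <- ln_1; apply ln_increasing; lra).
    left; apply exp_increasing. lra. }
  assert (M2 : r * Rpower r (- (3 / 4)) = Rpower t (1 / 8)).
  { rewrite <- (Rpower_1 r) at 1 by lra. rewrite <- Rpower_plus. unfold r. rewrite Rpower_sqrt_base by lra. f_equal; field. }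
  assert (M3 : / INR m <= 2 / r).
  { replace (2 / r) with (/ (r / 2)) by (field; lra). apply Rinv_le_contravar; lra. }
  assert (E := Rpower_16_sqr t). fold y in E.
  assert (Y1 : 1 <= y).
  { apply Rle_trans with (Rpower 1 (1 / 16)); [rewrite Rpower_base_1; lra | apply Rpower_incr; lra]. }
  set (z := Rpower t (1 / 8)) in *. assert (Z0 : 0 < z) by apply Rpower_pos.
  assert (T1 : r * X * rsum (fun k => Rpower (INR (S (m + k))) (- (3 / 4) - 1)) n <= 4 * (z * X)).
  { apply Rle_trans with (r * X * (3 * Rpower r (- (3 / 4)))).
    - apply Rmult_le_compat_l; [apply Rmult_le_pos; lra|]. apply Rle_trans with (1 := Q1).
      apply div_le_l; [lra|]. generalize (Rpower_pos r (- (3 / 4))); lra.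
    - replace (r * X * (3 * Rpower r (- (3 / 4)))) with (3 * (r * Rpower r (- (3 / 4)) * X)) by ring.
      rewrite M2. assert (0 <= z * X) by (apply Rmult_le_pos; lra). lra. }
  assert (T2 : r * y * rsum (fun k => / INR (S (m + k)) ^ 2) n <= 2 * z).
  { apply Rle_trans with (r * y * (2 / r)).
    - apply Rmult_le_compat_l; [apply Rmult_le_pos; lra|]. lra.
    - replace (r * y * (2 / r)) with (2 * y) by (field; lra). nra. }
  assert (0 <= z * X) by (apply Rmult_le_pos; lra). lra.
Qed.

(** As t H <= sqrt t / 8 and a > sqrt t, both terms of the general bound are at most of order sqrt t
    / a^3. *)
Lemma smooth_second_difference_mid (t H a : R) :
  400 <= t -> 0 < H <= / (8 * sqrt t) -> sqrt t < a ->
  Cmod (second_diff (smooth_coef t H) a) <= 8 * (sqrt t * / a ^ 3).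
Proof.
  intros Ht HH Ha.
  assert (R20 : 20 <= sqrt t).
  { replace 20 with (sqrt (20 * 20)) by (apply sqrt_square; lra). apply sqrt_le_1; lra. }
  set (r := sqrt t) in *. assert (Rr : r * r = t) by (apply sqrt_sqrt; lra).
  apply Rle_trans with (1 := smooth_second_difference_large t H a ltac:(lra) ltac:(lra) ltac:(lra)).
  assert (Hr : r * H <= / 8).
  { apply Rle_trans with (r * / (8 * r)); [apply Rmult_le_compat_l; lra | right; field; lra]. }
  assert (Hr0 : 0 <= r * H) by (apply Rmult_le_pos; lra).
  set (h := r * H) in *. set (b := a - 1).
  assert (B : a / 2 <= b) by (unfold b; lra). assert (B1 : r / 2 <= b) by (unfold b; lra).
  replace (6 * t ^ 2 * H ^ 2 / b ^ 4 + 4 * t * H / b ^ 3) with (r / b ^ 3 * (6 * (h * h) * (r / b) + 4 * h))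
    by (unfold h; rewrite <- Rr; field; unfold b; lra).
  assert (C1 : r / b <= 2) by (apply div_le_l; lra).
  assert (C0 : 0 <= r / b) by (apply Rdiv_le_0_compat; lra).
  assert (C2 : h * h <= / 64) by nra.
  assert (C3 : 6 * (h * h) * (r / b) + 4 * h <= 1) by nra.
  assert (C4 : 0 <= r / b ^ 3) by (apply Rdiv_le_0_compat; [lra | apply pow_lt; lra]).
  apply Rle_trans with (r / b ^ 3); [nra|].
  replace (8 * (r * / a ^ 3)) with (r * / (a / 2) ^ 3) by (field; lra).
  apply Rmult_le_compat_l; [lra|]. apply Rinv_le_contravar; [apply pow_lt; lra | apply pow_incr; lra].
Qed.

(** The sum of about t^2 terms is cut at L near t / 20. Up to L + 1 the Cesaro estimates apply, as 4
    PI (L + 1) <= t; beyond L the bound |V_k| <= sqrt t / (4 (k + 1)) already makes the tail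
    O(1). *)
Lemma afe_bound (t T : R) (Z : R -> C) :
  3600 <= t -> is_hurwitz_on_line t Z -> t / (2 * PI) <= T <= t ->
  Cmod (Z 0) <= 10 ^ 15 * Rpower t (1 / 8) * (sqrt (sqrt (pairing_sum t T Z)) + 1).
Proof.
  intros Ht HZ HT. assert (P3 := PI_gt_3). assert (P4 := PI_4).
  assert (R60 : 60 <= sqrt t).
  { replace 60 with (sqrt (60 * 60)) by (apply sqrt_square; lra). apply sqrt_le_1; lra. }
  assert (Rr : sqrt t * sqrt t = t) by (apply sqrt_sqrt; lra).
  set (X := sqrt (sqrt (pairing_sum t T Z))). assert (HX : 0 <= X) by apply sqrt_pos.
  (* The kernel length used for the mean over [0, H]; its order sqrt t puts H at the order t^(-1/2),
     as the second difference bounds require. *)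
  destruct (nat_above (sqrt t) ltac:(lra)) as [N0 [HN0 [HN1 HN2]]].
  set (H := / (8 * INR N0)).
  assert (HH0 : 0 < H) by (apply Rinv_0_lt_compat; lra).
  assert (HH1 : / (16 * sqrt t) <= H <= / (8 * sqrt t)) by (split; apply Rinv_le_contravar; lra).
  assert (HH2 : H <= 1) by (rewrite <- Rinv_1; apply Rinv_le_contravar; lra).
  assert (HtH : sqrt t * H <= / 8).
  { apply Rle_trans with (sqrt t * / (8 * sqrt t)); [apply Rmult_le_compat_l; lra | right; field; lra]. }
  assert (HtH2 : 2 * t * H <= sqrt t / 4) by nra.
  destruct (nat_above (t / 20) ltac:(lra)) as [L [HL0 [HL1 HL2]]].
  destruct (nat_above (t ^ 2) ltac:(apply pow2_ge_0)) as [M [HM0 HM]].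
  assert (HLM : (L <= M)%nat) by (apply INR_le; nra).
  assert (HN0L : (N0 + 2 <= L)%nat) by (apply INR_le; rewrite plus_INR; simpl; nra).
  assert (SE := smoothing_error t H Z M ltac:(lra) HZ ltac:(lra) HM).
  assert (AV := smooth_average_bound t T Z N0 ltac:(lra) HZ HT HN0 ltac:(apply le_div_r; nra)).
  cbv zeta in AV. fold H X in AV.
  set (V := fun k => smooth_coef t H (INR (S k))).
  assert (VB : forall k, Cmod (V k) <= sqrt t / 4 * / INR (S k)).
  { intros k. assert (P := INR_S_pos k).
    apply Rle_trans with (1 := smooth_coef_bound t H (INR (S k)) ltac:(lra) HH0 P).
    unfold Rdiv at 1. apply Rmult_le_compat_r; [left; apply Rinv_0_lt_compat; exact P | exact HtH2]. }
  assert (SqL : sqrt t / 5 <= sqrt (INR L)).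
  { replace (sqrt t / 5) with (sqrt (sqrt t / 5 * (sqrt t / 5))) by (apply sqrt_square; lra). apply sqrt_le_1; nra. }
  assert (Z18 : 1 <= Rpower t (1 / 8)).
  { apply Rle_trans with (Rpower 1 (1 / 8)); [rewrite Rpower_base_1; lra | apply Rpower_incr; lra]. }
  set (z := Rpower t (1 / 8)) in *.
  assert (Tail : Cmod (csum (fun k => dirichlet_term t (L + k) * V (L + k)%nat) (M - L))%C <= 3).
  { apply Rle_trans with (rsum (fun k => sqrt t / 4 * Rpower (INR (S (L + k))) (- (1 / 2) - 1)) (M - L)).
    - apply Cmod_csum_le. intros k _. assert (P := INR_S_pos (L + k)).
      rewrite Cmod_mult, Cmod_dirichlet_term, <- Rpower_div_self, Rpower_mhalf by exact P.
      assert (0 < / sqrt (INR (S (L + k)))) by (apply Rinv_0_lt_compat, sqrt_lt_R0; exact P).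
      apply Rle_trans with (/ sqrt (INR (S (L + k))) * (sqrt t / 4 * / INR (S (L + k)))); [|right; ring].
      apply Rmult_le_compat_l; [lra | apply VB].
    - rewrite rsum_scal.
      assert (Q := rsum_Rpower_tail (1 / 2) L (M - L) ltac:(lra) HL0).
      rewrite Rpower_mhalf in Q by (apply lt_0_INR; exact HL0).
      assert (Q2 : / sqrt (INR L) <= 5 / sqrt t).
      { replace (5 / sqrt t) with (/ (sqrt t / 5)) by (field; lra). apply Rinv_le_contravar; lra. }
      apply Rle_trans with (sqrt t / 4 * (10 / sqrt t)).
      + apply Rmult_le_compat_l; [lra|]. unfold Rdiv in *. lra.
      + replace (sqrt t / 4 * (10 / sqrt t)) with (10 / 4) by (field; lra). lra. }
  assert (Main : Cmod (csum (fun k => dirichlet_term t k * V k)%C L) <= 10 ^ 14 * z * (X + 1)).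
  { rewrite abel_twice. cbv zeta.
    set (B := csum (dirichlet_term t)). set (A := csum B).
    assert (SL0 : 0 < sqrt (INR L)) by lra.
    assert (SLL : sqrt (INR L) * sqrt (INR L) = INR L) by (apply sqrt_sqrt, pos_INR).
    (* The boundary terms sit at an index of order t, where termwise bounds for the Dirichlet sums
       suffice. *)
    assert (B1 : Cmod (B L * V L)%C <= 3).
    { rewrite Cmod_mult.
      apply Rle_trans with (2 * sqrt (INR L) * (sqrt t / 4 * / INR L)).
      - apply Rmult_le_compat; [apply Cmod_ge_0 | apply Cmod_ge_0 | apply Cmod_dirichlet_sum|].
        apply Rle_trans with (1 := VB L). apply Rmult_le_compat_l; [lra|].
        apply Rinv_le_contravar; [apply lt_0_INR; exact HL0 | rewrite S_INR; lra].
      - rewrite <- SLL at 2. replace (2 * sqrt (INR L) * (sqrt t / 4 * / (sqrt (INR L) * sqrt (INR L)))) with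
          (sqrt t / 2 / sqrt (INR L)) by (field; lra). apply div_le_l; lra. }
    assert (B2 : Cmod (A (S L) * (V (S L) - V L))%C <= 3).
    { rewrite Cmod_mult. assert (PS := INR_S_pos L).
      assert (SS : sqrt (INR L) <= sqrt (INR (S L))) by (apply sqrt_le_1; rewrite ?S_INR; lra).
      assert (SSS : sqrt (INR (S L)) * sqrt (INR (S L)) = INR (S L)) by (apply sqrt_sqrt, pos_INR).
      apply Rle_trans with (INR (S L) * (2 * sqrt (INR (S L))) * (sqrt t / 4 / INR (S L) ^ 2)).
      - apply Rmult_le_compat; [apply Cmod_ge_0 | apply Cmod_ge_0 | apply Cmod_dirichlet_double_sum|].
        unfold V. rewrite (S_INR (S L)).
        apply Rle_trans with (1 := smooth_coef_increment t H (INR (S L)) ltac:(lra) HH0 PS).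
        apply Rmult_le_compat_r; [left; apply Rinv_0_lt_compat, pow_lt; exact PS | exact HtH2].
      - set (q := sqrt (INR (S L))) in *. rewrite <- SSS.
        replace (q * q * (2 * q) * (sqrt t / 4 / (q * q) ^ 2)) with (sqrt t / 2 / q) by (field; lra).
        apply div_le_l; lra. }
    assert (AE : forall N, (0 < N)%nat -> (N <= L + 1)%nat -> Cmod (A N) <= 10 ^ 6 * INR N *
      (Rpower (INR N) (1 / 4) * X + Rpower t (1 / 16))).
    { intros N HN HNL. unfold A, B. rewrite csum_csum_dirichlet_conj, Cmod_Cconj.
      apply cesaro_poly_estimate; [exact Ht | exact HZ | exact HT | exact HN|].
      assert (INR N <= INR L + 1) by (rewrite <- S_INR; apply le_INR; lia). nra. }
    assert (W : forall N, 0 < INR N -> 0 <= INR N * (Rpower (INR N) (1 / 4) * X + Rpower t (1 / 16))).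
    { intros N HN. apply Rmult_le_pos; [lra|]. apply Rplus_le_le_0_compat; [|left; apply Rpower_pos].
      apply Rmult_le_pos; [left; apply Rpower_pos | exact HX]. }
    assert (SD : forall k, (V (S (S k)) - RtoC 2 * V (S k) + V k)%C = second_diff (smooth_coef t H) (INR (S (S k)))).
    { intros k. unfold V, second_diff. rewrite <- S_INR.
      replace (INR (S (S k)) - 1) with (INR (S k)) by (rewrite (S_INR (S k)); ring). reflexivity. }
    set (F := fun k => (A (S (S k)) * (V (S (S k)) - RtoC 2 * V (S k) + V k))%C).
    assert (B3 : Cmod (csum F L) <= 3 * 10 ^ 13 * z * (X + 1)).
    (* The k-th second difference is centred at k + 2: for k < K the centre is at most N0 - 1 <=
       sqrt t, and from K on it is at least N0 > sqrt t. *)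
    { set (K := (N0 - 2)%nat). replace L with (K + (L - K))%nat by (unfold K; lia). rewrite csum_split.
      assert (HN0' : (2 <= N0)%nat) by (apply INR_le; simpl; lra).
      apply Rle_trans with (1 := Cmod_triangle _ _).
      assert (S1 : Cmod (csum F K) <= 3 * 10 ^ 12 * (8 * z * (X + 1))).
      { assert (HK : INR (S K) <= sqrt t).
        { replace (S K) with (N0 - 1)%nat by (unfold K; lia). rewrite minus_INR by lia. simpl. lra. }
        apply Rle_trans with (3 * 10 ^ 12 * rsum (fun k => INR (S (S k)) *
          (Rpower (INR (S (S k))) (1 / 4) * X + Rpower t (1 / 16)) * / INR (S (S k)) ^ 2) K).
        - rewrite <- rsum_scal. apply Cmod_csum_le. intros k Hk. unfold F. rewrite Cmod_mult, SD.
          assert (P := INR_S_pos (S k)).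
          assert (P2 : 2 <= INR (S (S k))) by (rewrite !S_INR; generalize (pos_INR k); lra).
          assert (P5 : INR (S (S k)) <= sqrt t).
          { apply Rle_trans with (2 := HK). apply le_INR; lia. }
          apply Rle_trans with ((10 ^ 6 * INR (S (S k)) * (Rpower (INR (S (S k))) (1 / 4) * X + Rpower t (1 / 16))) *
            (3 * 10 ^ 6 / INR (S (S k)) ^ 2)).
          + apply Rmult_le_compat; [apply Cmod_ge_0 | apply Cmod_ge_0 | apply AE; unfold K in Hk; lia |].
            apply smooth_second_difference_small; lra.
          + right. field. lra.
        - apply Rmult_le_compat_l; [lra|]. apply sum_small_indices; [lra | exact HX | exact HK]. }
      assert (S2 : Cmod (csum (fun k => F (K + k)%nat) (L - K)) <= 8 * 10 ^ 6 * (4 * z * (X + 1))).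
      { set (m := (N0 - 1)%nat).
        assert (Hm : sqrt t / 2 <= INR m) by (unfold m; rewrite minus_INR by lia; simpl; lra).
        apply Rle_trans with (8 * 10 ^ 6 * rsum (fun i => INR (S (m + i)) *
          (Rpower (INR (S (m + i))) (1 / 4) * X + Rpower t (1 / 16)) * (sqrt t * / INR (S (m + i)) ^ 3)) (L - K)).
        - rewrite <- rsum_scal. apply Cmod_csum_le. intros i Hi. unfold F. rewrite Cmod_mult, SD.
          replace (S (S (K + i))) with (S (m + i)) by (unfold m, K; lia).
          assert (P := INR_S_pos (m + i)).
          assert (P5 : sqrt t < INR (S (m + i))).
          { apply Rlt_le_trans with (1 := HN1). apply le_INR; unfold m; lia. }
          apply Rle_trans with ((10 ^ 6 * INR (S (m + i)) * (Rpower (INR (S (m + i))) (1 / 4) * X + Rpower t (1 / 16))) *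
            (8 * (sqrt t * / INR (S (m + i)) ^ 3))).
          + apply Rmult_le_compat; [apply Cmod_ge_0 | apply Cmod_ge_0 | apply AE; unfold m, K in *; lia |].
            apply smooth_second_difference_mid; [lra | lra | exact P5].
          + right. ring.
        - apply Rmult_le_compat_l; [lra|]. apply sum_large_indices; [lra | exact HX | unfold m; lia | exact Hm]. }
      assert (0 <= z * (X + 1)) by (apply Rmult_le_pos; lra). lra. }
    fold F.
    apply Rle_trans with (1 := Cmod_triangle _ _).
    assert (D := Cmod_triangle_minus (B L * V L) (A (S L) * (V (S L) - V L))).
    assert (1 * 1 <= z * (X + 1)) by (apply Rmult_le_compat; lra). lra. }
  assert (Y16 : Rpower t (1 / 16) <= z) by (apply Rle_Rpower; lra).
  assert (N14 : Rpower (INR N0) (1 / 4) <= 2 * z).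
  { apply Rle_trans with (Rpower (2 * sqrt t) (1 / 4)); [apply Rpower_incr; lra|].
    rewrite <- Rpower_mult_distr, Rpower_sqrt_base by lra. replace (1 / 4 / 2) with (1 / 8) by field. fold z.
    apply Rmult_le_compat_r; [lra|]. rewrite <- (Rpower_1 2) at 2 by lra. apply Rle_Rpower; lra. }
  replace M with (L + (M - L))%nat in SE by lia. rewrite csum_split in SE.
  set (W1 := CI (fun x => Z x * RtoC (weight H x))%C 0 H) in *.
  set (W2 := csum (fun k => dirichlet_term t k * V k)%C L) in *.
  set (W3 := csum (fun k => dirichlet_term t (L + k) * V (L + k)%nat)%C (M - L)) in *.
  change (Cmod (Z 0%R - W1 - (W2 + W3))%C <= 12) in SE.
  replace (Z 0) with ((Z 0%R - W1 - (W2 + W3)) + W1 + (W2 + W3))%C by ring.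
  apply Rle_trans with (1 := Cmod_triangle _ _).
  assert (D1 := Cmod_triangle (Z 0%R - W1 - (W2 + W3)) W1). assert (D2 := Cmod_triangle W2 W3).
  assert (1 * 1 <= z * (X + 1)) by (apply Rmult_le_compat; lra).
  assert (Rpower (INR N0) (1 / 4) * X <= 2 * z * X) by (apply Rmult_le_compat_r; lra).
  assert (0 <= z * X) by (apply Rmult_le_pos; lra).
  lra.
Qed.

(** * Repeated integration by parts *)

(* [f] has [k] derivatives on [0,1], all bounded by [M]; under [v], those of order [< k] vanish at 0 and 1. *)
Fixpoint Smooth (v : Prop) (k : nat) (M : R) (f : R -> C) : Prop :=
  (forall x, 0 <= x <= 1 -> Cmod (f x) <= M) /\
  match k with
  | O => forall x, 0 <= x <= 1 -> Ccont f x
  | S k' => (v -> f 0 = RtoC 0 /\ f 1 = RtoC 0) /\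
      exists f', (forall x, 0 <= x <= 1 -> Cder f x (f' x)) /\ Smooth v k' M f'
  end.

Lemma Smooth_bound (v : Prop) (k : nat) (M : R) (f : R -> C) (x : R) :
  Smooth v k M f -> 0 <= x <= 1 -> Cmod (f x) <= M.
Proof. destruct k; intros [H _]; apply H. Qed.

Lemma Smooth_cont (v : Prop) (k : nat) (M : R) (f : R -> C) (x : R) :
  Smooth v k M f -> 0 <= x <= 1 -> Ccont f x.
Proof.
  destruct k as [|k]; intros [_ H] Hx; [apply H; exact Hx|].
  destruct H as [_ [f' [D _]]]. apply Cder_cont with (1 := D x Hx).
Qed.

Lemma Smooth_nonneg (v : Prop) (k : nat) (M : R) (f : R -> C) : Smooth v k M f -> 0 <= M.
Proof.
  intros H. apply Rle_trans with (1 := Cmod_ge_0 (f 0)). apply (Smooth_bound v k M f 0 H). lra.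
Qed.

Lemma Smooth_mono (v : Prop) (k : nat) (M M' : R) (f : R -> C) :
  M <= M' -> Smooth v k M f -> Smooth v k M' f.
Proof.
  intros HM. revert f. induction k as [|k IH]; intros f [B H].
  - split; [intros x Hx; apply Rle_trans with (2 := HM), B, Hx | exact H].
  - destruct H as [V [f' [D S]]].
    split; [intros x Hx; apply Rle_trans with (2 := HM), B, Hx|]. split; [exact V|].
    exists f'. split; [exact D | apply IH; exact S].
Qed.

Lemma Smooth_drop (v : Prop) (k : nat) (M : R) (f : R -> C) : Smooth v (S k) M f -> Smooth v k M f.
Proof.
  revert f. induction k as [|k IH]; intros f [B [V [f' [D S]]]].
  - split; [exact B | intros x Hx; apply Cder_cont with (1 := D x Hx)].
  - split; [exact B|]. split; [exact V|]. exists f'. split; [exact D | apply IH; exact S].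
Qed.

Lemma Smooth_plus (v : Prop) (k : nat) (M N : R) (f g : R -> C) :
  Smooth v k M f -> Smooth v k N g -> Smooth v k (M + N) (fun x => f x + g x)%C.
Proof.
  revert f g. induction k as [|k IH]; intros f g [Bf Hf] [Bg Hg].
  - split.
    + intros x Hx. apply Rle_trans with (1 := Cmod_triangle _ _). apply Rplus_le_compat; [apply Bf | apply Bg]; exact Hx.
    + intros x Hx. apply Ccont_plus; [apply Hf | apply Hg]; exact Hx.
  - destruct Hf as [Vf [f' [Df Sf]]], Hg as [Vg [g' [Dg Sg]]]. split; [|split].
    + intros x Hx. apply Rle_trans with (1 := Cmod_triangle _ _). apply Rplus_le_compat; [apply Bf | apply Bg]; exact Hx.
    + intros Hv. destruct (Vf Hv) as [-> ->], (Vg Hv) as [-> ->]. split; apply Cplus_0_l.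
    + exists (fun x => f' x + g' x)%C. split; [|apply IH; assumption].
      intros x Hx. apply Cder_plus; [apply Df | apply Dg]; exact Hx.
Qed.

(** Leibniz rule, with 2^k counting its terms; the vanishing at the endpoints passes from the first
    factor to the product. *)
Lemma Smooth_mult (v : Prop) (k : nat) (M N : R) (f g : R -> C) :
  Smooth v k M f -> Smooth False k N g -> Smooth v k (2 ^ k * (M * N)) (fun x => f x * g x)%C.
Proof.
  revert f g. induction k as [|k IH]; intros f g Hf Hg;
    assert (HM := Smooth_nonneg _ _ _ _ Hf); assert (HN := Smooth_nonneg _ _ _ _ Hg);
    assert (HMN : 0 <= M * N) by (apply Rmult_le_pos; assumption).
  - destruct Hf as [Bf Hf], Hg as [Bg Hg]. split.
    + intros x Hx. rewrite Cmod_mult. simpl pow. rewrite Rmult_1_l.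
      apply Rmult_le_compat; [apply Cmod_ge_0 | apply Cmod_ge_0 | apply Bf; exact Hx | apply Bg; exact Hx].
    + intros x Hx. apply Ccont_mult; [apply Hf | apply Hg]; exact Hx.
  - assert (Hf0 := Smooth_drop _ _ _ _ Hf). assert (Hg0 := Smooth_drop _ _ _ _ Hg).
    destruct Hf as [Bf [Vf [f' [Df Sf]]]], Hg as [Bg [Vg [g' [Dg Sg]]]]. split; [|split].
    + intros x Hx. rewrite Cmod_mult. apply Rle_trans with (1 * (M * N)).
      * rewrite Rmult_1_l.
        apply Rmult_le_compat; [apply Cmod_ge_0 | apply Cmod_ge_0 | apply Bf; exact Hx | apply Bg; exact Hx].
      * apply Rmult_le_compat_r; [exact HMN | apply pow_R1_Rle; lra].
    + intros Hv. destruct (Vf Hv) as [-> ->]. split; apply Cmult_0_l.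
    + exists (fun x => f' x * g x + f x * g' x)%C. split.
      * intros x Hx. apply Cder_mult; [apply Df | apply Dg]; exact Hx.
      * replace (2 ^ S k * (M * N)) with (2 ^ k * (M * N) + 2 ^ k * (M * N)) by (simpl; ring).
        apply Smooth_plus; apply IH; assumption.
Qed.

Lemma Smooth_const (k : nat) (c : C) (M : R) : Cmod c <= M -> Smooth False k M (fun _ => c).
Proof.
  revert c. induction k as [|k IH]; intros c Hc.
  - split; [intros; exact Hc | intros; apply Ccont_const].
  - split; [intros; exact Hc|]. split; [tauto|]. exists (fun _ => RtoC 0).
    split; [intros; apply Cder_const|]. apply IH. rewrite Cmod_0. apply Rle_trans with (2 := Hc), Cmod_ge_0.
Qed.

Lemma Smooth_scal (v : Prop) (k : nat) (M : R) (c : C) (f : R -> C) :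
  Smooth v k M f -> Smooth v k (Cmod c * M) (fun x => c * f x)%C.
Proof.
  revert f. induction k as [|k IH]; intros f [B H].
  - split; intros x Hx.
    + rewrite Cmod_mult. apply Rmult_le_compat_l; [apply Cmod_ge_0 | apply B; exact Hx].
    + apply Ccont_mult; [apply Ccont_const | apply H; exact Hx].
  - destruct H as [V [f' [D S]]]. split; [|split].
    + intros x Hx. rewrite Cmod_mult. apply Rmult_le_compat_l; [apply Cmod_ge_0 | apply B; exact Hx].
    + intros Hv. destruct (V Hv) as [-> ->]. split; apply Cmult_0_r.
    + exists (fun x => c * f' x)%C. split; [|apply IH; exact S].
      intros x Hx. apply Cder_scal, D, Hx.
Qed.

Lemma Smooth_shift (k : nat) (a : R) : 0 <= a -> Smooth False k (1 + a) (fun x => RtoC (x + a)).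
Proof.
  intros Ha.
  assert (B : forall x, 0 <= x <= 1 -> Cmod (RtoC (x + a)) <= 1 + a).
  { intros x Hx. rewrite Cmod_R_nonneg; lra. }
  destruct k as [|k].
  - split; [exact B|]. intros x _. apply Ccont_RtoC, continuous_sqrt_rational. auto_derive. trivial.
  - split; [exact B|]. split; [tauto|]. exists (fun _ => RtoC 1). split.
    + intros x _. apply Cder_RtoC. auto_derive; [trivial | ring].
    + apply Smooth_const. rewrite Cmod_1. lra.
Qed.

Lemma Smooth_cis (k : nat) (a : R) : Smooth False k ((1 + Rabs a) ^ k) (fun x => cis (a * x)).
Proof.
  assert (A := Rabs_pos a).
  assert (L : forall x, continuous (fun y => a * y) x).
  { intros x. apply continuous_sqrt_rational. auto_derive. trivial. }
  induction k as [|k IH].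
  - split; [intros; rewrite Cmod_cis; simpl; lra | intros; apply Ccont_cis, L].
  - split; [intros; rewrite Cmod_cis; apply pow_R1_Rle; lra|]. split; [tauto|].
    exists (fun x => RtoC a * Ci * cis (a * x))%C. split.
    + intros x _. apply (Cder_cis_comp (fun y => a * y)). auto_derive; [trivial | ring].
    + apply Smooth_mono with (Cmod (RtoC a * Ci) * (1 + Rabs a) ^ k).
      * assert (E : Cmod (RtoC a * Ci)%C = Rabs a).
        { rewrite Cmod_mult, Cmod_R. replace (Cmod Ci) with 1; [ring|]. unfold Cmod, Ci; simpl.
          replace (0 * (0 * 1) + 1 * (1 * 1)) with 1 by ring. symmetry; apply sqrt_1. }
        rewrite E. simpl. apply Rmult_le_compat_r; [apply pow_le; lra | lra].
      * apply Smooth_scal. exact IH.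
Qed.

(** The constant is chosen before the shift [a], so the bound is uniform over all the terms of the
    series for Z. *)
Lemma Smooth_Rpower (k : nat) : forall p, p <= 0 -> exists K, 1 <= K /\ forall a, 1 <= a ->
  Smooth False k (K * Rpower a p) (fun x => RtoC (Rpower (x + a) p)).
Proof.
  assert (B : forall p a x, p <= 0 -> 1 <= a -> 0 <= x <= 1 -> Cmod (RtoC (Rpower (x + a) p)) <= Rpower a p).
  { intros p a x Hp Ha Hx. rewrite Cmod_R_nonneg; [apply Rpower_decr; lra | left; apply Rpower_pos]. }
  induction k as [|k IH]; intros p Hp.
  - exists 1. split; [lra|]. intros a Ha. split; intros x Hx.
    + rewrite Rmult_1_l. apply B; assumption.
    + apply Ccont_RtoC, (continuous_comp (fun y => y + a) (fun y => Rpower y p)).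
      * apply continuous_sqrt_rational. auto_derive. trivial.
      * apply continuous_Rpower. lra.
  - destruct (IH (p - 1) ltac:(lra)) as [K [HK S]]. exists (1 + Rabs p * K).
    assert (P := Rabs_pos p). assert (PK : 0 <= Rabs p * K) by (apply Rmult_le_pos; lra).
    split; [lra|]. intros a Ha. assert (Q := Rpower_pos a p). split; [|split; [tauto|]].
    + intros x Hx. apply Rle_trans with (1 := B p a x Hp Ha Hx).
      rewrite <- (Rmult_1_l (Rpower a p)) at 1. apply Rmult_le_compat_r; lra.
    + exists (fun x => RtoC p * RtoC (Rpower (x + a) (p - 1)))%C. split.
      * intros x Hx. rewrite <- RtoC_mult. apply Cder_RtoC.
        replace (p * Rpower (x + a) (p - 1)) with (1 * (p * Rpower (x + a) (p - 1))) by ring.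
        apply (is_derive_comp (fun y => Rpower y p) (fun y => y + a)); [apply is_derive_Rpower; lra|].
        auto_derive; [trivial | ring].
      * apply Smooth_mono with (2 := Smooth_scal False k _ (RtoC p) _ (S a Ha)). rewrite Cmod_R.
        apply Rle_trans with (Rabs p * K * Rpower a p).
        -- rewrite Rmult_assoc. apply Rmult_le_compat_l; [exact P|]. apply Rmult_le_compat_l; [lra|].
           apply Rle_Rpower; lra.
        -- apply Rmult_le_compat_r; lra.
Qed.

(** The constant depends on [k], [M] and [c] only, hence is uniform over the phases met later. The
    derivative of 1 / rho is - rho' / rho^2, and the induction applies to both factors 1 / rho. *)
Lemma Smooth_inv (k : nat) (M c : R) : 0 < c -> exists N, 0 < N /\ forall rho : R -> R,
  Smooth False k M (fun x => RtoC (rho x)) -> (forall x, 0 <= x <= 1 -> c <= Rabs (rho x)) ->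
  Smooth False k N (fun x => RtoC (/ rho x)).
Proof.
  intros Hc.
  assert (B : forall (rho : R -> R) x, c <= Rabs (rho x) -> rho x <> 0 /\ Cmod (RtoC (/ rho x)) <= / c).
  { intros rho x H.
    assert (N : rho x <> 0) by (intros E; rewrite E, Rabs_R0 in H; lra). split; [exact N|].
    rewrite Cmod_R, Rabs_inv. apply Rinv_le_contravar; assumption. }
  assert (Hc' := Rinv_0_lt_compat c Hc).
  assert (D : forall (rho : R -> R) x l, rho x <> 0 -> Cder (fun y => RtoC (rho y)) x l ->
    Cder (fun y => RtoC (/ rho y)) x (l * (RtoC (- 1) * (RtoC (/ rho x) * RtoC (/ rho x))))%C).
  { intros rho x l N [D1 D2]. simpl in D1, D2.
    (* The derivative is given as a complex number; its imaginary part differentiates the constant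
       0. *)
    assert (I0 : Im l = 0).
    { rewrite <- (is_derive_unique _ _ _ D2). apply Derive_const. }
    apply Cder_eq with (RtoC (- Re l / rho x ^ 2)); [|apply Cder_RtoC, is_derive_inv; assumption].
    apply C_ext; rewrite ?Re_mult, ?Im_mult, ?I0; simpl; field; exact N. }
  induction k as [|k [N [HN IH]]].
  - exists (/ c). split; [exact Hc'|]. intros rho [_ H] Hr. split; intros x Hx.
    + apply B, Hr, Hx.
    + destruct (B rho x (Hr x Hx)) as [N _]. destruct (H x Hx) as [C1 _]. simpl in C1.
      apply Ccont_RtoC, continuous_Rinv_comp; assumption.
  - exists (/ c + 2 ^ k * (Rabs M * (2 ^ k * (N * N)))).
    assert (P2 : 0 < 2 ^ k) by (apply pow_lt; lra).
    assert (P : 0 <= 2 ^ k * (Rabs M * (2 ^ k * (N * N)))).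
    { apply Rmult_le_pos; [lra|]. apply Rmult_le_pos; [apply Rabs_pos|].
      apply Rmult_le_pos; [lra|]. apply Rmult_le_pos; lra. }
    split; [lra|]. intros rho Hrho Hr.
    assert (S0 := IH rho (Smooth_drop _ _ _ _ Hrho) Hr).
    destruct Hrho as [_ [_ [g [Dg Sg]]]]. split; [|split; [tauto|]].
    + intros x Hx. destruct (B rho x (Hr x Hx)) as [_ H]. lra.
    + exists (fun x => g x * (RtoC (- 1) * (RtoC (/ rho x) * RtoC (/ rho x))))%C. split.
      * intros x Hx. apply D; [apply B, Hr, Hx | apply Dg, Hx].
      * apply Smooth_mono with (2 ^ k * (M * (Cmod (RtoC (- 1)) * (2 ^ k * (N * N))))).
        -- replace (Cmod (RtoC (- 1))) with 1 by (rewrite Cmod_R, Rabs_left; lra). rewrite Rmult_1_l.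
           rewrite (Rabs_pos_eq M) by apply (Smooth_nonneg _ _ _ _ Sg). lra.
        -- apply Smooth_mult; [exact Sg|]. apply Smooth_scal, Smooth_mult; exact S0.
Qed.

(** Each integration by parts replaces [A] by the derivative of A / rho, gains 1 / mu and consumes
    one derivative; the boundary terms vanish with [A]. The bound [D] absorbs the factors 2^k N of
    all the steps, so that the induction yields a pure power. *)
Lemma oscillation_decay (mu N D : R) (R0 rho : R -> R) :
  0 < mu -> 0 <= D -> (forall x, 0 <= x <= 1 -> is_derive R0 x (rho x)) ->
  (forall x, 0 <= x <= 1 -> rho x <> 0) ->
  forall k M A, 2 ^ k * N <= D -> Smooth False k N (fun x => RtoC (/ rho x)) -> Smooth True k M A ->
  Cmod (CI (fun x => A x * cis (- (mu * R0 x)))%C 0 1) <= M * (D / mu) ^ k.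
Proof.
  intros Hmu HD HR Hrho.
  assert (DR : forall x, 0 <= x <= 1 -> is_derive (fun y => - (mu * R0 y)) x (- (mu * rho x))).
  { intros x Hx. apply (is_derive_opp (fun y => mu * R0 y)). apply (is_derive_scal R0), HR, Hx. }
  assert (CR : forall x, 0 <= x <= 1 -> Ccont (fun y => cis (- (mu * R0 y))) x).
  { intros x Hx. apply Cder_cont with (1 := Cder_cis_comp _ _ _ (DR x Hx)). }
  induction k as [|k IH]; intros M A HN HU HA.
  - simpl. rewrite Rmult_1_r. replace M with (M * (1 - 0)) by ring.
    apply CI_bound; [lra | |].
    + intros x Hx. apply Ccont_mult; [apply (Smooth_cont _ _ _ _ x HA Hx) | apply CR, Hx].
    + intros x Hx. rewrite Cmod_mult, Cmod_cis, Rmult_1_r. apply (Smooth_bound _ _ _ _ x HA); lra.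
  - assert (HM := Smooth_nonneg _ _ _ _ HA). assert (N0 := Smooth_nonneg _ _ _ _ HU).
    assert (HB := Smooth_mult True (S k) M N A _ HA HU).
    destruct HB as [_ [V [B' [DB SB]]]].
    set (B := fun x => (A x * RtoC (/ rho x))%C) in *.
    assert (V01 : B 0 = RtoC 0 /\ B 1 = RtoC 0) by exact (V I). destruct V01 as [V0 V1]. clear V.
    assert (F := CI_FTC (fun x => B x * cis (- (mu * R0 x)))%C
      (fun x => B' x * cis (- (mu * R0 x)) - RtoC mu * Ci * (A x * cis (- (mu * R0 x))))%C 0 1 ltac:(lra)).
    cbv beta in F.
    assert (CA : forall x, 0 <= x <= 1 -> Ccont (fun y => A y * cis (- (mu * R0 y)))%C x).
    { intros x Hx. apply Ccont_mult; [apply (Smooth_cont _ _ _ _ x HA Hx) | apply CR, Hx]. }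
    assert (CB : forall x, 0 <= x <= 1 -> Ccont (fun y => B' y * cis (- (mu * R0 y)))%C x).
    { intros x Hx. apply Ccont_mult; [apply (Smooth_cont _ _ _ _ x SB Hx) | apply CR, Hx]. }
    assert (CA' : forall x, 0 <= x <= 1 -> Ccont (fun y => RtoC mu * Ci * (A y * cis (- (mu * R0 y))))%C x).
    { intros x Hx. apply (Ccont_mult (fun _ => RtoC mu * Ci)%C); [apply Ccont_const | apply CA, Hx]. }
    rewrite V0, V1, !Cmult_0_l in F.
    rewrite (CI_minus _ (fun x => RtoC mu * Ci * (A x * cis (- (mu * R0 x))))%C 0 1 ltac:(lra) CB CA') in F.
    rewrite (CI_scal _ _ 0 1 ltac:(lra) CA) in F.
    assert (E : (RtoC mu * Ci * CI (fun x => A x * cis (- (mu * R0 x))) 0 1)%C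
      = CI (fun x => B' x * cis (- (mu * R0 x)))%C 0 1).
    { set (X := CI (fun x => A x * cis (- (mu * R0 x)))%C 0 1) in *.
      set (Y := CI (fun x => B' x * cis (- (mu * R0 x)))%C 0 1) in *.
      assert (F' : (Y - RtoC mu * Ci * X = RtoC 0)%C).
      { rewrite F; [ring | |].
        - intros x Hx. apply Cder_eq with (2 := Cder_mult _ _ _ _ _ (DB x Hx) (Cder_cis_comp _ _ _ (DR x Hx))).
          unfold B. assert (Hr := Hrho x Hx).
          replace (RtoC (- (mu * rho x))) with (- (RtoC mu * RtoC (rho x)))%C by (rewrite <- RtoC_mult, <- RtoC_opp; reflexivity).
          rewrite RtoC_inv by exact Hr. field.
          intros Z0. apply Hr. injection Z0; auto.
        - intros x Hx. exact (Ccont_minus _ _ x (CB x Hx) (CA' x Hx)). }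
      replace Y with ((Y - RtoC mu * Ci * X) + RtoC mu * Ci * X)%C by ring. rewrite F'. ring. }
    assert (IH' := IH (2 ^ S k * (M * N)) B').
    assert (P2 : 0 < 2 ^ k) by (apply pow_lt; lra).
    simpl in HN. assert (HNk : 2 ^ k * N <= D) by nra.
    specialize (IH' HNk (Smooth_drop _ _ _ _ HU) SB).
    assert (G : mu * Cmod (CI (fun x => A x * cis (- (mu * R0 x)))%C 0 1) <= 2 ^ S k * (M * N) * (D / mu) ^ k).
    { apply Rle_trans with (2 := IH'). rewrite <- E, !Cmod_mult, Cmod_R, Rabs_pos_eq by lra.
      replace (Cmod Ci) with 1; [right; ring|]. unfold Cmod, Ci; simpl.
      replace (0 * (0 * 1) + 1 * (1 * 1)) with 1 by ring. symmetry; apply sqrt_1. }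
    assert (Q : 0 <= (D / mu) ^ k) by (apply pow_le, Rdiv_le_0_compat; lra).
    apply Rmult_le_reg_l with mu; [exact Hmu|]. apply Rle_trans with (1 := G).
    replace (mu * (M * (D / mu) ^ S k)) with (M * D * (D / mu) ^ k) by (simpl; field; lra).
    apply Rmult_le_compat_r; [exact Q|].
    replace (2 ^ S k * (M * N)) with (M * (2 * 2 ^ k * N)) by (simpl; ring).
    apply Rmult_le_compat_l; assumption.
Qed.

(** * Uniform approximation by Fourier partial sums *)

(** Coefficients being taken against e(n x), the expansion runs over e(- n x), the exponentials that
    occur in [pairing_coef]. *)
Definition fourier_term (q : R -> C) (x : R) (n : Z) : C := (fourier_coef q n * expi (- n) x)%C.

Definition fourier_partial (q : R -> C) (N : nat) (x : R) : C :=
  csum (fun k => fourier_term q x (Z.of_nat k - Z.of_nat N)) (2 * N + 1).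

(** The Dirichlet sum is geometric: (e(u) - 1) D_M(u) = e(M u) - 1, with |e(u) - 1| = 2 |sin(PI
    u)|. *)
Lemma fejer_sin_le (M : nat) (u : R) : (0 < M)%nat -> sin (PI * u) ^ 2 * fejer M u <= / INR M.
Proof.
  intros HM. assert (PM := lt_0_INR M HM).
  assert (E : ((expi 1 u - RtoC 1) * dirichlet_sum M u)%C = (expi (Z.of_nat M) u - RtoC 1)%C).
  { unfold dirichlet_sum. rewrite <- csum_scal.
    rewrite <- (expi_0 u). change 0%Z with (Z.of_nat 0).
    rewrite <- (csum_telescope (fun k => expi (Z.of_nat k) u) M).
    apply csum_ext. intros k _. replace (Z.of_nat (S k)) with (1 + Z.of_nat k)%Z by lia.
    rewrite expi_plus. change (Z.of_nat 0) with 0%Z. rewrite expi_0. ring. }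
  apply (f_equal (fun z => Cmod z ^ 2)) in E. rewrite Cmod_mult, Rpow_mult_distr in E.
  assert (S1 : Cmod (expi 1 u - RtoC 1)%C ^ 2 = 4 * sin (PI * u) ^ 2).
  { rewrite Cmod_sqr. unfold expi, cis. simpl Re; simpl Im. unfold RtoC; simpl.
    replace (2 * PI * 1 * u) with (2 * (PI * u)) by ring.
    rewrite cos_2a_sin, sin_2a. assert (Q := sin2_cos2 (PI * u)). unfold Rsqr in Q. nra. }
  assert (S2 : Cmod (expi (Z.of_nat M) u - RtoC 1)%C ^ 2 <= 4).
  { assert (D := Cmod_triangle_minus (expi (Z.of_nat M) u) (RtoC 1)). rewrite Cmod_expi, Cmod_1 in D.
    assert (P := Cmod_ge_0 (expi (Z.of_nat M) u - RtoC 1)%C). nra. }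
  unfold fejer. apply Rmult_le_reg_l with (4 * INR M); [lra|].
  replace (4 * INR M * (sin (PI * u) ^ 2 * (/ INR M * Cmod (dirichlet_sum M u) ^ 2)))
    with (4 * sin (PI * u) ^ 2 * Cmod (dirichlet_sum M u) ^ 2) by (field; lra).
  replace (4 * INR M * / INR M) with 4 by (field; lra). rewrite <- S1. lra.
Qed.

Lemma expi_shift_opp (n : Z) (x y : R) : expi n (y + - x) = (expi n y * expi (- n) x)%C.
Proof. unfold expi. rewrite <- cis_add, opp_IZR. f_equal; ring. Qed.

Lemma fejer_mean_expand (q : R -> C) (M : nat) (x : R) : (forall y, 0 <= y <= 1 -> Ccont q y) ->
  CI (fun y => q y * RtoC (fejer M (y + - x)))%C 0 1 = (RtoC (/ INR M) *
    csum (fun j => csum (fun k => fourier_term q x (Z.of_nat j - Z.of_nat k)) M) M)%C.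
Proof.
  intros Hq.
  assert (C1 : forall n y, 0 <= y <= 1 -> Ccont (fun y => expi (- n) x * (q y * expi n y))%C y).
  { intros n y Hy. apply (Ccont_mult (fun _ => expi (- n) x)); [apply Ccont_const|].
    apply Ccont_mult; [apply Hq, Hy | apply Ccont_expi]. }
  rewrite (CI_ext _ (fun y => RtoC (/ INR M) * csum (fun j => csum (fun k =>
    expi (- (Z.of_nat j - Z.of_nat k)) x * (q y * expi (Z.of_nat j - Z.of_nat k) y)) M) M)%C); [|lra|].
  - rewrite CI_scal; [|lra|].
    + f_equal. rewrite CI_csum; [|lra|].
      * apply csum_ext; intros j _. rewrite CI_csum; [|lra | intros; apply C1; assumption].
        apply csum_ext; intros k _. unfold fourier_term, fourier_coef.
        rewrite CI_scal; [ring | lra |].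
        intros y Hy. apply Ccont_mult; [apply Hq, Hy | apply Ccont_expi].
      * intros j y _ Hy. apply Ccont_csum. intros; apply C1; assumption.
    + intros y Hy. apply Ccont_csum. intros. apply Ccont_csum. intros; apply C1; assumption.
  - intros y _. rewrite fejer_expand.
    rewrite (csum_ext (fun j => csum (fun k => expi (- (Z.of_nat j - Z.of_nat k)) x
      * (q y * expi (Z.of_nat j - Z.of_nat k) y)) M)%C
      (fun j => q y * csum (fun k => expi (Z.of_nat j - Z.of_nat k) (y + - x)) M)%C).
    + rewrite csum_scal. ring.
    + intros j _. rewrite <- csum_scal. apply csum_ext; intros k _. rewrite expi_shift_opp. ring.
Qed.

(** The deviation is at most L times the mean of s = |sin|. The inequality s <= 1 / (2 r) + s^2 r /
    2 with r = sqrt M balances the mass of the kernel against s^2 F_M <= 1 / M. *)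
Lemma fejer_mean_close (q : R -> C) (M : nat) (L x : R) :
  (0 < M)%nat -> 0 <= L -> 0 <= x <= 1 -> (forall y, 0 <= y <= 1 -> Ccont q y) ->
  (forall y, 0 <= y <= 1 -> Cmod (q y - q x)%C <= L * Rabs (sin (PI * (y + - x)))) ->
  Cmod (CI (fun y => q y * RtoC (fejer M (y + - x)))%C 0 1 - q x)%C <= L / sqrt (INR M).
Proof.
  intros HM HL Hx Hq HLip.
  assert (PM := lt_0_INR M HM). set (r := sqrt (INR M)). assert (Hr : 0 < r) by (apply sqrt_lt_R0; exact PM).
  assert (Rr : r * r = INR M) by (apply sqrt_sqrt; lra).
  set (F := fun y => fejer M (y + - x)).
  assert (CF : forall y, continuous F y).
  { intros y. unfold F. apply (continuous_comp (fun y => y + - x) (fejer M)); [|apply fejer_continuous].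
    apply continuous_sqrt_rational. auto_derive. trivial. }
  assert (MF : RInt F 0 1 = 1).
  { unfold F. rewrite (RInt_shift (fejer M) 0 1 (- x)).
    - replace (1 + - x) with (0 + - x + 1) by ring. apply fejer_mass, HM.
    - apply ex_RInt_cont; [lra | intros; apply fejer_continuous]. }
  assert (MC : CI (fun y => RtoC (F y)) 0 1 = RtoC 1).
  { unfold CI. apply C_ext; unfold Re, Im; simpl; [exact MF|].
    rewrite RInt_const. unfold scal; simpl. unfold mult; simpl. ring. }
  assert (CqF : forall y, 0 <= y <= 1 -> Ccont (fun y => q y * RtoC (F y))%C y).
  { intros y Hy. apply Ccont_mult; [apply Hq, Hy | apply Ccont_RtoC, CF]. }
  replace (q x) with (CI (fun y => q x * RtoC (F y))%C 0 1).
  2: { rewrite CI_scal, MC by (try lra; intros; apply Ccont_RtoC, CF). ring. }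
  rewrite <- (CI_minus (fun y => q y * RtoC (F y))%C (fun y => q x * RtoC (F y))%C).
  2: lra. 2: exact CqF.
  2: { intros y _. apply (Ccont_mult (fun _ => q x)); [apply Ccont_const | apply Ccont_RtoC, CF]. }
  replace (L / r) with (RInt (fun y => L / (2 * r) * F y + L * r / (2 * INR M)) 0 1).
  2: { rewrite RInt_Rplus, RInt_Rscal, MF, RInt_const.
       - unfold scal; simpl. unfold mult; simpl. rewrite <- Rr. field. lra.
       - apply ex_RInt_cont; [lra | intros; apply CF].
       - apply ex_RInt_Rscal, ex_RInt_cont; [lra | intros; apply CF].
       - apply ex_RInt_const. }
  apply CI_norm; [lra | | |].
  - intros y Hy. apply (Ccont_minus (fun y => q y * RtoC (F y))%C (fun y => q x * RtoC (F y))%C).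
    + apply CqF, Hy.
    + apply (Ccont_mult (fun _ => q x)); [apply Ccont_const | apply Ccont_RtoC, CF].
  - intros y _. apply continuous_Rplus; [|apply continuous_const].
    apply (continuous_Rmult (fun _ => L / (2 * r))); [apply continuous_const | apply CF].
  - intros y Hy.
    replace (q y * RtoC (F y) - q x * RtoC (F y))%C with ((q y - q x) * RtoC (F y))%C by ring.
    assert (F0 : 0 <= F y) by (apply fejer_nonneg, HM).
    rewrite Cmod_mult, (Cmod_R_nonneg (F y)) by exact F0.
    assert (H1 := HLip y ltac:(lra)). assert (H2 := fejer_sin_le M (y + - x) HM). fold (F y) in H2.
    set (s := Rabs (sin (PI * (y + - x)))) in *.
    assert (Es : sin (PI * (y + - x)) ^ 2 = s ^ 2) by (unfold s; rewrite <- !Rsqr_pow2; apply Rsqr_abs).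
    rewrite Es in H2.
    assert (AG : s <= / (2 * r) + s ^ 2 * r / 2).
    { apply Rmult_le_reg_l with (2 * r); [lra|].
      replace (2 * r * (/ (2 * r) + s ^ 2 * r / 2)) with (1 + (s * r) ^ 2) by (field; lra).
      assert (0 <= (s * r - 1) ^ 2) by apply pow2_ge_0. nra. }
    apply Rle_trans with (L * (/ (2 * r) + s ^ 2 * r / 2) * F y).
    + apply Rmult_le_compat_r; [exact F0|]. apply Rle_trans with (1 := H1). apply Rmult_le_compat_l; lra.
    + replace (L * (/ (2 * r) + s ^ 2 * r / 2) * F y) with (L / (2 * r) * F y + L * r / 2 * (s ^ 2 * F y)) by (field; lra).
      apply Rplus_le_compat_l.
      replace (L * r / (2 * INR M)) with (L * r / 2 * / INR M) by (field; lra).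
      apply Rmult_le_compat_l; [|exact H2]. apply Rmult_le_pos; [apply Rmult_le_pos; lra | lra].
Qed.

Lemma rsum_sqr_decay (f : nat -> R) (N n : nat) (B E : R) :
  (0 < N)%nat -> 0 <= E -> (forall i, 0 <= f i <= B) -> (forall i, (N < i)%nat -> f i <= E / INR i ^ 2) ->
  rsum f n <= INR (S N) * B + E / INR N.
Proof.
  intros HN HE HB HD.
  apply Rle_trans with (rsum f (S N + n)); [apply rsum_mono_range; [lia | intros; apply HB]|].
  rewrite rsum_split. apply Rplus_le_compat.
  - rewrite <- rsum_const. apply rsum_le. intros; apply HB.
  - apply Rle_trans with (E * rsum (fun k => / INR (S (N + k)) ^ 2) n).
    + rewrite <- rsum_scal. apply rsum_le. intros k _. apply HD. lia.
    + apply Rmult_le_compat_l; [exact HE | apply rsum_inv_sqr, HN].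
Qed.

Lemma csum_row_split (a : Z -> C) (M j : nat) : (j < M)%nat ->
  csum (fun k => a (Z.of_nat j - Z.of_nat k)%Z) M =
  (csum (fun i => a (Z.of_nat i)) (S j) + csum (fun i => a (- Z.of_nat (S i))%Z) (M - S j))%C.
Proof.
  intros Hj. replace M with (S j + (M - S j))%nat at 1 by lia. rewrite csum_split. f_equal.
  - rewrite <- (csum_rev (fun i => a (Z.of_nat i))). apply csum_ext. intros k Hk. f_equal. lia.
  - apply csum_ext. intros k Hk. f_equal. lia.
Qed.

Lemma csum_window_split (a : Z -> C) (N : nat) :
  csum (fun k => a (Z.of_nat k - Z.of_nat N)%Z) (2 * N + 1) =
  (csum (fun i => a (Z.of_nat i)) (S N) + csum (fun i => a (- Z.of_nat (S i))%Z) N)%C.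
Proof.
  rewrite <- (csum_rev _ (2 * N + 1)).
  rewrite (csum_ext _ (fun k => a (Z.of_nat N - Z.of_nat k)%Z)) by (intros k Hk; f_equal; lia).
  rewrite csum_row_split by lia. do 2 f_equal. lia.
Qed.

Lemma csum_extend_small (f : nat -> C) (N n : nat) (E : R) :
  (0 < N)%nat -> 0 <= E -> (N <= n)%nat -> (forall i, (N <= i)%nat -> Cmod (f i) <= E / INR (S i) ^ 2) ->
  Cmod (csum f n - csum f N)%C <= E / INR N.
Proof.
  intros HN HE Hn HD. replace n with (N + (n - N))%nat by lia. rewrite csum_split.
  replace (csum f N + csum (fun k => f (N + k)%nat) (n - N) - csum f N)%C
    with (csum (fun k => f (N + k)%nat) (n - N)) by ring.
  apply Rle_trans with (E * rsum (fun k => / INR (S (N + k)) ^ 2) (n - N)).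
  - rewrite <- rsum_scal. apply Cmod_csum_le. intros k _. apply HD. lia.
  - apply Rmult_le_compat_l; [exact HE | apply rsum_inv_sqr, HN].
Qed.

(** The rows N <= j < N + K contain the whole window [-N, N] and differ from the partial sum by
    tails only. The 2 N other rows are bounded crudely, and their share of the average disappears as
    K grows. *)
Lemma cesaro_rows (a : Z -> C) (N K : nat) (B E : R) :
  (0 < N)%nat -> 0 <= E -> (forall n, Cmod (a n) <= B) ->
  (forall n, (Z.of_nat N < Z.abs n)%Z -> Cmod (a n) <= E / IZR n ^ 2) ->
  let M := (N + K + N)%nat in
  let P := csum (fun k => a (Z.of_nat k - Z.of_nat N)%Z) (2 * N + 1) in
  Cmod (csum (fun j => csum (fun k => a (Z.of_nat j - Z.of_nat k)%Z) M - P) M)%C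
    <= INR M * (2 * E / INR N) + 2 * INR N * (4 * (INR (S N) * B + E / INR N)).
Proof.
  intros HN HE HB HD M P.
  assert (PN := lt_0_INR N HN).
  assert (E0 : 0 <= E / INR N) by (apply Rdiv_le_0_compat; lra).
  assert (HB0 : 0 <= B) by (apply Rle_trans with (2 := HB 0%Z), Cmod_ge_0).
  assert (PB : 0 <= INR (S N) * B) by (apply Rmult_le_pos; [apply pos_INR | exact HB0]).
  set (W := INR (S N) * B + E / INR N) in *.
  set (f := fun i => a (Z.of_nat i)). set (g := fun i => a (- Z.of_nat (S i))%Z).
  assert (Df : forall i, (N < i)%nat -> Cmod (f i) <= E / INR i ^ 2).
  { intros i Hi. apply Rle_trans with (1 := HD (Z.of_nat i) ltac:(lia)). rewrite <- INR_IZR_INZ. lra. }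
  assert (Dg : forall i, (N <= i)%nat -> Cmod (g i) <= E / INR (S i) ^ 2).
  { intros i Hi. apply Rle_trans with (1 := HD (- Z.of_nat (S i))%Z ltac:(lia)).
    rewrite opp_IZR, <- INR_IZR_INZ. replace ((- INR (S i)) ^ 2) with (INR (S i) ^ 2) by ring. lra. }
  assert (Wf : forall n, Cmod (csum f n) <= W).
  { intros n. apply Rle_trans with (1 := Cmod_csum f n). apply rsum_sqr_decay; try assumption.
    intros i. split; [apply Cmod_ge_0 | apply HB]. }
  assert (Wg : forall n, Cmod (csum g n) <= W).
  { intros n. apply Rle_trans with (1 := Cmod_csum g n). apply rsum_sqr_decay; try assumption.
    - intros i. split; [apply Cmod_ge_0 | apply HB].
    - intros i Hi. apply Rle_trans with (1 := Dg i ltac:(lia)).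
      apply Rmult_le_compat_l; [exact HE|]. assert (0 < INR i) by (apply lt_0_INR; lia).
      apply Rinv_le_contravar; [apply pow_lt; lra|]. apply pow_incr. rewrite S_INR. lra. }
  assert (EP : P = (csum f (S N) + csum g N)%C) by apply csum_window_split.
  assert (ER : forall j, (j < M)%nat -> csum (fun k => a (Z.of_nat j - Z.of_nat k)%Z) M = (csum f (S j) + csum g (M - S j))%C).
  { intros j Hj. apply csum_row_split, Hj. }
  assert (R1 : forall j, (j < M)%nat -> Cmod (csum (fun k => a (Z.of_nat j - Z.of_nat k)%Z) M - P)%C <= 4 * W).
  { intros j Hj. rewrite ER, EP by exact Hj.
    assert (D1 := Cmod_triangle_minus (csum f (S j) + csum g (M - S j)) (csum f (S N) + csum g N)).
    assert (D2 := Cmod_triangle (csum f (S j)) (csum g (M - S j))).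
    assert (D3 := Cmod_triangle (csum f (S N)) (csum g N)).
    assert (A1 := Wf (S j)). assert (A2 := Wf (S N)). assert (A3 := Wg N). assert (A4 := Wg (M - S j)%nat). lra. }
  assert (R2 : forall j, (N <= j)%nat -> (j < N + K)%nat ->
    Cmod (csum (fun k => a (Z.of_nat j - Z.of_nat k)%Z) M - P)%C <= 2 * E / INR N).
  { intros j Hj1 Hj2. rewrite ER, EP by (unfold M; lia).
    replace (csum f (S j) + csum g (M - S j) - (csum f (S N) + csum g N))%C
      with ((csum f (S j) - csum f (S N)) + (csum g (M - S j) - csum g N))%C by ring.
    apply Rle_trans with (1 := Cmod_triangle _ _).
    assert (A1 : Cmod (csum f (S j) - csum f (S N))%C <= E / INR N).
    { change (S j) with (1 + j)%nat. change (S N) with (1 + N)%nat. rewrite !csum_split.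
      replace (csum f 1 + csum (fun k => f (1 + k)%nat) j - (csum f 1 + csum (fun k => f (1 + k)%nat) N))%C
        with (csum (fun k => f (1 + k)%nat) j - csum (fun k => f (1 + k)%nat) N)%C by ring.
      apply csum_extend_small; [exact HN | exact HE | exact Hj1 |]. intros i Hi. apply Df. lia. }
    assert (A2 : Cmod (csum g (M - S j) - csum g N)%C <= E / INR N).
    { apply csum_extend_small; [exact HN | exact HE | unfold M; lia | exact Dg]. }
    replace (2 * E / INR N) with (E / INR N + E / INR N) by (field; lra). lra. }
  apply Rle_trans with (1 := Cmod_csum _ _). unfold M at 2. rewrite !rsum_split.
  apply Rle_trans with (rsum (fun _ => 4 * W) N + rsum (fun _ => 2 * E / INR N) K + rsum (fun _ => 4 * W) N).
  - apply Rplus_le_compat; [apply Rplus_le_compat|]; apply rsum_le; intros i Hi.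
    + apply R1. unfold M; lia.
    + apply R2; lia.
    + apply R1. unfold M; lia.
  - rewrite !rsum_const. unfold M. rewrite !plus_INR.
    assert (0 <= 2 * E / INR N) by (apply Rdiv_le_0_compat; lra).
    assert (0 <= INR N * (2 * E / INR N)) by (apply Rmult_le_pos; lra). lra.
Qed.

Lemma Rabs_sin_ge (u : R) : Rabs u <= / 2 -> 2 / 3 * Rabs u <= Rabs (sin (PI * u)).
Proof.
  intros Hu. assert (P3 := PI_gt_3).
  assert (P : forall v, 0 <= v <= / 2 -> 2 / 3 * v <= sin (PI * v)).
  { intros v Hv. assert (S := sin_ge_third (PI * v) ltac:(nra)). nra. }
  destruct (Rle_or_lt 0 u) as [H|H].
  - rewrite (Rabs_pos_eq u) in * by exact H. apply Rle_trans with (2 := Rle_abs _). apply P; lra.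
  - rewrite (Rabs_left u) in * by exact H. rewrite <- Rabs_Ropp, <- sin_neg.
    apply Rle_trans with (2 := Rle_abs _). replace (- (PI * u)) with (PI * - u) by ring. apply P; lra.
Qed.

(* Continuity of [q] across the period lets distances be measured on the circle. *)
Lemma circle_lipschitz (q : R -> C) (L x y : R) :
  0 <= L -> q 0 = RtoC 0 -> q 1 = RtoC 0 ->
  (forall x y, 0 <= x <= 1 -> 0 <= y <= 1 -> Cmod (q y - q x)%C <= L * Rabs (y - x)) ->
  0 <= x <= 1 -> 0 <= y <= 1 -> Cmod (q y - q x)%C <= 2 * L * Rabs (sin (PI * (y + - x))).
Proof.
  intros HL Q0 Q1 HLip Hx Hy.
  assert (G : forall v, Rabs v <= / 2 -> L * Rabs v <= 2 * L * Rabs (sin (PI * v))).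
  { intros v Hv. assert (H := Rabs_sin_ge v Hv). assert (P := Rabs_pos v).
    apply Rle_trans with (L * (2 * (2 / 3 * Rabs v))); [apply Rmult_le_compat_l; lra|].
    rewrite (Rmult_comm 2 L), Rmult_assoc. apply Rmult_le_compat_l; lra. }
  assert (Far : forall a b, 0 <= a <= 1 -> 0 <= b <= 1 -> / 2 < b - a ->
    Cmod (q b - q a)%C <= 2 * L * Rabs (sin (PI * (b + - a)))).
  { intros a b Ha Hb Hab.
    replace (q b - q a)%C with ((q b - q 1%R) + (q 0%R - q a))%C by (rewrite Q0, Q1; ring).
    apply Rle_trans with (1 := Cmod_triangle _ _).
    assert (D1 := HLip 1 b ltac:(lra) Hb). assert (D2 := HLip a 0 Ha ltac:(lra)).
    rewrite Rabs_left1 in D1, D2 by lra.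
    assert (K := G (b - a - 1)). rewrite Rabs_left1 in K by lra.
    replace (sin (PI * (b - a - 1))) with (- sin (PI * (b + - a))) in K.
    2: { replace (PI * (b - a - 1)) with (PI * (b + - a) - PI) by ring. rewrite sin_minus, cos_PI, sin_PI. ring. }
    rewrite Rabs_Ropp in K. specialize (K ltac:(lra)). lra. }
  destruct (Rle_or_lt (Rabs (y - x)) (/ 2)) as [H|H].
  - apply Rle_trans with (1 := HLip x y Hx Hy). apply (G (y - x)), H.
  - destruct (Rle_or_lt x y) as [H'|H'].
    + apply Far; try assumption. rewrite Rabs_pos_eq in H; lra.
    + rewrite Cmod_minus_sym. replace (PI * (y + - x)) with (- (PI * (x + - y))) by ring.
      rewrite sin_neg, Rabs_Ropp. apply Far; try assumption. rewrite Rabs_left1 in H; lra.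
Qed.

(** Letting K tend to infinity in the Cesaro means removes the Lipschitz error and the incomplete
    rows, so that [L] and [Q] leave no trace in the bound. This matters because the Lipschitz
    constant obtained for the test function grows with t. *)
Lemma fourier_partial_close (q : R -> C) (N : nat) (L Q E x : R) :
  (0 < N)%nat -> 0 <= E -> 0 <= L -> (forall y, 0 <= y <= 1 -> Ccont q y) ->
  (forall y, 0 <= y <= 1 -> Cmod (q y) <= Q) -> q 0 = RtoC 0 -> q 1 = RtoC 0 ->
  (forall x y, 0 <= x <= 1 -> 0 <= y <= 1 -> Cmod (q y - q x)%C <= L * Rabs (y - x)) ->
  (forall n, (Z.of_nat N < Z.abs n)%Z -> Cmod (fourier_coef q n) <= E / IZR n ^ 2) ->
  0 <= x <= 1 -> Cmod (q x - fourier_partial q N x)%C <= 2 * E / INR N.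
Proof.
  intros HN HE HL Hq HQ Q0 Q1 HLip HD Hx.
  set (a := fourier_term q x).
  assert (Ha : forall n, Cmod (a n) <= Q).
  { intros n. unfold a, fourier_term. rewrite Cmod_mult, Cmod_expi, Rmult_1_r. unfold fourier_coef.
    replace Q with (Q * (1 - 0)) by ring. apply CI_bound; [lra | |].
    - intros y Hy. apply Ccont_mult; [apply Hq, Hy | apply Ccont_expi].
    - intros y Hy. rewrite Cmod_mult, Cmod_expi, Rmult_1_r. apply HQ. lra. }
  assert (Da : forall n, (Z.of_nat N < Z.abs n)%Z -> Cmod (a n) <= E / IZR n ^ 2).
  { intros n Hn. unfold a, fourier_term. rewrite Cmod_mult, Cmod_expi, Rmult_1_r. apply HD, Hn. }
  assert (PN := lt_0_INR N HN).
  set (W := 2 * INR N * (4 * (INR (S N) * Q + E / INR N))).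
  assert (HQ0 : 0 <= Q) by (apply Rle_trans with (2 := Ha 0%Z), Cmod_ge_0).
  assert (W0 : 0 <= W).
  { assert (0 <= E / INR N) by (apply Rdiv_le_0_compat; lra).
    assert (0 <= INR (S N) * Q) by (apply Rmult_le_pos; [apply pos_INR | exact HQ0]).
    apply Rmult_le_pos; lra. }
  apply le_of_inv_sqrt with (2 * L + W); [lra|].
  intros K HK. assert (R1 := cesaro_rows a N K Q E HN HE Ha Da). cbv zeta in R1.
  set (M := (N + K + N)%nat) in *.
  assert (HM : (0 < M)%nat) by (unfold M; lia).
  assert (F := fejer_mean_close q M (2 * L) x HM ltac:(lra) Hx Hq
    ltac:(intros y Hy; apply circle_lipschitz; assumption)).
  rewrite fejer_mean_expand in F by exact Hq. fold a in F.
  change (csum (fun k => a (Z.of_nat k - Z.of_nat N)%Z) (2 * N + 1)) with (fourier_partial q N x) in R1.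
  set (P := fourier_partial q N x) in *.
  rewrite csum_minus, csum_const in R1.
  set (Sg := csum (fun j => csum (fun k => a (Z.of_nat j - Z.of_nat k)%Z) M) M) in *.
  assert (PM := lt_0_INR M HM). assert (PK := lt_0_INR K HK).
  assert (KM : INR K <= INR M) by (apply le_INR; unfold M; lia).
  assert (K1 : 1 <= INR K) by (replace 1 with (INR 1) by reflexivity; apply le_INR; lia).
  assert (R2 : Cmod (RtoC (/ INR M) * Sg - P)%C <= 2 * E / INR N + W / INR M).
  { replace (RtoC (/ INR M) * Sg - P)%C with (RtoC (/ INR M) * (Sg - RtoC (INR M) * P))%C.
    2: { rewrite RtoC_inv by lra. field. intros Z0. injection Z0. lra. }
    rewrite Cmod_mult, Cmod_R_nonneg by (left; apply Rinv_0_lt_compat; exact PM).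
    apply Rmult_le_reg_l with (INR M); [exact PM|].
    rewrite <- Rmult_assoc, Rinv_r, Rmult_1_l by lra. apply Rle_trans with (1 := R1). fold W.
    right. field. lra. }
  assert (SK : sqrt (INR K) <= INR K).
  { assert (1 <= sqrt (INR K)) by (rewrite <- sqrt_1 at 1; apply sqrt_le_1; lra).
    assert (QQ : sqrt (INR K) * sqrt (INR K) = INR K) by (apply sqrt_sqrt; lra). nra. }
  assert (S0 : 0 < sqrt (INR K)) by (apply sqrt_lt_R0; exact PK).
  assert (B1 : W / INR M <= W / sqrt (INR K)).
  { apply Rmult_le_compat_l; [exact W0|]. apply Rinv_le_contravar; lra. }
  assert (B2 : 2 * L / sqrt (INR M) <= 2 * L / sqrt (INR K)) by (apply div_sqrt_le; lra).
  apply Rle_trans with (1 := Cmod_minus_triangle _ (RtoC (/ INR M) * Sg)%C _).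
  rewrite Cmod_minus_sym. rewrite Rdiv_plus_distr. lra.
Qed.

Lemma fourier_partial_cont (q : R -> C) (N : nat) (x : R) : Ccont (fourier_partial q N) x.
Proof.
  apply Ccont_csum. intros k _. apply (Ccont_mult (fun _ => fourier_coef q (Z.of_nat k - Z.of_nat N)));
    [apply Ccont_const | apply Ccont_expi].
Qed.

Lemma fourier_partial_periodic (q : R -> C) (N k : nat) (x : R) :
  fourier_partial q N (x + INR k) = fourier_partial q N x.
Proof. apply csum_ext. intros j _. unfold fourier_term. rewrite expi_add_nat. reflexivity. Qed.

(** The sum of squares is the integral of [q] times the conjugate of its partial sum, so uniform
    bounds for these two functions control it. *)
Lemma bessel_uniform (q : R -> C) (N : nat) (Q Q' : R) :
  (forall y, 0 <= y <= 1 -> Ccont q y) ->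
  (forall y, 0 <= y <= 1 -> Cmod (q y) <= Q) -> (forall y, 0 <= y <= 1 -> Cmod (fourier_partial q N y) <= Q') ->
  rsum (fun k => Cmod (fourier_coef q (Z.of_nat k - Z.of_nat N)) ^ 2) (2 * N + 1) <= Q * Q'.
Proof.
  intros Hq HQ HP. set (c := fun k => fourier_coef q (Z.of_nat k - Z.of_nat N)).
  set (G := fun y => (q y * Cconj (fourier_partial q N y))%C).
  assert (EG : forall y, G y = csum (fun k => Cconj (c k) * (q y * expi (Z.of_nat k - Z.of_nat N) y))%C (2 * N + 1)).
  { intros y. unfold G, fourier_partial. rewrite Cconj_csum, <- csum_scal. apply csum_ext. intros k _.
    unfold fourier_term. rewrite Cmult_conj, expi_opp. fold (c k).
    replace (Cconj (Cconj (expi (Z.of_nat k - Z.of_nat N) y))) with (expi (Z.of_nat k - Z.of_nat N) y); [ring|].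
    apply C_ext; unfold Re, Im; simpl; ring. }
  assert (C1 : forall (k : nat) y, 0 <= y <= 1 -> Ccont (fun y => q y * expi (Z.of_nat k - Z.of_nat N) y)%C y).
  { intros k y Hy. apply Ccont_mult; [apply Hq, Hy | apply Ccont_expi]. }
  assert (C2 : forall (k : nat) y, 0 <= y <= 1 -> Ccont (fun y => Cconj (c k) * (q y * expi (Z.of_nat k - Z.of_nat N) y))%C y).
  { intros k y Hy. apply (Ccont_mult (fun _ => Cconj (c k))); [apply Ccont_const | apply C1, Hy]. }
  assert (E : CI G 0 1 = RtoC (rsum (fun k => Cmod (c k) ^ 2) (2 * N + 1))).
  { rewrite (CI_ext G (fun y => csum (fun k => Cconj (c k) * (q y * expi (Z.of_nat k - Z.of_nat N) y))%C (2 * N + 1)));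
      [|lra | intros; apply EG].
    rewrite CI_csum; [|lra | intros; apply C2; assumption].
    generalize (2 * N + 1)%nat. intros n. induction n as [|n IH]; [reflexivity|].
    simpl csum. simpl rsum. rewrite IH, RtoC_plus. f_equal.
    rewrite CI_scal; [|lra | intros; apply C1; assumption].
    change (CI (fun x => q x * expi (Z.of_nat n - Z.of_nat N) x)%C 0 1) with (c n).
    change (Cmod (c n) * (Cmod (c n) * 1)) with (Cmod (c n) ^ 2). rewrite RtoC_Cmod_sqr. ring. }
  assert (CG : forall y, 0 <= y <= 1 -> Ccont G y).
  { intros y Hy. apply (Ccont_ext (fun y => csum (fun k => Cconj (c k) * (q y * expi (Z.of_nat k - Z.of_nat N) y))%C (2 * N + 1))).
    - intros; symmetry; apply EG.
    - apply Ccont_csum. intros; apply C2, Hy. }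
  assert (B : Cmod (CI G 0 1) <= Q * Q' * (1 - 0)).
  { apply CI_bound; [lra | exact CG |]. intros y Hy. unfold G. rewrite Cmod_mult, Cmod_Cconj.
    apply Rmult_le_compat; [apply Cmod_ge_0 | apply Cmod_ge_0 | apply HQ; lra | apply HP; lra]. }
  rewrite E, Cmod_R_nonneg in B; [unfold c in B; lra|].
  apply rsum_nonneg. intros; apply pow2_ge_0.
Qed.

(** * The test function *)

(* This is [(1 - cos (2 PI x)) ^ 2], which vanishes to fourth order at the integers. *)
Definition bump (x : R) : R := 3 / 2 - 2 * cos (2 * PI * x) + / 2 * cos (4 * PI * x).

(** The factor (x + 1)^(1/2) is written (x + 1) (x + 1)^(-1/2), a product of functions whose
    smoothness bounds are at hand. The factor e(x) moves the spectrum of the bump to be centred at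
    1, where the coefficient of Z is bounded below. *)
Definition amplitude (x : R) : C :=
  (RtoC (bump x) * expi 1 x * (RtoC (x + 1) * RtoC (Rpower (x + 1) (- (1 / 2)))))%C.

(** The phase - t ln(x + 1) is opposite to that of (x + 1)^(s-1), the power in the pairing on
    [1, 2]. *)
Definition test (t x : R) : C := (amplitude x * cis (- (t * ln (x + 1))))%C.

Lemma Smooth_real_step (v : Prop) (k : nat) (M : R) (f f' : R -> R) :
  (forall x, is_derive f x (f' x)) -> (forall x, Rabs (f x) <= M) -> (v -> f 0 = 0 /\ f 1 = 0) ->
  Smooth v k M (fun x => RtoC (f' x)) -> Smooth v (S k) M (fun x => RtoC (f x)).
Proof.
  intros D B V S. split; [|split].
  - intros x _. rewrite Cmod_R. apply B.
  - intros Hv. destruct (V Hv) as [-> ->]. split; reflexivity.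
  - exists (fun x => RtoC (f' x)). split; [intros x _; apply Cder_RtoC, D | exact S].
Qed.

(** 3072 = 48 times 64 majorises the third derivative, whose coefficients are 16 PI^3 and 32 PI^3,
    as PI <= 4. *)
Lemma bump_smooth : Smooth True 3 3072 (fun x => RtoC (bump x)).
Proof.
  assert (P3 := PI_gt_3). assert (P4 := PI_4).
  assert (P2 : PI * PI <= 16) by nra. assert (PP : PI * PI * PI <= 64) by nra.
  assert (T0 : cos (2 * PI * 0) = 1 /\ cos (4 * PI * 0) = 1 /\ sin (2 * PI * 0) = 0 /\ sin (4 * PI * 0) = 0).
  { rewrite !Rmult_0_r, cos_0, sin_0. auto. }
  assert (T1 : cos (2 * PI * 1) = 1 /\ cos (4 * PI * 1) = 1 /\ sin (2 * PI * 1) = 0 /\ sin (4 * PI * 1) = 0).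
  { replace (4 * PI * 1) with (2 * PI + 2 * PI) by ring. rewrite !Rmult_1_r, cos_plus, sin_plus, cos_2PI, sin_2PI.
    repeat split; ring. }
  destruct T0 as [T01 [T02 [T03 T04]]], T1 as [T11 [T12 [T13 T14]]].
  apply (Smooth_real_step True 2 3072 bump (fun x => 4 * PI * sin (2 * PI * x) - 2 * PI * sin (4 * PI * x))).
  { intros x. unfold bump. auto_derive; [trivial | field]. }
  { intros x. unfold bump. assert (A := COS_bound (2 * PI * x)). assert (B := COS_bound (4 * PI * x)).
    apply Rabs_le. lra. }
  { intros _. unfold bump. rewrite T01, T02, T11, T12. split; field. }
  apply (Smooth_real_step True 1 3072 (fun x => 4 * PI * sin (2 * PI * x) - 2 * PI * sin (4 * PI * x))
    (fun x => 8 * PI * PI * cos (2 * PI * x) - 8 * PI * PI * cos (4 * PI * x))).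
  { intros x. auto_derive; [trivial | ring]. }
  { intros x. assert (A := SIN_bound (2 * PI * x)). assert (B := SIN_bound (4 * PI * x)).
    apply Rabs_le. split; nra. }
  { intros _. rewrite T03, T04, T13, T14. split; ring. }
  apply (Smooth_real_step True 0 3072 (fun x => 8 * PI * PI * cos (2 * PI * x) - 8 * PI * PI * cos (4 * PI * x))
    (fun x => - (16 * (PI * PI * PI) * sin (2 * PI * x)) + 32 * (PI * PI * PI) * sin (4 * PI * x))).
  { intros x. auto_derive; [trivial | ring]. }
  { intros x. assert (A := COS_bound (2 * PI * x)). assert (B := COS_bound (4 * PI * x)).
    apply Rabs_le. split; nra. }
  { intros _. rewrite T01, T02, T11, T12. split; ring. }
  split.
  - intros x _. rewrite Cmod_R. assert (A := SIN_bound (2 * PI * x)). assert (B := SIN_bound (4 * PI * x)).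
    assert (0 < PI * PI * PI) by (apply Rmult_lt_0_compat; [apply Rmult_lt_0_compat; lra | lra]).
    set (p := PI * PI * PI) in *. apply Rabs_le. split; nra.
  - intros x _. apply Ccont_RtoC, continuous_sqrt_rational. auto_derive. trivial.
Qed.

Lemma amplitude_smooth : exists M, 1 <= M /\ Smooth True 3 M amplitude.
Proof.
  destruct (Smooth_Rpower 3 (- (1 / 2)) ltac:(lra)) as [K [HK S]].
  assert (S1 := S 1 ltac:(lra)).
  assert (SE : Smooth False 3 ((1 + Rabs (2 * PI * 1)) ^ 3) (expi 1)) by exact (Smooth_cis 3 (2 * PI * 1)).
  assert (SA := Smooth_mult _ _ _ _ _ _ (Smooth_mult _ _ _ _ _ _ bump_smooth SE)
    (Smooth_mult _ _ _ _ _ _ (Smooth_shift 3 1 ltac:(lra)) S1)).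
  match type of SA with Smooth _ _ ?M _ => exists (1 + M); assert (M0 : 0 <= M) by apply (Smooth_nonneg _ _ _ _ SA) end.
  split; [lra|]. apply Smooth_mono with (2 := SA). lra.
Qed.

Lemma is_derive_ln_shift (a x : R) : 0 < x + a -> is_derive (fun y => ln (y + a)) x (Rpower (x + a) (- (1))).
Proof.
  intros H. replace (Rpower (x + a) (- (1))) with (/ (x + a)).
  - auto_derive; [exact H | field; lra].
  - rewrite Rpower_Ropp, Rpower_1 by exact H. reflexivity.
Qed.

Lemma Rpower_m1 (x : R) : 0 < x -> Rpower x (- (1)) = / x.
Proof. intros H. rewrite Rpower_Ropp, Rpower_1 by exact H. reflexivity. Qed.

Lemma test_lipschitz (t : R) : 0 <= t -> exists L, 0 <= L /\ forall x y, 0 <= x <= 1 -> 0 <= y <= 1 ->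
  Cmod (test t y - test t x)%C <= L * Rabs (y - x).
Proof.
  intros Ht. destruct amplitude_smooth as [M [HM S]].
  assert (Dph : forall x, 0 <= x <= 1 -> is_derive (fun y => - (t * ln (y + 1))) x (- (t * / (x + 1)))).
  { intros x Hx. auto_derive; [lra | field; lra]. }
  assert (SC : Smooth False 1 (1 + t) (fun x => cis (- (t * ln (x + 1))))).
  { split; [intros; rewrite Cmod_cis; lra|]. split; [tauto|].
    exists (fun x => RtoC (- (t * / (x + 1))) * Ci * cis (- (t * ln (x + 1))))%C. split.
    - intros x Hx. apply (Cder_cis_comp (fun y => - (t * ln (y + 1)))), Dph, Hx.
    - split.
      + intros x Hx. rewrite !Cmod_mult, Cmod_cis, Cmod_R, Rabs_Ropp.
        replace (Cmod Ci) with 1.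
        2: { unfold Cmod, Ci; simpl. replace (0 * (0 * 1) + 1 * (1 * 1)) with 1 by ring. symmetry; apply sqrt_1. }
        assert (H : 0 < / (x + 1) <= 1).
        { split; [apply Rinv_0_lt_compat; lra|]. rewrite <- Rinv_1 at 2. apply Rinv_le_contravar; lra. }
        rewrite Rabs_pos_eq by (apply Rmult_le_pos; lra). nra.
      + intros x Hx. apply Ccont_mult.
        * apply (Ccont_mult (fun y => RtoC (- (t * / (y + 1))))); [|apply Ccont_const].
          apply Ccont_RtoC, continuous_sqrt_rational. auto_derive. lra.
        * apply Cder_cont with (1 := Cder_cis_comp _ _ _ (Dph x Hx)). }
  assert (ST := Smooth_mult True 1 M (1 + t) _ _ (Smooth_drop _ _ _ _ (Smooth_drop _ _ _ _ S)) SC).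
  fold (test t) in ST. set (L := 2 ^ 1 * (M * (1 + t))) in *. exists L.
  assert (HL := Smooth_nonneg _ _ _ _ ST). split; [exact HL|].
  destruct ST as [_ [_ [f' [D [B C]]]]].
  assert (G : forall x y, 0 <= x <= y -> y <= 1 -> Cmod (test t y - test t x)%C <= L * (y - x)).
  { intros x y Hx Hy. rewrite <- (CI_FTC (test t) f' x y).
    - apply CI_bound; [lra | intros; apply C; lra | intros; apply B; lra].
    - lra.
    - intros; apply D; lra.
    - intros; apply C; lra. }
  intros x y Hx Hy. destruct (Rle_or_lt x y) as [H|H].
  - rewrite Rabs_pos_eq by lra. apply G; lra.
  - rewrite Rabs_left, Cmod_minus_sym by lra. replace (- (y - x)) with (x - y) by ring. apply G; lra.
Qed.

(** For |n| > t / PI the linear phase has derivative 2 PI |n| > 2 t in size, against t / (x + 1) <=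
    t for the logarithm; after division by |n| at least 2 PI - PI >= 3 remains. Three integrations
    by parts give |n|^(-3), uniformly in t because kap = t / |n| stays below PI. *)
Lemma test_coef_decay : exists K, 0 < K /\ forall t n, 0 < t -> t / PI < Rabs (IZR n) ->
  Cmod (fourier_coef (test t) n) <= K / Rabs (IZR n) ^ 3.
Proof.
  assert (P3 := PI_gt_3). assert (P4 := PI_4).
  destruct amplitude_smooth as [M [HM SA]].
  destruct (Smooth_Rpower 3 (- (1)) ltac:(lra)) as [K1 [HK1 S1]].
  destruct (Smooth_inv 3 (4 * (K1 * Rpower 1 (- (1))) + 8) 3 ltac:(lra)) as [N [HN SI]].
  exists (M * (8 * N) ^ 3). split; [apply Rmult_lt_0_compat; [lra | apply pow_lt; lra]|].
  intros t n Ht Hn. set (mu := Rabs (IZR n)) in *.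
  assert (Hmu : 0 < mu) by (apply Rlt_trans with (2 := Hn), Rdiv_lt_0_compat; lra).
  set (kap := t / mu). assert (Hk0 : 0 < kap) by (apply Rdiv_lt_0_compat; lra).
  assert (Hk : kap < PI).
  { unfold kap. apply Rmult_lt_reg_r with mu; [exact Hmu|]. replace (t / mu * mu) with t by (field; lra).
    replace t with (t / PI * PI) by (field; lra). rewrite (Rmult_comm PI). apply Rmult_lt_compat_r; lra. }
  (* The sign of -n, so that both signs of the frequency are handled by one phase normalised by
     |n|. *)
  set (sg := - (IZR n / mu)).
  assert (Hsg : sg = 1 \/ sg = - (1)).
  { unfold sg. unfold mu in *. destruct (Rle_or_lt 0 (IZR n)) as [H|H].
    - right. rewrite (Rabs_pos_eq _ H) in *. field. lra.
    - left. rewrite (Rabs_left _ H) in *. field. lra. }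
  set (rho := fun x => kap * Rpower (x + 1) (- (1)) + 2 * PI * sg).
  assert (Hrho : forall x, 0 <= x <= 1 -> 3 <= Rabs (rho x)).
  { intros x Hx. unfold rho. rewrite Rpower_m1 by lra.
    assert (H : 0 < / (x + 1) <= 1).
    { split; [apply Rinv_0_lt_compat; lra|]. rewrite <- Rinv_1 at 2. apply Rinv_le_contravar; lra. }
    assert (0 <= kap * / (x + 1) <= PI) by nra.
    destruct Hsg as [-> | ->]; [rewrite Rabs_pos_eq; lra | rewrite Rabs_left; lra]. }
  assert (SR : Smooth False 3 (4 * (K1 * Rpower 1 (- (1))) + 8) (fun x => RtoC (rho x))).
  { assert (E : forall x, (RtoC kap * RtoC (Rpower (x + 1) (- (1))) + RtoC (2 * PI * sg))%C = RtoC (rho x)).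
    { intros x. unfold rho. apply C_ext; simpl; ring. }
    assert (SS := Smooth_plus False 3 _ _ _ _ (Smooth_scal _ _ _ (RtoC kap) _ (S1 1 ltac:(lra)))
      (Smooth_const 3 (RtoC (2 * PI * sg)) 8 ltac:(rewrite Cmod_R; apply Rabs_le; destruct Hsg as [-> | ->]; lra))).
    apply Smooth_mono with (M' := 4 * (K1 * Rpower 1 (- (1))) + 8) in SS.
    - destruct SS as [B [V [f' [D SS]]]]. split; [intros x Hx; rewrite <- E; apply B, Hx|]. split; [tauto|].
      exists f'. split; [|exact SS]. intros x Hx. apply Cder_ext with (2 := D x Hx). exact E.
    - apply Rplus_le_compat_r. apply Rmult_le_compat_r.
      + apply Rmult_le_pos; [lra | left; apply Rpower_pos].
      + rewrite Cmod_R_nonneg; lra. }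
  assert (NR : forall x, 0 <= x <= 1 -> rho x <> 0).
  { intros x Hx E. assert (H := Hrho x Hx). rewrite E, Rabs_R0 in H. lra. }
  assert (DR : forall x, 0 <= x <= 1 -> is_derive (fun y => kap * ln (y + 1) + 2 * PI * sg * y) x (rho x)).
  { intros x Hx. unfold rho. rewrite Rpower_m1 by lra. auto_derive; [lra | field; lra]. }
  assert (O := oscillation_decay mu N (8 * N) _ rho Hmu ltac:(lra) DR NR 3 M amplitude ltac:(simpl; lra)
    (SI rho SR Hrho) SA).
  replace (M * (8 * N) ^ 3 / mu ^ 3) with (M * (8 * N / mu) ^ 3) by (field; lra).
  apply Rle_trans with (2 := O). right. f_equal. apply CI_ext; [lra|]. intros x Hx.
  unfold test, expi. rewrite <- Cmult_assoc, <- cis_add. do 2 f_equal.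
  unfold kap, sg. field. lra.
Qed.

(** * Lower bound for the pairing sum *)

(** One term of Z on [j, j + 1] gives a phase with derivative t (1 / (x+1) - 1 / (x+j) + 1 / (x+b)),
    up to sign. For j >= 2 this is at least t (1 / (x+1) - 1 / (x+2)) >= t / 6: the oscillation of
    the test function prevails. *)
Lemma nonstationary_bound : exists K, 0 < K /\ forall t j b G g,
  0 < t -> 2 <= j -> j <= b -> Smooth False 3 G g ->
  Cmod (CI (fun x => amplitude x * (RtoC (Rpower (x + j) (- (1 / 2))) * (RtoC (Rpower (x + b) (- (1 / 2))) * g x))
    * cis (- (t * (ln (x + 1) - ln (x + j) + ln (x + b)))))%C 0 1)
  <= K * G / (t ^ 3 * sqrt j * sqrt b).
Proof.
  destruct amplitude_smooth as [M [HM SA]].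
  destruct (Smooth_Rpower 3 (- (1)) ltac:(lra)) as [K1 [HK1 S1]].
  destruct (Smooth_Rpower 3 (- (1 / 2)) ltac:(lra)) as [K2 [HK2 S2]].
  destruct (Smooth_inv 3 (K1 * 3) (/ 6) ltac:(lra)) as [N [HN SI]].
  exists (M * K2 * K2 * 8 ^ 3 * (8 * N) ^ 3). split.
  { repeat apply Rmult_lt_0_compat; try lra; apply pow_lt; lra. }
  intros t j b G g Ht Hj Hb Sg.
  assert (Rj : 0 < sqrt j) by (apply sqrt_lt_R0; lra). assert (Rb : 0 < sqrt b) by (apply sqrt_lt_R0; lra).
  set (rho := fun x => Rpower (x + 1) (- (1)) - Rpower (x + j) (- (1)) + Rpower (x + b) (- (1))).
  assert (Hrho : forall x, 0 <= x <= 1 -> / 6 <= Rabs (rho x)).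
  { intros x Hx. unfold rho. rewrite !Rpower_m1 by lra.
    assert (H1 : / (x + j) <= / (x + 2)) by (apply Rinv_le_contravar; lra).
    assert (H2 : 0 < / (x + b)) by (apply Rinv_0_lt_compat; lra).
    assert (H3 : / 6 <= / (x + 1) - / (x + 2)).
    { replace (/ (x + 1) - / (x + 2)) with (/ ((x + 1) * (x + 2))) by (field; lra).
      apply Rinv_le_contravar; nra. }
    apply Rle_trans with (2 := Rle_abs _). lra. }
  assert (SR : Smooth False 3 (K1 * 3) (fun x => RtoC (rho x))).
  { assert (E : forall x, (RtoC (Rpower (x + 1) (- (1))) + (RtoC (- (1)) * RtoC (Rpower (x + j) (- (1)))
      + RtoC (Rpower (x + b) (- (1)))))%C = RtoC (rho x)).
    { intros x. unfold rho. apply C_ext; simpl; ring. }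
    assert (Q : forall a, 1 <= a -> Smooth False 3 (K1 * 1) (fun x => RtoC (Rpower (x + a) (- (1))))).
    { intros a Ha. apply Smooth_mono with (2 := S1 a Ha). apply Rmult_le_compat_l; [lra|].
      rewrite Rpower_m1 by lra. rewrite <- Rinv_1. apply Rinv_le_contravar; lra. }
    assert (SS := Smooth_plus False 3 _ _ _ _ (Q 1 ltac:(lra)) (Smooth_plus False 3 _ _ _ _
      (Smooth_scal _ _ _ (RtoC (- (1))) _ (Q j ltac:(lra))) (Q b ltac:(lra)))).
    apply Smooth_mono with (M' := K1 * 3) in SS.
    - destruct SS as [B [V [f' [D SS]]]]. split; [intros x Hx; rewrite <- E; apply B, Hx|]. split; [tauto|].
      exists f'. split; [|exact SS]. intros x Hx. apply Cder_ext with (2 := D x Hx). exact E.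
    - replace (Cmod (RtoC (- (1)))) with 1 by (rewrite Cmod_R, Rabs_left; lra). lra. }
  assert (NR : forall x, 0 <= x <= 1 -> rho x <> 0).
  { intros x Hx E. assert (H := Hrho x Hx). rewrite E, Rabs_R0 in H. lra. }
  assert (DR : forall x, 0 <= x <= 1 -> is_derive (fun y => ln (y + 1) - ln (y + j) + ln (y + b)) x (rho x)).
  { intros x Hx. unfold rho. rewrite !Rpower_m1 by lra. auto_derive; [repeat split; lra | field; lra]. }
  assert (SB := Smooth_mult _ _ _ _ _ _ SA (Smooth_mult _ _ _ _ _ _ (S2 j ltac:(lra))
    (Smooth_mult _ _ _ _ _ _ (S2 b ltac:(lra)) Sg))).
  assert (O := oscillation_decay t N (8 * N) _ rho Ht ltac:(lra) DR NR 3 _ _ ltac:(simpl; lra) (SI rho SR Hrho) SB).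
  apply Rle_trans with (1 := O). right. rewrite !Rpower_mhalf by lra. simpl pow. field. lra.
Qed.

Lemma Rcpow_crit_minus_1 (t a : R) :
  Rcpow a (crit t - 1) = (RtoC (Rpower a (- (1 / 2))) * cis (t * ln a))%C.
Proof.
  rewrite Rcpow_polar, crit_eq. unfold Rpower. simpl.
  replace (1 / 2 + - (1)) with (- (1 / 2)) by field. replace (t + - 0) with t by ring. reflexivity.
Qed.

Lemma Rcpow_opp_crit (t a : R) :
  Rcpow a (- crit t) = (RtoC (Rpower a (- (1 / 2))) * cis (- (t * ln a)))%C.
Proof.
  rewrite Rcpow_polar, crit_eq. unfold Rpower. simpl.
  replace (- t * ln a) with (- (t * ln a)) by ring. reflexivity.
Qed.

Lemma Rcpow_1_minus_crit (t a : R) : 0 < a ->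
  Rcpow a (RtoC 1 - crit t) = (RtoC (Rpower a (- (1 / 2))) * RtoC a * cis (- (t * ln a)))%C.
Proof.
  intros Ha. replace (RtoC 1 - crit t)%C with (- crit t + RtoC 1)%C by ring.
  rewrite Rcpow_add, Rcpow_1, Rcpow_opp_crit by exact Ha. ring.
Qed.

Lemma Ccont_amplitude (x : R) : 0 <= x -> Ccont amplitude x.
Proof.
  intros Hx. apply Ccont_mult; [apply Ccont_mult; [|apply Ccont_expi]|apply Ccont_mult].
  - apply Ccont_RtoC, continuous_sqrt_rational. unfold bump. auto_derive. trivial.
  - apply Ccont_RtoC, continuous_sqrt_rational. auto_derive. trivial.
  - apply Ccont_RtoC, (continuous_comp (fun y => y + 1) (fun y => Rpower y (- (1 / 2)))).
    + apply continuous_sqrt_rational. auto_derive. trivial.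
    + apply continuous_Rpower. lra.
Qed.

Lemma Ccont_test (t x : R) : 0 <= x -> Ccont (test t) x.
Proof.
  intros Hx. apply Ccont_mult; [apply Ccont_amplitude, Hx|].
  apply (Ccont_cis (fun y => - (t * ln (y + 1)))). apply continuous_sqrt_rational. auto_derive. lra.
Qed.

Lemma Cmod_test (M t x : R) : Smooth True 3 M amplitude -> 0 <= x <= 1 -> Cmod (test t x) <= M.
Proof.
  intros S Hx. unfold test. rewrite Cmod_mult, Cmod_cis, Rmult_1_r. exact (Smooth_bound _ _ _ _ x S Hx).
Qed.

Lemma Ccont_pairing_test (t : R) (Z : R -> C) (j x : R) : is_hurwitz_on_line t Z -> 1 <= j -> 0 <= x ->
  Ccont (fun x => pairing t Z (x + j) * test t x)%C x.
Proof.
  intros HZ Hj Hx. apply (Ccont_mult (fun x => pairing t Z (x + j))); [|apply Ccont_test, Hx].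
  apply (Ccont_comp (pairing t Z) (fun y => y + j)).
  - apply continuous_sqrt_rational. auto_derive. trivial.
  - apply pairing_cont; [exact HZ | lra].
Qed.

(** With about t^4 terms, the bounds t^(-3) (j b)^(-1/2) sum to the order t^(-1) j^(-1/2), and the
    truncation error 4 t / sqrt L is of order 1 / t. The correction term has the same phase, with x
    + b as additional amplitude. *)
Lemma middle_interval_bound : exists K, 0 < K /\ forall t Z j,
  1 <= t -> is_hurwitz_on_line t Z -> 2 <= j <= t ->
  Cmod (CI (fun x => pairing t Z (x + j) * test t x)%C 0 1) <= K / (t * sqrt j).
Proof.
  destruct nonstationary_bound as [K [HK NB]]. destruct amplitude_smooth as [M [HM SA]].
  exists (12 * K + 4 * M). split; [lra|].
  intros t Z j Ht HZ Hj.
  assert (T3 : 0 < t ^ 3) by (apply pow_lt; lra). assert (T4 : 1 <= t ^ 4) by (apply pow_R1_Rle; lra).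
  assert (Rj : 0 < sqrt j) by (apply sqrt_lt_R0; lra).
  destruct (nat_above (t ^ 4) ltac:(lra)) as [L [HL0 HL]].
  assert (SL1 : t ^ 2 <= sqrt (INR L)).
  { replace (t ^ 2) with (sqrt (t ^ 2 * t ^ 2)) by (apply sqrt_square, pow2_ge_0).
    apply sqrt_le_1; [|apply pos_INR|].
    - apply Rmult_le_pos; apply pow2_ge_0.
    - replace (t ^ 2 * t ^ 2) with (t ^ 4) by ring. lra. }
  assert (SL2 : sqrt (INR L + j) <= 2 * t ^ 2).
  { replace (2 * t ^ 2) with (sqrt ((2 * t ^ 2) * (2 * t ^ 2))).
    2: { apply sqrt_square. assert (0 <= t ^ 2) by apply pow2_ge_0. lra. }
    assert (t <= t ^ 4) by (replace t with (t ^ 1) at 1 by ring; apply Rle_pow; [lra | lia]).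
    apply sqrt_le_1; [generalize (pos_INR L); lra | | ];
      replace (2 * t ^ 2 * (2 * t ^ 2)) with (4 * t ^ 4) by ring; lra. }
  set (u := fun (c : C) b x => (Rcpow (x + j) (crit t - 1) * Rcpow (x + b) c * test t x)%C).
  assert (Cu : forall c b x, 0 < b -> 0 <= x -> Ccont (u c b) x).
  { intros c b x Hb Hx. apply (Ccont_mult (fun x => Rcpow (x + j) (crit t - 1) * Rcpow (x + b) c)%C); [|apply Ccont_test, Hx].
    apply Ccont_mult; apply Ccont_Rcpow; lra. }
  assert (U1 : forall b, j <= b -> Cmod (CI (u (- crit t)%C b) 0 1) <= K / (t ^ 3 * sqrt j * sqrt b)).
  { intros b Hb. replace (K / (t ^ 3 * sqrt j * sqrt b)) with (K * 1 / (t ^ 3 * sqrt j * sqrt b)) by (unfold Rdiv; ring).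
    apply Rle_trans with (2 := NB t j b 1 (fun _ => RtoC 1) ltac:(lra) ltac:(lra) Hb
      (Smooth_const 3 (RtoC 1) 1 ltac:(rewrite Cmod_1; lra))).
    right. f_equal. apply CI_ext; [lra|]. intros x Hx. unfold u, test.
    rewrite Rcpow_crit_minus_1, Rcpow_opp_crit.
    replace (- (t * (ln (x + 1) - ln (x + j) + ln (x + b)))) with (- (t * ln (x + 1)) + (t * ln (x + j) + - (t * ln (x + b)))) by ring.
    rewrite !cis_add. ring. }
  assert (U2 : forall b, j <= b -> Cmod (CI (u (RtoC 1 - crit t)%C b) 0 1) <= K * (1 + b) / (t ^ 3 * sqrt j * sqrt b)).
  { intros b Hb. apply Rle_trans with (2 := NB t j b (1 + b) (fun x => RtoC (x + b)) ltac:(lra) ltac:(lra) Hb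
      (Smooth_shift 3 b ltac:(lra))).
    right. f_equal. apply CI_ext; [lra|]. intros x Hx. unfold u, test.
    rewrite Rcpow_crit_minus_1, Rcpow_1_minus_crit by lra.
    replace (- (t * (ln (x + 1) - ln (x + j) + ln (x + b)))) with (- (t * ln (x + 1)) + (t * ln (x + j) + - (t * ln (x + b)))) by ring.
    rewrite !cis_add. ring. }
  set (v := fun x => (Rcpow (x + j) (crit t - 1) * (Z (x + j)%R - hurwitz_partial t (x + j) L) * test t x)%C).
  assert (EV : forall x, (pairing t Z (x + j) * test t x)%C = (v x + (csum (fun l => u (- crit t)%C (j + INR (S l))%R x) L
    - / (RtoC 1 - crit t) * u (RtoC 1 - crit t)%C (j + INR L)%R x))%C).
  { intros x. unfold v, pairing, hurwitz_partial.
    replace (csum (fun l => u (- crit t)%C (j + INR (S l))%R x) L) with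
      (Rcpow (x + j) (crit t - 1) * csum (fun k => Rcpow (INR (S k) + (x + j)) (- crit t)) L * test t x)%C.
    - unfold u. replace (INR L + (x + j)) with (x + (j + INR L)%R) by ring. unfold Cdiv. ring.
    - rewrite <- csum_scal, Cmult_comm, <- csum_scal. apply csum_ext. intros l _. unfold u.
      replace (INR (S l) + (x + j)) with (x + (j + INR (S l))%R) by ring. ring. }
  assert (PL := pos_INR L).
  assert (CS : forall x, 0 <= x <= 1 -> Ccont (fun x => csum (fun l => u (- crit t)%C (j + INR (S l))%R x) L) x).
  { intros x Hx. apply Ccont_csum. intros l _. apply Cu; [generalize (pos_INR (S l)); lra | lra]. }
  assert (CT : forall x, 0 <= x <= 1 -> Ccont (u (RtoC 1 - crit t)%C (j + INR L)%R) x).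
  { intros x Hx. apply Cu; lra. }
  assert (CT' : forall x, 0 <= x <= 1 -> Ccont (fun x => / (RtoC 1 - crit t) * u (RtoC 1 - crit t)%C (j + INR L)%R x)%C x).
  { intros x Hx. apply (Ccont_mult (fun _ => / (RtoC 1 - crit t))%C); [apply Ccont_const | apply CT, Hx]. }
  assert (CM : forall x, 0 <= x <= 1 -> Ccont (fun x => csum (fun l => u (- crit t)%C (j + INR (S l))%R x) L
    - / (RtoC 1 - crit t) * u (RtoC 1 - crit t)%C (j + INR L)%R x)%C x).
  { intros x Hx. exact (Ccont_minus _ _ x (CS x Hx) (CT' x Hx)). }
  assert (CV : forall x, 0 <= x <= 1 -> Ccont v x).
  { intros x Hx. apply (Ccont_ext (fun x => pairing t Z (x + j) * test t x
      - (csum (fun l => u (- crit t)%C (j + INR (S l))%R x) L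
    - / (RtoC 1 - crit t) * u (RtoC 1 - crit t)%C (j + INR L)%R x))%C).
    - intros y. rewrite EV. ring.
    - exact (Ccont_minus _ _ x (Ccont_pairing_test t Z j x HZ ltac:(lra) ltac:(lra)) (CM x Hx)). }
  rewrite (CI_ext _ _ 0 1 ltac:(lra) (fun x _ => EV x)).
  rewrite (CI_plus _ _ 0 1 ltac:(lra) CV CM), (CI_minus _ _ 0 1 ltac:(lra) CS CT'), (CI_scal _ _ 0 1 ltac:(lra) CT).
  rewrite CI_csum; [|lra|].
  2: { intros l x _ Hx. apply Cu; [generalize (pos_INR (S l)); lra | lra]. }
  apply Rle_trans with (1 := Cmod_triangle _ _).
  assert (BV : Cmod (CI v 0 1) <= 4 * M / (t * sqrt j)).
  { replace (4 * M / (t * sqrt j)) with (4 * M / (t * sqrt j) * (1 - 0)) by ring.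
    apply CI_bound; [lra | exact CV |]. intros x Hx. unfold v. rewrite !Cmod_mult.
    rewrite Rcpow_crit_minus_1, Cmod_mult, Cmod_cis, Rmult_1_r, Cmod_R_nonneg by (left; apply Rpower_pos).
    destruct HZ as [_ HZ]. assert (B1 := HZ (x + j) L ltac:(lra) HL0).
    assert (B2 := Cmod_test M t x SA ltac:(lra)).
    assert (B3 : Rpower (x + j) (- (1 / 2)) <= / sqrt j).
    { rewrite <- Rpower_mhalf by lra. apply Rpower_decr; lra. }
    assert (B4 : 4 * t / sqrt (INR L + (x + j)) <= 4 / t).
    { apply Rle_trans with (4 * t / t ^ 2); [|right; field; lra].
      apply Rmult_le_compat_l; [lra|]. apply Rinv_le_contravar; [apply pow_lt; lra|].
      apply Rle_trans with (1 := SL1). apply sqrt_le_1; lra. }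
    apply Rle_trans with (/ sqrt j * (4 / t) * M); [|right; field; lra].
    apply Rmult_le_compat; [|apply Cmod_ge_0| |exact B2].
    - apply Rmult_le_pos; [left; apply Rpower_pos | apply Cmod_ge_0].
    - apply Rmult_le_compat; [left; apply Rpower_pos | apply Cmod_ge_0 | exact B3 | lra]. }
  assert (BS : Cmod (csum (fun k => CI (u (- crit t)%C (j + INR (S k))%R) 0 1) L) <= 4 * K / (t * sqrt j)).
  { apply Rle_trans with (rsum (fun k => K / (t ^ 3 * sqrt j) * / sqrt (INR (S k))) L).
    - apply Cmod_csum_le. intros k _. assert (P := INR_S_pos k).
      apply Rle_trans with (1 := U1 (j + INR (S k))%R ltac:(lra)).
      assert (Q : 0 < sqrt (INR (S k))) by (apply sqrt_lt_R0; exact P).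
      assert (Q2 : sqrt (INR (S k)) <= sqrt (j + INR (S k))%R) by (apply sqrt_le_1; lra).
      replace (K / (t ^ 3 * sqrt j * sqrt (j + INR (S k))%R)) with (K / (t ^ 3 * sqrt j) * / sqrt (j + INR (S k))%R) by (field; lra).
      apply Rmult_le_compat_l; [|apply Rinv_le_contravar; lra].
      apply Rdiv_le_0_compat; [lra | apply Rmult_lt_0_compat; lra].
    - rewrite rsum_scal. assert (RS := rsum_inv_sqrt L).
      assert (SL3 : sqrt (INR L) <= 2 * t ^ 2) by (apply Rle_trans with (2 := SL2); apply sqrt_le_1; lra).
      apply Rle_trans with (K / (t ^ 3 * sqrt j) * (4 * t ^ 2)).
      + apply Rmult_le_compat_l; [|lra]. apply Rdiv_le_0_compat; [lra | apply Rmult_lt_0_compat; lra].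
      + right. field. lra. }
  assert (BT : Cmod (/ (RtoC 1 - crit t) * CI (u (RtoC 1 - crit t)%C (j + INR L)%R) 0 1)%C <= 8 * K / (t * sqrt j)).
  { rewrite Cmod_mult, Cmod_inv by apply crit_neq_1.
    assert (A1 := Cmod_1_minus_crit t Ht).
    set (b := j + INR L) in *. assert (Hb : j <= b) by (unfold b; lra).
    assert (A2 := U2 b Hb). assert (Rb : 0 < sqrt b) by (apply sqrt_lt_R0; lra).
    assert (RRb : sqrt b * sqrt b = b) by (apply sqrt_sqrt; lra).
    assert (SL3 : sqrt b <= 2 * t ^ 2) by (unfold b; rewrite Rplus_comm; exact SL2).
    assert (A3 : K * (1 + b) / (t ^ 3 * sqrt j * sqrt b) <= 4 * K / (t * sqrt j)).
    { apply Rle_trans with (K * (2 * (sqrt b * sqrt b)) / (t ^ 3 * sqrt j * sqrt b)).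
      - apply Rmult_le_compat_r.
        + left. apply Rinv_0_lt_compat, Rmult_lt_0_compat; [apply Rmult_lt_0_compat; lra | lra].
        + apply Rmult_le_compat_l; lra.
      - replace (K * (2 * (sqrt b * sqrt b)) / (t ^ 3 * sqrt j * sqrt b)) with (2 * K / (t ^ 3 * sqrt j) * sqrt b) by (field; lra).
        apply Rle_trans with (2 * K / (t ^ 3 * sqrt j) * (2 * t ^ 2)).
        + apply Rmult_le_compat_l; [|lra]. apply Rdiv_le_0_compat; [lra | apply Rmult_lt_0_compat; lra].
        + right. field. lra. }
    assert (A4 : / Cmod (RtoC 1 - crit t) <= 1).
    { apply Rle_trans with (/ 1); [apply Rinv_le_contravar; lra | lra]. }
    assert (A5 : 0 < / Cmod (RtoC 1 - crit t)) by (apply Rinv_0_lt_compat; lra).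
    apply Rle_trans with (1 * (4 * K / (t * sqrt j))).
    - apply Rmult_le_compat; [lra | apply Cmod_ge_0 | exact A4 | lra].
    - rewrite Rmult_1_l. apply Rmult_le_compat_r; [|lra].
      left. apply Rinv_0_lt_compat, Rmult_lt_0_compat; lra. }
  assert (D := Cmod_triangle_minus (csum (fun k => CI (u (- crit t)%C (j + INR (S k))%R) 0 1) L)
    (/ (RtoC 1 - crit t) * CI (u (RtoC 1 - crit t)%C (j + INR L)%R) 0 1)).
  replace ((12 * K + 4 * M) / (t * sqrt j)) with (4 * M / (t * sqrt j) + (4 * K / (t * sqrt j) + 8 * K / (t * sqrt j)))
    by (field; lra).
  exact (Rplus_le_compat _ _ _ _ BV (Rle_trans _ _ _ D (Rplus_le_compat _ _ _ _ BS BT))).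
Qed.

Lemma bump_expi (x : R) : (RtoC (bump x) * expi 1 x)%C =
  (RtoC (3 / 2) * expi 1 x - (expi 2 x + expi 0 x) + RtoC (1 / 4) * (expi 3 x + expi (- 1) x))%C.
Proof.
  assert (E : forall n : nat, RtoC (2 * cos (2 * PI * IZR (Z.of_nat n) * x)) = (expi (Z.of_nat n) x + expi (- Z.of_nat n) x)%C).
  { intros n. rewrite expi_opp. unfold expi, cis. apply C_ext; simpl; ring. }
  assert (E1 := E 1%nat). assert (E2 := E 2%nat). simpl in E1, E2.
  replace (2 * PI * 1 * x) with (2 * PI * x) in E1 by ring. replace (2 * PI * 2 * x) with (4 * PI * x) in E2 by ring.
  replace (RtoC (bump x)) with (RtoC (3 / 2) - RtoC (2 * cos (2 * PI * x)) + RtoC (1 / 4) * RtoC (2 * cos (4 * PI * x)))%C.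
  2: { unfold bump. apply C_ext; simpl; field. }
  rewrite E1, E2.
  change 3%Z with (2 + 1)%Z. rewrite (expi_plus 2 1).
  replace (expi 0 x) with (expi (-1) x * expi 1 x)%C by (rewrite <- expi_plus; reflexivity).
  replace (expi 2 x) with (expi 1 x * expi 1 x)%C at 2 by (rewrite <- expi_plus; reflexivity).
  replace (expi (-1) x) with (expi (-2) x * expi 1 x)%C at 3 by (rewrite <- expi_plus; reflexivity).
  ring.
Qed.

Lemma bump_coef (Z : R -> C) : (forall x, Ccont Z x) ->
  CI (fun x => RtoC (bump x) * expi 1 x * Z x)%C 0 1 =
  (RtoC (3 / 2) * fourier_coef Z 1 - (fourier_coef Z 2 + fourier_coef Z 0)
    + RtoC (1 / 4) * (fourier_coef Z 3 + fourier_coef Z (- 1)))%C.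
Proof.
  intros HZ.
  assert (C0 : forall n x, Ccont (fun x => Z x * expi n x)%C x).
  { intros n x. apply Ccont_mult; [apply HZ | apply Ccont_expi]. }
  assert (C1 : forall n m x, Ccont (fun x => Z x * expi n x + Z x * expi m x)%C x).
  { intros n m x. exact (Ccont_plus _ _ x (C0 n x) (C0 m x)). }
  assert (C2 : forall c n x, Ccont (fun x => c * (Z x * expi n x))%C x).
  { intros c n x. apply (Ccont_mult (fun _ => c)); [apply Ccont_const | apply C0]. }
  assert (C3 : forall c n m x, Ccont (fun x => c * (Z x * expi n x + Z x * expi m x))%C x).
  { intros c n m x. apply (Ccont_mult (fun _ => c)); [apply Ccont_const | apply C1]. }
  rewrite (CI_ext _ (fun x => (RtoC (3 / 2) * (Z x * expi 1 x) - (Z x * expi 2 x + Z x * expi 0 x))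
    + RtoC (1 / 4) * (Z x * expi 3 x + Z x * expi (- 1) x))%C 0 1); [|lra|].
  2: { intros x _. rewrite bump_expi. ring. }
  rewrite CI_plus; [|lra | |intros; apply C3].
  2: { intros x _. exact (Ccont_minus _ _ x (C2 _ _ x) (C1 _ _ x)). }
  rewrite CI_minus; [|lra | intros; apply C2 | intros; apply C1].
  rewrite !CI_scal; [|lra | intros; apply C1 | lra | intros; apply C0].
  rewrite !CI_plus; try lra; try (intros; apply C0). reflexivity.
Qed.

(** As c_2 and c_3 are close to 2^(s-1) c_1 and 3^(s-1) c_1, the combination is at least (3/2 -
    71/100 - 6/40) |c_1| = (64/100) |c_1| up to O(t^(-1/2)), which exceeds 1/50 because |c_1| >=
    1/25. *)
Lemma bump_coef_lower (t : R) (Z : R -> C) : 3600 <= t -> is_hurwitz_on_line t Z ->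
  / 50 - 7 / sqrt t <= Cmod (CI (fun x => RtoC (bump x) * expi 1 x * Z x)%C 0 1).
Proof.
  intros Ht HZ. assert (P4 := PI_4). assert (P3 := PI_gt_3).
  rewrite bump_coef by apply HZ.
  assert (A1 := fourier_coef_1_lower t Z Ht HZ).
  assert (A0 := fourier_coef_0_bound t Z ltac:(lra) HZ).
  assert (A2 := fourier_coef_pos t Z 2 ltac:(lra) HZ ltac:(lia) ltac:(simpl; nra)).
  assert (A3 := fourier_coef_pos t Z 3 ltac:(lra) HZ ltac:(lia) ltac:(simpl; nra)).
  assert (Am := fourier_coef_neg t Z 1 ltac:(lra) HZ ltac:(lia)).
  change (Z.of_nat 2) with 2%Z in A2. change (Z.of_nat 3) with 3%Z in A3. change (- Z.of_nat 1)%Z with (- 1)%Z in Am.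
  replace (t * INR 1) with t in Am by (simpl; ring).
  set (c1 := fourier_coef Z 1) in *. set (c2 := fourier_coef Z 2) in *. set (c3 := fourier_coef Z 3) in *.
  set (c0 := fourier_coef Z 0) in *. set (cm := fourier_coef Z (- 1)) in *.
  assert (M : forall n, (0 < n)%nat -> Cmod (Rcpow (INR n) (crit t - 1)) = / sqrt (INR n)).
  { intros n Hn. rewrite Cmod_Rcpow, crit_eq. simpl. rewrite <- Rpower_mhalf by (apply lt_0_INR; exact Hn).
    f_equal; field. }
  assert (S2 : / sqrt (INR 2) <= 71 / 100).
  { replace (71 / 100) with (/ (100 / 71)) by field. apply Rinv_le_contravar; [lra|].
    replace (100 / 71) with (sqrt ((100 / 71) * (100 / 71))) by (apply sqrt_square; lra). apply sqrt_le_1; simpl; lra. }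
  assert (S3 : / sqrt (INR 3) <= 6 / 10).
  { replace (6 / 10) with (/ (10 / 6)) by field. apply Rinv_le_contravar; [lra|].
    replace (10 / 6) with (sqrt ((10 / 6) * (10 / 6))) by (apply sqrt_square; lra). apply sqrt_le_1; simpl; lra. }
  assert (B2 := Cmod_le_add c2 (Rcpow (INR 2) (crit t - 1) * c1)%C).
  assert (B3 := Cmod_le_add c3 (Rcpow (INR 3) (crit t - 1) * c1)%C).
  rewrite Cmod_mult, M in B2, B3 by lia.
  assert (P1 := Cmod_ge_0 c1).
  assert (D2 : / sqrt (INR 2) * Cmod c1 <= 71 / 100 * Cmod c1) by (apply Rmult_le_compat_r; lra).
  assert (D3 : / sqrt (INR 3) * Cmod c1 <= 6 / 10 * Cmod c1) by (apply Rmult_le_compat_r; lra).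
  assert (T : / t <= / sqrt t).
  { assert (60 <= sqrt t) by (replace 60 with (sqrt (60 * 60)) by (apply sqrt_square; lra); apply sqrt_le_1; lra).
    assert (sqrt t * sqrt t = t) by (apply sqrt_sqrt; lra). apply Rinv_le_contravar; nra. }
  assert (T0 : 0 < / sqrt t) by (apply Rinv_0_lt_compat, sqrt_lt_R0; lra).
  assert (E1 : 3 / 2 * Cmod c1 <= Cmod (RtoC (3 / 2) * c1 - (c2 + c0) + RtoC (1 / 4) * (c3 + cm))%C
    + (Cmod c2 + Cmod c0) + 1 / 4 * (Cmod c3 + Cmod cm)).
  { replace (3 / 2 * Cmod c1) with (Cmod (RtoC (3 / 2) * c1)%C) by (rewrite Cmod_mult, Cmod_R_nonneg; lra).
    replace (RtoC (3 / 2) * c1)%C with ((RtoC (3 / 2) * c1 - (c2 + c0) + RtoC (1 / 4) * (c3 + cm)) + (c2 + c0)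
      - RtoC (1 / 4) * (c3 + cm))%C at 1 by ring.
    apply Rle_trans with (1 := Cmod_triangle_minus _ _). apply Rplus_le_compat.
    - apply Rle_trans with (1 := Cmod_triangle _ _). apply Rplus_le_compat_l, Cmod_triangle.
    - rewrite Cmod_mult, Cmod_R_nonneg by lra. apply Rmult_le_compat_l; [lra | apply Cmod_triangle]. }
  unfold Rdiv in *. lra.
Qed.

Lemma inv_le_inv_sqrt (t : R) (n : nat) : 1 <= t -> (0 < n)%nat -> / t ^ n <= / sqrt t.
Proof.
  intros Ht Hn. apply Rinv_le_contravar; [apply sqrt_lt_R0; lra|].
  apply Rle_trans with (t ^ 1); [|apply Rle_pow; [exact Ht | lia]].
  assert (1 <= sqrt t) by (rewrite <- sqrt_1 at 1; apply sqrt_le_1; lra).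
  assert (sqrt t * sqrt t = t) by (apply sqrt_sqrt; lra). simpl. nra.
Qed.

Lemma shift_term_bound : exists K, 0 < K /\ forall t, 1 <= t ->
  Cmod (CI (fun x => RtoC (bump x) * expi 1 x * Rcpow (x + 1) (- crit t))%C 0 1) <= K / sqrt t.
Proof.
  destruct (Smooth_Rpower 3 (- (1)) ltac:(lra)) as [K1 [HK1 S1]].
  destruct (Smooth_Rpower 3 (- (1 / 2)) ltac:(lra)) as [K2 [HK2 S2]].
  destruct (Smooth_inv 3 (K1 * Rpower 1 (- (1))) (/ 2) ltac:(lra)) as [N [HN SI]].
  assert (SE : Smooth False 3 ((1 + Rabs (2 * PI * 1)) ^ 3) (expi 1)) by exact (Smooth_cis 3 (2 * PI * 1)).
  assert (SA := Smooth_mult _ _ _ _ _ _ (Smooth_mult _ _ _ _ _ _ bump_smooth SE) (S2 1 ltac:(lra))).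
  match type of SA with Smooth _ _ ?M _ => set (M0 := M) in SA end.
  assert (HM := Smooth_nonneg _ _ _ _ SA).
  assert (D3 : 0 < (8 * N) ^ 3) by (apply pow_lt; lra).
  exists (M0 * (8 * N) ^ 3 + 1). split; [assert (0 <= M0 * (8 * N) ^ 3) by (apply Rmult_le_pos; lra); lra|].
  intros t Ht.
  assert (Hrho : forall x, 0 <= x <= 1 -> / 2 <= Rabs (Rpower (x + 1) (- (1)))).
  { intros x Hx. rewrite Rpower_m1 by lra. apply Rle_trans with (2 := Rle_abs _). apply Rinv_le_contravar; lra. }
  assert (NR : forall x, 0 <= x <= 1 -> Rpower (x + 1) (- (1)) <> 0).
  { intros x _. apply Rgt_not_eq, Rpower_pos. }
  assert (DR : forall x, 0 <= x <= 1 -> is_derive (fun y => ln (y + 1)) x (Rpower (x + 1) (- (1)))).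
  { intros x Hx. apply is_derive_ln_shift. lra. }
  assert (O := oscillation_decay t N (8 * N) _ _ ltac:(lra) ltac:(lra) DR NR 3 M0 _ ltac:(simpl; lra)
    (SI _ (S1 1 ltac:(lra)) Hrho) SA).
  rewrite (CI_ext _ (fun x => RtoC (bump x) * expi 1 x * RtoC (Rpower (x + 1) (- (1 / 2))) * cis (- (t * ln (x + 1))))%C);
    [|lra | intros x _; rewrite Rcpow_opp_crit; ring].
  apply Rle_trans with (1 := O). replace (M0 * (8 * N / t) ^ 3) with (M0 * (8 * N) ^ 3 * / t ^ 3) by (field; lra).
  assert (I := inv_le_inv_sqrt t 3 Ht ltac:(lia)).
  assert (T0 : 0 < / sqrt t) by (apply Rinv_0_lt_compat, sqrt_lt_R0; lra).
  apply Rle_trans with (M0 * (8 * N) ^ 3 * / sqrt t).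
  - apply Rmult_le_compat_l; [apply Rmult_le_pos; lra | exact I].
  - unfold Rdiv. apply Rmult_le_compat_r; lra.
Qed.

(** On [1, 2] the test function cancels (x + 1)^(s-1) exactly and leaves the bump times e(x). Z(x +
    1) is traded for Z(x) at the cost of (x + 1)^(-s), whose phase has no stationary point. *)
Lemma first_interval_lower : exists K, 0 < K /\ forall t Z, 3600 <= t -> is_hurwitz_on_line t Z ->
  / 50 - K / sqrt t <= Cmod (CI (fun x => pairing t Z (x + 1) * test t x)%C 0 1).
Proof.
  destruct shift_term_bound as [K [HK B]]. exists (7 + K). split; [lra|].
  intros t Z Ht HZ.
  assert (B1 := bump_coef_lower t Z Ht HZ). assert (B2 := B t ltac:(lra)).
  assert (Cb : forall x, Ccont (fun x => RtoC (bump x) * expi 1 x)%C x).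
  { intros x. apply Ccont_mult; [|apply Ccont_expi].
    apply Ccont_RtoC, continuous_sqrt_rational. unfold bump. auto_derive. trivial. }
  assert (E : CI (fun x => pairing t Z (x + 1) * test t x)%C 0 1 =
    (CI (fun x => RtoC (bump x) * expi 1 x * Z x) 0 1 - CI (fun x => RtoC (bump x) * expi 1 x * Rcpow (x + 1) (- crit t)) 0 1)%C).
  { rewrite <- CI_minus.
    - apply CI_ext; [lra|]. intros x Hx.
      rewrite (hurwitz_shift t Z x ltac:(lra) HZ ltac:(lra)).
      unfold pairing, test, amplitude. rewrite Rcpow_crit_minus_1.
      set (p := Rpower (x + 1) (- (1 / 2))).
      assert (PP : (RtoC p * RtoC p * RtoC (x + 1))%C = RtoC 1).
      { rewrite <- !RtoC_mult. f_equal. unfold p. rewrite <- Rpower_plus.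
        replace (- (1 / 2) + - (1 / 2)) with (- (1)) by field. rewrite Rpower_m1 by lra. field. lra. }
      assert (CC : (cis (t * ln (x + 1)) * cis (- (t * ln (x + 1))))%C = RtoC 1).
      { rewrite <- cis_add, Rplus_opp_r. apply cis_0. }
      transitivity (RtoC p * RtoC p * RtoC (x + 1) * (cis (t * ln (x + 1)) * cis (- (t * ln (x + 1))))
        * (RtoC (bump x) * expi 1 x * Z (x + 1)%R))%C; [ring|]. rewrite PP, CC. ring.
    - lra.
    - intros x _. apply (Ccont_mult (fun x => RtoC (bump x) * expi 1 x)%C); [apply Cb | apply HZ].
    - intros x Hx. apply (Ccont_mult (fun x => RtoC (bump x) * expi 1 x)%C); [apply Cb | apply Ccont_Rcpow; lra]. }
  rewrite E. set (X := CI (fun x => RtoC (bump x) * expi 1 x * Z x)%C 0 1) in *.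
  set (Y := CI (fun x => RtoC (bump x) * expi 1 x * Rcpow (x + 1) (- crit t))%C 0 1) in *.
  assert (D := Cmod_le_add X (X - Y)%C). replace (X - (X - Y))%C with Y in D by ring.
  rewrite Rdiv_plus_distr. lra.
Qed.

(** The integral of the pairing times the periodic extension of [test] over [1, p + 1 + th], cut at
    the integers; the last interval may be incomplete. *)
Definition test_pairing (t : R) (Z : R -> C) (p : nat) (th : R) : C :=
  (csum (fun k => CI (fun x => pairing t Z (x + INR (S k)) * test t x) 0 1) p
    + CI (fun x => pairing t Z (x + INR (S p)) * test t x) 0 th)%C.

(** The complete intervals beyond the first add up to the sum of K / (t sqrt j) over j <= t, of
    order t^(-1/2). On the incomplete one the amplitude need not vanish at [th], so integration by
    parts gives way to [hurwitz_bounded], the arguments lying beyond t / (2 PI) - 1. *)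
Lemma test_pairing_lower : exists K, 0 < K /\ forall t Z p th,
  3600 <= t -> is_hurwitz_on_line t Z -> (0 < p)%nat -> 0 <= th <= 1 ->
  t / (2 * PI) <= INR (S p) + th <= t ->
  / 50 - K / sqrt t <= Cmod (test_pairing t Z p th).
Proof.
  destruct first_interval_lower as [K1 [HK1 F]]. destruct middle_interval_bound as [K2 [HK2 Md]].
  destruct amplitude_smooth as [M [HM SA]].
  exists (K1 + 2 * K2 + 40000 * M). split; [lra|].
  intros t Z p th Ht HZ Hp Hth HT. assert (P3 := PI_gt_3). assert (P4 := PI_4).
  assert (R0 : 0 < sqrt t) by (apply sqrt_lt_R0; lra).
  assert (RR : sqrt t * sqrt t = t) by (apply sqrt_sqrt; lra).
  assert (Low : t / 16 <= INR (S p)).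
  { assert (t / 8 <= t / (2 * PI)) by (apply Rmult_le_compat_l; [lra | apply Rinv_le_contravar; lra]). lra. }
  assert (PSp : 0 < INR (S p)) by lra.
  destruct p as [|p]; [lia|]. unfold test_pairing.
  change (S p) with (1 + p)%nat at 1. rewrite csum_split.
  set (h := fun k => CI (fun x => pairing t Z (x + INR (S k)) * test t x)%C 0 1).
  assert (H0 : / 50 - K1 / sqrt t <= Cmod (h O)) by exact (F t Z Ht HZ).
  assert (H1 : Cmod (csum (fun k => h (1 + k)%nat) p) <= 2 * K2 / sqrt t).
  { apply Rle_trans with (rsum (fun k => K2 / t * / sqrt (INR (S k))) p).
    - apply Cmod_csum_le. intros k Hk. assert (Q := INR_S_pos k).
      assert (J : 2 <= INR (S (1 + k)) <= t).
      { split.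
        - change (S (1 + k)) with (S (S k)). rewrite !S_INR. generalize (pos_INR k). lra.
        - apply Rle_trans with (INR (S (S p))); [apply le_INR; lia | lra]. }
      apply Rle_trans with (1 := Md t Z (INR (S (1 + k))) ltac:(lra) HZ J).
      assert (Q1 : 0 < sqrt (INR (S k))) by (apply sqrt_lt_R0; exact Q).
      assert (Q2 : sqrt (INR (S k)) <= sqrt (INR (S (1 + k)))) by (apply sqrt_le_1; [lra | lra | apply le_INR; lia]).
      replace (K2 / (t * sqrt (INR (S (1 + k))))) with (K2 / t * / sqrt (INR (S (1 + k)))) by (field; lra).
      apply Rmult_le_compat_l; [apply Rdiv_le_0_compat; lra | apply Rinv_le_contravar; lra].
    - rewrite rsum_scal. assert (RS := rsum_inv_sqrt p).
      assert (sqrt (INR p) <= sqrt t).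
      { apply sqrt_le_1; [apply pos_INR | lra |]. apply Rle_trans with (INR (S (S p))); [apply le_INR; lia | lra]. }
      apply Rle_trans with (K2 / t * (2 * sqrt t)).
      + apply Rmult_le_compat_l; [apply Rdiv_le_0_compat; lra | lra].
      + right. rewrite <- RR at 1. field. lra. }
  set (e := CI (fun x => pairing t Z (x + INR (S (S p))) * test t x)%C 0 th).
  assert (He : Cmod e <= 40000 * M / sqrt t).
  { apply Rle_trans with (40000 * M / sqrt t * (th - 0)).
    - apply CI_bound; [lra | |].
      + intros x Hx. apply Ccont_pairing_test; [exact HZ | lra | lra].
      + intros x Hx. unfold pairing. rewrite !Cmod_mult.
        rewrite Rcpow_crit_minus_1, Cmod_mult, Cmod_cis, Rmult_1_r, Cmod_R_nonneg by (left; apply Rpower_pos).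
        assert (B1 := hurwitz_bounded t (x + INR (S (S p))) Z ltac:(lra) HZ ltac:(lra)).
        assert (B2 := Cmod_test M t x SA ltac:(lra)).
        assert (B3 : Rpower (x + INR (S (S p))) (- (1 / 2)) <= 4 / sqrt t).
        { rewrite Rpower_mhalf by lra. replace (4 / sqrt t) with (/ (sqrt t / 4)) by (field; lra).
          apply Rinv_le_contravar; [lra|].
          replace (sqrt t / 4) with (sqrt (sqrt t / 4 * (sqrt t / 4))) by (apply sqrt_square; lra).
          apply sqrt_le_1; nra. }
        apply Rle_trans with (4 / sqrt t * 10000 * M); [|right; field; lra].
        apply Rmult_le_compat; [|apply Cmod_ge_0| |exact B2].
        * apply Rmult_le_pos; [left; apply Rpower_pos | apply Cmod_ge_0].
        * apply Rmult_le_compat; [left; apply Rpower_pos | apply Cmod_ge_0 | exact B3 | exact B1].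
    - assert (0 <= 40000 * M / sqrt t) by (apply Rdiv_le_0_compat; lra).
      rewrite <- (Rmult_1_r (40000 * M / sqrt t)) at 2. apply Rmult_le_compat_l; lra. }
  change (csum h 1) with (RtoC 0 + h O)%C. rewrite Cplus_0_l.
  set (md := csum (fun k => h (1 + k)%nat) p) in *.
  assert (D := Cmod_le_add (h O) (h O + md + e)%C).
  replace (h O - (h O + md + e))%C with (- (md + e))%C in D by ring. rewrite Cmod_opp in D.
  assert (D2 := Cmod_triangle md e).
  apply Rle_trans with (Cmod (h O + md + e)%C); [|apply Rle_refl].
  rewrite !Rdiv_plus_distr. lra.
Qed.

(** Obtained from the approximation by a single term of the series. The factor t lost here is repaid
    by the error t^(-2) of the Fourier approximation. *)
Lemma Cmod_pairing_crude (t : R) (Z : R -> C) (j a : R) : 3600 <= t -> is_hurwitz_on_line t Z ->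
  1 <= j <= a -> a <= t -> Cmod (pairing t Z a) <= 7 * t * / sqrt j.
Proof.
  intros Ht HZ Hj Ha. unfold pairing. rewrite Cmod_mult.
  rewrite Rcpow_crit_minus_1, Cmod_mult, Cmod_cis, Rmult_1_r, Cmod_R_nonneg by (left; apply Rpower_pos).
  assert (B1 : Rpower a (- (1 / 2)) <= / sqrt j).
  { rewrite <- Rpower_mhalf by lra. apply Rpower_decr; lra. }
  assert (B2 : Cmod (Z a) <= 7 * t).
  { destruct HZ as [_ HZ]. assert (H := HZ a 1%nat ltac:(lra) ltac:(lia)).
    assert (D := Cmod_le_add (Z a) (hurwitz_partial t a 1)).
    assert (S1 : 1 <= sqrt (INR 1 + a)) by (rewrite <- sqrt_1 at 1; apply sqrt_le_1; simpl; lra).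
    assert (S2 : sqrt (INR 1 + a) * sqrt (INR 1 + a) = INR 1 + a) by (apply sqrt_sqrt; simpl; lra).
    assert (H4 : 4 * t / sqrt (INR 1 + a) <= 4 * t) by (apply div_le_l; [lra | nra]).
    change (INR 1) with 1 in *. unfold hurwitz_partial in D, H. change (INR 1) with 1 in D, H. simpl csum in D, H. rewrite Cplus_0_l in D, H.
    set (u := Rcpow (1 + a) (- crit t)) in *. set (w := (Rcpow (1 + a) (1 - crit t) / (1 - crit t))%C) in *.
    assert (U : Cmod u <= 1).
    { unfold u. rewrite Cmod_Rcpow_crit by lra. apply Rle_trans with (/ 1); [apply Rinv_le_contravar; lra | lra]. }
    assert (W : Cmod w <= 2).
    { unfold w, Cdiv. rewrite Cmod_mult, Cmod_inv, Cmod_Rcpow_1_crit by (try apply crit_neq_1; lra).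
      assert (A := Cmod_1_minus_crit t ltac:(lra)).
      apply Rle_trans with ((1 + t) * / t).
      - apply Rmult_le_compat; [lra | left; apply Rinv_0_lt_compat; lra | nra | apply Rinv_le_contravar; lra].
      - replace 2 with ((2 * t) * / t) by (field; lra). apply Rmult_le_compat_r; [left; apply Rinv_0_lt_compat|]; lra. }
    assert (D2 := Cmod_triangle_minus u w). lra. }
  rewrite Rmult_comm. apply Rmult_le_compat; [apply Cmod_ge_0 | left; apply Rpower_pos | exact B2 | exact B1].
Qed.

(** The partial sum involves only frequencies of absolute value at most N <= t / PI, all of them
    present in S; Cauchy-Schwarz separates the coefficients of [q] from those of the pairing. *)
Lemma pairing_partial_bound (t T : R) (Z q : R -> C) (N : nat) (W : R) :
  is_hurwitz_on_line t Z -> 1 <= T -> INR N <= t / PI ->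
  rsum (fun k => Cmod (fourier_coef q (Z.of_nat k - Z.of_nat N)) ^ 2) (2 * N + 1) <= W ->
  Cmod (CI (fun a => pairing t Z a * fourier_partial q N a)%C 1 T) <= sqrt (W * pairing_sum t T Z).
Proof.
  intros HZ HT HN HW.
  set (c := fun k => fourier_coef q (Z.of_nat k - Z.of_nat N)) in *.
  set (d := fun k => pairing_coef t T Z (Z.of_nat k - Z.of_nat N)).
  assert (C1 : forall n a, 1 <= a <= T -> Ccont (fun a => pairing t Z a * expi n a)%C a).
  { intros n a Ha. apply Ccont_mult; [apply pairing_cont; [exact HZ | lra] | apply Ccont_expi]. }
  assert (E : CI (fun a => pairing t Z a * fourier_partial q N a)%C 1 T = csum (fun k => c k * d k)%C (2 * N + 1)).
  { rewrite (CI_ext _ (fun a => csum (fun k => c k * (pairing t Z a * expi (- (Z.of_nat k - Z.of_nat N)) a))%C (2 * N + 1)));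
      [|lra|].
    - rewrite CI_csum; [|lra|].
      + apply csum_ext. intros k _. rewrite CI_scal; [reflexivity | lra | intros; apply C1; assumption].
      + intros k a _ Ha. apply (Ccont_mult (fun _ => c k)); [apply Ccont_const | apply C1, Ha].
    - intros a _. unfold fourier_partial. rewrite <- csum_scal. apply csum_ext. intros k _. unfold fourier_term.
      fold (c k). ring. }
  rewrite E. apply le_sqrt_of_sqr; [apply Cmod_ge_0|].
  apply Rle_trans with (rsum (fun k => Cmod (c k) * Cmod (d k)) (2 * N + 1) ^ 2).
  - apply pow_incr. split; [apply Cmod_ge_0|]. apply Cmod_csum_le. intros k _. rewrite Cmod_mult. lra.
  - apply Rle_trans with (1 := rsum_cauchy_schwarz _ _ _).
    apply Rmult_le_compat; [| |exact HW|].
    + apply rsum_nonneg. intros; apply pow2_ge_0.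
    + apply rsum_nonneg. intros; apply pow2_ge_0.
    + unfold pairing_sum.
      apply Rle_trans with (2 := sum_Zabs_le_sub (t / PI) (fun n => Cmod (pairing_coef t T Z n) ^ 2)
        (- Z.of_nat N) (2 * N + 1) N (fun n => pow2_ge_0 _) HN ltac:(lia) ltac:(lia)).
      apply rsum_le. intros k _. unfold d. replace (Z.of_nat k - Z.of_nat N)%Z with (- Z.of_nat N + Z.of_nat k)%Z by lia. lra.
Qed.

Lemma CI_split_periods (g P : R -> C) (p : nat) (th : R) :
  0 <= th -> (forall a, 1 <= a -> Ccont g a) -> (forall a, Ccont P a) ->
  (forall (k : nat) x, P (x + INR k) = P x) ->
  CI (fun a => g a * P a)%C 1 (INR (S p) + th) =
  (csum (fun k => CI (fun x => g (x + INR (S k))%R * P x) 0 1) p + CI (fun x => g (x + INR (S p))%R * P x) 0 th)%C.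
Proof.
  intros Hth Hg HP Per.
  assert (C1 : forall a, 1 <= a -> Ccont (fun a => g a * P a)%C a).
  { intros a Ha. apply Ccont_mult; [apply Hg, Ha | apply HP]. }
  assert (Pp := pos_INR p).
  rewrite (CI_Chasles _ 1 (1 + INR p) (INR (S p) + th)); rewrite ?S_INR; try lra.
  2: { intros x Hx. apply C1. lra. }
  f_equal.
  - rewrite (CI_unit_intervals (fun a => g a * P a)%C p) by exact C1. apply csum_ext. intros k _.
    apply CI_ext; [lra|]. intros x _. rewrite Per. reflexivity.
  - replace (1 + INR p) with (0 + INR (S p)) by (rewrite S_INR; ring).
    replace (INR p + 1 + th) with (th + INR (S p)) by (rewrite S_INR; ring).
    rewrite <- (CI_shift (fun a => g a * P a)%C 0 th (INR (S p))).
    + apply CI_ext; [lra|]. intros x _. rewrite Per, <- S_INR. reflexivity.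
    + lra.
    + intros x Hx. apply C1. rewrite S_INR in Hx. lra.
Qed.

Lemma CI_diff_bound (f g : R -> C) (M a b : R) : a <= b ->
  (forall x, a <= x <= b -> Ccont f x) -> (forall x, a <= x <= b -> Ccont g x) ->
  (forall x, a < x < b -> Cmod (f x - g x)%C <= M) ->
  Cmod (CI f a b - CI g a b)%C <= M * (b - a).
Proof.
  intros Hab Hf Hg HM. rewrite <- CI_minus by assumption.
  apply CI_bound; [exact Hab | | exact HM]. intros x Hx. exact (Ccont_minus _ _ x (Hf x Hx) (Hg x Hx)).
Qed.

(** The test function is replaced by its Fourier partial sum, to which [pairing_partial_bound]
    applies. The uniform error O(t^(-2)), multiplied by the size t / sqrt j of the pairing and
    summed over j <= t, costs O(t^(-1/2)). *)
Lemma test_pairing_upper : exists K, 0 < K /\ forall t Z p th,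
  3600 <= t -> is_hurwitz_on_line t Z -> 0 <= th <= 1 -> INR (S p) + th <= t ->
  Cmod (test_pairing t Z p th) <= K * sqrt (pairing_sum t (INR (S p) + th) Z) + K / sqrt t.
Proof.
  destruct amplitude_smooth as [M [HM SA]]. destruct test_coef_decay as [K [HK TD]].
  exists (M + 128 * K + 2000 * K). split; [lra|].
  intros t Z p th Ht HZ Hth HT. assert (P3 := PI_gt_3). assert (P4 := PI_4).
  set (T := INR (S p) + th) in *. set (Sm := pairing_sum t T Z).
  assert (S0 : 0 <= Sm) by apply pairing_sum_nonneg.
  assert (Pp := INR_S_ge_1 p).
  destruct (nat_above (t / PI) ltac:(apply Rdiv_le_0_compat; lra)) as [n [Hn0 [Hn1 Hn2]]].
  (* Now N is the integer part of t / PI: the window fits into the range of S, and every frequency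
     outside it falls under [test_coef_decay]. *)
  destruct n as [|N]; [lia|]. clear Hn0. rewrite S_INR in Hn1, Hn2.
  assert (TP : t / 4 <= t / PI) by (apply Rmult_le_compat_l; [lra | apply Rinv_le_contravar; lra]).
  assert (HN8 : t / 8 <= INR N) by lra.
  assert (HN : (0 < N)%nat) by (apply INR_lt; simpl; lra).
  assert (PN : 0 < INR N) by lra.
  assert (Dec : forall n, (Z.of_nat N < Z.abs n)%Z -> Cmod (fourier_coef (test t) n) <= (K / INR N) / IZR n ^ 2).
  { intros n Hn.
    assert (Hn' : INR N + 1 <= Rabs (IZR n)).
    { rewrite <- abs_IZR, INR_IZR_INZ, <- plus_IZR. apply IZR_le. lia. }
    apply Rle_trans with (1 := TD t n ltac:(lra) ltac:(lra)).
    assert (E : IZR n ^ 2 = Rabs (IZR n) ^ 2) by (rewrite <- !Rsqr_pow2; apply Rsqr_abs).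
    rewrite E. set (m := Rabs (IZR n)) in *.
    replace (K / INR N / m ^ 2) with (K / m ^ 2 * / INR N) by (field; lra).
    replace (K / m ^ 3) with (K / m ^ 2 * / m) by (field; lra).
    apply Rmult_le_compat_l; [apply Rdiv_le_0_compat; [lra | apply pow_lt; lra] | apply Rinv_le_contravar; lra]. }
  destruct (test_lipschitz t ltac:(lra)) as [L [HL Lip]].
  assert (T0 : test t 0 = RtoC 0 /\ test t 1 = RtoC 0).
  { destruct SA as [_ [V _]]. destruct (V I) as [V0 V1]. unfold test. rewrite V0, V1. split; apply Cmult_0_l. }
  assert (Bd : forall y, 0 <= y <= 1 -> Cmod (test t y) <= M) by (intros; apply Cmod_test; assumption).
  assert (Cq : forall y, 0 <= y <= 1 -> Ccont (test t) y) by (intros; apply Ccont_test; lra).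
  set (P := fourier_partial (test t) N).
  set (tau := 2 * (K / INR N) / INR N).
  assert (Cl : forall x, 0 <= x <= 1 -> Cmod (test t x - P x)%C <= tau).
  { intros x Hx. apply (fourier_partial_close (test t) N L M (K / INR N) x); try assumption; try tauto.
    apply Rdiv_le_0_compat; lra. }
  assert (Htau : 0 <= tau <= 128 * K / t ^ 2).
  { unfold tau. split; [apply Rdiv_le_0_compat; [|lra]; assert (0 <= K / INR N) by (apply Rdiv_le_0_compat; lra); lra|].
    replace (2 * (K / INR N) / INR N) with (2 * K * / INR N ^ 2) by (field; lra).
    replace (128 * K / t ^ 2) with (2 * K * / (t / 8) ^ 2) by (field; lra).
    apply Rmult_le_compat_l; [lra|]. apply Rinv_le_contravar; [apply pow_lt; lra | apply pow_incr; lra]. }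
  assert (Tau1 : 128 * K / t ^ 2 <= 128 * K).
  { apply div_le_l; [apply pow_lt; lra|]. assert (1 <= t ^ 2) by (apply pow_R1_Rle; lra).
    rewrite <- (Rmult_1_r (128 * K)) at 1. apply Rmult_le_compat_l; lra. }
  assert (BP : forall y, 0 <= y <= 1 -> Cmod (P y) <= M + 128 * K).
  { intros y Hy. assert (D := Cmod_le_add (P y) (test t y)). rewrite Cmod_minus_sym in D.
    assert (D1 := Cl y Hy). assert (D2 := Bd y Hy). lra. }
  assert (Bes := bessel_uniform (test t) N M (M + 128 * K) Cq Bd BP).
  assert (Main := pairing_partial_bound t T Z (test t) N _ HZ ltac:(unfold T; lra) ltac:(lra) Bes).
  fold P Sm in Main.
  unfold T in Main. rewrite (CI_split_periods (pairing t Z) P p th) in Main.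
  2: lra. 2: { intros a Ha. apply pairing_cont; [exact HZ | lra]. }
  2: apply fourier_partial_cont. 2: intros; apply fourier_partial_periodic.
  set (U := (csum (fun k => CI (fun x => pairing t Z (x + INR (S k)) * P x) 0 1) p
    + CI (fun x => pairing t Z (x + INR (S p)) * P x) 0 th)%C) in *.
  assert (CP : forall (k : nat) x, 0 <= x <= 1 -> Ccont (fun x => pairing t Z (x + INR (S k)) * P x)%C x).
  { intros k x Hx. assert (Q := INR_S_ge_1 k).
    apply (Ccont_mult (fun x => pairing t Z (x + INR (S k)))); [|apply fourier_partial_cont].
    apply (Ccont_comp (pairing t Z) (fun y => y + INR (S k))).
    - apply continuous_sqrt_rational. auto_derive. trivial.
    - apply pairing_cont; [exact HZ | lra]. }
  assert (CT : forall (k : nat) x, 0 <= x <= 1 -> Ccont (fun x => pairing t Z (x + INR (S k)) * test t x)%C x).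
  { intros k x Hx. apply Ccont_pairing_test; [exact HZ | apply INR_S_ge_1 | lra]. }
  assert (Dif : forall (k : nat) b, 0 <= b <= 1 -> INR (S k) + b <= t ->
    Cmod (CI (fun x => pairing t Z (x + INR (S k)) * test t x) 0 b - CI (fun x => pairing t Z (x + INR (S k)) * P x) 0 b)%C
      <= 7 * t * tau * / sqrt (INR (S k))).
  { intros k b Hb Hkb. assert (Q := INR_S_ge_1 k).
    assert (I0 : 0 < / sqrt (INR (S k))) by (apply Rinv_0_lt_compat, sqrt_lt_R0; lra).
    apply Rle_trans with (7 * t * tau * / sqrt (INR (S k)) * (b - 0)).
    - apply CI_diff_bound; [lra | intros; apply CT; lra | intros; apply CP; lra |].
      intros x Hx.
      replace (pairing t Z (x + INR (S k)) * test t x - pairing t Z (x + INR (S k)) * P x)%C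
        with (pairing t Z (x + INR (S k)) * (test t x - P x))%C by ring.
      rewrite Cmod_mult.
      replace (7 * t * tau * / sqrt (INR (S k))) with (7 * t * / sqrt (INR (S k)) * tau) by ring.
      apply Rmult_le_compat; [apply Cmod_ge_0 | apply Cmod_ge_0 | |apply Cl; lra].
      apply Cmod_pairing_crude; [exact Ht | exact HZ | lra | lra].
    - assert (0 <= 7 * t * tau * / sqrt (INR (S k))).
      { apply Rmult_le_pos; [apply Rmult_le_pos; lra | lra]. }
      rewrite <- (Rmult_1_r (7 * t * tau * / sqrt (INR (S k)))) at 2. apply Rmult_le_compat_l; lra. }
  assert (R0 : 0 < sqrt t) by (apply sqrt_lt_R0; lra).
  assert (RR : sqrt t * sqrt t = t) by (apply sqrt_sqrt; lra).
  assert (DU : Cmod (test_pairing t Z p th - U)%C <= 2000 * K / sqrt t).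
  { unfold test_pairing, U.
    set (A1 := csum (fun k => CI (fun x => pairing t Z (x + INR (S k)) * test t x) 0 1)%C p).
    set (A2 := CI (fun x => pairing t Z (x + INR (S p)) * test t x)%C 0 th).
    set (B1 := csum (fun k => CI (fun x => pairing t Z (x + INR (S k)) * P x) 0 1)%C p).
    set (B2 := CI (fun x => pairing t Z (x + INR (S p)) * P x)%C 0 th).
    replace (A1 + A2 - (B1 + B2))%C with ((A1 - B1) + (A2 - B2))%C by ring.
    apply Rle_trans with (1 := Cmod_triangle _ _).
    apply Rle_trans with (rsum (fun k => 7 * t * tau * / sqrt (INR (S k))) (S p)).
    - simpl rsum. apply Rplus_le_compat.
      + unfold A1, B1. rewrite <- csum_minus. apply Cmod_csum_le. intros k Hk. apply Dif; [lra|].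
        rewrite <- S_INR. apply Rle_trans with (INR (S p)); [apply le_INR; lia | unfold T in HT; lra].
      + apply Dif; assumption.
    - rewrite rsum_scal. assert (RS := rsum_inv_sqrt (S p)).
      assert (sqrt (INR (S p)) <= sqrt t) by (apply sqrt_le_1; unfold T in HT; lra).
      apply Rle_trans with (7 * t * (128 * K / t ^ 2) * (2 * sqrt t)).
      + apply Rmult_le_compat.
        * apply Rmult_le_pos; lra.
        * apply rsum_nonneg. intros k _. left. apply Rinv_0_lt_compat, sqrt_lt_R0, INR_S_pos.
        * apply Rmult_le_compat_l; lra.
        * lra.
      + replace (7 * t * (128 * K / t ^ 2) * (2 * sqrt t)) with (1792 * K * (sqrt t / (sqrt t * sqrt t))).
        * replace (1792 * K * (sqrt t / (sqrt t * sqrt t))) with (1792 * K / sqrt t) by (field; lra).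
          unfold Rdiv. apply Rmult_le_compat_r; [left; apply Rinv_0_lt_compat; exact R0 | lra].
        * rewrite RR. field. lra. }
  assert (SQ : sqrt (M * (M + 128 * K) * Sm) <= (M + 128 * K) * sqrt Sm).
  { rewrite <- (sqrt_square (M + 128 * K)) at 2 by lra. rewrite <- sqrt_mult by nra.
    apply sqrt_le_1.
    - apply Rmult_le_pos; [apply Rmult_le_pos; lra | exact S0].
    - apply Rmult_le_pos; [apply Rmult_le_pos; lra | exact S0].
    - apply Rmult_le_compat_r; [exact S0|]. apply Rmult_le_compat_r; lra. }
  assert (D := Cmod_le_add (test_pairing t Z p th) U).
  assert (0 <= sqrt Sm) by apply sqrt_pos.
  assert (0 <= 2000 * K * sqrt Sm) by (apply Rmult_le_pos; lra).
  assert (0 <= (M + 128 * K) / sqrt t) by (apply Rdiv_le_0_compat; lra).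
  rewrite (Rdiv_plus_distr (M + 128 * K)). lra.
Qed.

Lemma pairing_sum_lower : exists c t0, 0 < c /\ 3600 <= t0 /\ forall t T Z,
  t0 <= t -> is_hurwitz_on_line t Z -> t / (2 * PI) <= T <= t -> c <= pairing_sum t T Z.
Proof.
  destruct test_pairing_lower as [K1 [HK1 Lo]]. destruct test_pairing_upper as [K2 [HK2 Up]].
  (* Beyond [t0] the error terms of both bounds add up to at most 1/100, half of the main term
     1/50. *)
  set (K := K1 + K2). set (t0 := 3600 + (100 * K) ^ 2).
  exists ((/ (100 * K2)) ^ 2), t0.
  assert (Hc : 0 < / (100 * K2)) by (apply Rinv_0_lt_compat; lra).
  assert (Q := pow2_ge_0 (100 * K)).
  split; [apply pow_lt, Hc|]. split; [unfold t0; lra|].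
  intros t T Z Ht HZ HT. assert (P3 := PI_gt_3). assert (P4 := PI_4).
  assert (Ht' : 3600 <= t) by (unfold t0 in Ht; lra).
  assert (T8 : t / 8 <= T).
  { assert (t / 8 <= t / (2 * PI)) by (apply Rmult_le_compat_l; [lra | apply Rinv_le_contravar; lra]). lra. }
  destruct (nat_above (T - 1) ltac:(lra)) as [m [Hm0 [Hm1 Hm2]]].
  destruct m as [|[|p]]; [lia | simpl in Hm1; lra |].
  set (th := T - INR (S (S p))).
  assert (ET : T = INR (S (S p)) + th) by (unfold th; ring).
  assert (Hth : 0 <= th <= 1) by (unfold th; lra).
  assert (L1 := Lo t Z (S p) th Ht' HZ ltac:(lia) Hth ltac:(rewrite <- ET; exact HT)).
  assert (U1 := Up t Z (S p) th Ht' HZ Hth ltac:(rewrite <- ET; lra)).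
  rewrite <- ET in U1.
  assert (R0 : 0 < sqrt t) by (apply sqrt_lt_R0; lra).
  assert (RK : 100 * K <= sqrt t).
  { rewrite <- (sqrt_pow2 (100 * K)) by (unfold K; lra). apply sqrt_le_1; [exact Q | lra | unfold t0 in Ht; lra]. }
  assert (KR : K / sqrt t <= / 100) by (apply div_le_l; lra).
  unfold K in KR. rewrite Rdiv_plus_distr in KR.
  assert (S0 := pairing_sum_nonneg t T Z). set (Sm := pairing_sum t T Z) in *.
  assert (B : / (100 * K2) <= sqrt Sm).
  { apply Rmult_le_reg_l with K2; [exact HK2|]. replace (K2 * / (100 * K2)) with (/ 100) by (field; lra). lra. }
  rewrite <- (pow2_sqrt Sm S0). apply pow_incr. lra.
Qed.

(** * The inequality and its conditional consequence *)

Theorem theorem2 (zeta : C -> C) (zeta1 : C -> R -> C)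
    (hzeta : is_riemann_zeta zeta)
    (hzeta1 : is_modified_hurwitz_zeta zeta1) :
  forall eta : R, 0 < eta ->
    (exists C_eta t_eta : R, 0 < C_eta /\ 0 < t_eta /\
       forall t : R, t_eta <= t ->
         Cmod (zeta (crit t)) ^ 4
           <= C_eta * Rpower t (1 / 2) * fourier_sum zeta1 eta t)
    /\
    ((forall eps : R, 0 < eps ->
        bigO_infty (fourier_sum zeta1 eta) (fun t => Rpower t eps)) ->
     forall eps : R, 0 < eps ->
       bigO_infty (fun t => Cmod (zeta (crit t)))
                  (fun t => Rpower t (1 / 8 + eps))).
Proof.
  intros eta Heta. assert (P3 := PI_gt_3).
  assert (Main : exists C_eta t_eta : R, 0 < C_eta /\ 0 < t_eta /\ forall t : R, t_eta <= t ->
    Cmod (zeta (crit t)) ^ 4 <= C_eta * Rpower t (1 / 2) * fourier_sum zeta1 eta t).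
  { destruct pairing_sum_lower as [c [t0 [Hc [Ht0 Lo]]]].
    set (d := sqrt (sqrt c)).
    assert (Hd : 0 < d) by (apply sqrt_lt_R0, sqrt_lt_R0, Hc).
    (* [d] is the fourth root of the lower bound for S, so that 1 <= S^(1/4) / d absorbs the
       additive 1. The threshold t0 + 2 eta ensures t / (2 PI) + eta <= t, the condition on the
       endpoint. *)
    exists ((10 ^ 15 * (1 + / d)) ^ 4), (t0 + 2 * eta).
    assert (Hd' := Rinv_0_lt_compat d Hd).
    split; [apply pow_lt, Rmult_lt_0_compat; lra|]. split; [lra|].
    intros t Ht.
    set (Z := fun x => zeta1 (crit t) (Rmax 0 x)).
    assert (HZ : is_hurwitz_on_line t Z) by (apply hurwitz_zeta_on_line; [exact hzeta1 | lra]).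
    set (T := t / (2 * PI) + eta).
    assert (HT : t / (2 * PI) <= T <= t).
    { unfold T. split; [lra|]. assert (t / (2 * PI) <= t / 2) by (apply Rmult_le_compat_l; [lra | apply Rinv_le_contravar; lra]). lra. }
    assert (T1 : 1 <= T).
    { unfold T. assert (P4 := PI_4). assert (t / 8 <= t / (2 * PI)) by (apply Rmult_le_compat_l; [lra | apply Rinv_le_contravar; lra]). lra. }
    rewrite (fourier_sum_eq zeta1 eta t T1 HZ). fold Z T.
    rewrite (zeta_eq_hurwitz zeta zeta1 t hzeta hzeta1) by lra.
    replace (zeta1 (crit t) 0) with (Z 0) by (unfold Z; rewrite Rmax_left by lra; reflexivity).
    assert (A := afe_bound t T Z ltac:(lra) HZ HT).
    assert (S0 := pairing_sum_nonneg t T Z).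
    assert (Sc := Lo t T Z ltac:(lra) HZ HT).
    set (Sm := pairing_sum t T Z) in *. set (X := sqrt (sqrt Sm)) in *.
    assert (HX : d <= X) by (apply sqrt_le_1; [apply sqrt_pos | apply sqrt_pos | apply sqrt_le_1; lra]).
    assert (X4 : X ^ 4 = Sm).
    { replace (X ^ 4) with ((X ^ 2) ^ 2) by ring. unfold X. rewrite !pow2_sqrt; [reflexivity | exact S0 | apply sqrt_pos]. }
    set (r := Rpower t (1 / 8)) in *. assert (Hr : 0 < r) by apply Rpower_pos.
    assert (R4 : r ^ 4 = Rpower t (1 / 2)).
    { unfold r. rewrite <- Rpower_pow, Rpower_mult by apply Rpower_pos. f_equal. simpl. field. }
    rewrite <- R4, <- X4, <- !Rpow_mult_distr.
    apply pow_incr. split; [apply Cmod_ge_0|]. apply Rle_trans with (1 := A).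
    assert (1 <= / d * X) by (apply Rmult_le_reg_l with d; [exact Hd|]; rewrite <- Rmult_assoc, Rinv_r; lra).
    replace (10 ^ 15 * (1 + / d) * r * X) with (10 ^ 15 * r * (X + / d * X)) by ring.
    apply Rmult_le_compat_l; [apply Rmult_le_pos; lra | lra]. }
  split; [exact Main|].
  intros HO eps Heps. destruct Main as [C0 [t1 [HC0 [Ht1 Bd]]]].
  (* The final fourth root divides this exponent by 4. *)
  destruct (HO (4 * eps) ltac:(lra)) as [K [B HK]].
  (* The constant [K] of the hypothesis may have any sign; [Q] is a positive majorant, so its real
     fourth root is available. *)
  set (Q := C0 * Rabs K + 1). assert (HQ : 0 < Q).
  { assert (0 <= C0 * Rabs K) by (apply Rmult_le_pos; [lra | apply Rabs_pos]). unfold Q; lra. }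
  exists (Rpower Q (1 / 4)), (Rmax B t1). intros t Ht.
  assert (HB : B < t) by (apply Rle_lt_trans with (2 := Ht), Rmax_l).
  assert (Htt : t1 < t) by (apply Rle_lt_trans with (2 := Ht), Rmax_r).
  assert (F := HK t HB). assert (G := Bd t ltac:(lra)).
  rewrite !Rabs_pos_eq by (try apply Cmod_ge_0; left; apply Rpower_pos).
  rewrite (Rabs_pos_eq (Rpower t (4 * eps))) in F by (left; apply Rpower_pos).
  assert (P1 := Rpower_pos t (4 * eps)). assert (P2 := Rpower_pos t (1 / 2)).
  set (z := Cmod (zeta (crit t))) in *. assert (Hz : 0 <= z) by apply Cmod_ge_0.
  assert (Z4 : z ^ 4 <= (Rpower Q (1 / 4) * Rpower t (1 / 8 + eps)) ^ 4).
  { rewrite Rpow_mult_distr, <- (Rpower_pow 4 (Rpower Q (1 / 4))), <- (Rpower_pow 4 (Rpower t (1 / 8 + eps))), !Rpower_mult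
      by apply Rpower_pos.
    replace (1 / 4 * INR 4) with 1 by (simpl; field).
    replace ((1 / 8 + eps) * INR 4) with (1 / 2 + 4 * eps) by (simpl; field).
    rewrite Rpower_1, Rpower_plus by exact HQ.
    apply Rle_trans with (1 := G).
    apply Rle_trans with (C0 * Rpower t (1 / 2) * (Rabs K * Rpower t (4 * eps))).
    - apply Rmult_le_compat_l; [apply Rmult_le_pos; lra|].
      apply Rle_trans with (1 := Rle_abs _). apply Rle_trans with (1 := F).
      apply Rmult_le_compat_r; [lra | apply Rle_abs].
    - replace (C0 * Rpower t (1 / 2) * (Rabs K * Rpower t (4 * eps))) with
        (C0 * Rabs K * (Rpower t (1 / 2) * Rpower t (4 * eps))) by ring.
      apply Rmult_le_compat_r; [apply Rmult_le_pos; lra | unfold Q; lra]. }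
  destruct (Rle_or_lt z (Rpower Q (1 / 4) * Rpower t (1 / 8 + eps))) as [H|H]; [exact H|].
  assert (Y : 0 < Rpower Q (1 / 4) * Rpower t (1 / 8 + eps)) by (apply Rmult_lt_0_compat; apply Rpower_pos).
  set (y := Rpower Q (1 / 4) * Rpower t (1 / 8 + eps)) in *.
  assert (y ^ 2 < z ^ 2) by (simpl; nra). assert (0 < y ^ 2) by (apply pow_lt; exact Y).
  assert (y ^ 4 < z ^ 4) by (replace (y ^ 4) with (y ^ 2 * y ^ 2) by ring; replace (z ^ 4) with (z ^ 2 * z ^ 2) by ring; nra).
  lra.
Qed.
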